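(* The maps $F\mapsto(J_RF)(Z_1,Z_2)$, $F\in\mathcal W'$, have the following properties: 1. If $Z_1,Z_2\in\mathbb D_R^+$, then the resulting map $J_R^{++}$ maps $\mathcal W'$ into $\mathcal V^+\otimes\mathcal V'^+$, annihilates all irreducible components of $(\rho'_2,\mathcal W')$ except for $\mathcal Q'^+$, and $(J_R^{++}F)(Z,Z)=(\operatorname{Mx}F)(Z)$ if $F\in\mathbb H_{\mathbb C}\otimes\mathit{Zh}^+$. 2. If $Z_1,Z_2\in\mathbb D_R^-$, then the resulting map $J_R^{--}$ maps $\mathcal W'$ into $\mathcal V^-\otimes\mathcal V'^-$, annihilates all irreducible components of $(\rho'_2,\mathcal W')$ except for $\mathcal Q'^-$, and $(J_R^{--}F)(Z,Z)=(\operatorname{Mx}F)(Z)$ if $F\in\mathbb H_{\mathbb C}\otimes\mathit{Zh}^-$. Here ''annihilates all irreducible components except for $\mathcal Q'^\pm$'' means: annihilates every element of the $K$-type basis of $\mathcal W'$ described in the context other than those spanning $\mathcal Q'^\pm$.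
   Context: $\mathbb H_{\mathbb C}$ is the algebra of complex $2\times2$ matrices $Z=(z_{ij})$; $N(Z)=\det Z$; for $F=(F_{ij})$, $F^+=\begin{pmatrix}F_{22}&-F_{12}\\-F_{21}&F_{11}\end{pmatrix}$. $\mathcal W'=\mathbb H_{\mathbb C}\otimes\mathbb C[z_{ij},N(Z)^{-1}]$. With $\partial_{ij}=\partial/\partial z_{ij}$, $\nabla=2\begin{pmatrix}\partial_{11}&\partial_{21}\\\partial_{12}&\partial_{22}\end{pmatrix}$, $\nabla^+=2\begin{pmatrix}\partial_{22}&-\partial_{21}\\-\partial_{12}&\partial_{11}\end{pmatrix}$, $\square=4(\partial_{11}\partial_{22}-\partial_{12}\partial_{21})$, $\operatorname{Mx}F=\nabla F\nabla-\square F^+$. $U(2)_R=\{RZ;Z\in U(2)\}$, $\mathbb D_R^+=\{ZZ^*<R^2\}$, $\mathbb D_R^-=\{ZZ^*>R^2\}$, $dV=\frac14dz_{11}\wedge dz_{12}\wedge dz_{21}\wedge dz_{22}$ with $U(2)_R$ oriented so that $\int_{U(2)_R}N(W)^{-2}dV=-2\pi^3i$ ($dV$ below is in the variable $W$), and $$(J_RF)(Z_1,Z_2)=\frac{12i}{\pi^3}\int_{W\in U(2)_R}\frac{(W-Z_1)^{-1}}{N(W-Z_1)}\cdot F(W)\cdot\frac{(W-Z_2)^{-1}}{N(W-Z_2)}\,dV.$$ $\mathbb S$, $\mathbb S'$: complex columns, rows of length 2, $\mathbb S\otimes\mathbb S'=\mathbb H_{\mathbb C}$. $\mathcal V^+$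 = polynomial maps $f:\mathbb H_{\mathbb C}\to\mathbb S$ with $\nabla^+f=0$; $\mathcal V^-$ = functions $f$ with $N(Z)^{-1}Z^{-1}f(Z^{-1})\in\mathcal V^+$; $\mathcal V'^+$ = polynomial maps $g:\mathbb H_{\mathbb C}\to\mathbb S'$ with $g\overleftarrow{\nabla^+}=0$; $\mathcal V'^-$ = functions $g$ with $N(Z)^{-1}g(Z^{-1})Z^{-1}\in\mathcal V'^+$. Elements $v\otimes v'$ are regarded as $\mathbb H_{\mathbb C}$-valued functions $v(Z_1)v'(Z_2)$. Matrix coefficients: $t^l_{n\,\underline m}(Z)=\frac1{2\pi i}\oint(sz_{11}+z_{21})^{l-m}(sz_{12}+z_{22})^{l+m}s^{-l+n}\frac{ds}s$ for $l\in\frac12\mathbb Z_{\ge0}$, $m,n\in\mathbb Z+l$, $|m|,|n|\le l$, and $0$ otherwise. $\mathit{Zh}^+=\operatorname{span}\{N^kt^l_{n\,\underline m};k\ge0\}$, $\mathit{Zh}^-=\operatorname{span}\{N^kt^l_{n\,\underline m};k\le-(2l+2)\}$. $K$-type basis of $\mathcal W'$ ($K=U(2)\times U(2)$; $m,n\in\mathbb Z+l$): $N^k\tilde F_{l,m,n}$, $N^k\tilde G_{l,m,n}$, $N^k\tilde H_{l,m,n}$ ($k\in\mathbb Z$), $\tilde I_{k,l,m,n}$ ($k\in\mathbb Z\setminus\{0\}$), $\tilde J_{l,m,n}$, where $\tilde F_{l,m,n}=\begin{pmatrix}(l+m+1)(l-n)t^l_{n\,\underline m}&-(l-m)(l-n)t^l_{n\,\underline{m+1}}\\(l+m+1)(l+n+1)t^l_{n+1\,\underline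 m}&-(l-m)(l+n+1)t^l_{n+1\,\underline{m+1}}\end{pmatrix}$, $l\ge\frac12$, $-l-1\le m\le l$, $-l\le n\le l-1$; $\tilde G_{l,m,n}=\begin{pmatrix}t^l_{n\,\underline m}&t^l_{n\,\underline{m+1}}\\-t^l_{n+1\,\underline m}&-t^l_{n+1\,\underline{m+1}}\end{pmatrix}$, $l\ge\frac12$, $-l\le m\le l-1$, $-l-1\le n\le l$; $\tilde H_{l,m,n}=\begin{pmatrix}(l+m+1)t^l_{n\,\underline m}&-(l-m)t^l_{n\,\underline{m+1}}\\-(l+m+1)t^l_{n+1\,\underline m}&(l-m)t^l_{n+1\,\underline{m+1}}\end{pmatrix}$, $l\ge0$, $-l-1\le m,n\le l$; $\tilde I_{k,l,m,n}=(2l+k+2)N^k\tilde H_{l,m,n}+kN^{k-1}\begin{pmatrix}(l-n+1)t^{l+1}_{n\,\underline m}&(l-n+1)t^{l+1}_{n\,\underline{m+1}}\\(l+n+2)t^{l+1}_{n+1\,\underline m}&(l+n+2)t^{l+1}_{n+1\,\underline{m+1}}\end{pmatrix}$, $l\ge-\frac12$, $-l-1\le m,n\le l$ (for $l=-\frac12$ it equals $kN^{k-1}Z$); $\tilde J_{l,m,n}=N^{-1}\begin{pmatrix}(l-n)t^l_{n\,\underline m}&(l-n)t^l_{n\,\underline{m+1}}\\(l+n+1)t^l_{n+1\,\underline m}&(l+n+1)t^l_{n+1\,\underline{m+1}}\end{pmatrix}$, $l\ge\frac12$, $-l\le m,n\le l-1$. Each of the thirteen irreducible components of $(\rho'_2,\mathcal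 W')$ is identified, as a $K$-invariant subspace, with the span of a subset of this basis. $\mathcal Q'^+$ is the span of $N^k\tilde F_{l,m,n},N^k\tilde G_{l,m,n},N^k\tilde H_{l,m,n}$ with $k\ge1$; $\mathcal Q'^-$ is the span of the same functions with $k\le-(2l+2)$. *)

(* Defs.v *)
(* The complex numbers are R[i] for R : realType. *)
From HB Require Import structures.
From mathcomp Require Import all_boot all_order all_algebra.
From mathcomp Require Import complex.
From mathcomp Require Import all_classical all_reals all_analysis.

Set Implicit Arguments.
Unset Strict Implicit.
Unset Printing Implicit Defensive.

Import Order.TTheory GRing.Theory Num.Theory.
Import numFieldNormedType.Exports.

Local Open Scope classical_set_scope.
Local Open Scope ring_scope.
Local Open Scope complex_scope.
Local Open Scope sesquilinear_scope.

Notation HC R := 'M[R[i]]_2.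

(* The indices 1, 2 of the entries z_ij are the ordinals 0, 1 of 'I_2. *)
Definition mx2 (T : Type) (a b c d : T) : 'M[T]_2 :=
  \matrix_(i < 2, j < 2)
    if i == 0 then (if j == 0 then a else b) else (if j == 0 then c else d).

Definition mxplus (R : realType) (F : HC R) : HC R :=
  mx2 (F 1 1) (- F 0 1) (- F 1 0) (F 0 0).

(* Functions on H_C or on a subset of it (such as {N(Z) <> 0}) are represented
   by total functions; HCunits is the locus N(Z) <> 0. *)
Definition HCunits (R : realType) : set (HC R) := [set Z | \det Z != 0].

(* Holomorphic partial derivative: limit of complex difference quotients. *)
Definition partial (R : realType) (i j : 'I_2) (f : HC R -> R[i]) (Z : HC R) :
    R[i] :=
  'D_(delta_mx i j) (f : HC R -> R[i]^o) Z.

Definition diffop (R : realType) := (HC R -> R[i]) -> HC R -> R[i].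

Definition cpartial (R : realType) (c : R[i]) (i j : 'I_2) : diffop R :=
  fun f Z => c * partial i j f Z.

Definition nabla (R : realType) : 'M[diffop R]_2 :=
  mx2 (cpartial 2 0 0) (cpartial 2 1 0)
      (cpartial 2 0 1) (cpartial 2 1 1).

Definition nablaplus (R : realType) : 'M[diffop R]_2 :=
  mx2 (cpartial 2 1 1) (cpartial (- 2) 1 0)
      (cpartial (- 2) 0 1) (cpartial 2 0 0).

Definition box (R : realType) : diffop R := fun f Z =>
  4 * (partial 0 0 (partial 1 1 f) Z - partial 0 1 (partial 1 0 f) Z).

Definition Mx (R : realType) (F : HC R -> HC R) (Z : HC R) : HC R :=
  \matrix_(i < 2, j < 2)
    (\sum_(a < 2) \sum_(b < 2)
        nabla R i a (nabla R b j (fun Y => F Y a b)) Z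
     - box (fun Y => mxplus (F Y) i j) Z).

Definition span_on (R : realType) (D : set (HC R)) (S : set (HC R -> R[i])) :
    set (HC R -> R[i]) :=
  [set f | exists (p : nat) (c : 'I_p -> R[i]) (g : 'I_p -> HC R -> R[i]),
     (forall i, S (g i)) /\
     (forall Z, D Z -> f Z = \sum_(i < p) c i * g i Z)].

Definition monomial (R : realType) (e : 'M[nat]_2) (Z : HC R) : R[i] :=
  \prod_(i < 2) \prod_(j < 2) Z i j ^+ e i j.

Definition polyfun (R : realType) : set (HC R -> R[i]) :=
  span_on setT [set f | exists e, f = @monomial R e].

Definition laurentfun (R : realType) : set (HC R -> R[i]) :=
  span_on (@HCunits R)
    [set f | exists e (k : int), f = (fun Z => \det Z ^ k * monomial e Z)].

Definition Wprime (R : realType) : set (HC R -> HC R) :=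
  [set F | forall i j, @laurentfun R (fun Z => F Z i j)].

Definition Vplus (R : realType) : set (HC R -> 'cV[R[i]]_2) :=
  [set f | (forall i, @polyfun R (fun Z => f Z i 0)) /\
     (forall Z i, \sum_(k < 2) nablaplus R i k (fun Y => f Y k 0) Z = 0)].

Definition Vminus (R : realType) : set (HC R -> 'cV[R[i]]_2) :=
  [set f | exists2 p, @Vplus R p &
     forall Z, HCunits Z -> (\det Z)^-1 *: (Z^-1 *m f Z^-1) = p Z].

Definition V'plus (R : realType) : set (HC R -> 'rV[R[i]]_2) :=
  [set g | (forall j, @polyfun R (fun Z => g Z 0 j)) /\
     (forall Z j, \sum_(k < 2) nablaplus R k j (fun Y => g Y 0 k) Z = 0)].

Definition V'minus (R : realType) : set (HC R -> 'rV[R[i]]_2) :=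
  [set g | exists2 q, @V'plus R q &
     forall Z, HCunits Z -> (\det Z)^-1 *: (g Z^-1 *m Z^-1) = q Z].

(* G, restricted to D x D, is (the restriction of) an element of the algebraic
   tensor product of V and V', regarded as functions of (Z1, Z2). *)
Definition in_tensor (R : realType) (V : set (HC R -> 'cV[R[i]]_2))
    (V' : set (HC R -> 'rV[R[i]]_2)) (D : set (HC R))
    (G : HC R -> HC R -> HC R) : Prop :=
  exists (p : nat) (v : 'I_p -> HC R -> 'cV[R[i]]_2)
         (v' : 'I_p -> HC R -> 'rV[R[i]]_2),
    [/\ forall i, V (v i), forall i, V' (v' i) &
        forall Z1 Z2, D Z1 -> D Z2 ->
          G Z1 Z2 = \sum_(i < p) v i Z1 *m v' i Z2].

Definition cis (R : realType) (x : R) : R[i] := cos x +i* sin x.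

Definition cint (R : realType) (a b : R) (f : R -> R[i]) : R[i] :=
  (\int[@lebesgue_measure R]_(x in `[a, b]) complex.Re (f x)) +i*
  (\int[@lebesgue_measure R]_(x in `[a, b]) complex.Im (f x)).

Definition row4 (R : realType) (a b c d : R) : 'rV[R]_4 :=
  \row_(k < 4) nth 0 [:: a; b; c; d] k.

(* U(2) = SU(2) . {diag(1, e^(i delta))}; with t = (phi, theta, psi, delta)
   ranging over [0,2pi] x [0,pi/2] x [0,2pi] x [0,2pi] this parametrizes
   U(2)_r = r U(2), bijectively up to null sets. *)
Definition U2param (R : realType) (r : R) (t : 'rV[R]_4) : HC R :=
  let phi := t 0 0 in let theta := t 0 1 in
  let psi := t 0 2%:R in let delta := t 0 3%:R in
  r%:C *: mx2 ((cos theta)%:C * cis phi)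
              ((sin theta)%:C * cis psi)
              (- (sin theta)%:C * cis (delta - psi))
              ((cos theta)%:C * cis (delta - phi)).

(* Partial derivative of a complex-valued function of real variables. *)
Definition rpartial (R : realType) (k : 'I_4) (g : 'rV[R]_4 -> R[i])
    (t : 'rV[R]_4) : R[i] :=
  ('D_(delta_mx 0 k) (fun s => complex.Re (g s) : R^o) t) +i*
  ('D_(delta_mx 0 k) (fun s => complex.Im (g s) : R^o) t).

(* Pullback of dV = 1/4 dz11 /\ dz12 /\ dz21 /\ dz22 under U2param. *)
Definition dV (R : realType) (r : R) (t : 'rV[R]_4) : R[i] :=
  4^-1 * \det (\matrix_(a < 4, k < 4)
    rpartial k (fun s => let W := U2param r s in
                         nth 0 [:: W 0 0; W 0 1; W 1 0; W 1 1] a) t).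

(* The order (phi, theta, psi, delta) of the parameters fixes the orientation:
   dV = - (i/2) r^4 cos theta sin theta e^(2 i delta) dphi dtheta dpsi ddelta and
   N(W)^2 = r^4 e^(2 i delta), so the integral of N(W)^-2 dV is - 2 pi^3 i. *)
Definition U2int (R : realType) (r : R) (f : HC R -> R[i]) : R[i] :=
  cint 0 (2 * pi) (fun phi => cint 0 (pi / 2) (fun theta =>
  cint 0 (2 * pi) (fun psi => cint 0 (2 * pi) (fun delta =>
    let t := row4 phi theta psi delta in f (U2param r t) * dV r t)))).

Definition kern (R : realType) (Y : HC R) : HC R := (\det Y)^-1 *: Y^-1.

Definition J (R : realType) (r : R) (F : HC R -> HC R) (Z1 Z2 : HC R) : HC R :=
  (12 * 'i%C / (pi ^+ 3)%:C) *:
    \matrix_(i < 2, j < 2)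
      U2int r (fun W => (kern (W - Z1) *m F W *m kern (W - Z2)) i j).

Definition posdef (R : realType) (A : HC R) : Prop :=
  forall v : 'cV[R[i]]_2, v != 0 -> 0 < (v^t* *m A *m v) 0 0.

Definition Dplus (R : realType) (r : R) : set (HC R) :=
  [set Z | posdef ((r ^+ 2)%:C%:M - Z *m Z^t*)].

Definition Dminus (R : realType) (r : R) : set (HC R) :=
  [set Z | posdef (Z *m Z^t* - (r ^+ 2)%:C%:M)].

(* Contour integral over the positively oriented unit circle. *)
Definition circle_int (R : realType) (g : R[i] -> R[i]) : R[i] :=
  cint 0 (2 * pi) (fun x : R => g (cis x) * ('i%C * cis x)).

(* Half-integers are rationals; under the guard the exponents l - m, l + m and
   n - l are integers (the first two nonnegative) and Num.floor is exact. *)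
Definition tcoef (R : realType) (l n m : rat) (Z : HC R) : R[i] :=
  if [&& 2 * l \is a Num.nat, m - l \is a Num.int, n - l \is a Num.int,
         `|m| <= l & `|n| <= l]
  then (2 * pi%:C * 'i%C)^-1 *
       circle_int (fun s => (s * Z 0 0 + Z 1 0) ^ Num.floor (l - m) *
                            (s * Z 0 1 + Z 1 1) ^ Num.floor (l + m) *
                            s ^ Num.floor (n - l) / s)
  else 0.

(* Functions in Zh+ are polynomial, so they are determined on all of H_C;
   those in Zh- only matter where N(Z) <> 0. *)
Definition Zhplus (R : realType) : set (HC R -> R[i]) :=
  span_on setT
    [set f | exists (k : int) (l m n : rat),
       0 <= k /\ f = (fun Z => \det Z ^ k * tcoef l n m Z)].

Definition Zhminus (R : realType) : set (HC R -> R[i]) :=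
  span_on (@HCunits R)
    [set f | exists (k : int) (l m n : rat),
       k%:~R <= - (2 * l + 2) /\ f = (fun Z => \det Z ^ k * tcoef l n m Z)].

Definition HCtensor (R : realType) (S : set (HC R -> R[i])) :
    set (HC R -> HC R) :=
  [set F | forall i j, S (fun Z => F Z i j)].

Definition Ftilde (R : realType) (l m n : rat) (Z : HC R) : HC R :=
  mx2 (ratr ((l + m + 1) * (l - n)) * tcoef l n m Z)
      (- ratr ((l - m) * (l - n)) * tcoef l n (m + 1) Z)
      (ratr ((l + m + 1) * (l + n + 1)) * tcoef l (n + 1) m Z)
      (- ratr ((l - m) * (l + n + 1)) * tcoef l (n + 1) (m + 1) Z).

Definition Gtilde (R : realType) (l m n : rat) (Z : HC R) : HC R :=
  mx2 (tcoef l n m Z) (tcoef l n (m + 1) Z)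
      (- tcoef l (n + 1) m Z) (- tcoef l (n + 1) (m + 1) Z).

Definition Htilde (R : realType) (l m n : rat) (Z : HC R) : HC R :=
  mx2 (ratr (l + m + 1) * tcoef l n m Z)
      (- ratr (l - m) * tcoef l n (m + 1) Z)
      (- ratr (l + m + 1) * tcoef l (n + 1) m Z)
      (ratr (l - m) * tcoef l (n + 1) (m + 1) Z).

Definition Itilde (R : realType) (k : int) (l m n : rat) (Z : HC R) : HC R :=
  (ratr (2 * l + k%:~R + 2) * \det Z ^ k) *: Htilde l m n Z +
  (k%:~R * \det Z ^ (k - 1)) *:
    mx2 (ratr (l - n + 1) * tcoef (l + 1) n m Z)
        (ratr (l - n + 1) * tcoef (l + 1) n (m + 1) Z)
        (ratr (l + n + 2) * tcoef (l + 1) (n + 1) m Z)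
        (ratr (l + n + 2) * tcoef (l + 1) (n + 1) (m + 1) Z).

Definition Jtilde (R : realType) (l m n : rat) (Z : HC R) : HC R :=
  (\det Z)^-1 *:
    mx2 (ratr (l - n) * tcoef l n m Z)
        (ratr (l - n) * tcoef l n (m + 1) Z)
        (ratr (l + n + 1) * tcoef l (n + 1) m Z)
        (ratr (l + n + 1) * tcoef l (n + 1) (m + 1) Z).

Inductive Kindex : Type :=
  | KF of int & rat & rat & rat
  | KG of int & rat & rat & rat
  | KH of int & rat & rat & rat
  | KI of int & rat & rat & rat
  | KJ of rat & rat & rat.

Definition Kfun (R : realType) (b : Kindex) : HC R -> HC R :=
  match b with
  | KF k l m n => fun Z => \det Z ^ k *: Ftilde l m n Z
  | KG k l m n => fun Z => \det Z ^ k *: Gtilde l m n Z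
  | KH k l m n => fun Z => \det Z ^ k *: Htilde l m n Z
  | KI k l m n => Itilde k l m n
  | KJ l m n => Jtilde l m n
  end.

Definition halfint3 (l m n : rat) : bool :=
  [&& 2 * l \is a Num.int, m - l \is a Num.int & n - l \is a Num.int].

Definition Kvalid (b : Kindex) : bool :=
  match b with
  | KF k l m n => [&& halfint3 l m n, 2^-1 <= l,
                      - l - 1 <= m <= l & - l <= n <= l - 1]
  | KG k l m n => [&& halfint3 l m n, 2^-1 <= l,
                      - l <= m <= l - 1 & - l - 1 <= n <= l]
  | KH k l m n => [&& halfint3 l m n, 0 <= l,
                      - l - 1 <= m <= l & - l - 1 <= n <= l]
  | KI k l m n => [&& k != 0, halfint3 l m n, - 2^-1 <= l,
                      - l - 1 <= m <= l & - l - 1 <= n <= l]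
  | KJ l m n => [&& halfint3 l m n, 2^-1 <= l,
                    - l <= m <= l - 1 & - l <= n <= l - 1]
  end.

(* The basis elements spanning Q'+ and Q'-. *)
Definition in_Qplus (b : Kindex) : bool :=
  match b with
  | KF k _ _ _ | KG k _ _ _ | KH k _ _ _ => 1 <= k
  | KI _ _ _ _ | KJ _ _ _ => false
  end.

Definition in_Qminus (b : Kindex) : bool :=
  match b with
  | KF k l _ _ | KG k l _ _ | KH k l _ _ => k%:~R <= - (2 * l + 2)
  | KI _ _ _ _ | KJ _ _ _ => false
  end.

(* Main.v *)
(** On Laurent monomials the functional Lam = ∫ over U(2)_R is explicit; it kills
    every ∂_ij f (Stokes), kills Laurent functions of degree <> -4 and is invariant
    under f ↦ N^-4 f(W^-1). The kernel K(W - Z) = N^-2(W - Z) (W - Z)^+ is expanded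
    in homogeneous terms E_a, in powers of Z on D_R^+ and of Z^-1 on D_R^-. Since
    N(W - tZ) splits into linear factors in t whose roots are bounded away from the
    unit disc uniformly on U(2)_R, the expansion converges uniformly, and J_R F is
    a finite sum of terms Lam (E_a K · F · E_b K) for each Laurent F.

    Values. The terms are polynomials in (Z_1, Z_2) (or in their inverses)
    satisfying the Dirac equations, because the rows and columns of K do; a rank
    factorization of the coefficient matrix puts them in the tensor product.

    Annihilation. The functions I, and H for k = 0, are ∇^+ of a scalar function;
    they die by Stokes because K is annihilated by ∇^+ on both sides. The others are
    N^k h with h harmonic of degree n, and Lam (p N^k h) = 0 for every polynomial p
    when k > -(n + 2): N^k h is a multiple of □(N^(k+1) h), and □ lowers the degree
    of p. This settles the case of D_R^-, where the E_a K are polynomial in W; an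
    inversion W ↦ W^-1 reduces D_R^+ to it, where for k = 0 the functions F and G
    gain one power of N from tr (h Z^+) = 0.

    Diagonal. One has 24 K_ip K_qj = L (N^-2), where L is the second order operator
    with constant coefficients that gives the contribution of F_pq to (Mx F)_ij.
    By the Leibniz rule the sum over a + b = n of E_a K_ip E_b K_qj is
    E_n (L (N^-2)) / 24, and Stokes moves the derivatives onto F. On D_R^- one uses
    that elements of Zh^- are constant coefficient derivatives of N^-2. *)
Require Import Defs.
From HB Require Import structures.
From mathcomp Require Import all_boot all_order all_algebra.
From mathcomp Require Import complex.
From mathcomp Require Import all_classical all_reals all_analysis.
From mathcomp Require Import ring lra zify.

Set Implicit Arguments.
Unset Strict Implicit.
Unset Printing Implicit Defensive.

Import Order.TTheory GRing.Theory Num.Theory.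
Import numFieldNormedType.Exports.
Local Open Scope classical_set_scope.
Local Open Scope ring_scope.
Local Open Scope complex_scope.

(** * Partial derivatives *)

(** Functions are total, so inverses and negative powers of N take junk values on N = 0. Laurent
    functions are therefore compared only off N = 0, whereas polynomials form a separate class with
    equality everywhere: D_R^+ contains singular matrices, and the Dirac equations and Mx F are
    evaluated there too. The threshold k > -(n + 2) decides both domains. On D_R^+ the inversion
    turns N^k h into a function with exponent -2 - k - n, for which the criterion reads k < 0. The
    value k = 0 is exactly the borderline case; hence the need for tr (h Z^+) = 0, or for a
    gradient. A polynomial in Z_1 and Z_2 that satisfies both Dirac equations is not yet a sum of
    products whose factors satisfy them one by one. In a rank factorization each factor is a linear
    combination of rows or columns of the coefficient matrix, hence again an integral of the kernel
    in one variable. On D_R^- the factors are explicit, being derivatives of K at Z. The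
    normalization of J is dictated by the diagonal: 12i/pi^3 times the integral -2 pi^3 i of N^-2 is
    24, which is 4 times the factor (-2)(-3) of the second derivatives of N^-2. *)

Lemma sum2 (V : nmodType) (F : 'I_2 -> V) : \sum_(i < 2) F i = F 0 + F 1.
Proof.
by rewrite big_ord_recl big_ord1; congr (_ + F _); exact/val_inj.
Qed.

Lemma ord2_cases (i : 'I_2) : i = 0 \/ i = 1.
Proof. by case: i => [[|[|//]] ?]; [left | right]; exact/val_inj. Qed.

Lemma det2 (K : comNzRingType) (W : 'M[K]_2) :
  \det W = W 0 0 * W 1 1 - W 0 1 * W 1 0.
Proof.
rewrite (expand_det_row _ 0) sum2 /cofactor !det_mx11 !mxE /= expr0 expr1 mul1r.
by rewrite mulN1r mulrN; congr (_ * W _ _ - _ * W _ _); exact/val_inj.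
Qed.

Lemma near_det_neq0 (K : numFieldType) (Z : 'M[K]_2) : \det Z != 0 ->
  \forall W \near Z, \det W != 0.
Proof.
have cdet : continuous (fun W : 'M[K]_2 => \det W).
  rewrite (_ : (fun _ => _) = fun W : 'M[K]_2 => W 0 0 * W 1 1 - W 0 1 * W 1 0).
    move=> W; apply: (@cvgD K K^o _ (nbhs W)); [|apply: (@cvgN K K^o)];
      by apply: (@cvgM K _ (nbhs W)); exact: coord_continuous.
  by apply/funext => W; rewrite det2.
by move=> Z0; have := @cvgr_neq0 K K^o _ (nbhs Z) _ _ _ (cdet Z); exact.
Qed.

Section Calculus.
Variable R : realType.
Implicit Types (f g : HC R -> R[i]) (Z : HC R).

Definition isd (i j : 'I_2) f Z d :=
  is_derive (Z : HC R) (delta_mx i j) (f : HC R -> R[i]^o) d.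

Lemma isd_cst i j z Z : isd i j (fun=> z) Z 0.
Proof. exact: is_derive_cst. Qed.

Lemma isdD i j f g Z a b : isd i j f Z a -> isd i j g Z b ->
  isd i j (fun W => f W + g W) Z (a + b).
Proof. exact: is_deriveD. Qed.

Lemma isdM i j f g Z a b : isd i j f Z a -> isd i j g Z b ->
  isd i j (fun W => f W * g W) Z (a * g Z + f Z * b).
Proof.
move=> fa gb; have := is_deriveM fa gb; rewrite /isd.
by set u := _ *: _ + _; suff -> : u = a * g Z + f Z * b by []; rewrite /u addrC mulrC.
Qed.

Lemma isd_eq i j f Z a b : isd i j f Z a -> a = b -> isd i j f Z b.
Proof. by move=> h <-. Qed.

Lemma isdZ i j f Z z a : isd i j f Z a -> isd i j (fun W => z * f W) Z (z * a).
Proof.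
by move=> h; apply: isd_eq (isdM (isd_cst i j z Z) h) _; rewrite mul0r add0r.
Qed.

Lemma isdN i j f Z a : isd i j f Z a -> isd i j (fun W => - f W) Z (- a).
Proof.
by move=> h; rewrite -mulN1r (_ : (fun _ => _) = (fun W => -1 * f W));
  [exact: isdZ | apply/funext => W; rewrite mulN1r].
Qed.

Lemma isdV i j f Z a : f Z != 0 -> isd i j f Z a ->
  isd i j (fun W => (f W)^-1) Z (- a / f Z ^+ 2).
Proof.
move=> f0 [dfa <-]; split; first exact: derivableV.
by rewrite deriveV// mulrC scaleNr mulrN.
Qed.

Lemma isdX i j f n Z a : isd i j f Z a ->
  isd i j (fun W => f W ^+ n) Z (n%:R * f Z ^+ n.-1 * a).
Proof.
by move=> h; have := is_deriveX n h; rewrite /isd exprfctE.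
Qed.

(* Locked, to prevent conversion from unfolding the limit. *)
Fact pd_key : unit. Proof. by []. Qed.
Definition pd i j f Z : R[i] := locked_with pd_key (@partial R) i j f Z.

Lemma pdE i j f : partial i j f = pd i j f.
Proof. by rewrite /pd; apply/funext => Z; rewrite unlock. Qed.

Lemma isd_pd i j f Z a : isd i j f Z a -> pd i j f Z = a.
Proof. by rewrite -pdE; case. Qed.

Lemma isd_self i j f Z a : isd i j f Z a -> isd i j f Z (pd i j f Z).
Proof. by move=> h; rewrite (isd_pd h). Qed.

Lemma isd_coord i j k l Z :
  isd i j (fun W => W k l) Z ((i == k) && (j == l))%:R.
Proof.
have h : (fun h : R[i] => h^-1 *: ((h *: delta_mx i j + Z : HC R) k l - Z k l : R[i]^o))
    @ (0:R[i]^o)^' --> (((i == k) && (j == l))%:R : R[i]^o).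
  apply: cvg_near_cst; near=> h.
  have h0 : h != 0 by near: h; exact: withinT.
  by rewrite !mxE addrK /GRing.scale /= mulKf// ![k == _]eq_sym ![l == _]eq_sym.
by split; [apply/cvg_ex; exists ((i == k) && (j == l))%:R | exact: cvg_lim h].
Unshelve. all: by end_near. Qed.

(** Junk values on N = 0 are ignored. The locus N <> 0 is open, so [pd] respects this relation,
    which is all that identities between Laurent functions require. *)
Definition eqU f g := forall Z, HCunits Z -> f Z = g Z.

Lemma pd_eqU i j f g : eqU f g -> eqU (pd i j f) (pd i j g).
Proof.
move=> fg Z uZ; rewrite -!pdE /partial; apply: (@near_eq_derive R[i] _ R[i]^o f g).
by apply: filterS (near_det_neq0 uZ) => W; exact: fg.
Qed.

Lemma isd_eqU i j f g Z a : eqU f g -> HCunits Z -> isd i j f Z a -> isd i j g Z a.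
Proof.
move=> fg uZ; apply: (@near_eq_is_derive R[i] _ R[i]^o f g).
by apply: filterS (near_det_neq0 uZ) => W; exact: fg.
Qed.

End Calculus.

(** * Laurent functions and polynomials *)

Section LaurentFunctions.
Variable R : realType.
Implicit Types (f g : HC R -> R[i]) (Z W : HC R).

Lemma mx2_00 (T : Type) (a b c d : T) : mx2 a b c d 0 0 = a.
Proof. by rewrite mxE. Qed.
Lemma mx2_01 (T : Type) (a b c d : T) : mx2 a b c d 0 1 = b.
Proof. by rewrite mxE. Qed.
Lemma mx2_10 (T : Type) (a b c d : T) : mx2 a b c d 1 0 = c.
Proof. by rewrite mxE. Qed.
Lemma mx2_11 (T : Type) (a b c d : T) : mx2 a b c d 1 1 = d.
Proof. by rewrite mxE. Qed.
Definition mx2E := (mx2_00, mx2_01, mx2_10, mx2_11).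

Definition pmon (a b c d : nat) W : R[i] :=
  W 0 0 ^+ a * W 0 1 ^+ b * W 1 0 ^+ c * W 1 1 ^+ d.

Definition mon (k : int) (a b c d : nat) W : R[i] := \det W ^ k * pmon a b c d W.

(** Truncated predecessors are harmless here: an exponent 0 comes with the coefficient 0. *)
Definition dpmon (i j : 'I_2) (a b c d : nat) : HC R -> R[i] :=
  mx2 (fun W => a%:R * pmon a.-1 b c d W) (fun W => b%:R * pmon a b.-1 c d W)
      (fun W => c%:R * pmon a b c.-1 d W) (fun W => d%:R * pmon a b c d.-1 W) i j.

Lemma isd_pmon i j a b c d W : isd i j (pmon a b c d) W (dpmon i j a b c d W).
Proof.
pose h k l n := isdX n (isd_coord i j k l W).
apply: isd_eq (isdM (isdM (isdM (h 0 0 a) (h 0 1 b)) (h 1 0 c)) (h 1 1 d)) _.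
by case: (ord2_cases i) => ->; case: (ord2_cases j) => ->; rewrite /dpmon !mx2E /pmon /=; ring.
Qed.

Lemma isd_det i j W : isd i j (fun W => \det W) W (mxplus W j i).
Proof.
rewrite (_ : (fun W => _) = fun W : HC R => W 0 0 * W 1 1 + - (W 0 1 * W 1 0)); last first.
  by apply/funext => V; rewrite det2.
pose h k l := isd_coord i j k l W.
apply: isd_eq (isdD (isdM (h 0 0) (h 1 1)) (isdN (isdM (h 0 1) (h 1 0)))) _.
by case: (ord2_cases i) => ->; case: (ord2_cases j) => ->; rewrite /mxplus !mx2E /=; ring.
Qed.

Lemma isd_detz i j (k : int) W : HCunits W ->
  isd i j (fun W => \det W ^ k) W (k%:~R * \det W ^ (k - 1) * mxplus W j i).
Proof.
move=> uW; have W0 : \det W != 0 by [].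
case: k => n; first apply: isd_eq (isdX n (isd_det i j W)) _.
  by case: n => [|n]; rewrite ?mul0r // intS addrAC subrr add0r.
apply: isd_eq (isdV _ (isdX n.+1 (isd_det i j W))) _; first by rewrite expf_neq0.
have -> : \det W ^ (Negz n - 1) = (\det W ^+ n.+2)^-1.
  by rewrite NegzE -opprD -PoszD addn1 -exprnN.
rewrite NegzE mulrNz -[(n.+1)%:~R]/(n.+1%:R) /= !exprS.
have dn0 : \det W ^+ n != 0 by rewrite expf_neq0.
by move: W0 dn0; set d := \det W; set e := d ^+ n => d0 e0; field; apply/andP.
Qed.

Lemma isd_mon i j k a b c d W : HCunits W ->
  isd i j (mon k a b c d) W
    (k%:~R * \det W ^ (k - 1) * mxplus W j i * pmon a b c d W
     + \det W ^ k * dpmon i j a b c d W).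
Proof. by move=> uW; exact: isdM (isd_detz _ _ _ uW) (isd_pmon _ _ _ _ _ _ _). Qed.

Lemma pmonM a b c d a' b' c' d' W :
  pmon a b c d W * pmon a' b' c' d' W = pmon (a + a') (b + b') (c + c') (d + d') W.
Proof. by rewrite /pmon !exprD; ring. Qed.

Lemma monM k a b c d k' a' b' c' d' W : HCunits W ->
  mon k a b c d W * mon k' a' b' c' d' W =
  mon (k + k') (a + a') (b + b') (c + c') (d + d') W.
Proof. by move=> uW; rewrite /mon -pmonM expfzDr//; ring. Qed.

(** An optional degree: [Some n] asks for homogeneity of degree n, [None] asks nothing. One
    predicate then serves both for the algebra of Laurent functions and for its grading. *)
Definition dok (o : option int) (d : int) : bool := if o is Some n then n == d else true.

(** Laurent functions are described by generation instead of coefficients: a linear statement is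
    proved by induction, with only the monomials N^k z^e to check. *)
Inductive L (o : option int) : (HC R -> R[i]) -> Prop :=
| L_mon z k a b c d : dok o (k * 2 + (a + b + c + d)%:Z) ->
    L o (fun W => z * mon k a b c d W)
| L_add f g : L o f -> L o g -> L o (fun W => f W + g W)
| L_ext f g : L o f -> eqU f g -> L o g.

Definition dokn (o : option nat) (d : nat) : bool := if o is Some n then n == d else true.

(** There is no closure under [eqU] here: members of [P] are polynomials at every matrix, singular
    ones included. This is what [Vplus] and the values of Mx on D_R^+ demand. *)
Inductive P (o : option nat) : (HC R -> R[i]) -> Prop :=
| P_mon z a b c d : dokn o (a + b + c + d)%N -> P o (fun W => z * pmon a b c d W)
| P_add f g : P o f -> P o g -> P o (fun W => f W + g W).

Lemma L_None o f : L o f -> L None f.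
Proof.
elim=> [z k a b c d _|f1 g1 _ h1 _ h2|f1 g1 _ h1 e].
- exact: L_mon.
- exact: L_add.
- exact: L_ext h1 e.
Qed.

Lemma P_None o f : P o f -> P None f.
Proof. by elim=> [z a b c d _|f1 g1 _ h1 _ h2]; [exact: P_mon|exact: P_add]. Qed.

Lemma P_L o f : P o f -> L (omap Posz o) f.
Proof.
elim=> [z a b c d h|f1 g1 _ h1 _ h2]; last exact: L_add.
apply: L_ext (_ : L _ (fun W => z * mon 0 a b c d W)) _ => [|W _].
  by apply: L_mon; case: o h => //= n /eqP ->; rewrite mul0r add0r.
by rewrite /mon expr0z mul1r.
Qed.

Lemma P_LN o f : P o f -> L None f.
Proof. by move/P_L/L_None. Qed.

Lemma L_0 o : L o (fun=> 0).
Proof.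
(* There is no constructor for 0, so a monomial of the prescribed degree n is exhibited with
   coefficient 0: N^(n div 2) times the power n mod 2 of [W 0 0]. *)
pose k : int := if o is Some n then (n %/ 2)%Z else 0.
pose a : nat := if o is Some n then `|(n %% 2)%Z|%N else 0%N.
apply: L_ext (L_mon 0 (k := k) (a := a) (b := 0) (c := 0) (d := 0) _) _.
  case: o @k @a => //= n; rewrite !addn0; apply/eqP; rewrite [LHS](divz_eq n 2).
  by rewrite gez0_abs// modz_ge0.
by move=> W _; rewrite mul0r.
Qed.

Lemma P_0 o : P o (fun=> 0).
Proof.
have := @P_mon o 0 (odflt 0%N o) 0 0 0; rewrite (_ : (fun _ => _) = fun=> 0); last first.
  by apply/funext => W; rewrite mul0r.
by apply; case: o => //= n; rewrite !addn0.
Qed.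

Lemma L_scale o z f : L o f -> L o (fun W => z * f W).
Proof.
elim=> [z' k a b c d h|f1 g1 _ h1 _ h2|f1 g1 _ h1 e].
- by apply: L_ext (L_mon (z * z') h) _ => W _; rewrite mulrA.
- by apply: L_ext (L_add h1 h2) _ => W _; rewrite mulrDr.
- by apply: L_ext h1 _ => W uW; rewrite e.
Qed.

Lemma P_eq o f g : P o f -> f = g -> P o g. Proof. by move=> h <-. Qed.

Lemma P_scale o z f : P o f -> P o (fun W => z * f W).
Proof.
elim=> [z' a b c d h|f1 g1 _ h1 _ h2].
- by apply: P_eq (P_mon (z * z') h) _; apply/funext => W; rewrite mulrA.
- by apply: P_eq (P_add h1 h2) _; apply/funext => W; rewrite mulrDr.
Qed.

Lemma L_opp o f : L o f -> L o (fun W => - f W).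
Proof. by move=> /(L_scale (-1)) h; apply: L_ext h _ => W _; rewrite mulN1r. Qed.

Lemma P_opp o f : P o f -> P o (fun W => - f W).
Proof.
by move=> /(P_scale (-1)) h; apply: P_eq h _; apply/funext => W; rewrite mulN1r.
Qed.

Lemma L_sub o f g : L o f -> L o g -> L o (fun W => f W - g W).
Proof. by move=> lf /L_opp; exact: L_add. Qed.

Lemma P_sub o f g : P o f -> P o g -> P o (fun W => f W - g W).
Proof. by move=> lf /P_opp; exact: P_add. Qed.

Lemma L_sum o (I : Type) (r : seq I) (p : pred I) (F : I -> HC R -> R[i]) :
  (forall i, p i -> L o (F i)) -> L o (fun W => \sum_(i <- r | p i) F i W).
Proof.
move=> h; elim: r => [|x r ih].
  by apply: L_ext (L_0 o) _ => W _; rewrite big_nil.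
case px: (p x).
  by apply: L_ext (L_add (h x px) ih) _ => W _; rewrite big_cons px.
by apply: L_ext ih _ => W _; rewrite big_cons px.
Qed.

Lemma P_sum o (I : Type) (r : seq I) (p : pred I) (F : I -> HC R -> R[i]) :
  (forall i, p i -> P o (F i)) -> P o (fun W => \sum_(i <- r | p i) F i W).
Proof.
move=> h; elim: r => [|x r ih].
  by apply: P_eq (P_0 o) _; apply/funext => W; rewrite big_nil.
case px: (p x).
  by apply: P_eq (P_add (h x px) ih) _; apply/funext => W; rewrite big_cons px.
by apply: P_eq ih _; apply/funext => W; rewrite big_cons px.
Qed.

Lemma L_mul_gen o1 o2 o3 f g :
  (forall d1 d2, dok o1 d1 -> dok o2 d2 -> dok o3 (d1 + d2)) ->
  L o1 f -> L o2 g -> L o3 (fun W => f W * g W).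
Proof.
move=> ho lf; elim: lf g => {f} [z k a b c d h|f1 g1 _ h1 _ h2|f1 g1 _ h1 e] g lg.
- elim: lg => [z' k' a' b' c' d' h'|f1 g1 _ h1 _ h2|f1 g1 _ h1 e].
  + apply: L_ext (L_mon (z * z') (k := k + k') (a := a + a') (b := b + b')
      (c := c + c') (d := d + d') _) _ => [|W uW].
      have := ho _ _ h h'; set x := (X in dok _ X); set y := (X in _ -> dok _ X).
      by rewrite (_ : x = y)// /x /y; lia.
    by rewrite -monM//; ring.
  + by apply: L_ext (L_add h1 h2) _ => W _; rewrite mulrDr.
  + by apply: L_ext h1 _ => W uW; rewrite e.
- by apply: L_ext (L_add (h1 _ lg) (h2 _ lg)) _ => W _; rewrite mulrDl.
- by apply: L_ext (h1 _ lg) _ => W uW; rewrite e.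
Qed.

Lemma L_mul f g : L None f -> L None g -> L None (fun W => f W * g W).
Proof. exact: L_mul_gen. Qed.

Lemma L_mulS m n p f g : L (Some m) f -> L (Some n) g -> p = m + n ->
  L (Some p) (fun W => f W * g W).
Proof. by move=> lf lg ->; apply: L_mul_gen lf lg => _ _ /eqP <- /eqP <- /=. Qed.

Lemma P_mul_gen o1 o2 o3 f g :
  (forall d1 d2, dokn o1 d1 -> dokn o2 d2 -> dokn o3 (d1 + d2)) ->
  P o1 f -> P o2 g -> P o3 (fun W => f W * g W).
Proof.
move=> ho lf; elim: lf g => {f} [z a b c d h|f1 g1 _ h1 _ h2] g lg.
- elim: lg => [z' a' b' c' d' h'|f1 g1 _ h1 _ h2].
  + apply: P_eq (P_mon (z * z') (a := a + a') (b := b + b')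
      (c := c + c') (d := d + d') _) _.
      have := ho _ _ h h'; set x := (X in dokn _ X); set y := (X in _ -> dokn _ X).
      by rewrite (_ : x = y)// /x /y; lia.
    by apply/funext => W; rewrite -pmonM; ring.
  + by apply: P_eq (P_add h1 h2) _; apply/funext => W; rewrite mulrDr.
- by apply: P_eq (P_add (h1 _ lg) (h2 _ lg)) _; apply/funext => W; rewrite mulrDl.
Qed.

Lemma P_mul f g : P None f -> P None g -> P None (fun W => f W * g W).
Proof. exact: P_mul_gen. Qed.

Lemma P_mulS m n f g : P (Some m) f -> P (Some n) g ->
  P (Some (m + n)%N) (fun W => f W * g W).
Proof. by move=> lf lg; apply: P_mul_gen lf lg => _ _ /eqP <- /eqP <- /=. Qed.

Lemma P_cst z : P (Some 0%N) (fun=> z).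
Proof.
by apply: P_eq (@P_mon (Some 0%N) z 0 0 0 0 _) _ => //; apply/funext => W;
  rewrite /pmon !expr0 !mulr1.
Qed.

Lemma P_coord i j : P (Some 1%N) (fun W => W i j).
Proof.
pose e k l : nat := (i == k) && (j == l).
apply: P_eq (P_mon 1 (a := e 0 0) (b := e 0 1) (c := e 1 0) (d := e 1 1) _) _.
  by rewrite /e; case: (ord2_cases i) => ->; case: (ord2_cases j) => ->.
apply/funext => W; rewrite /e /pmon.
by case: (ord2_cases i) => ->; case: (ord2_cases j) => -> /=; rewrite ?expr0 ?expr1; ring.
Qed.

Lemma P_mxplus i j : P (Some 1%N) (fun W => mxplus W i j).
Proof.
case: (ord2_cases i) => ->; case: (ord2_cases j) => ->.
- by apply: P_eq (P_coord 1 1) _; apply/funext => W; rewrite /mxplus mx2E.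
- by apply: P_eq (P_opp (P_coord 0 1)) _; apply/funext => W; rewrite /mxplus mx2E.
- by apply: P_eq (P_opp (P_coord 1 0)) _; apply/funext => W; rewrite /mxplus mx2E.
- by apply: P_eq (P_coord 0 0) _; apply/funext => W; rewrite /mxplus mx2E.
Qed.

Lemma P_det : P (Some 2%N) (fun W => \det W).
Proof.
apply: P_eq (P_sub (P_mulS (P_coord 0 0) (P_coord 1 1)) (P_mulS (P_coord 0 1) (P_coord 1 0))) _.
by apply/funext => W; rewrite det2.
Qed.

Lemma L_detz k : L (Some (k * 2)) (fun W => \det W ^ k).
Proof.
apply: L_ext (@L_mon (Some (k * 2)) 1 k 0 0 0 0 _) _ => [|W _]; first by rewrite /= addr0.
by rewrite /mon /pmon !expr0 !mulr1 mul1r.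
Qed.

Lemma L_isd o f i j Z : L o f -> HCunits Z -> isd i j f Z (pd i j f Z).
Proof.
move=> lf; elim: lf Z => [z k a b c d h|f1 g1 _ h1 _ h2|f1 g1 _ h1 e] Z uZ.
- exact: isd_self (isdZ z (isd_mon i j k a b c d uZ)).
- exact: isd_self (isdD (h1 _ uZ) (h2 _ uZ)).
- exact: isd_self (isd_eqU e uZ (h1 _ uZ)).
Qed.

Lemma P_isd o f i j Z : P o f -> isd i j f Z (pd i j f Z).
Proof.
move=> lf; elim: lf Z => [z a b c d h|f1 g1 _ h1 _ h2] Z.
- exact: isd_self (isdZ z (isd_pmon i j a b c d Z)).
- exact: isd_self (isdD (h1 _) (h2 _)).
Qed.

Lemma P_dpmon i j a b c d : P None (dpmon i j a b c d) /\
  forall n, (n.+1 = a + b + c + d)%N -> P (Some n) (dpmon i j a b c d).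
Proof.
split=> [|n e]; rewrite /dpmon; case: (ord2_cases i) => ->; case: (ord2_cases j) => ->;
  rewrite !mx2E; try by apply: P_mon.
- by case: a e => [|a] e; [apply: P_eq (P_0 _) _; apply/funext => W; rewrite mul0r
    | apply: P_mon; rewrite /=; apply/eqP; move: e => /=; lia].
- by case: b e => [|b] e; [apply: P_eq (P_0 _) _; apply/funext => W; rewrite mul0r
    | apply: P_mon; rewrite /=; apply/eqP; move: e => /=; lia].
- by case: c e => [|c] e; [apply: P_eq (P_0 _) _; apply/funext => W; rewrite mul0r
    | apply: P_mon; rewrite /=; apply/eqP; move: e => /=; lia].
- by case: d e => [|d] e; [apply: P_eq (P_0 _) _; apply/funext => W; rewrite mul0r
    | apply: P_mon; rewrite /=; apply/eqP; move: e => /=; lia].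
Qed.

Lemma P0_cst f : P (Some 0%N) f -> exists z, f = fun=> z.
Proof.
elim=> [z [|//] [|//] [|//] [|//] _|f1 g1 _ [z1 ->] _ [z2 ->]]; last by exists (z1 + z2).
by exists z; apply/funext => W; rewrite /pmon !expr0 !mulr1.
Qed.

Lemma pd_cst i j z : pd i j (fun=> z : R[i]) = fun=> 0.
Proof. by apply/funext => Z; apply: isd_pd (isd_cst _ _ _ _). Qed.

Lemma P_pdS n f i j : P (Some n.+1) f -> P (Some n) (pd i j f).
Proof.
elim=> [z a b c d /= /eqP h|f1 g1 lf1 h1 lg1 h2].
- apply: P_eq (P_scale z ((P_dpmon i j a b c d).2 n h)) _; apply/funext => Z.
  by rewrite (isd_pd (isdZ z (isd_pmon i j a b c d Z))).
- apply: P_eq (P_add h1 h2) _; apply/funext => Z.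
  by rewrite (isd_pd (isdD (P_isd i j Z lf1) (P_isd i j Z lg1))).
Qed.

Lemma P_pd0 f i j : P (Some 0%N) f -> pd i j f = fun=> 0.
Proof. by move=> /P0_cst [z ->]; exact: pd_cst. Qed.

Lemma P_pd f i j : P None f -> P None (pd i j f).
Proof.
elim=> [z a b c d /= h|f1 g1 lf1 h1 lg1 h2].
- apply: P_eq (P_scale z (P_dpmon i j a b c d).1) _; apply/funext => Z.
  by rewrite (isd_pd (isdZ z (isd_pmon i j a b c d Z))).
- apply: P_eq (P_add h1 h2) _; apply/funext => Z.
  by rewrite (isd_pd (isdD (P_isd i j Z lf1) (P_isd i j Z lg1))).
Qed.

Definition opred (o : option int) : option int := if o is Some n then Some (n - 1) else None.

Lemma L_cast o o' f : L o f -> o = o' -> L o' f. Proof. by move=> h <-. Qed.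

Lemma L_pmon a b c d : L (Some (a + b + c + d)%:Z) (pmon a b c d).
Proof.
apply: L_ext (P_L (@P_mon (Some (a + b + c + d)%N) 1 a b c d (eqxx _))) _.
by move=> W _; rewrite mul1r.
Qed.

Lemma L_dpmon i j a b c d : L (Some ((a + b + c + d)%:Z - 1)) (dpmon i j a b c d).
Proof.
case e: (a + b + c + d)%N => [|n]; last first.
  by apply: L_cast (P_L ((P_dpmon i j a b c d).2 n (esym e))) _ => /=; congr Some; lia.
have [-> -> -> ->] : [/\ a = 0, b = 0, c = 0 & d = 0]%N by split; move: e; lia.
apply: L_ext (L_0 _) _ => W _; rewrite /dpmon.
by case: (ord2_cases i) => ->; case: (ord2_cases j) => ->; rewrite !mx2E mul0r.
Qed.

Lemma L_dmon i j z k a b c d :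
  L (Some (k * 2 + (a + b + c + d)%:Z - 1)) (pd i j (fun W => z * mon k a b c d W)).
Proof.
apply: L_ext (_ : L _ (fun W => z * (k%:~R * \det W ^ (k - 1) * mxplus W j i * pmon a b c d W
     + \det W ^ k * dpmon i j a b c d W))) _; last first.
  by move=> W uW; rewrite (isd_pd (isdZ z (isd_mon i j k a b c d uW))).
apply: L_scale; apply: L_add; last by apply: L_mulS (L_detz _) (L_dpmon _ _ _ _ _ _) _; lia.
have l1 : L (Some (k * 2 - 1)) (fun W => k%:~R * \det W ^ (k - 1) * mxplus W j i).
  by apply: L_mulS (L_scale _ (L_detz _)) (P_L (P_mxplus j i)) _ => /=; lia.
by apply: L_mulS l1 (L_pmon a b c d) _; lia.
Qed.

Lemma L_pd o f i j : L o f -> L (opred o) (pd i j f).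
Proof.
elim=> [z k a b c d h|f1 g1 lf1 h1 lg1 h2|f1 g1 _ h1 e].
- case: o h => [n|_] /=; last exact: L_None (L_dmon _ _ _ _ _ _ _ _).
  by move=> /eqP ->; exact: L_dmon.
- by apply: L_ext (L_add h1 h2) _ => Z uZ; rewrite (isd_pd (isdD (L_isd i j lf1 uZ) (L_isd i j lg1 uZ))).
- by apply: L_ext h1 _; exact: pd_eqU.
Qed.

Lemma L_pdS n f i j : L (Some n) f -> L (Some (n - 1)) (pd i j f).
Proof. exact: L_pd. Qed.

Lemma L_pdN f i j : L None f -> L None (pd i j f).
Proof. exact: L_pd. Qed.

Lemma pdD f g i j : L None f -> L None g ->
  eqU (pd i j (fun W => f W + g W)) (fun W => pd i j f W + pd i j g W).
Proof. by move=> lf lg Z uZ; apply: isd_pd (isdD (L_isd i j lf uZ) (L_isd i j lg uZ)). Qed.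

Lemma pdZ f z i j : L None f ->
  eqU (pd i j (fun W => z * f W)) (fun W => z * pd i j f W).
Proof. by move=> lf Z uZ; apply: isd_pd (isdZ z (L_isd i j lf uZ)). Qed.

Lemma pdM f g i j : L None f -> L None g ->
  eqU (pd i j (fun W => f W * g W))
      (fun W => pd i j f W * g W + f W * pd i j g W).
Proof. by move=> lf lg Z uZ; apply: isd_pd (isdM (L_isd i j lf uZ) (L_isd i j lg uZ)). Qed.

Lemma pd_coord i j k l :
  pd i j (fun W : HC R => W k l) = fun=> ((i == k) && (j == l))%:R.
Proof. by apply/funext => W; apply: isd_pd (isd_coord i j k l W). Qed.

Lemma pd_detz i j k :
  eqU (pd i j (fun W => \det W ^ k)) (fun W => k%:~R * \det W ^ (k - 1) * mxplus W j i).
Proof. by move=> W uW; apply: isd_pd (isd_detz _ _ _ uW). Qed.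

Lemma L_coord o i j : dok o 1 -> L o (fun W => W i j).
Proof.
case: o => [n /= /eqP ->|_]; first exact: P_L (P_coord i j).
exact: P_LN (P_coord i j).
Qed.

Lemma L_cst z : L (Some 0) (fun=> z).
Proof. exact: P_L (P_cst z). Qed.

Lemma pd_sum (I : Type) (r : seq I) (p : pred I) (F : I -> HC R -> R[i]) i j :
  (forall k, p k -> L None (F k)) ->
  eqU (pd i j (fun W => \sum_(k <- r | p k) F k W))
      (fun W => \sum_(k <- r | p k) pd i j (F k) W).
Proof.
move=> h; elim: r => [|x r ih] W uW.
  rewrite big_nil (_ : (fun _ => _) = fun=> 0) ?pd_cst//.
  by apply/funext => V; rewrite big_nil.
rewrite (_ : (fun _ => _) = fun V => if p x then F x V + \sum_(k <- r | p k) F k V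
    else \sum_(k <- r | p k) F k V); last by apply/funext => V; rewrite big_cons.
rewrite big_cons -!ih//; case px: (p x) => //.
by rewrite pdD//; [exact: h|exact: L_sum].
Qed.

End LaurentFunctions.

(** * Commutation of partial derivatives, by algebra *)

Section Schwarz.
Variable R : realType.
Implicit Types (f g : HC R -> R[i]) (Z W : HC R).

Lemma mxplusF : ((fun V : HC R => mxplus V 0 0) = (fun V => V 1 1)) *
  ((fun V : HC R => mxplus V 0 1) = (fun V => - V 0 1)) *
  ((fun V : HC R => mxplus V 1 0) = (fun V => - V 1 0)) *
  ((fun V : HC R => mxplus V 1 1) = (fun V => V 0 0)).
Proof. by do ! split; apply/funext => V; rewrite /mxplus mx2E. Qed.

Lemma L_inv_det : L None (fun W : HC R => (\det W)^-1).
Proof.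
by apply: L_ext (L_None (L_detz R (-1))) _ => W _; rewrite exprN1.
Qed.

(** Off N = 0 the Laurent functions form the algebra generated by the coordinates and N^-1. A
    property stable under sums and products is thus checked on generators, where the Leibniz rule
    replaces computations with exponents. It serves for the symmetry of second derivatives and for
    the chain rule under inversion. *)
Lemma L_generated (C : (HC R -> R[i]) -> Prop) :
  (forall g h, C g -> C h -> C (fun W => g W * h W)) ->
  (forall g h, C g -> C h -> C (fun W => g W + h W)) ->
  (forall g h, C g -> eqU g h -> C h) ->
  (forall z, C (fun=> z)) ->
  (forall a b, C (fun W => W a b)) ->
  C (fun W => (\det W)^-1) ->
  forall f, L None f -> C f.
Proof.
move=> CM Cadd Cext Ccst Ccoord Cinv.
have CX g n : C g -> C (fun W => g W ^+ n).
  move=> cg; elim: n => [|n ih]; first by apply: Cext (Ccst 1) _ => W _; rewrite expr0.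
  by apply: Cext (CM _ _ cg ih) _ => W _; rewrite exprS.
have Cdet : C (fun W => \det W).
  apply: Cext (Cadd _ _ (CM _ _ (Ccoord 0 0) (Ccoord 1 1))
                        (CM _ _ (Ccst (-1)) (CM _ _ (Ccoord 0 1) (Ccoord 1 0)))) _.
  by move=> W _; rewrite det2 mulN1r.
move=> f; elim=> {f} [z m a b c d _|f1 g1 _ h1 _ h2|f1 g1 _ h1 e].
- apply: (CM _ _ (Ccst z)); apply: (CM).
    case: m => m; first exact: (CX _ _ Cdet).
    by apply: Cext (CX _ m.+1 Cinv) _ => W _; rewrite NegzE exprVn exprnN.
  exact: (CM _ _ (CM _ _ (CM _ _ (CX _ _ (Ccoord 0 0)) (CX _ _ (Ccoord 0 1))) (CX _ _ (Ccoord 1 0))) (CX _ _ (Ccoord 1 1))).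
- exact: Cadd.
- exact: Cext e.
Qed.

Lemma pd_inv_det a b : eqU (pd a b (fun W => (\det W)^-1))
  (fun W => - 1 * (mxplus W b a * ((\det W)^-1 * (\det W)^-1))).
Proof.
move=> W uW; have := isdV uW (isd_det a b W) => /isd_pd ->.
by rewrite -invfM expr2 mulN1r mulNr.
Qed.

(** Laurent functions are closed under [pd], so the symmetry of second derivatives reduces to the
    Leibniz rule and to the one generator with a nonzero Hessian, N^-1. *)
Lemma pd_comm f i j k l : L None f -> eqU (pd i j (pd k l f)) (pd k l (pd i j f)).
Proof.
have l2 a b (u : HC R -> R[i]) : L None u -> L None (pd a b u) by exact: L_pdN.
pose C g := L None g /\ eqU (pd i j (pd k l g)) (pd k l (pd i j g)).
move=> lf; suff : C f by case.
apply: (L_generated (C := C)) lf => [g h [lg cg] [lh ch]|g h [lg cg] [lh ch]|g h [lg cg] e|z|a b|].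
- split; first exact: L_mul.
  have st a b c d : eqU (pd a b (pd c d (fun W => g W * h W)))
     (fun W => pd a b (pd c d g) W * h W + pd c d g W * pd a b h W
       + (pd a b g W * pd c d h W + g W * pd a b (pd c d h) W)).
    move=> W uW; rewrite (pd_eqU a b (pdM c d lg lh) uW).
    rewrite (pdD a b (L_mul (l2 _ _ _ lg) lh) (L_mul lg (l2 _ _ _ lh)) uW).
    by rewrite (pdM a b (l2 _ _ _ lg) lh uW) (pdM a b lg (l2 _ _ _ lh) uW).
  by move=> W uW; rewrite (st _ _ _ _ _ uW) (st _ _ _ _ _ uW) (cg _ uW) (ch _ uW); ring.
- split; first exact: L_add.
  have st a b c d : eqU (pd a b (pd c d (fun W => g W + h W)))
     (fun W => pd a b (pd c d g) W + pd a b (pd c d h) W).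
    move=> W uW; rewrite (pd_eqU a b (pdD c d lg lh) uW).
    by rewrite (pdD a b (l2 _ _ _ lg) (l2 _ _ _ lh) uW).
  by move=> W uW; rewrite (st _ _ _ _ _ uW) (st _ _ _ _ _ uW) (cg _ uW) (ch _ uW).
- split; first exact: L_ext lg e.
  move=> W uW; rewrite -(pd_eqU i j (pd_eqU k l e) uW) (cg _ uW).
  exact: (pd_eqU k l (pd_eqU i j e)).
- by split; [exact: L_None (L_cst z)|move=> W uW; rewrite !pd_cst].
- by split; [exact: L_coord|move=> W uW; rewrite !pd_coord !pd_cst].
- split; first exact: L_inv_det.
  have li := L_inv_det; have lp a b := P_LN (P_mxplus R a b).
  (* Symmetry of the Hessian of N, whose gradient has the entries of [mxplus]. *)
  have dp a b c d W : pd a b (fun V => mxplus V d c) W = pd c d (fun V => mxplus V b a) W.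
    have h x y u v : isd x y (fun V => mxplus V u v) W
        (mx2 ((x == 1) && (y == 1))%:R (- ((x == 0) && (y == 1))%:R)
           (- ((x == 1) && (y == 0))%:R) ((x == 0) && (y == 0))%:R u v).
      case: (ord2_cases u) => ->; case: (ord2_cases v) => ->; rewrite mx2E mxplusF;
        try apply: isdN; exact: isd_coord.
    rewrite (isd_pd (h a b d c)) (isd_pd (h c d b a)).
    by case: (ord2_cases a) => ->; case: (ord2_cases b) => ->;
       case: (ord2_cases c) => ->; case: (ord2_cases d) => ->; rewrite !mx2E /= ?oppr0.
  have st a b c d : eqU (pd a b (pd c d (fun W => (\det W)^-1)))
    (fun W => - 1 * (pd a b (fun V => mxplus V d c) W * ((\det W)^-1 * (\det W)^-1)
      - 2 * (mxplus W b a * mxplus W d c * (\det W)^-1 ^+ 3))).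
    move=> W uW; rewrite (pd_eqU a b (pd_inv_det c d) uW).
    rewrite (pdZ _ a b (L_mul (lp _ _) (L_mul li li)) uW).
    rewrite (pdM a b (lp _ _) (L_mul li li) uW) (pdM a b li li uW) (pd_inv_det _ _ uW).
    by ring.
  by move=> W uW; rewrite (st _ _ _ _ _ uW) (st _ _ _ _ _ uW) dp; ring.
Qed.

End Schwarz.

(** * Taylor expansions *)

Section Taylor.
Variable R : realType.
Implicit Types (f g u : HC R -> R[i]) (X Z W : HC R).

Lemma L_pdi f i j : L None f -> L None (pd i j f). Proof. exact: L_pdN. Qed.
Hint Resolve L_pdi : core.

(** The sign makes the exponential of [dX X] the translation by -X, as in K (W - Z). *)
Definition dX X f W := - \sum_k \sum_l X k l * pd k l f W.

Lemma dX_eqU X f g : eqU f g -> eqU (dX X f) (dX X g).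
Proof.
move=> e W uW; rewrite /dX; congr (- _); apply: eq_bigr => k _; apply: eq_bigr => l _.
by rewrite (pd_eqU k l e uW).
Qed.

Lemma dX_L X o f : L o f -> L (opred o) (dX X f).
Proof.
move=> lf; apply: L_opp; apply: L_sum => k _; apply: L_sum => l _.
exact: L_scale (L_pd _ _ lf).
Qed.

Lemma dX_LN X f : L None f -> L None (dX X f). Proof. exact: dX_L. Qed.
Hint Resolve dX_LN : core.

Lemma dXD X f g : L None f -> L None g ->
  eqU (dX X (fun W => f W + g W)) (fun W => dX X f W + dX X g W).
Proof.
move=> lf lg W uW; rewrite /dX -opprD -big_split; congr (- _).
apply: eq_bigr => k _; rewrite -big_split; apply: eq_bigr => l _ /=.
by rewrite (pdD k l lf lg uW) mulrDr.
Qed.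

Lemma dXZ X z f : L None f -> eqU (dX X (fun W => z * f W)) (fun W => z * dX X f W).
Proof.
move=> lf W uW; rewrite /dX mulrN mulr_sumr; congr (- _).
apply: eq_bigr => k _; rewrite mulr_sumr; apply: eq_bigr => l _ /=.
by rewrite (pdZ z k l lf uW) mulrCA.
Qed.

Lemma dXM X f g : L None f -> L None g ->
  eqU (dX X (fun W => f W * g W)) (fun W => dX X f W * g W + f W * dX X g W).
Proof.
move=> lf lg W uW; rewrite /dX mulNr mulrN -opprD mulr_sumr mulr_suml -big_split; congr (- _).
apply: eq_bigr => k _; rewrite /= mulr_sumr mulr_suml -big_split; apply: eq_bigr => l _ /=.
by rewrite (pdM k l lf lg uW) mulrDr mulrA (mulrCA (f W)).
Qed.

Lemma dX_sum X (I : Type) (r : seq I) (p : pred I) (F : I -> HC R -> R[i]) :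
  (forall k, p k -> L None (F k)) ->
  eqU (dX X (fun W => \sum_(k <- r | p k) F k W)) (fun W => \sum_(k <- r | p k) dX X (F k) W).
Proof.
move=> h W uW; rewrite /dX sumrN; congr (- _); rewrite [RHS]exchange_big /=.
apply: eq_bigr => k _; rewrite [RHS]exchange_big /=; apply: eq_bigr => l _.
by rewrite (pd_sum r k l h uW) mulr_sumr.
Qed.

Lemma pd_dX X f i j : L None f -> eqU (pd i j (dX X f)) (dX X (pd i j f)).
Proof.
move=> lf W uW; rewrite /dX.
have l1 k l : L None (fun V => X k l * pd k l f V) by apply: L_scale; exact: L_pdi.
have e : eqU (dX X f) (fun V => - 1 * \sum_k \sum_l X k l * pd k l f V).
  by move=> V _; rewrite mulN1r.
rewrite (pd_eqU i j e uW) (pdZ (-1) i j _ uW); last by apply: L_sum => k _; exact: L_sum.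
rewrite mulN1r; congr (- _).
rewrite (@pd_sum _ _ _ _ (fun k V => \sum_l X k l * pd k l f V) i j _ W uW); last by move=> k _; exact: L_sum.
apply: eq_bigr => k _.
rewrite (@pd_sum _ _ _ _ (fun l V => X k l * pd k l f V) i j _ W uW)//.
by apply: eq_bigr => l _; rewrite (pdZ _ i j (L_pdi k l lf) uW) (pd_comm i j k l lf uW).
Qed.

(* The Taylor expansion: f (W - X) is the sum over a of E a X f W. *)
Definition E a X f W := (a`!%:R)^-1 * iter a (dX X) f W.

Lemma iter_dX_L a X n f : L (Some n) f -> L (Some (n - a%:Z)) (iter a (dX X) f).
Proof.
elim: a => [|a ih] lf /=; first by rewrite subr0.
by apply: L_cast (dX_L X (ih lf)) _ => /=; congr Some; lia.
Qed.

Lemma iter_dX_LN a X f : L None f -> L None (iter a (dX X) f).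
Proof. by elim: a => //= a ih lf; apply: dX_LN; exact: ih. Qed.

Lemma E_L a X n f : L (Some n) f -> L (Some (n - a%:Z)) (E a X f).
Proof. by move=> lf; apply: L_scale; exact: iter_dX_L. Qed.

Lemma E_LN a X f : L None f -> L None (E a X f).
Proof. by move=> lf; apply: L_scale; exact: iter_dX_LN. Qed.

Lemma iter_dX_eqU a X f g : eqU f g -> eqU (iter a (dX X) f) (iter a (dX X) g).
Proof. by move=> e; elim: a => //= a ih; exact: dX_eqU. Qed.

Lemma E_eqU a X f g : eqU f g -> eqU (E a X f) (E a X g).
Proof. by move=> e W uW; rewrite /E (iter_dX_eqU a X e uW). Qed.

Lemma iter_dXD a X f g : L None f -> L None g ->
  eqU (iter a (dX X) (fun W => f W + g W)) (fun W => iter a (dX X) f W + iter a (dX X) g W).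
Proof.
move=> lf lg; elim: a => //= a ih W uW.
by rewrite (dX_eqU X ih uW) (dXD X (iter_dX_LN a X lf) (iter_dX_LN a X lg) uW).
Qed.

Lemma iter_dXZ a X z f : L None f ->
  eqU (iter a (dX X) (fun W => z * f W)) (fun W => z * iter a (dX X) f W).
Proof.
move=> lf; elim: a => //= a ih W uW.
by rewrite (dX_eqU X ih uW) (dXZ X z (iter_dX_LN a X lf) uW).
Qed.

Lemma ED a X f g : L None f -> L None g ->
  eqU (E a X (fun W => f W + g W)) (fun W => E a X f W + E a X g W).
Proof. by move=> lf lg W uW; rewrite /E (iter_dXD a X lf lg uW) mulrDr. Qed.

Lemma EZ a X z f : L None f -> eqU (E a X (fun W => z * f W)) (fun W => z * E a X f W).
Proof. by move=> lf W uW; rewrite /E (iter_dXZ a X z lf uW) mulrCA. Qed.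

Lemma E_sum a X (I : Type) (r : seq I) (p : pred I) (F : I -> HC R -> R[i]) :
  (forall k, p k -> L None (F k)) ->
  eqU (E a X (fun W => \sum_(k <- r | p k) F k W)) (fun W => \sum_(k <- r | p k) E a X (F k) W).
Proof.
move=> h; elim: r => [|x r ih] W uW.
  rewrite big_nil (E_eqU (g := fun W => 0 * 0) _ _ _ uW); last by move=> V uV; rewrite big_nil mul0r.
  by rewrite (EZ a X 0 (L_0 _ _) uW) mul0r.
have e : eqU (fun W => \sum_(k <- x :: r | p k) F k W)
   (if p x then (fun V => F x V + \sum_(k <- r | p k) F k V)
    else (fun V => \sum_(k <- r | p k) F k V)).
  by move=> V _; rewrite big_cons; case: ifP.
rewrite (E_eqU a X e uW) big_cons -(ih W uW); case px: (p x) => //.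
by rewrite (ED a X (h _ px) _ uW)//; exact: L_sum.
Qed.

Lemma pd_iter_dX a X f i j : L None f ->
  eqU (pd i j (iter a (dX X) f)) (iter a (dX X) (pd i j f)).
Proof.
move=> lf; elim: a => //= a ih W uW.
by rewrite (pd_dX X i j (iter_dX_LN a X lf) uW) (dX_eqU X ih uW).
Qed.

Lemma pd_E a X f i j : L None f -> eqU (pd i j (E a X f)) (E a X (pd i j f)).
Proof.
by move=> lf W uW; rewrite (pdZ _ i j (iter_dX_LN a X lf) uW) (pd_iter_dX a X i j lf uW).
Qed.

Lemma E0 X f : E 0 X f = f.
Proof. by apply/funext => W; rewrite /E invr1 mul1r. Qed.

Lemma ESl a X f : L None f -> eqU (fun W => a.+1%:R * E a.+1 X f W) (dX X (E a X f)).
Proof.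
move=> lf W uW; rewrite (dXZ X _ (iter_dX_LN a X lf) uW) /E factS natrM invfM /=.
by rewrite !mulrA mulfV ?mul1r// pnatr_eq0.
Qed.

Lemma ESr a X f W : E a.+1 X f W = a.+1%:R^-1 * E a X (dX X f) W.
Proof. by rewrite /E iterSr factS natrM invfM mulrA. Qed.

(** The Leibniz rule for divided powers of a derivation: both sides are multiplied by n + 1, and the
    induction step splits n + 1 as a + (n + 1 - a). *)
Lemma E_mul n X f g : L None f -> L None g ->
  eqU (E n X (fun W => f W * g W)) (fun W => \sum_(a < n.+1) E a X f W * E (n - a) X g W).
Proof.
move=> lf lg; elim: n => [|n ih] W uW; first by rewrite big_ord1 !E0.
have n0 : n.+1%:R != 0 :> R[i] by rewrite pnatr_eq0.
apply: (mulfI n0); rewrite (ESl n X (L_mul lf lg) uW) (dX_eqU X ih uW).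
rewrite (@dX_sum X _ _ _ (fun (a : 'I_n.+1) W => E a X f W * E (n - a) X g W) _ W uW); last first.
  by move=> a _; apply: L_mul; exact: E_LN.
rewrite mulr_sumr.
have -> : \sum_(a < n.+1) dX X (fun V => E a X f V * E (n - a) X g V) W =
  \sum_(a < n.+1) (a.+1%:R * E a.+1 X f W * E (n - a) X g W) +
  \sum_(a < n.+1) (E a X f W * ((n - a).+1%:R * E (n - a).+1 X g W)).
  rewrite -big_split; apply: eq_bigr => a _ /=.
  by rewrite (dXM X (E_LN a X lf) (E_LN (n - a) X lg) uW) (ESl a X lf uW) (ESl (n - a) X lg uW).
have -> : \sum_(a < n.+2) n.+1%:R * (E a X f W * E (n.+1 - a) X g W) =
  \sum_(a < n.+2) (a%:R * E a X f W * E (n.+1 - a) X g W) +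
  \sum_(a < n.+2) (E a X f W * ((n.+1 - a)%:R * E (n.+1 - a) X g W)).
  rewrite -big_split; apply: eq_bigr => a _ /=.
  have -> : n.+1%:R = a%:R + (n.+1 - a)%:R :> R[i] by rewrite -natrD subnKC// -ltnS.
  by ring.
congr (_ + _).
  by rewrite [RHS]big_ord_recl /= mul0r mul0r add0r; apply: eq_bigr => a _; rewrite /bump /= add1n subSS.
rewrite [RHS]big_ord_recr /= subnn mul0r mulr0 addr0; apply: eq_bigr => a _.
by rewrite subSn// -ltnS.
Qed.

Lemma dX_coord X i j W : dX X (fun V => V i j) W = - X i j.
Proof.
rewrite /dX; congr (- _); rewrite !sum2 !pd_coord.
by case: (ord2_cases i) => ->; case: (ord2_cases j) => -> /=; ring.
Qed.

Lemma E1_coord X i j W : HCunits W -> E 1 X (fun V => V i j) W = - X i j.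
Proof. by move=> uW; rewrite ESr E0 dX_coord invr1 mul1r. Qed.

Lemma dX_cst X z W : dX X (fun=> z) W = 0.
Proof.
rewrite /dX; under eq_bigr do under eq_bigr do rewrite pd_cst mulr0.
by rewrite big1 ?oppr0// => k _; rewrite big1.
Qed.

Lemma E_cst a X z : E a.+1 X (fun=> z) = fun=> 0.
Proof.
elim: a z => [|a ih] z; apply/funext => W; rewrite ESr.
  by rewrite E0 dX_cst mulr0.
by rewrite (_ : dX X _ = fun=> 0) ?ih ?mulr0//; apply/funext => V; rewrite dX_cst.
Qed.

Lemma E_coord a X i j W : E a.+2 X (fun V => V i j) W = 0.
Proof.
rewrite ESr (_ : dX X _ = fun=> - X i j); last by apply/funext => V; exact: dX_coord.
by rewrite E_cst mulr0.
Qed.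

Lemma E_mulX a X i j f : L None f ->
  eqU (E a.+1 X (fun W => W i j * f W)) (fun W => W i j * E a.+1 X f W - X i j * E a X f W).
Proof.
move=> lf W uW; have lc : L None (fun V : HC R => V i j) by exact: L_coord.
rewrite (E_mul a.+1 X lc lf uW) big_ord_recl big_ord_recl /= E0 subn0 big1.
  by rewrite addr0 /bump /= add1n subSS subn0 (E1_coord _ _ _ uW) mulNr.
by move=> k _; rewrite E_coord mul0r.
Qed.

(** The coefficient of t in N (W - t X). *)
Definition n1 X W := - (X 0 0 * W 1 1 + X 1 1 * W 0 0 - X 0 1 * W 1 0 - X 1 0 * W 0 1).

Lemma det_mulE f : L None f -> eqU (fun W => \det W * f W)
  (fun W => W 0 0 * (W 1 1 * f W) + -1 * (W 0 1 * (W 1 0 * f W))).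
Proof. by move=> lf W _; rewrite det2; ring. Qed.

Lemma E_det1 X f : L None f ->
  eqU (E 1 X (fun W => \det W * f W)) (fun W => \det W * E 1 X f W + n1 X W * f W).
Proof.
move=> lf W uW; have lX i j g : L None g -> L None (fun V => V i j * g V).
  by move=> lg; apply: L_mul => //; exact: L_coord.
rewrite (E_eqU 1 X (det_mulE lf) uW).
rewrite (ED 1 X (lX _ _ _ (lX _ _ _ lf)) (L_scale _ (lX _ _ _ (lX _ _ _ lf))) uW).
rewrite (EZ 1 X _ (lX _ _ _ (lX _ _ _ lf)) uW).
rewrite (E_mulX 0 X 0 0 (lX 1 1 _ lf) uW) (E_mulX 0 X 0 1 (lX 1 0 _ lf) uW).
rewrite (E_mulX 0 X 1 1 lf uW) (E_mulX 0 X 1 0 lf uW) !E0 /n1 det2.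
by ring.
Qed.

(** As N is quadratic, N (W - t X) has just the coefficients N (W), [n1 X W] and N (X), so
    multiplication by N becomes a three-term relation between Taylor coefficients. Solved for the
    leading term, it is the recurrence that controls convergence. *)
Lemma E_detS a X f : L None f ->
  eqU (E a.+2 X (fun W => \det W * f W))
   (fun W => \det W * E a.+2 X f W + n1 X W * E a.+1 X f W + \det X * E a X f W).
Proof.
move=> lf W uW; have lX i j g : L None g -> L None (fun V => V i j * g V).
  by move=> lg; apply: L_mul => //; exact: L_coord.
rewrite (E_eqU a.+2 X (det_mulE lf) uW).
rewrite (ED a.+2 X (lX _ _ _ (lX _ _ _ lf)) (L_scale _ (lX _ _ _ (lX _ _ _ lf))) uW).
rewrite (EZ a.+2 X _ (lX _ _ _ (lX _ _ _ lf)) uW).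
rewrite (E_mulX a.+1 X 0 0 (lX 1 1 _ lf) uW) (E_mulX a.+1 X 0 1 (lX 1 0 _ lf) uW).
rewrite (E_mulX a.+1 X 1 1 lf uW) (E_mulX a.+1 X 1 0 lf uW).
rewrite (E_mulX a X 1 1 lf uW) (E_mulX a X 1 0 lf uW) /n1 !det2.
by ring.
Qed.

(** Two kinds of functional are meant: integration against a fixed Laurent factor, where the
    translation parameter is Z in D_R^+, and evaluation at a fixed Z in D_R^-, where the translation
    parameter is the integration variable. Facts on [l (E a X u)] as a function of X then cover both
    domains. *)
Definition linear_on_L (l : (HC R -> R[i]) -> R[i]) := [/\
  forall f g, L None f -> L None g -> l (fun W => f W + g W) = l f + l g,
  forall z f, L None f -> l (fun W => z * f W) = z * l f &
  forall f g, L None f -> eqU f g -> l f = l g].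

Lemma linear_on_L_sum l (I : Type) (r : seq I) (p : pred I) (F : I -> HC R -> R[i]) :
  linear_on_L l -> (forall k, p k -> L None (F k)) ->
  l (fun W => \sum_(k <- r | p k) F k W) = \sum_(k <- r | p k) l (F k).
Proof.
move=> [lD lZ le] h; elim: r => [|x r ih].
  have l00 : l (fun=> 0) = 0.
    by have := lZ 0 _ (L_0 R None); rewrite !mul0r.
  rewrite big_nil -[RHS]l00; congr l; apply/funext => W; exact: big_nil.
have e : eqU (if p x then (fun V => F x V + \sum_(k <- r | p k) F k V)
    else (fun V => \sum_(k <- r | p k) F k V)) (fun W => \sum_(k <- x :: r | p k) F k W).
  by move=> V _; rewrite big_cons; case: ifP.
have ls : L None (fun V => \sum_(k <- r | p k) F k V) by exact: L_sum.
rewrite big_cons -ih.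
case px: (p x) e => e; rewrite -(le _ _ _ e)//.
  by rewrite lD//; exact: h.
by apply: L_add => //; exact: h.
Qed.

Lemma linear_ES l a X u : linear_on_L l -> L None u ->
  l (E a.+1 X u) = - a.+1%:R^-1 * \sum_k \sum_m X k m * l (E a X (pd k m u)).
Proof.
move=> hl lu; have [lD lZ le] := hl.
have l1 k m : L None (fun W => X k m * pd k m u W) by apply: L_scale; exact: L_pdi.
have e : eqU (fun W => - a.+1%:R^-1 * \sum_k \sum_m X k m * E a X (pd k m u) W) (E a.+1 X u).
  move=> W uW; rewrite ESr mulNr -mulrN; congr (_ * _).
  have e2 : eqU (fun W => -1 * (\sum_k \sum_m X k m * pd k m u W)) (dX X u).
    by move=> V _; rewrite mulN1r.
  rewrite -(E_eqU a X e2 uW) (EZ a X (-1) _ uW); last by apply: L_sum => k _; exact: L_sum.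
  rewrite mulN1r; congr (- _).
  rewrite (@E_sum a X _ _ _ (fun k V => \sum_m X k m * pd k m u V) _ W uW); last by move=> k _; exact: L_sum.
  apply: eq_bigr => k _.
  rewrite (@E_sum a X _ _ _ (fun m V => X k m * pd k m u V) _ W uW)//.
  by apply: eq_bigr => m _; rewrite (EZ a X _ (L_pdi k m lu) uW).
have l2 k m : L None (fun W => X k m * E a X (pd k m u) W).
  by apply: L_scale; apply: E_LN; exact: L_pdi.
rewrite -(le _ _ _ e); last first.
  by apply: L_scale; apply: L_sum => k _; exact: L_sum.
rewrite lZ; last by apply: L_sum => k _; exact: L_sum.
congr (_ * _).
rewrite (@linear_on_L_sum l _ _ _ (fun k V => \sum_m X k m * E a X (pd k m u) V) hl)//; last by move=> k _; exact: L_sum.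
apply: eq_bigr => k _.
rewrite (@linear_on_L_sum l _ _ _ (fun m V => X k m * E a X (pd k m u) V) hl)//.
by apply: eq_bigr => m _; rewrite lZ//; apply: E_LN; exact: L_pdi.
Qed.

Lemma linear_E_P l a u : linear_on_L l -> L None u -> P (Some a) (fun X => l (E a X u)).
Proof.
move=> hl; elim: a u => [|a ih] u lu.
  by apply: P_eq (P_cst (l u)) _; apply/funext => X; rewrite E0.
rewrite (_ : (fun X => _) = (fun X => - a.+1%:R^-1 * \sum_k \sum_m X k m * l (E a X (pd k m u)))); last first.
  by apply/funext => X; rewrite linear_ES.
apply: P_scale; apply: P_sum => k _; apply: P_sum => m _.
by rewrite -[a.+1]add1n; apply: P_mulS (P_coord _ k m) _; apply: ih; exact: L_pdi.
Qed.

(** Degree by degree, this is the chain rule for u (W - X) in the variable X. *)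
Lemma linear_E_pd l a u i j X : linear_on_L l -> L None u ->
  pd i j (fun X => l (E a.+1 X u)) X = - l (E a X (pd i j u)).
Proof.
move=> hl; elim: a u X => [|a ih] u X lu.
  rewrite (_ : (fun X => _) = (fun X => \sum_k \sum_m - X k m * l (pd k m u))); last first.
    apply/funext => Y; rewrite linear_ES// invr1 mulN1r -sumrN; apply: eq_bigr => k _.
    by rewrite -sumrN; apply: eq_bigr => m _; rewrite E0 mulNr.
  rewrite E0; apply: isd_pd.
  rewrite (_ : (fun X0 => _) = (fun X : HC R =>
      - X 0 0 * l (pd 0 0 u) + - X 0 1 * l (pd 0 1 u) + (- X 1 0 * l (pd 1 0 u) + - X 1 1 * l (pd 1 1 u)))); last first.
    by apply/funext => Y; rewrite !sum2.
  pose h k m := isdM (isdN (isd_coord i j k m X)) (isd_cst i j (l (pd k m u)) X).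
  apply: isd_eq (isdD (isdD (h 0 0) (h 0 1)) (isdD (h 1 0) (h 1 1))) _.
  by case: (ord2_cases i) => ->; case: (ord2_cases j) => -> /=; ring.
pose Q k m Y := l (E a.+1 Y (pd k m u)).
have lp k m : L None (pd k m u) by exact: L_pdi.
rewrite (_ : (fun X => _) = (fun X => - a.+2%:R^-1 *
   (X 0 0 * Q 0 0 X + X 0 1 * Q 0 1 X + (X 1 0 * Q 1 0 X + X 1 1 * Q 1 1 X)))); last first.
  by apply/funext => Y; rewrite linear_ES// !sum2.
have hQ k m : isd i j (Q k m) X (- l (E a X (pd k m (pd i j u)))).
  have := P_isd i j X (linear_E_P a.+1 hl (lp k m)); rewrite ih// => h.
  apply: isd_eq h _; congr (- _); apply: (let: And3 _ _ le := hl in le).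
    by apply: E_LN; do 2 apply: L_pdi.
  by apply: E_eqU; exact: pd_comm.
pose h k m := isdM (isd_coord i j k m X) (hQ k m).
apply: isd_pd; apply: isd_eq (isdZ _ (isdD (isdD (h 0 0) (h 0 1)) (isdD (h 1 0) (h 1 1)))) _.
have a2 : a.+2%:R != 0 :> R[i] by rewrite pnatr_eq0.
rewrite mulNr; congr (- _); apply: (mulfI a2); rewrite mulVKf//.
(* The derivative of the coordinate factor contributes 1, and the remaining sum contributes a + 1 by
   [linear_ES]; together they cancel the prefactor 1/(a + 2). *)
have -> : a.+2%:R = 1 + a.+1%:R :> R[i] by rewrite nat1r.
rewrite mulrDl mul1r.
have -> : a.+1%:R * l (E a.+1 X (pd i j u)) =
   - \sum_k \sum_m X k m * l (E a X (pd k m (pd i j u))).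
  rewrite (linear_ES a X hl (L_pdi i j lu)).
  by rewrite mulrA mulrN mulfV ?pnatr_eq0// mulN1r.
rewrite !sum2 /Q.
by case: (ord2_cases i) => ->; case: (ord2_cases j) => -> /=; ring.
Qed.

(** Homogeneous differential operators of order n with constant coefficients; the inductive form
    yields commutation with [pd] and the effect on degrees without a symbol calculus. *)
Inductive Dop : nat -> ((HC R -> R[i]) -> HC R -> R[i]) -> Prop :=
| Dop_id : Dop 0 id
| Dop_pd n T i j : Dop n T -> Dop n.+1 (fun f => T (pd i j f))
| Dop_add n T T' : Dop n T -> Dop n T' -> Dop n (fun f W => T f W + T' f W)
| Dop_scale n z T : Dop n T -> Dop n (fun f W => z * T f W).

Lemma Dop_L n T d f : Dop n T -> L (Some d) f -> L (Some (d - n%:Z)) (T f).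
Proof.
move=> h; elim: h d f => {n T} [|n T i j _ ih|n T T' _ ih _ ih'|n z T _ ih] d f lf.
- by rewrite subr0.
- by apply: L_cast (ih _ _ (L_pdS i j lf)) _; congr Some; lia.
- exact: L_add (ih _ _ lf) (ih' _ _ lf).
- exact: L_scale (ih _ _ lf).
Qed.

Lemma Dop_LN n T f : Dop n T -> L None f -> L None (T f).
Proof.
move=> h; elim: h f => {n T} [|n T i j _ ih|n T T' _ ih _ ih'|n z T _ ih] f lf //.
- by apply: ih; exact: L_pdi.
- exact: L_add (ih _ lf) (ih' _ lf).
- exact: L_scale (ih _ lf).
Qed.

Lemma Dop_eqU n T f g : Dop n T -> eqU f g -> eqU (T f) (T g).
Proof.
move=> h; elim: h f g => {n T} [|n T i j _ ih|n T T' _ ih _ ih'|n z T _ ih] f g e //.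
- by apply: ih; exact: pd_eqU.
- by move=> W uW; rewrite (ih _ _ e _ uW) (ih' _ _ e _ uW).
- by move=> W uW; rewrite (ih _ _ e _ uW).
Qed.

Lemma pd_Dop n T f i j : Dop n T -> L None f -> eqU (pd i j (T f)) (T (pd i j f)).
Proof.
move=> h; elim: h f => {n T} [|n T k l hT ih|n T T' hT ih hT' ih'|n z T hT ih] f lf //.
- move=> W uW; rewrite (ih _ (L_pdi k l lf) _ uW).
  exact: (Dop_eqU hT (pd_comm i j k l lf) uW).
- move=> W uW; rewrite (pdD i j (Dop_LN hT lf) (Dop_LN hT' lf) uW).
  by rewrite (ih _ lf _ uW) (ih' _ lf _ uW).
- by move=> W uW; rewrite (pdZ z i j (Dop_LN hT lf) uW) (ih _ lf _ uW).
Qed.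

Lemma DopD n T f g : Dop n T -> L None f -> L None g ->
  eqU (T (fun W => f W + g W)) (fun W => T f W + T g W).
Proof.
move=> h; elim: h f g => {n T} [|n T k l hT ih|n T T' hT ih hT' ih'|n z T hT ih] f g lf lg W uW //.
- rewrite (Dop_eqU hT (pdD k l lf lg) uW).
  by rewrite (ih _ _ (L_pdi k l lf) (L_pdi k l lg) _ uW).
- by rewrite (ih _ _ lf lg _ uW) (ih' _ _ lf lg _ uW) addrACA.
- by rewrite (ih _ _ lf lg _ uW) mulrDr.
Qed.

Lemma DopZ n T z f : Dop n T -> L None f ->
  eqU (T (fun W => z * f W)) (fun W => z * T f W).
Proof.
move=> h; elim: h f => {n T} [|n T k l hT ih|n T T' hT ih hT' ih'|n z' T hT ih] f lf W uW //.
- by rewrite (Dop_eqU hT (pdZ z k l lf) uW) (ih _ (L_pdi k l lf) _ uW).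
- by rewrite (ih _ lf _ uW) (ih' _ lf _ uW) mulrDr.
- by rewrite (ih _ lf _ uW) mulrCA.
Qed.

Lemma linear_eval Z : HCunits Z -> linear_on_L (fun f => f Z).
Proof. by move=> uZ; split=> // f g _; apply. Qed.

(** Separation of variables: X enters only through polynomials, W only through derivatives of u, and
    the index set depends on a alone. This is the source of the finite sums in the tensor
    products. *)
Lemma E_expand a : exists (I : finType) (m : I -> HC R -> R[i])
    (d : I -> (HC R -> R[i]) -> HC R -> R[i]),
  [/\ forall k, P None (m k), forall k, Dop a (d k) &
   forall u X, L None u -> eqU (E a X u) (fun W => \sum_k m k X * d k u W)].
Proof.
elim: a => [|a [I [m [d [hm hd he]]]]].
  exists unit, (fun _ => fun=> 1), (fun _ => id); split=> [_|_|u X lu W uW].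
  - exact: P_None (P_cst 1).
  - exact: Dop_id.
  - by rewrite E0 (big_pred1 tt) ?mul1r// => -[].
exists ('I_2 * 'I_2 * I)%type,
  (fun k X => - a.+1%:R^-1 * (X k.1.1 k.1.2 * m k.2 X)), (fun k u => d k.2 (pd k.1.1 k.1.2 u)).
split=> [k|k|u X lu W uW].
- by apply: P_scale; apply: P_mul => //; exact: P_None (P_coord _ _ _).
- exact: Dop_pd.
- rewrite (linear_ES a X (linear_eval uW) lu).
  rewrite -(pair_bigA _ (fun kl k => - a.+1%:R^-1 * (X kl.1 kl.2 * m k X) * d k (pd kl.1 kl.2 u) W)) /=.
  rewrite -(pair_bigA _ (fun k l => \sum_k0 - a.+1%:R^-1 * (X k l * m k0 X) * d k0 (pd k l u) W)) /=.
  rewrite mulr_sumr; apply: eq_bigr => k _; rewrite mulr_sumr; apply: eq_bigr => l _.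
  rewrite (he _ X (L_pdi k l lu) _ uW) !mulr_sumr; apply: eq_bigr => n _; ring.
Qed.

End Taylor.

(** * The kernel, the inversion and the Laplacian *)

Section Kernel.
Variable R : realType.
Implicit Types (f g u h : HC R -> R[i]) (X Z W : HC R).

Lemma inv_mx2 W : HCunits W -> W^-1 = (\det W)^-1 *: mxplus W.
Proof.
move=> uW; have W0 : \det W != 0 by [].
have e : mxplus W *m W = (\det W)%:M.
  apply/matrixP => i j; rewrite !mxE sum2 det2.
  by case: (ord2_cases i) => ->; case: (ord2_cases j) => ->; rewrite !mx2E /=; ring.
have uW' : W \is a GRing.unit by rewrite unitmxE unitfE.
apply: (mulIr uW'); rewrite mulVr// -scalerAl.
rewrite (_ : mxplus W * W = (\det W)%:M)//.
by rewrite scale_scalar_mx mulVf.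
Qed.

Lemma det_invHC W : \det W^-1 = (\det W)^-1.
Proof. exact: det_inv. Qed.

Lemma inv_HCunits W : HCunits W -> HCunits W^-1.
Proof. by move=> uW; rewrite /HCunits /= det_invHC invr_neq0. Qed.

Lemma inv_entry W i j : HCunits W -> W^-1 i j = (\det W)^-1 * mxplus W i j.
Proof. by move=> uW; rewrite (inv_mx2 uW) mxE. Qed.

Lemma expN2 (x : R[i]) : x ^ (-2) = x^-1 * x^-1.
Proof. by rewrite -invfM. Qed.

Definition K i p W : R[i] := \det W ^ (-2) * mxplus W i p.

Lemma K_L i p : L (Some (-3)) (K i p).
Proof. by apply: L_mulS (L_detz _ _) (P_L (P_mxplus _ i p)) _. Qed.

Lemma K_LN i p : L None (K i p). Proof. exact: L_None (K_L i p). Qed.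

Lemma kernE i p W : HCunits W -> kern W i p = K i p W.
Proof.
by move=> uW; rewrite /kern mxE (inv_entry _ _ uW) mulrA /K expN2.
Qed.

(** In ['I_2] the map i to 1 - i exchanges the two indices, so this is the (i, k) entry of ∇^+ in
    one formula. *)
Definition nbp (i k : 'I_2) f W := (if i == k then 2 else -2) * pd (1 - i) (1 - k) f W.

Lemma nablaplusE i k f : nablaplus R i k f = nbp i k f.
Proof.
apply/funext => W; rewrite /nablaplus /nbp; have e0 : (1 - 0 = 1 :> 'I_2) by exact/val_inj.
have e1 : (1 - 1 = 0 :> 'I_2) by exact/val_inj.
by case: (ord2_cases i) => ->; case: (ord2_cases k) => ->; rewrite mx2E /cpartial pdE ?e0 ?e1.
Qed.

Lemma nablaE i k f : nabla R i k f = fun W => 2 * pd k i f W.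
Proof.
apply/funext => W; rewrite /nabla.
by case: (ord2_cases i) => ->; case: (ord2_cases k) => ->; rewrite mx2E /cpartial pdE.
Qed.

Definition sub1ord : (1 - 0 = 1 :> 'I_2) * (1 - 1 = 0 :> 'I_2).
Proof. by split; exact/val_inj. Qed.

Lemma pd_mxplus a b i p W :
  pd a b (fun V => mxplus V i p) W = if i == p then (((1 - i) == a) && ((1 - p) == b))%:R
     else - ((i == a) && (p == b))%:R.
Proof.
have [-> | ->] := ord2_cases i; have [-> | ->] := ord2_cases p; rewrite mxplusF ?sub1ord /=;
  case: (ord2_cases a) => ->; case: (ord2_cases b) => ->;
  by rewrite /= ?(isd_pd (isd_coord _ _ _ _ _)) ?(isd_pd (isdN (isd_coord _ _ _ _ _))).
Qed.

Lemma pd_K a b i p : eqU (pd a b (K i p))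
  (fun W => - 2 * \det W ^ (-3) * mxplus W b a * mxplus W i p
            + \det W ^ (-2) * pd a b (fun V => mxplus V i p) W).
Proof.
move=> W uW; rewrite (pdM a b (L_None (L_detz _ _)) (P_LN (P_mxplus _ _ _)) uW).
by rewrite (pd_detz _ _ _ uW).
Qed.

(** N^-1 W^-1 is the Cauchy-Fueter kernel, which is regular from both sides; this is regularity from
    the left. *)
Lemma nbp_K_col q j : eqU (fun W => \sum_k nbp q k (K k j) W) (fun=> 0).
Proof.
move=> W uW; rewrite sum2 /nbp !(pd_K _ _ _ _ uW) !pd_mxplus.
have -> : \det W ^ (-2) = \det W ^ (-3) * \det W by rewrite -[X in _ * X]expr1z -expfzDr.
case: (ord2_cases q) => ->; case: (ord2_cases j) => ->;
  rewrite ?sub1ord /= /mxplus !mx2E det2; ring.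
Qed.

Lemma nbp_K_row i q : eqU (fun W => \sum_k nbp k q (K i k) W) (fun=> 0).
Proof.
move=> W uW; rewrite sum2 /nbp !(pd_K _ _ _ _ uW) !pd_mxplus.
have -> : \det W ^ (-2) = \det W ^ (-3) * \det W by rewrite -[X in _ * X]expr1z -expfzDr.
case: (ord2_cases q) => ->; case: (ord2_cases i) => ->;
  rewrite ?sub1ord /= /mxplus !mx2E det2; ring.
Qed.

Definition invo f W := f (W^-1).

Lemma invo_eqU f g : eqU f g -> eqU (invo f) (invo g).
Proof. by move=> e W uW; rewrite /invo e//; exact: inv_HCunits. Qed.

(** The chain rule for d (W^-1) = - W^-1 dW W^-1. Membership in [L] is proved at the same time
    because the Leibniz rule for the inverted functions presupposes it. *)
Lemma invo_pd f : L None f -> L None (invo f) /\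
  forall i j, eqU (pd i j (invo f))
    (fun W => - \sum_k \sum_l (W^-1) k i * (W^-1) j l * invo (pd k l f) W).
Proof.
pose C f := L None (invo f) /\ forall i j, eqU (pd i j (invo f))
    (fun W => - \sum_k \sum_l (W^-1) k i * (W^-1) j l * invo (pd k l f) W).
pose D f := L None f /\ C f.
suff h : L None f -> D f by move=> /h [].
apply: (L_generated (C := D)) => {f} [f g [lf [lf' hf]] [lg [lg' hg]]|f g [lf [lf' hf]] [lg [lg' hg]]|f g [lf [lf' hf]] e|z|a b|].
- split; first exact: L_mul.
  split=> [|i j W uW]; first exact: L_mul.
  have uV := inv_HCunits uW.
  rewrite (pdM i j lf' lg' uW) (hf _ _ _ uW) (hg _ _ _ uW) !sum2 /invo.
  rewrite !(pdM _ _ lf lg uV); ring.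
- split; first exact: L_add.
  split=> [|i j W uW]; first exact: L_add.
  have uV := inv_HCunits uW.
  rewrite (pdD i j lf' lg' uW) (hf _ _ _ uW) (hg _ _ _ uW) !sum2 /invo.
  rewrite !(pdD _ _ lf lg uV); ring.
- split; first exact: L_ext lf e.
  split=> [|i j W uW]; first exact: L_ext lf' (invo_eqU e).
  have uV := inv_HCunits uW.
  rewrite -(pd_eqU i j (invo_eqU e) uW) (hf _ _ _ uW) !sum2 /invo.
  by rewrite !(pd_eqU _ _ e uV).
- split; first exact: L_None (L_cst z).
  split=> [|i j W uW]; first exact: L_None (L_cst z).
  rewrite /invo !sum2 !pd_cst; ring.
- split; first exact: L_coord.
  have e : eqU (fun W => \det W ^ (-1) * mxplus W a b) (invo (fun W => W a b)).
    by move=> W uW; rewrite /invo (inv_entry _ _ uW) exprN1.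
  split=> [|i j W uW]; first by apply: L_ext e; apply: L_mul; [exact: L_None (L_detz _ _)|exact: P_LN (P_mxplus _ _ _)].
  rewrite -(pd_eqU i j e uW) (pdM i j (L_None (L_detz _ _)) (P_LN (P_mxplus _ _ _)) uW).
  rewrite (pd_detz _ _ _ uW) !sum2 /invo !pd_coord !(inv_entry _ _ uW) pd_mxplus.
  have -> : \det W ^ (-1 - 1) = (\det W)^-1 * (\det W)^-1 by rewrite -invfM.
  rewrite exprN1; set d := (_)^-1.
  (* [ring] does not know that N^-1 N = 1; one factor N^-1 is rewritten as N^-2 times the expanded
     determinant, so that both sides become polynomials in N^-1 and the entries. *)
  have dd : d = d * d * (W 0 0 * W 1 1 - W 0 1 * W 1 0).
    by rewrite -det2 -mulrA mulVf ?mulr1.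
  rewrite [in X in _ + X]dd.
  case: (ord2_cases i) => ->; case: (ord2_cases j) => ->;
  case: (ord2_cases a) => ->; case: (ord2_cases b) => ->; rewrite ?sub1ord /= /mxplus !mx2E; ring.
- split; first exact: L_inv_det.
  have e : eqU (fun W => \det W) (invo (fun W => (\det W)^-1)).
    by move=> W uW; rewrite /invo det_invHC invrK.
  split=> [|i j W uW]; first by apply: L_ext e; exact: P_LN (P_det _).
  rewrite -(pd_eqU i j e uW) (isd_pd (isd_det i j W)) !sum2 /invo.
  have uV := inv_HCunits uW; rewrite !(pd_inv_det _ _ uV) det_invHC invrK.
  have -> : mxplus W j i = \det W * W^-1 j i by rewrite (inv_entry _ _ uW) mulVKf.
  have dd : \det W * \det W * (W^-1 0 0 * W^-1 1 1 - W^-1 0 1 * W^-1 1 0) = \det W.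
    by rewrite -det2 det_invHC -mulrA mulfV ?mulr1.
  rewrite -[in LHS]dd.
  case: (ord2_cases i) => ->; case: (ord2_cases j) => ->; rewrite /mxplus !mx2E; ring.
Qed.

Lemma invo_L f : L None f -> L None (invo f). Proof. by case/invo_pd. Qed.

Lemma L_euler n f : L (Some n) f ->
  eqU (fun W => \sum_i \sum_j W i j * pd i j f W) (fun W => n%:~R * f W).
Proof.
elim=> [z k a b c d /= /eqP ->|f1 g1 lf h1 lg h2|f1 g1 lf h1 e] W uW.
- rewrite !sum2 !(isd_pd (isdZ z (isd_mon _ _ k a b c d uW))) /mon /dpmon /mxplus !mx2E.
  have W0 : \det W != 0 by [].
  have -> : \det W ^ k = \det W ^ (k - 1) * (W 0 0 * W 1 1 - W 0 1 * W 1 0).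
    by rewrite -det2 -[X in _ * X]expr1z -expfzDr// subrK.
  have ha (x : R[i]) (m : nat) : m%:R * x ^+ m = x * (m%:R * x ^+ m.-1).
    by case: m => [|m]; rewrite ?mul0r ?mulr0//= exprS; ring.
  have pa : a%:R * pmon a b c d W = W 0 0 * (a%:R * pmon a.-1 b c d W).
    by rewrite /pmon !mulrA ha; ring.
  have pb : b%:R * pmon a b c d W = W 0 1 * (b%:R * pmon a b.-1 c d W).
    rewrite /pmon. have := ha (W 0 1) b => e.
    by transitivity (W 0 0 ^+ a * (b%:R * W 0 1 ^+ b) * W 1 0 ^+ c * W 1 1 ^+ d); [|rewrite e]; ring.
  have pc : c%:R * pmon a b c d W = W 1 0 * (c%:R * pmon a b c.-1 d W).
    rewrite /pmon. have := ha (W 1 0) c => e.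
    by transitivity (W 0 0 ^+ a * W 0 1 ^+ b * (c%:R * W 1 0 ^+ c) * W 1 1 ^+ d); [|rewrite e]; ring.
  have pd' : d%:R * pmon a b c d W = W 1 1 * (d%:R * pmon a b c d.-1 W).
    rewrite /pmon. have := ha (W 1 1) d => e.
    by transitivity (W 0 0 ^+ a * W 0 1 ^+ b * W 1 0 ^+ c * (d%:R * W 1 1 ^+ d)); [|rewrite e]; ring.
  rewrite rmorphD rmorphM /= -[(Posz _)%:~R]/((a + b + c + d)%:R) !natrD.
  set D := \det W ^ (k - 1); set p := pmon a b c d W in pa pb pc pd' *.
  transitivity (z * (k%:~R * 2 * (D * (W 0 0 * W 1 1 - W 0 1 * W 1 0)) * p +
     (D * (W 0 0 * W 1 1 - W 0 1 * W 1 0)) * (a%:R * p + b%:R * p + c%:R * p + d%:R * p))); last by ring.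
  by rewrite pa pb pc pd'; ring.
- have := h1 _ uW; have := h2 _ uW; rewrite !sum2 => e2 e1.
  rewrite !(pdD _ _ (L_None lf) (L_None lg) uW) [RHS]mulrDr -e1 -e2; ring.
- rewrite -(e _ uW) -(h1 _ uW) !sum2; by rewrite !(pd_eqU _ _ e uW).
Qed.

Definition box2 f W := pd 0 0 (pd 1 1 f) W - pd 0 1 (pd 1 0 f) W.

Lemma boxE f : box f = fun W => 4 * box2 f W.
Proof. by apply/funext => W; rewrite /box /box2 !pdE. Qed.

Lemma box2_eqU f g : eqU f g -> eqU (box2 f) (box2 g).
Proof. by move=> e W uW; rewrite /box2 (pd_eqU 0 0 (pd_eqU 1 1 e) uW) (pd_eqU 0 1 (pd_eqU 1 0 e) uW). Qed.

Lemma box2_L o f : L o f -> L (opred (opred o)) (box2 f).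
Proof. by move=> lf; apply: L_sub; apply: L_pd; exact: L_pd. Qed.

(** Three contributions: (k + 1)(k + 2) N^k from N^(k+1) alone, (k + 1) N^k times the Euler field
    applied to h, which is multiplication by n, and [box2 h], which vanishes. *)
Lemma box2_detz k n h : L (Some n) h -> eqU (box2 h) (fun=> 0) ->
  eqU (box2 (fun W => \det W ^ (k + 1) * h W))
      (fun W => ((k + 1) * (k + 2 + n))%:~R * (\det W ^ k * h W)).
Proof.
move=> lh bh W uW; have lN := L_None lh; have ld m : L None (fun V : HC R => \det V ^ m) by exact: L_None (L_detz _ _).
have l2 a b u : L None u -> L None (pd a b u) by exact: L_pdN.
have lp a b : L None (fun V : HC R => mxplus V a b) := P_LN (P_mxplus R a b).
have e a b : eqU (pd a b (fun W => \det W ^ (k + 1) * h W))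
   (fun W => (k + 1)%:~R * (\det W ^ k * (mxplus W b a * h W)) + \det W ^ (k + 1) * pd a b h W).
  by move=> V uV; rewrite (pdM a b (ld _) lN uV) (pd_detz _ _ _ uV) addrK; ring.
have e2 a b c d : eqU (pd c d (pd a b (fun W => \det W ^ (k + 1) * h W)))
   (fun W => (k + 1)%:~R * (k%:~R * \det W ^ (k - 1) * mxplus W d c * mxplus W b a * h W
     + \det W ^ k * (pd c d (fun V => mxplus V b a) W * h W
     + mxplus W b a * pd c d h W + mxplus W d c * pd a b h W)) + \det W ^ (k + 1) * pd c d (pd a b h) W).
  move=> V uV; rewrite (pd_eqU c d (e a b) uV).
  rewrite (pdD c d (L_scale _ (L_mul (ld _) (L_mul (lp _ _) lN))) (L_mul (ld _) (l2 _ _ _ lN)) uV).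
  rewrite (pdZ _ c d (L_mul (ld _) (L_mul (lp _ _) lN)) uV).
  rewrite (pdM c d (ld _) (L_mul (lp _ _) lN) uV) (pdM c d (lp _ _) lN uV) (pdM c d (ld _) (l2 _ _ _ lN) uV).
  by rewrite !(pd_detz _ _ _ uV) addrK; ring.
have := L_euler lh uW; have := bh _ uW; rewrite /box2 !sum2 => b0 eu.
rewrite (e2 _ _ _ _ _ uW) (e2 _ _ _ _ _ uW) !pd_mxplus ?sub1ord /= /mxplus !mx2E.
have -> : \det W ^ (k + 1) = \det W ^ k * \det W by rewrite -[X in _ * X]expr1z -expfzDr.
have dk : \det W ^ k = \det W ^ (k - 1) * \det W by rewrite -[X in _ * X]expr1z -expfzDr// subrK.
have b1 : pd 0 0 (pd 1 1 h) W = pd 0 1 (pd 1 0 h) W by apply/eqP; rewrite -subr_eq0 b0.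
rewrite !rmorphM !rmorphD /= b1.
rewrite !mulr1z. transitivity ((k%:~R + 1) * (k%:~R * (\det W ^ (k - 1) * (W 0 0 * W 1 1 - W 0 1 * W 1 0)) * h W
  + \det W ^ k * (2 * h W + (W 0 0 * pd 0 0 h W + W 0 1 * pd 0 1 h W + (W 1 0 * pd 1 0 h W + W 1 1 * pd 1 1 h W))))); first by ring.
by rewrite -det2 -dk eu; ring.
Qed.

End Kernel.

(** * Integration over U(2) *)

Section ComplexIntegral.
Variable R : realType.
Implicit Types (f g : R -> R[i]) (a b x y e : R) (z w : R[i]).

(** [cint] integrates real and imaginary parts separately, so estimates are kept for both parts
    instead of the modulus. *)
Definition cle z e := `|complex.Re z| <= e /\ `|complex.Im z| <= e.

Lemma cle_normc z e : `|z| <= e%:C -> cle z e.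
Proof.
case: z => a b; rewrite normc_def lecR /= => h; split => /=; apply: le_trans h.
  by rewrite -[leLHS]sqrtr_sqr ler_sqrt ?addr_ge0 ?sqr_ge0// lerDl sqr_ge0.
by rewrite -[leLHS]sqrtr_sqr ler_sqrt ?addr_ge0 ?sqr_ge0// lerDr sqr_ge0.
Qed.

Lemma cle_eq0 z : (forall e, 0 < e -> cle z e) -> z = 0.
Proof.
case: z => a b h; have h0 (u : R) : (forall e, 0 < e -> `|u| <= e) -> u = 0.
  move=> hu; apply: normr0_eq0; apply/eqP; rewrite eq_le normr_ge0 andbT.
  apply/ler_addgt0Pr => e e0.
  by rewrite add0r; exact: hu.
congr (_ +i* _); apply: h0 => e e0; by case: (h e e0).
Qed.

Definition cc f := continuous (fun x => complex.Re (f x) : R) /\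
                   continuous (fun x => complex.Im (f x) : R).

Lemma cc_cst z : cc (fun=> z). Proof. by split=> x; exact: cvg_cst. Qed.

Lemma ccD f g : cc f -> cc g -> cc (fun x => f x + g x).
Proof.
move=> [f1 f2] [g1 g2]; split=> x.
  rewrite (_ : (fun _ => _) = fun x => complex.Re (f x) + complex.Re (g x)).
    by apply: cvgD; [exact: f1|exact: g1].
  by apply/funext => y; case: (f y) (g y) => [? ?] [? ?].
rewrite (_ : (fun _ => _) = fun x => complex.Im (f x) + complex.Im (g x)).
  by apply: cvgD; [exact: f2|exact: g2].
by apply/funext => y; case: (f y) (g y) => [? ?] [? ?].
Qed.

Lemma ccM f g : cc f -> cc g -> cc (fun x => f x * g x).
Proof.
move=> [f1 f2] [g1 g2]; split=> x.
  rewrite (_ : (fun _ => _) = fun x => complex.Re (f x) * complex.Re (g x)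
      - complex.Im (f x) * complex.Im (g x)).
    by apply: cvgB; apply: cvgM; [exact: f1|exact: g1|exact: f2|exact: g2].
  by apply/funext => y; case: (f y) (g y) => [? ?] [? ?].
rewrite (_ : (fun _ => _) = fun x => complex.Re (f x) * complex.Im (g x)
      + complex.Im (f x) * complex.Re (g x)).
  by apply: cvgD; apply: cvgM; [exact: f1|exact: g2|exact: f2|exact: g1].
by apply/funext => y; case: (f y) (g y) => [? ?] [? ?].
Qed.

Lemma ccX f n : cc f -> cc (fun x => f x ^+ n).
Proof.
move=> cf; elim: n => [|n ih].
  by rewrite (_ : (fun _ => _) = fun=> 1)//; exact: cc_cst.
rewrite (_ : (fun _ => _) = fun x => f x * f x ^+ n); first exact: ccM.
by apply/funext => x; rewrite exprS.
Qed.

Lemma cc_real (u : R -> R) : continuous u -> cc (fun x => (u x)%:C).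
Proof. by move=> cu; split=> // x; exact: cvg_cst. Qed.

Lemma uniform_limit_cont (u : R -> R) :
  (forall e, 0 < e -> exists2 v : R -> R, continuous v & forall x, `|u x - v x| <= e) ->
  continuous u.
Proof.
move=> h x; apply/cvgrPdist_le => e e0.
have e3 : 0 < e / 3 by lra.
have [v cv uv] := h _ e3.
have /cvgrPdist_le /(_ _ e3) := cv x.
apply: filterS => y vy.
have := uv x; have := uv y; move: vy; rewrite !ler_norml.
move=> /andP[? ?] /andP[? ?] /andP[? ?]; apply/andP; split; lra.
Qed.

(** The integrand of J is accessible only as a uniform limit; its continuity, hence the
    integrability at each stage of the iterated integral, comes from here. *)
Lemma cc_lim f :
  (forall e, 0 < e -> exists2 g, cc g & forall x, cle (f x - g x) e) -> cc f.
Proof.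
move=> h; split; apply: uniform_limit_cont => e e0; have [g [g1 g2] fg] := h _ e0.
  by exists (fun x => complex.Re (g x)) => // x; have [] := fg x; case: (f x) (g x) => [? ?] [? ?].
by exists (fun x => complex.Im (g x)) => // x; have [] := fg x; case: (f x) (g x) => [? ?] [? ?].
Qed.

Let mu := @lebesgue_measure R.

Lemma cont_integrable (u : R -> R) a b : continuous u -> mu.-integrable `[a, b] (EFin \o u).
Proof.
move=> cu; apply: continuous_compact_integrable; first exact: segment_compact.
by apply: continuous_subspaceT => x; exact: cu.
Qed.

Lemma cintD a b f g : cc f -> cc g ->
  cint a b (fun x => f x + g x) = cint a b f + cint a b g.
Proof.
move=> [f1 f2] [g1 g2]; rewrite /cint.
have -> : (fun x => complex.Re (f x + g x)) = (fun x => complex.Re (f x) + complex.Re (g x)).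
  by apply/funext => y; case: (f y) (g y) => [? ?] [? ?].
have -> : (fun x => complex.Im (f x + g x)) = (fun x => complex.Im (f x) + complex.Im (g x)).
  by apply/funext => y; case: (f y) (g y) => [? ?] [? ?].
by rewrite !RintegralD//; exact: cont_integrable.
Qed.

Lemma cintZ a b z f : cc f -> cint a b (fun x => z * f x) = z * cint a b f.
Proof.
move=> [f1 f2]; rewrite /cint; case: z => p q.
have iZ s (u : R -> R) : continuous u -> mu.-integrable `[a, b] (EFin \o (fun x => s * u x)).
  by move=> cu; apply: cont_integrable => x; apply: cvgM; [exact: cvg_cst|exact: cu].
have -> : (fun x => complex.Re ((p +i* q) * f x)) =
    (fun x => p * complex.Re (f x) - q * complex.Im (f x)).
  by apply/funext => y; case: (f y).
have -> : (fun x => complex.Im ((p +i* q) * f x)) =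
    (fun x => p * complex.Im (f x) + q * complex.Re (f x)).
  by apply/funext => y; case: (f y).
rewrite RintegralB//; [|exact: iZ|exact: iZ].
rewrite RintegralD//; [|exact: iZ|exact: iZ].
by rewrite !RintegralZl//; exact: cont_integrable.
Qed.

Lemma Rint_cst a b e : a <= b -> \int[mu]_(x in `[a, b]) e = (b - a) * e.
Proof.
move=> ab; have len : fine ((@lebesgue_measure R) `[a, b]) = b - a.
  rewrite lebesgue_measure_itv/= lte_fin.
  by case: ltP => [_|ba]; rewrite //= (_ : b = a) ?subrr//; apply/eqP; rewrite eq_le ba ab.
by rewrite Rintegral_cst// [X in _ * X](_ : _ = b - a) 1?mulrC//; exact: len.
Qed.

Lemma Rint_le a b (u : R -> R) e : a <= b -> continuous u -> (forall x, `|u x| <= e) ->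
  `|\int[mu]_(x in `[a, b]) u x| <= (b - a) * e.
Proof.
move=> ab cu h; apply: le_trans (le_normr_Rintegral _ _) _ => //; first exact: cont_integrable.
have cnu : continuous (fun x => `|u x|) by move=> x; apply: cvg_norm; exact: cu.
have := @le_Rintegral _ _ _ mu `[a, b] (fun x => `|u x|) (fun=> e).
rewrite Rint_cst//.
apply => //; first exact: cont_integrable.
by apply: cont_integrable => x; exact: cvg_cst.
Qed.

Lemma cint_cle a b f e : a <= b -> cc f -> (forall x, cle (f x) e) ->
  cle (cint a b f) ((b - a) * e).
Proof.
by move=> ab [f1 f2] h; split; apply: Rint_le => // x; case: (h x).
Qed.

Lemma cintB_cle a b f g e : a <= b -> cc f -> cc g -> (forall x, cle (f x - g x) e) ->
  cle (cint a b f - cint a b g) ((b - a) * e).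
Proof.
move=> ab cf cg h; have cg' : cc (fun x => -1 * g x) by apply: ccM => //; exact: cc_cst.
rewrite -mulN1r -cintZ// -cintD//; apply: cint_cle => //; first exact: ccD.
by move=> x; rewrite mulN1r.
Qed.

Lemma Rint_FTC (u F : R -> R) a b : a < b -> continuous u ->
  (forall x, is_derive x 1 F (u x)) -> \int[mu]_(x in `[a, b]) u x = F b - F a.
Proof.
move=> ab cu dF; rewrite /Rintegral (@continuous_FTC2 _ u F)//.
- by apply: continuous_subspaceT => x; exact: cu.
- have cF x : {for x, continuous F}.
    by apply: differentiable_continuous; apply/derivable1_diffP; case: (dF x).
  split=> [x _||].
  + by case: (dF x).
  + by apply: cvg_at_right_filter; exact: cF.
  + by apply: cvg_at_left_filter; exact: cF.
- by move=> x _; rewrite derive1E; case: (dF x).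
Qed.

Definition em (m : int) x : R[i] := cis (m%:~R * x).

Lemma cisD x y : cis (x + y) = cis x * cis y :> R[i].
Proof.
rewrite /cis cosD sinD; apply/eqP; rewrite eq_complex /=.
by apply/andP; split; apply/eqP; ring.
Qed.

Lemma cis0 : cis 0 = 1 :> R[i].
Proof. by rewrite /cis cos0 sin0. Qed.

Lemma emD m n x : em m x * em n x = em (m + n) x.
Proof. by rewrite /em -cisD rmorphD mulrDl. Qed.

Lemma em0 x : em 0 x = 1.
Proof. by rewrite /em mul0r cis0. Qed.

Lemma emX m n x : em m x ^+ n = em (m * n%:Z) x.
Proof.
elim: n => [|n ih]; first by rewrite expr0 mulr0 em0.
by rewrite exprS ih emD; congr em; lia.
Qed.

Lemma em_neq0 m x : em m x != 0.
Proof.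
apply/eqP => h; have := emD m (- m) x; rewrite h mul0r subrr em0.
by move/eqP; rewrite eq_sym oner_eq0.
Qed.

Lemma emXz m (n : int) x : em m x ^ n = em (m * n) x.
Proof.
case: n => n; first by rewrite -emX.
apply: (mulIf (em_neq0 (m * n.+1%:Z) x)); rewrite emD -emX NegzE -exprnN mulVf ?expf_neq0 ?em_neq0//.
by rewrite (_ : _ + _ = 0) ?em0//; lia.
Qed.

Lemma cont_em_aux (m : int) : continuous (fun x : R => m%:~R * x).
Proof. by move=> x; apply: cvgM; [exact: cvg_cst|exact: cvg_id]. Qed.

Lemma cc_em m : cc (em m).
Proof.
by split=> x; rewrite /em /cis /=;
  [apply: (@continuous_comp _ _ _ _ (@cos R)) | apply: (@continuous_comp _ _ _ _ (@sin R))];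
  first [exact: cont_em_aux | exact: continuous_cos | exact: continuous_sin].
Qed.

Lemma em_period m : em m (2 * pi) = 1.
Proof.
have e1 : em 1 (2 * pi) = 1.
  by rewrite /em mul1r mulrC mulr_natr /cis cos2pi sin2pi.
by rewrite -[m]mul1r -emXz e1 exp1rz.
Qed.

Lemma cint_em m : cint 0 (2 * pi) (em m) = if m == 0 then (2 * pi)%:C else 0.
Proof.
have p0 : (0 : R) < 2 * pi by rewrite mulr_gt0// pi_gt0.
have [cr ci] := cc_em m.
have [m0|m0] := eqVneq m 0.
  rewrite /cint m0 /em /cis /=.
  have -> : (fun x : R => cos (0%:~R * x)) = fun=> 1 by apply/funext => x; rewrite mul0r cos0.
  have -> : (fun x : R => sin (0%:~R * x)) = fun=> 0 by apply/funext => x; rewrite mul0r sin0.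
  by rewrite !Rint_cst ?(ltW p0)// mulr0 mulr1 subr0.
have mr : m%:~R != 0 :> R by rewrite intr_eq0.
have dm x : is_derive x 1 (fun y : R => m%:~R * y) (m%:~R : R).
  have h := is_deriveZ (m%:~R) (is_derive_id x (1 : R)).
  by move: h; rewrite /GRing.scale /= mulr1.
have h1 x : is_derive x (1 : R) (fun x => m%:~R^-1 * sin (m%:~R * x) : R) (complex.Re (em m x)).
  have := is_derive1_comp (is_derive_sin (m%:~R * x)) (dm x).
  move=> /(is_deriveZ m%:~R^-1); rewrite /GRing.scale /= => h.
  by apply: is_derive_eq h _; rewrite mulrC mulfK.
have h2 x : is_derive x (1 : R) (fun x => - m%:~R^-1 * cos (m%:~R * x) : R) (complex.Im (em m x)).
  have := is_derive1_comp (is_derive_cos (m%:~R * x)) (dm x).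
  move=> /(is_deriveZ (- m%:~R^-1)); rewrite /GRing.scale /= => h.
  by apply: is_derive_eq h _; rewrite mulNr mulNr mulrN opprK mulrC mulfK.
rewrite /cint (Rint_FTC p0 cr h1) (Rint_FTC p0 ci h2).
have := em_period m; rewrite /em /cis => -[-> ->].
by rewrite !mulr0 sin0 cos0 !mulr0 !subrr.
Qed.

End ComplexIntegral.

(** * Trigonometric polynomials in the four angles and their uniform limits *)

Section TrigPolynomials.
Variable R : realType.
Implicit Types (h f g : R -> R -> R -> R -> R[i]) (x y e : R) (z w : R[i]).

(** The variables x, y, u, v are phi, theta, psi, delta. Pullbacks of Laurent monomials, volume
    factor included, have this shape: powers of cos y and sin y, and characters in the three other
    angles. *)
Definition tm z (a b : nat) (m n k : int) x y u v : R[i] :=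
  z * (cos y)%:C ^+ a * (sin y)%:C ^+ b * em m x * em n u * em k v.

Inductive TP : (R -> R -> R -> R -> R[i]) -> Prop :=
| TP_mon z a b m n k : TP (tm z a b m n k)
| TP_add f g : TP f -> TP g -> TP (fun x y u v => f x y u v + g x y u v).

(** The variable integrated out is kept as a dummy, so that all four partial integrals act on one
    function space and one interface, [Iop], describes them. *)
Definition I4 h := fun x y u (_ : R) => cint 0 (2 * pi) (fun v => h x y u v).
Definition I3 h := fun x y (_ : R) v => cint 0 (2 * pi) (fun u => h x y u v).
Definition I2 h := fun x (_ : R) u v => cint 0 (pi / 2) (fun y => h x y u v).
Definition I1 h := fun (_ : R) y u v => cint 0 (2 * pi) (fun x => h x y u v).
Definition Us h : R[i] := cint 0 (2 * pi) (fun x => cint 0 (pi / 2) (fun y =>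
  cint 0 (2 * pi) (fun u => cint 0 (2 * pi) (fun v => h x y u v)))).

Lemma UsE h : Us h = I1 (I2 (I3 (I4 h))) 0 0 0 0.
Proof. by []. Qed.

Lemma cc_cs a b : cc (fun y : R => (cos y)%:C ^+ a * (sin y)%:C ^+ b).
Proof.
by apply: ccM; apply: ccX; apply: cc_real; [exact: continuous_cos|exact: continuous_sin].
Qed.

Definition csc a b : R[i] := cint 0 (pi / 2) (fun y => (cos y)%:C ^+ a * (sin y)%:C ^+ b).

Lemma TP_cc f : TP f -> forall x y u v,
  [/\ cc (fun x => f x y u v), cc (fun y => f x y u v), cc (fun u => f x y u v)
    & cc (fun v => f x y u v)].
Proof.
elim=> [z a b m n k|f1 f2 _ h1 _ h2] x y u v; last first.
  by have [? ? ? ?] := h1 x y u v; have [? ? ? ?] := h2 x y u v; split; exact: ccD.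
rewrite /tm; split.
- by do 2! [apply: ccM; last exact: cc_cst]; apply: ccM; [exact: cc_cst|exact: cc_em].
- do 3! [apply: ccM; last exact: cc_cst].
  rewrite (_ : (fun _ => _) = fun y => z * ((cos y)%:C ^+ a * (sin y)%:C ^+ b)).
    by apply: ccM; [exact: cc_cst|exact: cc_cs].
  by apply/funext => ?; rewrite mulrA.
- by apply: ccM; last exact: cc_cst; apply: ccM; [exact: cc_cst|exact: cc_em].
- by apply: ccM; [exact: cc_cst|exact: cc_em].
Qed.

Lemma I4_tm z a b m n k : I4 (tm z a b m n k) =
  tm (if k == 0 then z * (2 * pi)%:C else 0) a b m n 0.
Proof.
apply/funext => x; apply/funext => y; apply/funext => u; apply/funext => v.
rewrite /I4 /tm cintZ ?cint_em; last exact: cc_em.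
by rewrite em0; case: eqP => _; rewrite ?mul0r ?mulr0//; ring.
Qed.

Lemma I3_tm z a b m n k : I3 (tm z a b m n k) =
  tm (if n == 0 then z * (2 * pi)%:C else 0) a b m 0 k.
Proof.
apply/funext => x; apply/funext => y; apply/funext => u; apply/funext => v.
rewrite /I3 /tm (_ : (fun _ => _) = fun u => z * (cos y)%:C ^+ a * (sin y)%:C ^+ b * em m x * em k v * em n u).
  rewrite cintZ ?cint_em; last exact: cc_em.
  by rewrite em0; case: eqP => _; rewrite ?mul0r ?mulr0//; ring.
by apply/funext => ?; ring.
Qed.

Lemma I2_tm z a b m n k : I2 (tm z a b m n k) = tm (z * csc a b) 0 0 m n k.
Proof.
apply/funext => x; apply/funext => y; apply/funext => u; apply/funext => v.
rewrite /I2 /tm (_ : (fun _ => _) = fun y => z * em m x * em n u * em k v * ((cos y)%:C ^+ a * (sin y)%:C ^+ b)).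
  by rewrite cintZ ?expr0; [rewrite /csc; ring|exact: cc_cs].
by apply/funext => ?; ring.
Qed.

Lemma I1_tm z a b m n k : I1 (tm z a b m n k) =
  tm (if m == 0 then z * (2 * pi)%:C else 0) a b 0 n k.
Proof.
apply/funext => x; apply/funext => y; apply/funext => u; apply/funext => v.
rewrite /I1 /tm (_ : (fun _ => _) = fun x => z * (cos y)%:C ^+ a * (sin y)%:C ^+ b * em n u * em k v * em m x).
  rewrite cintZ ?cint_em; last exact: cc_em.
  by rewrite em0; case: eqP => _; rewrite ?mul0r ?mulr0//; ring.
by apply/funext => ?; ring.
Qed.

Definition Iop (I : (R -> R -> R -> R -> R[i]) -> R -> R -> R -> R -> R[i]) (c : R) :=
  [/\ forall f, TP f -> TP (I f),
      forall f g, TP f -> TP g -> I (fun x y u v => f x y u v + g x y u v) =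
         (fun x y u v => I f x y u v + I g x y u v) &
   forall f g e, (forall x y u v, [/\ cc (fun x => f x y u v), cc (fun y => f x y u v),
        cc (fun u => f x y u v) & cc (fun v => f x y u v)]) ->
     (forall x y u v, [/\ cc (fun x => g x y u v), cc (fun y => g x y u v),
        cc (fun u => g x y u v) & cc (fun v => g x y u v)]) ->
     (forall x y u v, cle (f x y u v - g x y u v) e) ->
     forall x y u v, cle (I f x y u v - I g x y u v) (c * e)].

Lemma Iop_of I c (tf : R[i] -> nat -> nat -> int -> int -> int -> R -> R -> R -> R -> R[i]) :
  (forall z a b m n k, I (tm z a b m n k) = tf z a b m n k) ->
  (forall z a b m n k, TP (tf z a b m n k)) ->
  (forall f g, TP f -> TP g -> I (fun x y u v => f x y u v + g x y u v) =
         (fun x y u v => I f x y u v + I g x y u v)) ->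
  (forall f g e, (forall x y u v, [/\ cc (fun x => f x y u v), cc (fun y => f x y u v),
        cc (fun u => f x y u v) & cc (fun v => f x y u v)]) ->
     (forall x y u v, [/\ cc (fun x => g x y u v), cc (fun y => g x y u v),
        cc (fun u => g x y u v) & cc (fun v => g x y u v)]) ->
     (forall x y u v, cle (f x y u v - g x y u v) e) ->
     forall x y u v, cle (I f x y u v - I g x y u v) (c * e)) ->
  Iop I c.
Proof.
move=> h1 h2 h3 h4; split => // f; elim=> [z a b m n k|f1 f2 t1 i1 t2 i2].
  by rewrite h1; exact: h2.
by rewrite h3//; exact: TP_add.
Qed.

Let p2 : (0 : R) <= 2 * pi. Proof. by rewrite mulr_ge0// pi_ge0. Qed.
Let ph : (0 : R) <= pi / 2. Proof. by rewrite divr_ge0// pi_ge0. Qed.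

Lemma Iop4 : Iop I4 (2 * pi).
Proof.
apply: Iop_of I4_tm _ _ _ => [*|f g tf tg|f g e hf hg h x y u v]; first exact: TP_mon.
  apply/funext => x; apply/funext => y; apply/funext => u; apply/funext => v.
  by rewrite /I4 cintD//; [case: (TP_cc tf x y u v)|case: (TP_cc tg x y u v)].
rewrite /I4 -[2 * pi in X in cle _ X]subr0; apply: cintB_cle => //.
  by case: (hf x y u v).
by case: (hg x y u v).
Qed.

Lemma Iop3 : Iop I3 (2 * pi).
Proof.
apply: Iop_of I3_tm _ _ _ => [*|f g tf tg|f g e hf hg h x y u v]; first exact: TP_mon.
  apply/funext => x; apply/funext => y; apply/funext => u; apply/funext => v.
  by rewrite /I3 cintD//; [case: (TP_cc tf x y u v)|case: (TP_cc tg x y u v)].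
rewrite /I3 -[2 * pi in X in cle _ X]subr0; apply: cintB_cle => //.
  by case: (hf x y u v).
by case: (hg x y u v).
Qed.

Lemma Iop2 : Iop I2 (pi / 2).
Proof.
apply: Iop_of I2_tm _ _ _ => [*|f g tf tg|f g e hf hg h x y u v]; first exact: TP_mon.
  apply/funext => x; apply/funext => y; apply/funext => u; apply/funext => v.
  by rewrite /I2 cintD//; [case: (TP_cc tf x y u v)|case: (TP_cc tg x y u v)].
rewrite /I2 -[pi / 2 in X in cle _ X]subr0; apply: cintB_cle => //.
  by case: (hf x y u v).
by case: (hg x y u v).
Qed.

Lemma Iop1 : Iop I1 (2 * pi).
Proof.
apply: Iop_of I1_tm _ _ _ => [*|f g tf tg|f g e hf hg h x y u v]; first exact: TP_mon.
  apply/funext => x; apply/funext => y; apply/funext => u; apply/funext => v.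
  by rewrite /I1 cintD//; [case: (TP_cc tf x y u v)|case: (TP_cc tg x y u v)].
rewrite /I1 -[2 * pi in X in cle _ X]subr0; apply: cintB_cle => //.
  by case: (hf x y u v).
by case: (hg x y u v).
Qed.

Lemma UsD f g : TP f -> TP g -> Us (fun x y u v => f x y u v + g x y u v) = Us f + Us g.
Proof.
move=> tf tg; have [t4 a4 _] := Iop4; have [t3 a3 _] := Iop3; have [t2 a2 _] := Iop2.
have [t1 a1 _] := Iop1.
rewrite !UsE a4// (a3 _ _ (t4 _ tf) (t4 _ tg)) (a2 _ _ (t3 _ (t4 _ tf)) (t3 _ (t4 _ tg))).
by rewrite (a1 _ _ (t2 _ (t3 _ (t4 _ tf))) (t2 _ (t3 _ (t4 _ tg)))).
Qed.

Lemma Us_tm z a b m n k : Us (tm z a b m n k) =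
  if [&& m == 0, n == 0 & k == 0] then z * csc a b * (2 * pi)%:C ^+ 3 else 0.
Proof.
rewrite UsE I4_tm I3_tm I2_tm I1_tm /tm !em0 !expr0 !mulr1.
by case: (m == 0); case: (n == 0); case: (k == 0) => //=; rewrite ?mul0r//; ring.
Qed.

(** Uniform approximability by trigonometric polynomials is preserved by each partial integral, so
    every stage of the iterated integral again has a continuous integrand. *)
Definition apx h := forall e, 0 < e ->
  exists2 g, TP g & forall x y u v, cle (h x y u v - g x y u v) e.

Lemma TP_apx f : TP f -> apx f.
Proof.
by move=> tf e e0; exists f => // x y u v; rewrite subrr; split; rewrite normr0 ltW.
Qed.

Lemma apx_cc h : apx h -> forall x y u v,
  [/\ cc (fun x => h x y u v), cc (fun y => h x y u v), cc (fun u => h x y u v)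
    & cc (fun v => h x y u v)].
Proof.
move=> ah x y u v; split; apply: cc_lim => e e0; have [g tg hg] := ah _ e0;
  have [? ? ? ?] := TP_cc tg x y u v.
- by exists (fun x => g x y u v).
- by exists (fun y => g x y u v).
- by exists (fun u => g x y u v).
- by exists (fun v => g x y u v).
Qed.

Lemma Iop_apx I c h : 0 < c -> Iop I c -> apx h -> apx (I h).
Proof.
move=> c0 [tI _ bI] ah e e0; have [g tg hg] := ah _ (divr_gt0 e0 c0).
exists (I g); first exact: tI.
move=> x y u v; have := bI h g _ (apx_cc ah) (TP_cc tg) hg x y u v.
by rewrite mulrC divfK// gt_eqF.
Qed.

Lemma Us_close h h' e : apx h -> apx h' ->
  (forall x y u v, cle (h x y u v - h' x y u v) e) ->
  cle (Us h - Us h') (2 * pi * (pi / 2 * (2 * pi * (2 * pi * e)))).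
Proof.
move=> ah ah' hh; have p2' : (0 : R) < 2 * pi by rewrite mulr_gt0// pi_gt0.
have ph' : (0 : R) < pi / 2 by rewrite divr_gt0// pi_gt0.
have a4 f (af : apx f) := Iop_apx p2' Iop4 af; have a3 f (af : apx f) := Iop_apx p2' Iop3 af.
have a2 f (af : apx f) := Iop_apx ph' Iop2 af.
have [_ _ b4] := Iop4; have [_ _ b3] := Iop3; have [_ _ b2] := Iop2; have [_ _ b1] := Iop1.
have h4 := b4 _ _ _ (apx_cc ah) (apx_cc ah') hh.
have h3 := b3 _ _ _ (apx_cc (a4 _ ah)) (apx_cc (a4 _ ah')) h4.
have h2 := b2 _ _ _ (apx_cc (a3 _ (a4 _ ah))) (apx_cc (a3 _ (a4 _ ah'))) h3.
exact: (b1 _ _ _ (apx_cc (a2 _ (a3 _ (a4 _ ah)))) (apx_cc (a2 _ (a3 _ (a4 _ ah')))) h2).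
Qed.

Let mu := @lebesgue_measure R.

Definition Jcs a b : R := \int[mu]_(y in `[0, pi / 2]) (cos y ^+ a * sin y ^+ b).

Lemma cont_cs a b : continuous (fun y : R => cos y ^+ a * sin y ^+ b).
Proof.
by move=> y; apply: cvgM; apply: (@continuous_comp _ _ _ _ (fun t : R => t ^+ _));
  try exact: exprn_continuous; [exact: continuous_cos|exact: continuous_sin].
Qed.

Lemma csc_real a b : csc a b = (Jcs a b)%:C.
Proof.
rewrite /csc /cint.
have -> : (fun x : R => complex.Re ((cos x)%:C ^+ a * (sin x)%:C ^+ b)) =
  (fun x => cos x ^+ a * sin x ^+ b).
  by apply/funext => y; rewrite -!rmorphXn -rmorphM.
have -> : (fun x : R => complex.Im ((cos x)%:C ^+ a * (sin x)%:C ^+ b)) = fun=> 0.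
  by apply/funext => y; rewrite -!rmorphXn -rmorphM.
by rewrite Rint_cst// mulr0.
Qed.

Lemma Jcs_split a b : Jcs a.+2 b + Jcs a b.+2 = Jcs a b.
Proof.
rewrite /Jcs -RintegralD//; try (by apply: cont_integrable; exact: cont_cs).
congr Rintegral; apply/funext => y.
transitivity (cos y ^+ a * sin y ^+ b * (cos y ^+ 2 + sin y ^+ 2)); last by rewrite cos2Dsin2 mulr1.
by rewrite !exprS expr0; ring.
Qed.

Lemma is_derive_cs a b (y : R) : is_derive y 1 (fun y : R => cos y ^+ a.+1 * sin y ^+ b.+1)
  (b.+1%:R * (cos y ^+ a.+2 * sin y ^+ b) - a.+1%:R * (cos y ^+ a * sin y ^+ b.+2)).
Proof.
have h1 := is_deriveX a.+1 (is_derive_cos y); have h2 := is_deriveX b.+1 (is_derive_sin y).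
have := is_deriveM h1 h2; rewrite !exprfctE => h.
by apply: is_derive_eq h _; rewrite /GRing.scale /= !exprS; ring.
Qed.

(** The primitive cos^(a+1) sin^(b+1) vanishes at both ends of [0, pi/2]. *)
Lemma Jcs_ibp a b : b.+1%:R * Jcs a.+2 b = a.+1%:R * Jcs a b.+2.
Proof.
have ph' : (0 : R) < pi / 2 by rewrite divr_gt0// pi_gt0.
have cZ k c d : continuous (fun y : R => k%:R * (cos y ^+ c * sin y ^+ d)).
  by move=> n y; apply: cvgM; [exact: cvg_cst|exact: cont_cs].
have cB : continuous (fun y : R => b.+1%:R * (cos y ^+ a.+2 * sin y ^+ b) - a.+1%:R * (cos y ^+ a * sin y ^+ b.+2)).
  by move=> y; apply: cvgB; exact: cZ.
have := Rint_FTC ph' cB (is_derive_cs a b).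
rewrite cos_pihalf sin0 !exprS !mul0r mulr0 subrr.
rewrite RintegralB//; [|exact: cont_integrable|exact: cont_integrable].
rewrite !RintegralZl//; try (by apply: cont_integrable; exact: cont_cs).
by move/eqP; rewrite subr_eq0 => /eqP.
Qed.

Lemma Jcs11 : Jcs 1 1 = 2^-1.
Proof.
have ph' : (0 : R) < pi / 2 by rewrite divr_gt0// pi_gt0.
have h y : is_derive y 1 (fun y : R => 2^-1 * sin y ^+ 2) (cos y ^+ 1 * sin y ^+ 1).
  have h2 := is_deriveZ 2^-1 (is_deriveX 2 (is_derive_sin y)).
  move: h2; rewrite !exprfctE => h2; apply: is_derive_eq h2 _.
  by rewrite /GRing.scale /= !expr1; field.
rewrite /Jcs (Rint_FTC ph' (@cont_cs 1 1) h) sin_pihalf sin0.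
by rewrite expr1n mulr1 expr0n mulr0 subr0.
Qed.

(** The two integrals that add up to [Jcs (2 * a).+1 (2 * b).+1] are in the ratio a + 1 : b + 1, by
    [Jcs_ibp]. *)
Lemma Jcs_step1 a b : Jcs (2 * a.+1).+1 (2 * b).+1 * (a + b).+2%:R = a.+1%:R * Jcs (2 * a).+1 (2 * b).+1.
Proof.
  have := Jcs_ibp (2 * a).+1 (2 * b).+1; have := Jcs_split (2 * a).+1 (2 * b).+1.
  have -> : (2 * a.+1).+1 = (2 * a).+3 by lia.
  move=> <-; set X := Jcs _ _; set Y := Jcs _ _ => e.
  have e' : b.+1%:R * X = a.+1%:R * Y.
    have t : 2 != 0 :> R by rewrite pnatr_eq0.
    move: e; have -> : (2 * b).+2 = (2 * b.+1)%N by lia.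
    have -> : (2 * a).+2 = (2 * a.+1)%N by lia.
    by rewrite !natrM -!mulrA => /(mulfI t).
  rewrite [RHS]mulrDr -e' -mulrDl mulrC -natrD; congr (_%:R * _); lia.
Qed.

Lemma Jcs_step2 a b : Jcs (2 * a).+1 (2 * b.+1).+1 * (a + b).+2%:R = b.+1%:R * Jcs (2 * a).+1 (2 * b).+1.
Proof.
  have := Jcs_ibp (2 * a).+1 (2 * b).+1; have := Jcs_split (2 * a).+1 (2 * b).+1.
  have -> : (2 * b.+1).+1 = (2 * b).+3 by lia.
  move=> <-; set X := Jcs _ _; set Y := Jcs _ _ => e.
  have e' : b.+1%:R * X = a.+1%:R * Y.
    have t : 2 != 0 :> R by rewrite pnatr_eq0.
    move: e; have -> : (2 * b).+2 = (2 * b.+1)%N by lia.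
    have -> : (2 * a).+2 = (2 * a.+1)%N by lia.
    by rewrite !natrM -!mulrA => /(mulfI t).
  rewrite [RHS]mulrDr e' -mulrDl mulrC -natrD; congr (_%:R * _); lia.
Qed.

(** Half the Beta value B (a + 1, b + 1). Only odd exponents occur, since orthogonality in the other
    angles pairs equal exponents and the volume factor adds one. *)
Lemma Jcs_odd a b : Jcs (2 * a).+1 (2 * b).+1 * (a + b).+1`!%:R = 2^-1 * a`!%:R * b`!%:R.
Proof.
elim: a => [|a ih]; last first.
  rewrite addSn factS natrM mulrA Jcs_step1 -mulrA ih factS natrM; ring.
elim: b => [|b ih]; first by rewrite !muln0 Jcs11 !mulr1.
by rewrite addnS factS natrM mulrA Jcs_step2 -mulrA ih factS natrM; ring.
Qed.

End TrigPolynomials.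

(** * The pullback of dV to the angles *)

Section VolumeForm.
Variable R : realType.
Implicit Types (x y u v t e r : R) (z w : R[i]).

Definition iscd (f : R -> R[i]) x (d : R[i]) :=
  is_derive x 1 (fun t => complex.Re (f t) : R) (complex.Re d) /\
  is_derive x 1 (fun t => complex.Im (f t) : R) (complex.Im d).

Lemma iscd_eq f x d d' : iscd f x d -> d = d' -> iscd f x d'.
Proof. by move=> h <-. Qed.

Lemma iscd_cst z x : iscd (fun=> z) x 0.
Proof. by split; exact: is_derive_cst. Qed.

Lemma ReM z w : complex.Re (z * w) = complex.Re z * complex.Re w - complex.Im z * complex.Im w.
Proof. by case: z w => [? ?] [? ?]. Qed.

Lemma ImM z w : complex.Im (z * w) = complex.Re z * complex.Im w + complex.Im z * complex.Re w.
Proof. by case: z w => [? ?] [? ?]. Qed.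

Lemma iscdM f g x a b : iscd f x a -> iscd g x b ->
  iscd (fun t => f t * g t) x (a * g x + f x * b).
Proof.
move=> [f1 f2] [g1 g2]; split.
  have h := is_deriveB (is_deriveM f1 g1) (is_deriveM f2 g2).
  rewrite (_ : (fun _ => _) = (fun t => complex.Re (f t)) * (fun t => complex.Re (g t)) -
     (fun t => complex.Im (f t)) * (fun t => complex.Im (g t))); last first.
    by apply/funext => t; exact: ReM.
  apply: is_derive_eq h _; rewrite /GRing.scale /=.
  by case: (f x) (g x) a b {f1 f2 g1 g2} => [? ?] [? ?] [? ?] [? ?] /=; ring.
have h := is_deriveD (is_deriveM f1 g2) (is_deriveM f2 g1).
rewrite (_ : (fun _ => _) = (fun t => complex.Re (f t)) * (fun t => complex.Im (g t)) +
   (fun t => complex.Im (f t)) * (fun t => complex.Re (g t))); last first.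
  by apply/funext => t; exact: ImM.
apply: is_derive_eq h _; rewrite /GRing.scale /=.
by case: (f x) (g x) a b {f1 f2 g1 g2} => [? ?] [? ?] [? ?] [? ?] /=; ring.
Qed.

Definition isl (f : R -> R) x d := is_derive x 1 f d.

Lemma isl_aff x k c : isl (fun t => t * k + c) x k.
Proof.
rewrite /isl (_ : (fun t => t * k + c) = k \*: (@id R) + cst c).
  apply: is_derive_eq (is_deriveD (is_deriveZ k (is_derive_id x (1 : R))) (is_derive_cst c x (1 : R))) _.
  by rewrite /GRing.scale /= mulr1 addr0.
by apply/funext => t; change (t * k + c = k * t + c); rewrite mulrC.
Qed.

Lemma comp_aff (f f' : R -> R) x k c : (forall y, is_derive y 1 f (f' y)) ->
  is_derive x 1 (fun t => f (t * k + c) : R) (f' (x * k + c) * k).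
Proof.
move=> h; exact: (@is_derive1_comp _ f (fun t => t * k + c) x _ _ (h _) (isl_aff x k c)).
Qed.

Lemma iscd_cis x k c : iscd (fun t => cis (t * k + c)) x ('i * k%:C * cis (x * k + c)).
Proof.
have hc := comp_aff x k c (@is_derive_cos R).
have hs := comp_aff x k c (@is_derive_sin R).
by split; [apply: is_derive_eq hc _|apply: is_derive_eq hs _]; rewrite /cis /=; ring.
Qed.

Lemma iscd_cos x k c : iscd (fun t => (cos (t * k + c))%:C) x (- (k * sin (x * k + c))%:C).
Proof.
have hc := comp_aff x k c (@is_derive_cos R).
by split; [apply: is_derive_eq hc _; rewrite /=; ring|rewrite /= oppr0; exact: is_derive_cst].
Qed.

Lemma iscd_sin x k c : iscd (fun t => (sin (t * k + c))%:C) x (k * cos (x * k + c))%:C.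
Proof.
have hc := comp_aff x k c (@is_derive_sin R).
by split; [apply: is_derive_eq hc _; rewrite /=; ring|exact: is_derive_cst].
Qed.

Lemma derive_line (V : normedModType R) (f : V -> R^o) (a v : V) :
  'D_v f a = 'D_1 (fun h : R => f (h *: v + a)) 0.
Proof.
rewrite /derive; suff -> : (fun h => h^-1 *: (((fun h : R => f (h *: v + a)) \o shift 0) (h *: (1 : R)) -
   f (0 *: v + a))) = (fun h => h^-1 *: ((f \o shift a) (h *: v) - f a)) by [].
by apply/funext => h /=; rewrite addr0 scale0r add0r [h *: 1]mulr1.
Qed.

Lemma rpartialE k g (t : 'rV[R]_4) d :
  iscd (fun h => g (h *: delta_mx 0 k + t)) 0 d -> rpartial k g t = d.
Proof.
move=> [h1 h2]; rewrite /rpartial (derive_line (fun s => complex.Re (g s) : R^o)).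
rewrite (derive_line (fun s => complex.Im (g s) : R^o)).
by case: h1 => _ ->; case: h2 => _ ->; case: d.
Qed.

Lemma row4E x y u v : (row4 x y u v 0 0 = x) * (row4 x y u v 0 1 = y) *
  (row4 x y u v 0 2%:R = u) * (row4 x y u v 0 3%:R = v).
Proof. by rewrite !mxE. Qed.

(** With Kronecker symbols as slopes, the restrictions of the parametrization to the four coordinate
    lines become a single family of functions with affine arguments. *)
Definition d4 (k j : 'I_4) : R := (k == j)%:R.

Lemma U2_line r x y u v k h : U2param r (h *: delta_mx 0 k + row4 x y u v) =
  r%:C *: mx2 ((cos (h * d4 k 1 + y))%:C * cis (h * d4 k 0 + x))
     ((sin (h * d4 k 1 + y))%:C * cis (h * d4 k 2%:R + u))
     (- (sin (h * d4 k 1 + y))%:C * cis (h * (d4 k 3%:R - d4 k 2%:R) + (v - u)))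
     ((cos (h * d4 k 1 + y))%:C * cis (h * (d4 k 3%:R - d4 k 0) + (v - x))).
Proof.
rewrite /U2param; have e j c : row4 x y u v 0 j = c ->
   (h *: delta_mx 0 k + row4 x y u v) 0 j = h * d4 k j + c.
  by move=> <-; rewrite !mxE eqxx /= eq_sym.
rewrite !(e _ _ (row4E x y u v).1.1.1) !(e _ _ (row4E x y u v).1.1.2) !(e _ _ (row4E x y u v).1.2).
rewrite !(e _ _ (row4E x y u v).2).
by congr (_ *: mx2 _ _ (_ * cis _) (_ * cis _)); ring.
Qed.

Lemma U2E r x y u v : let W := U2param r (row4 x y u v) in
  (W 0 0 = r%:C * (cos y)%:C * em 1 x) * (W 0 1 = r%:C * (sin y)%:C * em 1 u) *
  (W 1 0 = - (r%:C * (sin y)%:C * (em 1 v * em (-1) u))) *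
  (W 1 1 = r%:C * (cos y)%:C * (em 1 v * em (-1) x)).
Proof.
have e1 a : cis a = em 1 a :> R[i] by rewrite /em mul1r.
have e2 a b : cis (a - b) = em 1 a * em (-1) b :> R[i].
  by rewrite /em -cisD mul1r mulNr mul1r.
rewrite /= /U2param !(row4E x y u v) !mxE /= !e2 !e1.
by do ! split; ring.
Qed.

Lemma det_U2 r x y u v : \det (U2param r (row4 x y u v)) = r%:C ^+ 2 * em 1 v.
Proof.
have := U2E r x y u v; rewrite /= det2 => E; rewrite !E.
have c2 : (cos y)%:C ^+ 2 + (sin y)%:C ^+ 2 = 1 :> R[i].
  by rewrite -!rmorphXn -rmorphD cos2Dsin2.
have ex a : em 1 a * em (-1) a = 1 by rewrite emD em0.
transitivity (r%:C ^+ 2 * em 1 v * ((cos y)%:C ^+ 2 * (em 1 x * em (-1) x) +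
   (sin y)%:C ^+ 2 * (em 1 u * em (-1) u))); first by ring.
by rewrite !ex !mulr1 c2 mulr1.
Qed.

Lemma det_eq2 (K : comNzRingType) n (f g : 'I_n -> 'I_n -> K) :
  (forall i j, f i j = g i j) -> \det (\matrix_(i, j) f i j) = \det (\matrix_(i, j) g i j).
Proof. by move=> e; congr (\det _); apply/matrixP => i j; rewrite !mxE e. Qed.

(** Laplace expansion: m collects the 2 x 2 minors of the last two rows, n the 3 x 3 minors of the
    last three. It turns the Jacobian into one explicit expression. *)
Lemma det4 (K : comNzRingType) (q : nat -> nat -> K) :
  let m i j := q 2 i * q 3 j - q 2 j * q 3 i in
  let n i j k := q 1 i * m j k - q 1 j * m i k + q 1 k * m i j in
  \det (\matrix_(i < 4, j < 4) q i j) =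
  q 0 0 * n 1 2 3 - q 0 1 * n 0 2 3 + q 0 2 * n 0 1 3 - q 0 3 * n 0 1 2.
Proof.
rewrite (expand_det_row _ 0) !big_ord_recl big_ord0 /cofactor.
rewrite !(expand_det_row _ 0) !big_ord_recl !big_ord0 /cofactor !det2 !mxE /bump /=.
have B : (bump 0 0 = 1%N) * (bump 0 1 = 2%N) * (bump 0 2 = 3%N) * (bump 1 0 = 0%N) * (bump 1 1 = 2%N) * (bump 1 2 = 3%N) *
  (bump 2 0 = 0%N) * (bump 2 1 = 1%N) * (bump 2 2 = 3%N) * (bump 3 0 = 0%N) * (bump 3 1 = 1%N) * (bump 3 2 = 2%N) * ((1 %% 2)%N = 1%N) * ((0 + 0)%N = 0%N) * ((0 + 1)%N = 1%N) * ((0 + 2)%N = 2%N) * ((0 + 3)%N = 3%N) by [].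
rewrite !B; ring.
Qed.

Lemma dV_U2 r x y u v : dV r (row4 x y u v) =
  - ('i / 2) * r%:C ^+ 4 * (cos y)%:C * (sin y)%:C * em 2 v.
Proof.
pose q (a k : nat) : R[i] := rpartial (inord k) (fun s => let W := U2param r s in
                         nth 0 [:: W 0 0; W 0 1; W 1 0; W 1 1] a) (row4 x y u v).
have -> : dV r (row4 x y u v) = 4^-1 * \det (\matrix_(a < 4, k < 4) q a k).
  by rewrite /dV; apply: (congr1 (fun w => _ * w)); apply: det_eq2 => a k; rewrite /q (inord_val k).
rewrite det4.
have q0 k : q 0 k = r%:C * (- (d4 (inord k) 1 * sin y)%:C * cis x +
   (cos y)%:C * ('i * (d4 (inord k) 0)%:C * cis x)).
  apply: rpartialE; rewrite (_ : (fun h : R => _) = fun h => r%:C * ((cos (h * d4 (inord k) 1 + y))%:C * cis (h * d4 (inord k) 0 + x))); last first.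
    by apply/funext => h; rewrite /= U2_line mxE mx2E.
  apply: iscd_eq (iscdM (iscd_cst _ _) (iscdM (iscd_cos _ _ _) (iscd_cis _ _ _))) _.
  by rewrite !mul0r !add0r.
have q1 k : q 1 k = r%:C * ((d4 (inord k) 1 * cos y)%:C * cis u +
   (sin y)%:C * ('i * (d4 (inord k) 2%:R)%:C * cis u)).
  apply: rpartialE; rewrite (_ : (fun h : R => _) = fun h => r%:C * ((sin (h * d4 (inord k) 1 + y))%:C * cis (h * d4 (inord k) 2%:R + u))); last first.
    by apply/funext => h; rewrite /= U2_line mxE mx2E.
  apply: iscd_eq (iscdM (iscd_cst _ _) (iscdM (iscd_sin _ _ _) (iscd_cis _ _ _))) _.
  by rewrite !mul0r !add0r.
have q2 k : q 2 k = - r%:C * ((d4 (inord k) 1 * cos y)%:C * cis (v - u) +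
   (sin y)%:C * ('i * (d4 (inord k) 3%:R - d4 (inord k) 2%:R)%:C * cis (v - u))).
  apply: rpartialE; rewrite (_ : (fun h : R => _) = fun h => - r%:C * ((sin (h * d4 (inord k) 1 + y))%:C * cis (h * (d4 (inord k) 3%:R - d4 (inord k) 2%:R) + (v - u)))); last first.
    by apply/funext => h; rewrite /= U2_line mxE mx2E; ring.
  apply: iscd_eq (iscdM (iscd_cst _ _) (iscdM (iscd_sin _ _ _) (iscd_cis _ _ _))) _.
  by rewrite !mul0r !add0r.
have q3 k : q 3 k = r%:C * (- (d4 (inord k) 1 * sin y)%:C * cis (v - x) +
   (cos y)%:C * ('i * (d4 (inord k) 3%:R - d4 (inord k) 0)%:C * cis (v - x))).
  apply: rpartialE; rewrite (_ : (fun h : R => _) = fun h => r%:C * ((cos (h * d4 (inord k) 1 + y))%:C * cis (h * (d4 (inord k) 3%:R - d4 (inord k) 0) + (v - x)))); last first.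
    by apply/funext => h; rewrite /= U2_line mxE mx2E.
  apply: iscd_eq (iscdM (iscd_cst _ _) (iscdM (iscd_cos _ _ _) (iscd_cis _ _ _))) _.
  by rewrite !mul0r !add0r.
have i0 : inord 0 = 0 :> 'I_4 by apply: val_inj; rewrite /= inordK.
have i1 : inord 1 = 1 :> 'I_4 by apply: val_inj; rewrite /= inordK.
have i2 : inord 2 = 2%:R :> 'I_4 by apply: val_inj; rewrite /= inordK.
have i3 : inord 3 = 3%:R :> 'I_4 by apply: val_inj; rewrite /= inordK.
have D : (d4 0 0 = 1) * (d4 0 1 = 0) * (d4 0 2%:R = 0) * (d4 0 3%:R = 0) *
  (d4 1 0 = 0) * (d4 1 1 = 1) * (d4 1 2%:R = 0) * (d4 1 3%:R = 0) *
  (d4 2%:R 0 = 0) * (d4 2%:R 1 = 0) * (d4 2%:R 2%:R = 1) * (d4 2%:R 3%:R = 0) *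
  (d4 3%:R 0 = 0) * (d4 3%:R 1 = 0) * (d4 3%:R 2%:R = 0) * (d4 3%:R 3%:R = 1).
  by [].
rewrite !(q0, q1, q2, q3) !(i0, i1, i2, i3) !D !(mul0r, mul1r, subr0, sub0r, subrr) !rmorphN.
rewrite (_ : (0 : R)%:C = 0)// (_ : (1 : R)%:C = 1)//.
have cc2 a : cis a * cis (v - a) = cis v :> R[i] by rewrite -cisD addrC subrK.
have c2 : (cos y)%:C ^+ 2 + (sin y)%:C ^+ 2 = 1 :> R[i].
  by rewrite -!rmorphXn -rmorphD cos2Dsin2.
have ii : 'i * 'i = -1 :> R[i] by rewrite -expr2 sqr_i.
have -> : em 2 v = cis v * cis v :> R[i] by rewrite -cisD /em -mulr2n mulr_natl.
set C := (cos y)%:C in c2 *; set S := (sin y)%:C in c2 *.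
transitivity (- ('i / 2) * r%:C ^+ 4 * C * S * ((cis x * cis (v - x)) * (cis u * cis (v - u))) * (C ^+ 2 + S ^+ 2)).
  set a1 := cis x; set a2 := cis (v - x); set a3 := cis u; set a4 := cis (v - u).
  (* Each derivative in phi, psi, delta brings out one factor ['i]; their cube is left visible so
     that [ii] can reduce it. *)
  transitivity ('i * ('i * 'i) / 2 * r%:C ^+ 4 * C * S * (a1 * a2 * (a3 * a4)) * (C ^+ 2 + S ^+ 2)).
    by field.
  by rewrite ii; ring.
by rewrite !cc2 c2 mulr1.
Qed.

End VolumeForm.

(** * Explicit values of the integral on Laurent functions *)

Section IntegralOfLaurent.
Variables (R : realType) (r : R).
Hypothesis hr : 0 < r.
Implicit Types (f g : HC R -> R[i]) (x y u v e : R) (z w : R[i]).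

Let rC : R[i] := r%:C.
Let rC0 : rC != 0. Proof. by rewrite /rC fmorph_eq0 gt_eqF. Qed.

Lemma U2_unit x y u v : HCunits (U2param r (row4 x y u v)).
Proof. by rewrite /HCunits /= det_U2 mulf_neq0 ?expf_neq0 ?em_neq0. Qed.

Definition pull f x y u v : R[i] := f (U2param r (row4 x y u v)) * dV r (row4 x y u v).

(* Locked, to prevent conversion from unfolding the integrals. *)
Fact Lam_key : unit. Proof. by []. Qed.
Definition Lam f : R[i] := locked_with Lam_key (U2int r) f.

Lemma LamE f : U2int r f = Lam f. Proof. by rewrite /Lam unlock. Qed.

Lemma LamU f : Lam f = Us (pull f). Proof. by rewrite -LamE. Qed.

(** On the parametrized group N is r^2 e^(i delta), and each entry is r times a cosine or sine times
    characters. The shifts by 1 in the exponents of cos and sin, by 2 in the last frequency and by 4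
    in the power of r come from [dV_U2]. *)
Lemma pull_mon z k a b c d : pull (fun W => z * mon k a b c d W) =
  tm (z * (- ('i / 2) * (-1) ^+ c * rC ^ (2 * k + (a + b + c + d + 4)%:Z)))
     (a + d).+1 (b + c).+1 (a%:Z - d%:Z) (b%:Z - c%:Z) (k + c%:Z + d%:Z + 2).
Proof.
apply/funext => x; apply/funext => y; apply/funext => u; apply/funext => v.
rewrite /pull dV_U2 /mon /pmon det_U2 !(U2E r x y u v) /tm -/rC.
rewrite exprzMl ?emXz; last 2 first.
  by rewrite unitfE expf_neq0.
  by rewrite unitfE em_neq0.
have -> : (rC ^+ 2) ^ k = rC ^ (2 * k) by rewrite [rC ^+ 2]exprnP exprz_exp.
rewrite -[- (_ * _)]mulN1r !exprMn !emX.
have -> : rC ^ (2 * k + (a + b + c + d + 4)%:Z) = rC ^ (2 * k) * rC ^+ a * rC ^+ b * rC ^+ c * rC ^+ d * rC ^+ 4.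
  by rewrite expfzDr// -!mulrA -!exprD -!exprnP; congr (_ * _ ^+ _); lia.
have -> : em (a%:Z - d%:Z) x = em (1 * a%:Z) x * em (-1 * d%:Z) x by rewrite emD; congr em; lia.
have -> : em (b%:Z - c%:Z) u = em (1 * b%:Z) u * em (-1 * c%:Z) u by rewrite emD; congr em; lia.
have -> : em (k + c%:Z + d%:Z + 2) v = em (1 * k) v * em (1 * c%:Z) v * em (1 * d%:Z) v * em 2 v.
  by rewrite !emD; congr em; lia.
by rewrite !exprS !exprD; ring.
Qed.

Lemma pull_add f g : pull (fun W => f W + g W) =
  fun x y u v => pull f x y u v + pull g x y u v.
Proof.
by apply/funext => x; apply/funext => y; apply/funext => u; apply/funext => v; rewrite /pull mulrDl.
Qed.

Lemma pull_eqU f g : eqU f g -> pull f = pull g.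
Proof.
move=> e; apply/funext => x; apply/funext => y; apply/funext => u; apply/funext => v.
by rewrite /pull e//; exact: U2_unit.
Qed.

Lemma TP_pull o f : L o f -> TP (pull f).
Proof.
elim=> [z k a b c d _|f1 f2 _ h1 _ h2|f1 f2 _ h1 e].
- by rewrite pull_mon; exact: TP_mon.
- by rewrite pull_add; exact: TP_add.
- by rewrite -(pull_eqU e).
Qed.

Definition lamn (a b : nat) : R[i] := a`!%:R * b`!%:R / (a + b).+1`!%:R.

(** The conditions say that the three frequencies of [pull_mon] vanish; the exponent of r is then 0,
    so the integral of a Laurent function does not depend on r. The sign comes from the entry
    [W 1 0]. *)
Definition lam (k : int) (a b c d : nat) : R[i] :=
  if [&& a == d, b == c & k == - (c + d + 2)%:Z] then (-1) ^+ c * lamn d c else 0.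

Definition lam0 : R[i] := - 2 * (pi%:C) ^+ 3 * 'i.

Lemma lamnC a b : lamn a b = lamn b a.
Proof. by rewrite /lamn addnC [X in X / _]mulrC. Qed.

Lemma lamnS a b : (a + b).+2%:R * lamn a.+1 b = a.+1%:R * lamn a b.
Proof.
have h1 : (a + b).+2%:R != 0 :> R[i] by rewrite pnatr_eq0.
have e1 : a.+1`!%:R = a.+1%:R * a`!%:R :> R[i] by rewrite factS natrM.
have e2 : (a + b).+2`!%:R = (a + b).+2%:R * (a + b).+1`!%:R :> R[i] by rewrite [_.+2`!]factS natrM.
rewrite /lamn addSn e1 e2.
have aux (N F G H A : R[i]) : N != 0 -> N * (A * G * H / (N * F)) = A * (G * H / F).
  by move=> n0; rewrite invfM mulrCA [N * _]mulrA mulfV// mul1r -!mulrA.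
exact: aux.
Qed.

Lemma lamnSr a b : (a + b).+2%:R * lamn a b.+1 = b.+1%:R * lamn a b.
Proof. by rewrite lamnC addnC lamnS lamnC. Qed.

Lemma Lam_mon z k a b c d : Lam (fun W => z * mon k a b c d W) = z * (lam0 * lam k a b c d).
Proof.
rewrite LamU pull_mon Us_tm /lam.
have -> : [&& a%:Z - d%:Z == 0, b%:Z - c%:Z == 0 & k + c%:Z + d%:Z + 2 == 0] =
  [&& a == d, b == c & k == - (c + d + 2)%:Z].
  by rewrite !subr_eq0 !eqz_nat; congr [&& _, _ & _]; lia.
case: ifP => [/and3P[/eqP -> /eqP -> /eqP ->]|_]; last by rewrite !mulr0.
rewrite (_ : (2 * _ + _ = 0)); last by lia.
rewrite expr0z mulr1 csc_real.
have [-> ->] : (d + d).+1 = (2 * d).+1 /\ (c + c).+1 = (2 * c).+1 by lia.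
have F0 : (d + c).+1`!%:R != 0 :> R by rewrite pnatr_eq0 -lt0n fact_gt0.
have -> : Jcs R (2 * d).+1 (2 * c).+1 = 2^-1 * (d`!%:R * c`!%:R) / (d + c).+1`!%:R.
  by apply: (mulIf F0); rewrite Jcs_odd divfK// mulrA.
have aux (D E G i p s : R[i]) : z * (- (i / 2) * s) * (2^-1 * (D * E) * G) * (2 * p) ^+ 3 =
    z * (- 2 * p ^+ 3 * i * (s * (D * E * G))) by field.
rewrite /lamn /lam0 !rmorphM !fmorphV !rmorph_nat.
exact: aux.
Qed.

Lemma LamD f g : L None f -> L None g ->
  Lam (fun W => f W + g W) = Lam f + Lam g.
Proof. by move=> lf lg; rewrite !LamU pull_add (UsD (TP_pull lf) (TP_pull lg)). Qed.

Lemma Lam_eqU f g : eqU f g -> Lam f = Lam g.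
Proof. by move=> e; rewrite !LamU (pull_eqU e). Qed.

Lemma LamZ z f : L None f -> Lam (fun W => z * f W) = z * Lam f.
Proof.
elim=> {f} [w k a b c d _|f g lf h1 lg h2|f g _ h1 e].
- rewrite Lam_mon mulrA -Lam_mon; apply: Lam_eqU => W _; by rewrite mulrA.
- rewrite (LamD lf lg) mulrDr -h1 -h2 -(LamD (L_scale z lf) (L_scale z lg)).
  by apply: Lam_eqU => W _; rewrite mulrDr.
- by rewrite -(Lam_eqU e) -h1; apply: Lam_eqU => W uW; rewrite e.
Qed.

Lemma Lam_linear : linear_on_L (Lam).
Proof.
by split=> [f g|z f|f g _]; [exact: LamD|exact: LamZ|exact: Lam_eqU].
Qed.

Lemma Lam_linear_mul g : L None g -> linear_on_L (fun f => Lam (fun W => f W * g W)).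
Proof.
move=> lg; split=> [f1 f2 l1 l2|z f lf|f1 f2 _ e].
- rewrite -LamD; [|exact: L_mul|exact: L_mul].
  by apply: Lam_eqU => W _; rewrite mulrDl.
- rewrite -LamZ; last exact: L_mul.
  by apply: Lam_eqU => W _; rewrite mulrA.
- by apply: Lam_eqU => W uW; rewrite e.
Qed.

(** A monomial with nonzero moment has a = d, b = c and k = -(c + d + 2), hence degree 2 k + 2 (c +
    d) = -4. *)
Lemma Lam_deg n f : L (Some n) f -> n != -4 -> Lam f = 0.
Proof.
move=> lf n4; elim: lf => {f} [z k a b c d /= /eqP e|f g lf h1 lg h2|f g _ h1 e].
- rewrite Lam_mon /lam; case: ifP; rewrite ?mulr0// => /and3P[/eqP ? /eqP ? /eqP ?].
  by move: n4; rewrite e; lia.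
- by rewrite (LamD (L_None lf) (L_None lg)) h1 h2 addr0.
- by rewrite -(Lam_eqU e).
Qed.

Lemma lam_stokes1 k a b c d : k%:~R * lam (k - 1) a b c d.+1 + a%:R * lam k a.-1 b c d = 0.
Proof.
rewrite /lam; case: a => [|a]; first by rewrite mul0r addr0 /= mulr0.
rewrite /= eqSS; have -> : (k - 1 == - (c + d.+1 + 2)%:Z) = (k == - (c + d + 2)%:Z) by lia.
case: ifP => [/and3P[/eqP -> _ /eqP ->]|_]; last by rewrite !mulr0 addr0.
have := lamnS d c; rewrite rmorphN /= -[(Posz _)%:~R]/((c + d + 2)%:R).
have -> : (c + d + 2)%N = (d + c).+2 by lia.
by move=> e; rewrite mulNr !(mulrCA _ ((-1) ^+ c)) e addNr.
Qed.

Lemma lam_stokes2 k a b c d : - k%:~R * lam (k - 1) a b c.+1 d + b%:R * lam k a b.-1 c d = 0.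
Proof.
rewrite /lam; case: b => [|b]; first by rewrite mul0r addr0 /= andbF mulr0.
rewrite /= eqSS; have -> : (k - 1 == - (c.+1 + d + 2)%:Z) = (k == - (c + d + 2)%:Z) by lia.
case: ifP => [/and3P[_ /eqP -> /eqP ->]|_]; last by rewrite !mulr0 addr0.
have := lamnSr d c; rewrite rmorphN opprK /= -[(Posz _)%:~R]/((c + d + 2)%:R).
have -> : (c + d + 2)%N = (d + c).+2 by lia.
by move=> e; rewrite !(mulrCA _ ((-1) ^+ _)) e exprS -mulrA mulN1r addNr.
Qed.

Lemma lam_sym1 k a b c d : lam k a b c d = lam k d b c a.
Proof.
by rewrite /lam; have [->|] := eqVneq a d.
Qed.

Lemma lam_sym2 k a b c d : lam k a b c d = lam k a c b d.
Proof.
by rewrite /lam; have [->|] := eqVneq b c; rewrite //= !andbF.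
Qed.

Lemma mon_mulX z k a b c d (W : HC R) :
  (z * W 0 0 * mon k a b c d W = z * mon k a.+1 b c d W) *
  (z * W 0 1 * mon k a b c d W = z * mon k a b.+1 c d W) *
  (z * W 1 0 * mon k a b c d W = z * mon k a b c.+1 d W) *
  (z * W 1 1 * mon k a b c d W = z * mon k a b c d.+1 W).
Proof. by rewrite /mon /pmon; do ! split; rewrite exprS; ring. Qed.

(** On a monomial, ∂_ij gives two monomials, one from N^k and one from the power of the coordinate;
    their moments cancel by the recurrences of the Beta values. The index pairs (1, 0) and (1, 1)
    follow by exchanging the exponents b, c or a, d. *)
Lemma Lam_pd i j f : L None f -> Lam (pd i j f) = 0.
Proof.
have Lm w k a b c d : L None (fun W => w * mon k a b c d W) by exact: L_mon.
elim=> {f} [z k a b c d _|f g lf h1 lg h2|f g _ h1 e].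
- have two w1 k1 a1 b1 c1 d1 w2 k2 a2 b2 c2 d2 :
     eqU (pd i j (fun W => z * mon k a b c d W)) (fun W => z * w1 * mon k1 a1 b1 c1 d1 W + z * w2 * mon k2 a2 b2 c2 d2 W) ->
     w1 * lam k1 a1 b1 c1 d1 + w2 * lam k2 a2 b2 c2 d2 = 0 ->
     Lam (pd i j (fun W => z * mon k a b c d W)) = 0.
    move=> e l0; rewrite (Lam_eqU e) (LamD (Lm _ _ _ _ _ _) (Lm _ _ _ _ _ _)) !Lam_mon.
    transitivity (z * lam0 * (w1 * lam k1 a1 b1 c1 d1 + w2 * lam k2 a2 b2 c2 d2)); first by ring.
    by rewrite l0 mulr0.
  case: (ord2_cases i) => ei; case: (ord2_cases j) => ej; rewrite ei ej in two *.
  + apply: (two k%:~R (k - 1) a b c d.+1 a%:R k a.-1 b c d _ (lam_stokes1 _ _ _ _ _)) => W uW.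
    rewrite (isd_pd (isdZ z (isd_mon _ _ k a b c d uW))) /dpmon /mxplus !mx2E -mon_mulX /mon; ring.
  + apply: (two (- k%:~R) (k - 1) a b c.+1 d b%:R k a b.-1 c d _ (lam_stokes2 _ _ _ _ _)) => W uW.
    rewrite (isd_pd (isdZ z (isd_mon _ _ k a b c d uW))) /dpmon /mxplus !mx2E -mon_mulX /mon; ring.
  + apply: (two (- k%:~R) (k - 1) a b.+1 c d c%:R k a b c.-1 d).
      move=> W uW; rewrite (isd_pd (isdZ z (isd_mon _ _ k a b c d uW))) /dpmon /mxplus !mx2E -mon_mulX /mon; ring.
    by rewrite (lam_sym2 (k - 1)) (lam_sym2 k) lam_stokes2.
  + apply: (two k%:~R (k - 1) a.+1 b c d d%:R k a b c d.-1).
      move=> W uW; rewrite (isd_pd (isdZ z (isd_mon _ _ k a b c d uW))) /dpmon /mxplus !mx2E -mon_mulX /mon; ring.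
    by rewrite (lam_sym1 (k - 1)) (lam_sym1 k) lam_stokes1.
- by rewrite (Lam_eqU (pdD i j lf lg)) (LamD (L_pdN _ _ lf) (L_pdN _ _ lg)) h1 h2 addr0.
- by rewrite -(Lam_eqU (pd_eqU i j e)).
Qed.

Lemma Lam_ibp i j f g : L None f -> L None g ->
  Lam (fun W => pd i j f W * g W) = - Lam (fun W => f W * pd i j g W).
Proof.
move=> lf lg; apply/eqP; rewrite -addr_eq0 -LamD; [|exact: L_mul (L_pdN _ _ _) _|exact: L_mul _ (L_pdN _ _ _)].
by rewrite -(Lam_eqU (pdM i j lf lg)) Lam_pd//; exact: L_mul.
Qed.

Lemma Lam_detN2 : Lam (fun W => \det W ^ (-2)) = lam0.
Proof.
rewrite (Lam_eqU (g := fun W => 1 * mon (-2) 0 0 0 0 W)); last first.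
  by move=> W _; rewrite /mon /pmon !expr0 !mulr1 mul1r.
have l1 : lamn 0 0 = 1 by rewrite /lamn addn0 divr1 mulr1.
by rewrite Lam_mon mul1r /lam /= l1 expr0 !mulr1.
Qed.

Lemma cle_mul (z w : R[i]) (e m : R) : 0 <= e -> `|w| <= m%:C -> `|z| <= e%:C -> cle (z * w) (e * m).
Proof.
move=> e0 hw hz; apply: cle_normc; rewrite normrM rmorphM.
by apply: ler_pM.
Qed.

Definition Ucl f g e := forall x y u v,
  `|f (U2param r (row4 x y u v)) - g (U2param r (row4 x y u v))| <= e%:C.

Lemma norm_real (x : R) : `|x%:C| = `|x|%:C :> R[i].
Proof. by rewrite normc_def /= expr0n /= addr0 sqrtr_sqr. Qed.

Lemma norm_em m x : `|em m x| = 1 :> R[i].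
Proof. by rewrite normc_def /= cos2Dsin2 sqrtr1. Qed.

Lemma norm_dV x y u v : `|dV r (row4 x y u v)| <= (r ^+ 4)%:C.
Proof.
rewrite dV_U2 normrM norm_em mulr1 3!normrM normrX !norm_real (ger0_norm (ltW hr)).
rewrite normrN normrM normc_def /= expr0n add0r expr1n sqrtr1 mul1r (_ : (r ^+ 4)%:C = rC ^+ 4) ?rmorphXn//.
have h2 : `|2^-1 : R[i]| <= 1.
  by rewrite ger0_norm ?invr_ge0// invf_le1// ler1n.
have hc : `|cos y|%:C <= 1 :> R[i] by rewrite lecR cos_max.
have hs : `|sin y|%:C <= 1 :> R[i] by rewrite lecR sin_max.
have r4 : 0 <= rC ^+ 4 by rewrite exprn_ge0// lecR ltW.
have p1 (s t : R[i]) : 0 <= s -> 0 <= t -> t <= 1 -> s * t <= s by move=> s0 t0 t1; rewrite -[leRHS]mulr1 ler_wpM2l.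
have ha : 0 <= `|2^-1 : R[i]| * rC ^+ 4 by rewrite mulr_ge0.
have hc0 : 0 <= `|cos y|%:C :> R[i] by rewrite lecR.
have hs0 : 0 <= `|sin y|%:C :> R[i] by rewrite lecR.
have := le_trans (p1 _ _ (mulr_ge0 ha hc0) hs0 hs) (le_trans (p1 _ _ ha hc0 hc) _).
by apply; rewrite mulrC; exact: p1.
Qed.

Lemma pull_close f g e : 0 <= e -> Ucl f g e ->
  forall x y u v, cle (pull f x y u v - pull g x y u v) (e * r ^+ 4).
Proof.
move=> e0 h x y u v; rewrite /pull -mulrBl; apply: cle_mul => //; exact: norm_dV.
Qed.

(** Here f is known only as a uniform limit over U(2)_r of Laurent functions. Eventual constancy of
    their integrals is the right hypothesis because Taylor terms of high order integrate to 0. *)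
Lemma Lam_limit f (S : nat -> HC R -> R[i]) w :
  (forall n, L None (S n)) ->
  (forall e, 0 < e -> exists N, forall n, (N <= n)%N -> Ucl f (S n) e) ->
  (exists N, forall n, (N <= n)%N -> Lam (S n) = w) -> Lam f = w.
Proof.
move=> lS h [N0 hN]; have r4 : 0 < r ^+ 4 by rewrite exprn_gt0.
have af : apx (pull f).
  move=> e e0; have [N hN'] := h _ (divr_gt0 e0 r4).
  exists (pull (S N)); first exact: TP_pull (lS N).
  move=> x y u v; have := pull_close (ltW (divr_gt0 e0 r4)) (hN' N (leqnn _)) x y u v.
  by rewrite divfK// gt_eqF.
apply/eqP; rewrite -subr_eq0; apply/eqP; apply: cle_eq0 => e e0.
have p0 : (0 : R) < pi by exact: pi_gt0.
(* The lengths of the four parameter intervals times the bound r^4 of [norm_dV]. *)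
pose c : R := 2 * pi * (pi / 2 * (2 * pi * (2 * pi * r ^+ 4))).
have c0 : 0 < c by rewrite /c !(mulr_gt0, divr_gt0).
have [N hN'] := h _ (divr_gt0 e0 c0); pose n := maxn N N0.
have hn := pull_close (ltW (divr_gt0 e0 c0)) (hN' n (leq_maxl _ _)).
have := Us_close af (TP_apx (TP_pull (lS n))) hn.
rewrite -!LamU (hN n (leq_maxr _ _)); congr (cle _ _).
transitivity (e / c * c); last by rewrite divfK// gt_eqF.
by move: (e / c) => t; rewrite /c; ring.
Qed.

End IntegralOfLaurent.

(** * Invariance under inversion and orthogonality to polynomials *)

Section Orthogonality.
Variables (R : realType) (r : R).
Hypothesis hr : 0 < r.
Implicit Types (f g h p : HC R -> R[i]) (W Z X : HC R) (z w : R[i]).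

(** Since W^-1 = N^-1 W^+, inversion exchanges a and d and brings the sign (-1)^(b + c), which is 1
    whenever the moment is nonzero because then b = c. *)
Lemma lam_inv k a b c d :
  (-1) ^+ (b + c) * lam R (- 4 - k - (a + b + c + d)%:Z) d b c a = lam R k a b c d.
Proof.
rewrite /lam; have [->|_] := eqVneq a d; last by rewrite mulr0.
have [->|_] := eqVneq b c; last by rewrite mulr0.
rewrite /= (_ : (_ == _) = (k == - (c + d + 2)%:Z)); last by lia.
by rewrite addnn -mul2n exprM sqrrN expr1n expr1n mul1r.
Qed.

Lemma Lam_inv f : L None f -> Lam r (fun W => \det W ^ (-4) * invo f W) = Lam r f.
Proof.
have Li g : L None g -> L None (fun W => \det W ^ (-4) * invo g W).
  by move=> lg; apply: L_mul; [exact: L_None (L_detz _ _)|exact: invo_L].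
elim=> {f} [z k a b c d _|f g lf h1 lg h2|f g _ h1 e].
- rewrite (Lam_mon hr) -lam_inv -(Lam_eqU hr (f := fun W => z * (-1) ^+ (b + c) *
     mon (- 4 - k - (a + b + c + d)%:Z) d b c a W)); first by rewrite (Lam_mon hr); ring.
  move=> W uW; rewrite /mon /invo /pmon det_invHC !(inv_entry _ _ uW) /mxplus !mx2E.
  have -> : (\det W)^-1 ^ k = \det W ^ (- k) by rewrite -[(\det W)^-1]exprN1 exprz_exp mulN1r.
  have -> : \det W ^ (-4 - k - (a + b + c + d)%:Z) =
     \det W ^ (-4) * \det W ^ (- k) * (\det W)^-1 ^+ a * (\det W)^-1 ^+ b * (\det W)^-1 ^+ c * (\det W)^-1 ^+ d.
    rewrite !exprVn !exprnN -!expfzDr//; congr (_ ^ _); lia.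
  by rewrite -[- W 0 1]mulN1r -[- W 1 0]mulN1r !exprMn exprD; ring.
- rewrite (LamD hr lf lg) -h1 -h2 -(LamD hr (Li _ lf) (Li _ lg)).
  by apply: (Lam_eqU hr) => W _; rewrite -mulrDr.
- rewrite -(Lam_eqU hr e) -h1; apply: (Lam_eqU hr) => W uW.
  by rewrite (invo_eqU e uW).
Qed.

Lemma P_homog_ind (Q : (HC R -> R[i]) -> Prop) :
  (forall f g, P None f -> P None g -> Q f -> Q g -> Q (fun W => f W + g W)) ->
  (forall n f, P (Some n) f -> Q f) -> forall f, P None f -> Q f.
Proof.
move=> QD Qh f; elim=> {f} [z a b c d _|f g pf qf pg qg]; last exact: QD.
by apply: (Qh (a + b + c + d)%N); apply: P_mon; exact: eqxx.
Qed.

Lemma box2_P e p : P (Some e.+2) p -> P (Some e) (box2 p).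
Proof. by move=> hp; apply: P_sub; apply: P_pdS; exact: P_pdS. Qed.

Lemma box2_P1 e p : P (Some e) p -> (e < 2)%N -> box2 p = fun=> 0.
Proof.
move=> hp e2; apply/funext => W; rewrite /box2.
case: e hp e2 => [|[|//]] hp _; first by rewrite !(P_pd0 _ _ hp) !pd_cst subrr.
by rewrite !(P_pd0 _ _ (P_pdS _ _ hp)) subrr.
Qed.

Lemma Lam_box2 f g : L None f -> L None g ->
  Lam r (fun W => box2 f W * g W) = Lam r (fun W => f W * box2 g W).
Proof.
move=> lf lg; have l2 a b (u : HC R -> R[i]) : L None u -> L None (pd a b u) by exact: L_pdN.
have e a b c d : Lam r (fun W => pd a b (pd c d f) W * g W) = Lam r (fun W => f W * pd a b (pd c d g) W).
  rewrite (Lam_ibp hr a b (l2 c d _ lf) lg) (Lam_ibp hr c d lf (l2 _ _ _ lg)) opprK.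
  by apply: (Lam_eqU hr) => W uW; rewrite (pd_comm c d a b lg uW).
have lfg a b c d : L None (fun W => pd a b (pd c d f) W * g W) by exact: L_mul (l2 _ _ _ (l2 _ _ _ lf)) lg.
have lfg' a b c d : L None (fun W => f W * pd a b (pd c d g) W) by exact: L_mul lf (l2 _ _ _ (l2 _ _ _ lg)).
transitivity (Lam r (fun W => pd 0 0 (pd 1 1 f) W * g W + -1 * (pd 0 1 (pd 1 0 f) W * g W))).
  by apply: (Lam_eqU hr) => W _; rewrite /box2; ring.
rewrite (LamD hr (lfg _ _ _ _) (L_scale _ (lfg _ _ _ _))) (LamZ hr _ (lfg _ _ _ _)) !e.
rewrite -(LamZ hr _ (lfg' _ _ _ _)) -(LamD hr (lfg' _ _ _ _) (L_scale _ (lfg' _ _ _ _))).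
by apply: (Lam_eqU hr) => W _; rewrite /box2; ring.
Qed.

(* If h is harmonic of degree n, then N^k h is a multiple of the Laplacian of
   N^(k+1) h; moving the Laplacian to p lowers the degree of p. *)
Lemma Lam_harmonic e p (k : int) n h : P (Some e) p -> L (Some n%:Z) h -> eqU (box2 h) (fun=> 0) ->
  0 < k + n%:Z + 2 -> Lam r (fun W => p W * (\det W ^ k * h W)) = 0.
Proof.
move=> hp lh bh; elim/ltn_ind: e p k hp => e ih p k hp kn.
have lk m : L (Some (m * 2 + n%:Z)) (fun W => \det W ^ m * h W).
  exact: L_mulS (L_detz _ _) lh _.
have [dg|dg] := eqVneq (e%:Z + (k * 2 + n%:Z)) (-4); last first.
  exact: (Lam_deg hr (L_mulS (P_L hp) (lk k) erefl)).
pose c : int := (k + 1) * (k + 2 + n%:Z).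
(* In total degree -4 one has 2 k = -4 - n - e, so k <= -2 and k + 1 is nonzero; the other factor is
   positive by hypothesis. *)
have c0 : c%:~R != 0 :> R[i] by rewrite intr_eq0 /c mulf_neq0//; lia.
have lN m := L_None (lk m); have lp := P_LN hp.
apply: (mulfI c0); rewrite mulr0 -(LamZ hr _ (L_mul lp (lN k))).
transitivity (Lam r (fun W => p W * box2 (fun V => \det V ^ (k + 1) * h V) W)).
  by apply: (Lam_eqU hr) => W uW; rewrite (box2_detz k lh bh uW) /c mulrCA.
rewrite -(Lam_box2 lp (lN (k + 1))).
have [e2|e2] := ltnP e 2.
  rewrite (box2_P1 hp e2) (Lam_eqU hr (g := fun=> 0 * 1)); last by move=> W _; rewrite !mul0r.
  by rewrite (LamZ hr 0 (L_None (L_cst 1))) mul0r.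
case: e hp {dg lp} e2 ih => [|[|e]] // hp _ ih.
by apply: (ih e) => //; [exact: box2_P|lia].
Qed.

(** On D_R^- both kernel expansions are polynomial in W, so entries of F that are orthogonal to all
    polynomials contribute nothing. On D_R^+ the notion is applied after inversion. *)
Definition negl f := L None f /\ forall p, P None p -> Lam r (fun W => p W * f W) = 0.

Lemma negl_harmonic k n h : L (Some n%:Z) h -> eqU (box2 h) (fun=> 0) ->
  0 < k + n%:Z + 2 -> negl (fun W => \det W ^ k * h W).
Proof.
move=> lh bh kn; have lk : L None (fun W => \det W ^ k * h W).
  by apply: L_mul; [exact: L_None (L_detz _ _)|exact: L_None lh].
split=> // p; apply: (P_homog_ind (Q := fun p => Lam r (fun W => p W * (\det W ^ k * h W)) = 0)).
  move=> f g pf pg qf qg.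
  rewrite (Lam_eqU hr (g := fun W => f W * (\det W ^ k * h W) + g W * (\det W ^ k * h W))); last first.
    by move=> W _; rewrite mulrDl.
  by rewrite (LamD hr (L_mul (P_LN pf) lk) (L_mul (P_LN pg) lk)) qf qg addr0.
by move=> m f pf; exact: (Lam_harmonic pf lh bh kn).
Qed.

Lemma Lam0 : Lam r (fun=> 0) = 0.
Proof.
rewrite (Lam_eqU hr (g := fun=> 0 * 1)); last by move=> W _; rewrite mul0r.
by rewrite (LamZ hr 0 (L_None (L_cst 1))) mul0r.
Qed.

Lemma negl_add f g : negl f -> negl g -> negl (fun W => f W + g W).
Proof.
move=> [lf hf] [lg hg]; split=> [|p hp]; first exact: L_add.
rewrite (Lam_eqU hr (g := fun W => p W * f W + p W * g W)); last by move=> W _; rewrite mulrDr.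
by rewrite (LamD hr (L_mul (P_LN hp) lf) (L_mul (P_LN hp) lg)) hf// hg// addr0.
Qed.

Lemma negl_mul f g : P None f -> negl g -> negl (fun W => f W * g W).
Proof.
move=> hf [lg hg]; split=> [|p hp]; first exact: L_mul (P_LN hf) lg.
rewrite -(hg _ (P_mul hp hf)); apply: (Lam_eqU hr) => W _; by rewrite mulrA.
Qed.

Lemma negl_eqU f g : negl f -> eqU f g -> negl g.
Proof.
move=> [lf hf] e; split=> [|p hp]; first exact: L_ext e.
by rewrite -(hf p hp); apply: (Lam_eqU hr) => W uW; rewrite e.
Qed.

End Orthogonality.

(** * Convergence of the kernel expansion *)

Section GeometricRecurrences.
Variables (K : numFieldType) (q rho s : K).
Hypotheses (q1 : q <= 1) (rho0 : 0 <= rho) (rho1 : rho <= 1) (s0 : 0 <= s)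
  (hs : s * (rho - q) = rho).

(** Here c is the convolution of b with the powers of l. The hypothesis on s encodes s = rho / (rho
    - q), the sum of the geometric series of ratio q / rho, without division. *)
Lemma rec1_bound (l M : K) (c b : nat -> K) : `|l| <= q -> 0 <= M ->
  c 0 = b 0 -> (forall a, c a.+1 = l * c a + b a.+1) ->
  (forall a, `|b a| <= M * rho ^+ a) -> 1 <= s -> forall a, `|c a| <= M * s * rho ^+ a.
Proof.
move=> lq M0 c0 cS hb s1; elim=> [|a ih].
  rewrite c0; apply: le_trans (hb 0) _; rewrite expr0 !mulr1.
  by rewrite -[leLHS]mulr1 ler_wpM2l.
rewrite cS; apply: le_trans (ler_normD _ _) _.
have -> : M * s * rho ^+ a.+1 = q * (M * s * rho ^+ a) + M * rho ^+ a.+1.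
  rewrite exprS; transitivity (q * (M * s * rho ^+ a) + M * (s * (rho - q)) * rho ^+ a); first by ring.
  by rewrite hs; ring.
apply: lerD (hb _); rewrite normrM; exact: ler_pM.
Qed.

(** As generating series, (1 - l1 t) (1 - l2 t) c (t) = b (t). *)
Definition rec2 (l1 l2 : K) (c b : nat -> K) := [/\ c 0 = b 0,
  c 1 = (l1 + l2) * c 0 + b 1 &
  forall a, c a.+2 = (l1 + l2) * c a.+1 - l1 * l2 * c a + b a.+2].

Lemma rec2_bound (l1 l2 M : K) (c b : nat -> K) : `|l1| <= q -> `|l2| <= q -> 0 <= M ->
  rec2 l1 l2 c b -> (forall a, `|b a| <= M * rho ^+ a) -> 1 <= s ->
  forall a, `|c a| <= M * s * s * rho ^+ a.
Proof.
move=> h1 h2 M0 [c0 c1 cS] hb s1.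
(* The coefficients of (1 - l1 t) c (t): the first-order bound applies twice, to v and then to c. *)
pose v a := if a is a'.+1 then c a - l1 * c a' else c 0.
have hv a : `|v a| <= M * s * rho ^+ a.
  apply: (rec1_bound h2 M0 _ _ hb s1) => // -[|b']; rewrite /v /= ?c1 ?cS; ring.
apply: (rec1_bound h1 (mulr_ge0 M0 s0) _ _ hv s1) => // a; rewrite /v /=; ring.
Qed.

(** The identity of generating series at t = 1, cut off after n + 2 terms; the last group is the
    truncation error. *)
Lemma rec2_sum (l1 l2 : K) (c b : nat -> K) n : rec2 l1 l2 c b ->
  (1 - l1) * (1 - l2) * \sum_(a < n.+2) c a =
  \sum_(a < n.+2) b a + (l1 * l2 * (c n.+1 + c n) - (l1 + l2) * c n.+1).
Proof.
move=> [c0 c1 cS]; elim: n => [|n ih].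
  rewrite !big_ord_recr !big_ord0 /= !add0r c1 c0; ring.
by rewrite big_ord_recr mulrDr ih [in RHS]big_ord_recr /= cS; ring.
Qed.

Lemma rec2_tail (l1 l2 M : K) (c : nat -> K) n : `|l1| <= q -> `|l2| <= q -> 0 <= M ->
  (forall a, `|c a| <= M * rho ^+ a) ->
  `|l1 * l2 * (c n.+1 + c n) - (l1 + l2) * c n.+1| <= 4 * M * rho ^+ n.
Proof.
move=> h1 h2 M0 hc; have e1 : `|c n.+1| <= M * rho ^+ n.
  apply: le_trans (hc _) _; rewrite ler_wpM2l// exprS -[leRHS]mul1r ler_wpM2r// exprn_ge0//.
have l11 : `|l1| <= 1 by apply: le_trans h1 q1.
have l21 : `|l2| <= 1 by apply: le_trans h2 q1.
have p1 (x y : K) m : `|x| <= 1 -> `|y| <= m -> `|x * y| <= m.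
  by move=> hx hy; rewrite normrM -[leRHS]mul1r; apply: ler_pM.
have -> : 4 * M * rho ^+ n = (M * rho ^+ n + M * rho ^+ n) + (M * rho ^+ n + M * rho ^+ n) by ring.
apply: le_trans (ler_normB _ _) _; apply: lerD.
  rewrite -mulrA; apply: (p1) => //; apply: (p1) => //.
  by apply: le_trans (ler_normD _ _) _; apply: lerD.
by rewrite mulrDl; apply: le_trans (ler_normD _ _) _; apply: lerD; exact: p1.
Qed.

End GeometricRecurrences.

Section TaylorConvergence.
Variables (R : realType) (q rho s B nu : R[i]).
Hypotheses (q1 : q < 1) (rho0 : 0 <= rho) (rho1 : rho <= 1) (s1 : 1 <= s)
  (hs : s * (rho - q) = rho) (B0 : 0 <= B) (nu0 : 0 < nu).
Implicit Types (X Y : HC R).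

(** The parameter nu bounds |N (Y)| from below, 1 - q does so for |1 - l1| and |1 - l2|, B bounds
    the entries, and the second and fourth powers of s come from two uses of [rec2_bound]. What
    matters is that neither X, Y nor n enters. *)
Definition Cst : R[i] := nu ^- 2 * ((1 - q) ^- 4 * (4 * (s * s) + 4 * (4 * (s * s * s * s))) * (B + B)
   + s * s * s * s * B).

Lemma Cst_ge0 : 0 <= Cst.
Proof.
have s0 : 0 <= s by apply: le_trans s1.
have q10 : 0 <= (1 - q) ^- 4 by rewrite invr_ge0 exprn_ge0// subr_ge0 ltW.
have n0 : 0 <= nu ^- 2 by rewrite invr_ge0 exprn_ge0// ltW.
by rewrite /Cst !(mulr_ge0, addr_ge0).
Qed.

(** The hypotheses say that N (Y - t X) = N (Y) (1 - t l1) (1 - t l2). Hence the Taylor coefficients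
    of N^-1 solve the recurrence driven by 1, those of N^-2 the one driven by the coefficients of
    N^-1, and K is N^-2 times a linear function. Sums have at least two terms because the recurrence
    has order two. *)
Lemma Taylor_K X Y (l1 l2 : R[i]) n i p : HCunits Y ->
  n1 X Y = - (\det Y * (l1 + l2)) -> \det X = \det Y * (l1 * l2) ->
  `|l1| <= q -> `|l2| <= q -> nu <= `|\det Y| ->
  (forall i j, `|X i j| <= B) -> (forall i j, `|Y i j| <= B) ->
  HCunits (Y - X) /\
  `|\sum_(a < n.+2) E a X (K i p) Y - K i p (Y - X)| <= Cst * rho ^+ n.
Proof.
move=> uY e1 e2 h1 h2 hn hX hY.
have s0 : 0 <= s by apply: le_trans s1.
have d0 : \det Y != 0 by [].
pose D := (1 - l1) * (1 - l2).
have dD : \det (Y - X) = \det Y * D.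
  transitivity (\det Y + n1 X Y + \det X).
    by rewrite !det2 /n1 !mxE; ring.
  by rewrite e1 e2 /D; ring.
have l1D (l : R[i]) : `|l| <= q -> 1 - q <= `|1 - l|.
  move=> hl; rewrite lerBlDr; apply: le_trans (_ : `|1 - l| + `|l| <= _); last by rewrite lerD2l.
  by rewrite -[X in X <= _](@normr1 R[i]) -{1}(subrK l 1) ler_normD.
have q10 : 0 < 1 - q by rewrite subr_gt0.
have nD : (1 - q) ^+ 2 <= `|D|.
  by rewrite /D normrM expr2; exact: ler_pM (ltW q10) (ltW q10) (l1D _ h1) (l1D _ h2).
have D0 : D != 0 by rewrite -normr_gt0; apply: lt_le_trans nD; rewrite exprn_gt0.
have uYX : HCunits (Y - X) by rewrite /HCunits /= dD mulf_neq0.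
split=> //.
have ld k : L None (fun W : HC R => \det W ^ k) by exact: L_None (L_detz _ _).
(* Normalized so that both sequences depend on l1 and l2 alone. *)
pose b a := \det Y * E a X (fun W => \det W ^ (-1)) Y.
pose g a := \det Y ^+ 2 * E a X (fun W => \det W ^ (-2)) Y.
pose dl a : R[i] := (a == 0%N)%:R.
have rb : rec2 l1 l2 b dl.
  have e : eqU (fun W : HC R => \det W * \det W ^ (-1)) (fun=> 1).
    by move=> W uW; rewrite exprN1 mulfV.
  split=> [||a].
  - by rewrite /b E0 exprN1 mulfV.
  - have := E_eqU 1 X e uY; rewrite E_cst (E_det1 X (ld _) uY) -[E 1 X _ Y in LHS]/(E 1 X _ Y) => e3.
    rewrite /b /dl /= E0 addr0; move: e3; rewrite e1 => /eqP; rewrite addr_eq0 => /eqP ->.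
    by ring.
  - have := E_eqU a.+2 X e uY; rewrite E_cst (E_detS a X (ld _) uY) e1 e2 => e3.
    rewrite /b /dl /= addr0; move: e3.
    set x := E a.+2 X _ Y; set y := E a.+1 X _ Y; set z := E a X _ Y => e3.
    transitivity (\det Y * x - (\det Y * x + - (\det Y * (l1 + l2)) * y + \det Y * (l1 * l2) * z)); last by ring.
    by rewrite e3 subr0.
have rg : rec2 l1 l2 g b.
  have e : eqU (fun W : HC R => \det W * \det W ^ (-2)) (fun W => \det W ^ (-1)).
    by move=> W uW; rewrite -[X in X * _]expr1z -expfzDr.
  split=> [||a].
  - by rewrite /g /b !E0 -(e _ uY) mulrA.
  - have := E_eqU 1 X e uY; rewrite (E_det1 X (ld _) uY) e1 /b => <-.
    by rewrite /g E0; ring.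
  - have := E_eqU a.+2 X e uY; rewrite (E_detS a X (ld _) uY) e1 e2 /b => <-.
    by rewrite /g; ring.
have hdl a : `|dl a| <= 1 * rho ^+ a.
  rewrite mul1r /dl; case: a => [|a] /=; first by rewrite normr1 expr0.
  by rewrite normr0 exprn_ge0.
have hb a : `|b a| <= s * s * rho ^+ a.
  by have := rec2_bound s0 hs h1 h2 ler01 rb hdl s1 a; rewrite !mul1r.
have hg a : `|g a| <= s * s * s * s * rho ^+ a.
  exact: (rec2_bound s0 hs h1 h2 (mulr_ge0 s0 s0) rg hb s1 a).
have s40 : 0 <= s * s * s * s by rewrite !mulr_ge0.
have tb := rec2_tail (ltW q1) rho0 rho1 n h1 h2 (mulr_ge0 s0 s0) hb.
have tg := rec2_tail (ltW q1) rho0 rho1 n h1 h2 s40 hg.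
have Sb := rec2_sum n rb; have Sg := rec2_sum n rg.
have sdl : \sum_(a < n.+2) dl a = 1.
  by rewrite big_ord_recl big1 ?addr0.
rewrite sdl -/D in Sb; rewrite -/D in Sg.
set G := \sum_(a < n.+2) g a in Sg.
set Sbn := \sum_(a < n.+2) b a in Sb Sg.
set tb' := _ - _ in tb Sb; set tg' := _ - _ in tg Sg.
(* G approximates D^-2; the truncation errors of the two recurrences make up the difference. *)
have D2 : D ^+ 2 * G - 1 = tb' + D * tg'.
  by rewrite expr2 -mulrA Sg mulrDr Sb; ring.
have ED' a : E a.+1 X (K i p) Y = E a.+1 X (fun W => \det W ^ (-2)) Y * mxplus Y i p
    - E a X (fun W => \det W ^ (-2)) Y * mxplus X i p.
  have lz : L None (fun W : HC R => \det W ^ (-2)) := ld _.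
  have st k l : eqU (fun W => \det W ^ (-2) * W k l) (fun W => W k l * \det W ^ (-2)) by move=> W _; rewrite mulrC.
  have sn k l : eqU (fun W : HC R => \det W ^ (-2) * - W k l) (fun W => -1 * (W k l * \det W ^ (-2))) by move=> W _; ring.
  have lw k l : L None (fun W : HC R => W k l * \det W ^ (-2)) by apply: L_mul => //; exact: L_coord.
  rewrite /K /mxplus; case: (ord2_cases i) => ->; case: (ord2_cases p) => ->; rewrite !mx2E.
  + rewrite (E_eqU (g := fun W => W 1 1 * \det W ^ (-2)) _ _ _ uY) ?(E_mulX _ _ _ _ lz uY); first by ring.
    by move=> W _; rewrite mx2E mulrC.
  + rewrite (E_eqU (g := fun W => -1 * (W 0 1 * \det W ^ (-2))) _ _ _ uY); last by move=> W _; rewrite mx2E; ring.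
    by rewrite (EZ _ _ _ (lw _ _) uY) (E_mulX _ _ _ _ lz uY); ring.
  + rewrite (E_eqU (g := fun W => -1 * (W 1 0 * \det W ^ (-2))) _ _ _ uY); last by move=> W _; rewrite mx2E; ring.
    by rewrite (EZ _ _ _ (lw _ _) uY) (E_mulX _ _ _ _ lz uY); ring.
  + rewrite (E_eqU (g := fun W => W 0 0 * \det W ^ (-2)) _ _ _ uY) ?(E_mulX _ _ _ _ lz uY); first by ring.
    by move=> W _; rewrite mx2E mulrC.
have d2 : \det Y ^ (-2) = \det Y ^- 2 by [].
have gE a : E a X (fun W => \det W ^ (-2)) Y = \det Y ^- 2 * g a.
  by rewrite /g mulKf// expf_neq0.
clearbody g b.
(* Summation by parts: each coefficient of K combines g (a + 1) Y^+ with g a X^+, so up to the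
   factor N (Y)^-2 the partial sum is G (Y - X)^+ plus a boundary term in g (n + 1). *)
have SE : \sum_(a < n.+2) E a X (K i p) Y = \det Y ^- 2 * (G * mxplus (Y - X) i p + g n.+1 * mxplus X i p).
  have mD : mxplus (Y - X) i p = mxplus Y i p - mxplus X i p.
    by rewrite /mxplus; case: (ord2_cases i) => ->; case: (ord2_cases p) => ->; rewrite !mx2E !mxE; ring.
  rewrite big_ord_recl /= E0 (eq_bigr (fun a : 'I_n.+1 => \det Y ^- 2 * g a.+1 * mxplus Y i p
     - \det Y ^- 2 * g a * mxplus X i p)); last by move=> a _; rewrite /bump /= add1n ED' !gE.
  rewrite big_split /= sumrN -!mulr_suml -!mulr_sumr {1}/K d2.
  have G1 : G = 1 + \sum_(a < n.+1) g a.+1.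
    by rewrite /G big_ord_recl; congr (_ + _); have [-> _ _] := rg; have [-> _ _] := rb.
  have G2 : G = \sum_(a < n.+1) g a + g n.+1 by rewrite /G big_ord_recr.
  have -> : \sum_(a < n.+1) g a = G - g n.+1 by rewrite G2 addrK.
  have -> : \sum_(i0 < n.+1) g i0.+1 = G - 1 by rewrite G1 addrC addKr.
  by rewrite mD; ring.
rewrite SE {1}/K dD.
have -> : (\det Y * D) ^ (-2) = \det Y ^- 2 * D ^- 2 by rewrite -[LHS]/((_ * _) ^- 2) exprMn invfM.
have -> : \det Y ^- 2 * (G * mxplus (Y - X) i p + g n.+1 * mxplus X i p) - \det Y ^- 2 * D ^- 2 * mxplus (Y - X) i p =
  \det Y ^- 2 * (D ^- 2 * (tb' + D * tg') * mxplus (Y - X) i p + g n.+1 * mxplus X i p).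
  rewrite -D2 mulrBr mulKf ?expf_neq0// mulr1; ring.
have hplus M (Z : HC R) : (forall i j, `|Z i j| <= M) -> `|mxplus Z i p| <= M.
  by move=> hZ; rewrite /mxplus; case: (ord2_cases i) => ->; case: (ord2_cases p) => ->;
    rewrite mx2E ?normrN; exact: hZ.
have hYX : `|mxplus (Y - X) i p| <= B + B.
  by apply: hplus => k l; rewrite !mxE; apply: le_trans (ler_normB _ _) _; exact: lerD.
have nDle : `|D| <= 4.
  have h (l : R[i]) : `|l| <= q -> `|1 - l| <= 2.
    move=> hl; apply: le_trans (ler_normB _ _) _; rewrite normr1.
    by rewrite (_ : 2 = 1 + 1)// lerD2l; apply: le_trans hl (ltW q1).
  by rewrite /D normrM (_ : 4 = 2 * 2); [apply: ler_pM => //; exact: h|rewrite -natrM].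
have rn0 : 0 <= rho ^+ n by rewrite exprn_ge0.
rewrite normrM /Cst -[leRHS]mulrA; apply: ler_pM => //.
  rewrite normfV normrX lef_pV2 ?posrE ?exprn_gt0// ?normr_gt0//.
  by rewrite lerXn2r// ?nnegrE ?normr_ge0// ltW.
rewrite [leRHS]mulrDl; apply: le_trans (ler_normD _ _) _; apply: lerD; last first.
  rewrite normrM [leRHS]mulrAC; apply: ler_pM => //; last exact: hplus.
  by apply: le_trans (hg _) _; rewrite ler_wpM2l// exprS -[leRHS]mul1r ler_wpM2r.
rewrite normrM [leRHS]mulrAC; apply: ler_pM => //.
rewrite normrM -[leRHS]mulrA; apply: ler_pM => //.
  rewrite normfV normrX lef_pV2 ?posrE ?exprn_gt0// ?normr_gt0//.
  rewrite (_ : 4 = 2 * 2)%N// exprM lerXn2r// ?nnegrE ?normr_ge0//.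
  by rewrite exprn_ge0// ltW.
rewrite [leRHS]mulrDl; apply: le_trans (ler_normD _ _) _; apply: lerD => //.
by rewrite normrM -[leRHS]mulrA; apply: ler_pM.
Qed.

End TaylorConvergence.

(** * Eigenvalue bounds on D_R^+ and D_R^- *)

Section Domains.
Local Open Scope sesquilinear_scope.
Variable R : realType.
Implicit Types (Z W X Y A : HC R) (v : 'rV[R[i]]_2) (l : R[i]).

Definition nn v : R[i] := (v *m v^t*) 0 0.

Lemma nnE v : nn v = `|v 0 0| ^+ 2 + `|v 0 1| ^+ 2.
Proof. by rewrite /nn mxE sum2 !mxE -!normCK. Qed.

Lemma nn_gt0 v : v != 0 -> 0 < nn v.
Proof.
move=> v0; rewrite nnE lt_neqAle addr_ge0 ?exprn_ge0// andbT.
apply: contra v0; rewrite eq_sym paddr_eq0 ?exprn_ge0// !expf_eq0 /= !normr_eq0.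
move=> /andP[/eqP h0 /eqP h1]; apply/eqP/rowP => j; rewrite mxE.
by case: (ord2_cases j) => ->.
Qed.

Definition qf A v : R[i] := (v *m A *m v^t*) 0 0.

Lemma qfE A v : qf A v = v 0 0 * A 0 0 * (Num.conj (v 0 0)) + v 0 1 * A 1 0 * (Num.conj (v 0 0))
   + v 0 0 * A 0 1 * (Num.conj (v 0 1)) + v 0 1 * A 1 1 * (Num.conj (v 0 1)).
Proof. by rewrite /qf mxE sum2 !mxE !sum2; ring. Qed.

Lemma posdef_qf A v : posdef A -> v != 0 -> 0 < qf A v.
Proof.
move=> pA v0; have := pA (v^t*); rewrite /qf.
have -> : v^t*^t* = v by apply/matrixP => i j; rewrite !mxE conjCK.
apply; apply: contra v0 => /eqP h; apply/eqP/matrixP => i j.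
have := congr1 (fun M : 'cV_2 => M j i) h; rewrite !mxE => /eqP.
by rewrite conjC_eq0 => /eqP.
Qed.

(** Compactness of the sphere is replaced by completing squares: a times the form and d times the
    form each dominate [Del] times the square of one coordinate, so e is the determinant over the
    trace. *)
Lemma posdef_lb A : posdef A -> A 1 0 = Num.conj (A 0 1) ->
  exists2 e : R, 0 < e & forall v, e%:C * nn v <= qf A v.
Proof.
move=> pA hA.
pose rv (x y : R[i]) : 'rV[R[i]]_2 := \row_j (if j == 0 then x else y).
have rv0 x y : rv x y 0 0 = x by rewrite mxE.
have rv1 x y : rv x y 0 1 = y by rewrite mxE.
have nz x y : (x != 0) || (y != 0) -> rv x y != 0.
  apply: contraL => /eqP h; have := congr1 (fun M : 'rV_2 => M 0 0) h.
  have := congr1 (fun M : 'rV_2 => M 0 1) h; rewrite rv0 rv1 !mxE => -> ->.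
  by rewrite eqxx.
have a0 : 0 < A 0 0.
  have := posdef_qf pA (nz 1 0 _); rewrite oner_neq0 => /(_ isT).
  by rewrite qfE !rv0 !rv1 conjC1 conjC0 !(mul0r, mulr0, mul1r, mulr1, addr0).
have d0 : 0 < A 1 1.
  have := posdef_qf pA (nz 0 1 _); rewrite oner_neq0 orbT => /(_ isT).
  by rewrite qfE !rv0 !rv1 conjC1 conjC0 !(mul0r, mulr0, mul1r, mulr1, addr0, add0r).
set a := A 0 0 in a0; set d := A 1 1 in d0; set b := A 0 1 in hA.
have aR : Num.conj a = a by apply: CrealP; exact: gtr0_real.
have dR : Num.conj d = d by apply: CrealP; exact: gtr0_real.
pose Del := a * d - b * Num.conj b.
have qa v : a * qf A v = `|a * v 0 0 + Num.conj b * v 0 1| ^+ 2 + Del * `|v 0 1| ^+ 2.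
  rewrite qfE !normCK rmorphD !rmorphM /= conjCK aR hA /Del -/a -/b -/d; ring.
have qd v : d * qf A v = `|d * v 0 1 + b * v 0 0| ^+ 2 + Del * `|v 0 0| ^+ 2.
  rewrite qfE !normCK rmorphD !rmorphM /= dR hA /Del -/a -/b -/d; ring.
(* The form is evaluated at a vector where the square in [qa] vanishes. *)
have D0 : 0 < Del.
  have h : rv (- Num.conj b) a != 0 by apply: nz; rewrite (gt_eqF a0) orbT.
  have := qa (rv (- Num.conj b) a); rewrite rv0 rv1.
  rewrite (_ : a * - Num.conj b + Num.conj b * a = 0) ?normr0 ?expr0n ?add0r => [e|]; last by ring.
  have := mulr_gt0 a0 (posdef_qf pA h); rewrite e pmulr_lgt0// exprn_gt0// normr_gt0.
  by rewrite gt_eqF.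
have ad0 : 0 < a + d by rewrite addr_gt0.
pose e := Del / (a + d).
have e0 : 0 < e by rewrite divr_gt0.
have eR : e = (complex.Re e)%:C by move: e0; clearbody e; case: e => x y; rewrite ltcE /= => /andP[/eqP -> _].
exists (complex.Re e) => [|v]; first by move: e0; rewrite {1}eR ltcR.
rewrite -eR /e mulrAC ler_pdivrMr// mulrDr [qf A v * a]mulrC [qf A v * d]mulrC qa qd nnE mulrDr.
rewrite addrC; apply: lerD; by rewrite lerDr exprn_ge0.
Qed.

(** The roots of N (X - l Y) in l, that is, the eigenvalues of X Y^-1. Left null vectors of X - l Y
    make them accessible to the Hermitian forms that define the domains. *)
Lemma roots_of X Y : HCunits Y -> exists l1 l2,
  [/\ n1 X Y = - (\det Y * (l1 + l2)), \det X = \det Y * (l1 * l2) &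
   forall l, l = l1 \/ l = l2 -> exists2 v : 'rV[R[i]]_2, v != 0 & v *m X = l *: (v *m Y)].
Proof.
move=> uY; have d0 : \det Y != 0 by [].
pose b := n1 X Y / \det Y; pose c := \det X / \det Y.
pose s := sqrtC (b ^+ 2 - 4 * c).
have s2 : s ^+ 2 = b ^+ 2 - 4 * c by rewrite sqrtCK.
pose l1 := (- b + s) / 2; pose l2 := (- b - s) / 2.
have hs : l1 + l2 = - b by rewrite /l1 /l2; field.
have hp : l1 * l2 = c.
  transitivity ((b ^+ 2 - s ^+ 2) / 4); first by rewrite /l1 /l2; field.
  by rewrite s2; field.
have e1 : n1 X Y = - (\det Y * (l1 + l2)) by rewrite hs /b mulrN opprK mulrCA mulfV// mulr1.
have e2 : \det X = \det Y * (l1 * l2) by rewrite hp /c mulrCA mulfV// mulr1.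
exists l1, l2; split=> // l hl.
have : \det (X - l *: Y) == 0.
  have -> : \det (X - l *: Y) = \det X + l * n1 X Y + l ^+ 2 * \det Y.
    by rewrite !det2 /n1 !mxE; ring.
  by rewrite e1 e2; case: hl => ->; apply/eqP; ring.
move/det0P => [v v0 /eqP]; rewrite mulmxBr subr_eq0 -scalemxAr => /eqP h.
by exists v.
Qed.

Lemma root_qf X Y l v : v *m X = l *: (v *m Y) ->
  qf (X *m X^t*) v = `|l| ^+ 2 * qf (Y *m Y^t*) v.
Proof.
have st (M : HC R) : qf (M *m M^t*) v = nn (v *m M).
  rewrite /qf /nn; congr (_ 0 0); rewrite !mulmxA -!mulmxA; congr (_ *m (_ *m _)).
  by rewrite trmx_mul map_mxM.
rewrite !st => ->; rewrite !nnE !mxE !normrM; ring.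
Qed.

Lemma norm_sqrt l (k : R) : `|l| ^+ 2 <= k%:C -> `|l| <= (Num.sqrt k)%:C.
Proof.
case: l => x y; rewrite normc_def -rmorphXn lecR /= => h; rewrite lecR.
have t0 : 0 <= x ^+ 2 + y ^+ 2 by rewrite addr_ge0 ?sqr_ge0.
by apply: ler_wsqrtr; rewrite -(sqr_sqrtr t0).
Qed.

Lemma qf_scalar (k : R[i]) v : qf (k%:M) v = k * nn v.
Proof. by rewrite /qf mul_mx_scalar -scalemxAl mxE. Qed.

Lemma qfB A1 A2 v : qf (A1 - A2) v = qf A1 v - qf A2 v.
Proof. by rewrite /qf mulmxBr mulmxBl !mxE. Qed.

Lemma herm_ZZ Z (k : R) : let A := Z *m Z^t* in
  (k%:C%:M - A) 1 0 = Num.conj ((k%:C%:M - A) 0 1) /\ (A - k%:C%:M) 1 0 = Num.conj ((A - k%:C%:M) 0 1).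
Proof.
rewrite /= !mxE !sum2 !mxE /= mulr0n !sub0r !subr0.
by rewrite rmorphN !rmorphD !rmorphM /= !conjCK; split; [congr (- _)|]; ring.
Qed.

(** At a left eigenvector v, the number |l|^2 r^2 |v|^2 is the value of the form of Z Z^* at v, at
    most (r^2 - e) |v|^2. Only e enters, so one bound serves all W in U(2)_r. *)
Lemma Dplus_roots (r : R) Z : 0 < r -> Dplus r Z -> exists2 q : R, 0 <= q < 1 &
  forall W l v, W *m W^t* = (r ^+ 2)%:C%:M -> v != 0 -> v *m Z = l *: (v *m W) -> `|l| <= q%:C.
Proof.
move=> r0 hZ; have [e e0 he] := posdef_lb hZ (herm_ZZ Z (r ^+ 2)).1.
have r2 : 0 < r ^+ 2 by rewrite exprn_gt0.
pose k := (r ^+ 2 - e) / r ^+ 2.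
have k1 : k < 1 by rewrite /k ltr_pdivrMr// mul1r ltrBlDr ltrDl.
exists (Num.sqrt k).
  rewrite sqrtr_ge0 /=; have [k0|k0] := leP k 0; first by rewrite ler0_sqrtr.
  by rewrite -(sqrtr1 R) ltr_sqrt.
move=> W l v hW v0 /root_qf; rewrite hW qf_scalar => h.
apply: norm_sqrt; have := he v; rewrite qfB qf_scalar h.
have n0 := nn_gt0 v0.
rewrite mulrA -mulrBl ler_pM2r// => h2.
rewrite /k rmorphM fmorphV ler_pdivlMr ?ltcR//.
by rewrite rmorphB lerBrDr addrC -lerBrDr.
Qed.

(** The roles of Z and W are exchanged; Z is invertible because a null vector would make the form of
    Z Z^* vanish, against its lower bound. *)
Lemma Dminus_roots (r : R) Z : 0 < r -> Dminus r Z -> HCunits Z /\ exists2 q : R, 0 <= q < 1 &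
  forall W l v, W *m W^t* = (r ^+ 2)%:C%:M -> v != 0 -> v *m W = l *: (v *m Z) -> `|l| <= q%:C.
Proof.
move=> r0 hZ; have [e e0 he] := posdef_lb hZ (herm_ZZ Z (r ^+ 2)).2.
have r2 : 0 < r ^+ 2 by rewrite exprn_gt0.
split.
  apply/negP => /det0P [v v0 h]; have := he v; rewrite qfB qf_scalar.
  have n0 := nn_gt0 v0.
  have -> : qf (Z *m Z^t*) v = 0 by rewrite /qf mulmxA h !mul0mx mxE.
  rewrite sub0r -mulNr ler_pM2r// -rmorphN lecR => h2.
  by move: e0; rewrite ltNge (le_trans h2)// oppr_le0 ltW.
pose k := r ^+ 2 / (r ^+ 2 + e).
have re : 0 < r ^+ 2 + e by rewrite addr_gt0.
have k1 : k < 1 by rewrite /k ltr_pdivrMr// mul1r ltrDl.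
exists (Num.sqrt k).
  rewrite sqrtr_ge0 /= -(sqrtr1 R) ltr_sqrt//.
move=> W l v hW v0 /root_qf; rewrite hW qf_scalar => h.
apply: norm_sqrt; have := he v; rewrite qfB qf_scalar.
have n0 := nn_gt0 v0.
rewrite lerBrDr -mulrDl => h2.
have := ler_wpM2l (exprn_ge0 2 (normr_ge0 l)) h2; rewrite -h mulrA ler_pM2r// => h3.
by rewrite /k rmorphM fmorphV ler_pdivlMr ?ltcR// addrC rmorphD.
Qed.

Lemma geometric_small (c rho e : R) : 0 <= rho -> rho < 1 -> 0 < e ->
  exists N, forall n, (N <= n)%N -> c * rho ^+ n <= e.
Proof.
move=> p0 p1 e0; have : geometric c rho @ \oo --> (0 : R).
  by apply: cvg_geometric; rewrite ger0_norm.
move/cvgrPdist_le => /(_ _ e0) [N _ hN]; exists N => n Nn.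
by have := hN n Nn; rewrite /= sub0r normrN; apply: le_trans; exact: ler_norm.
Qed.

End Domains.

(** * Uniform convergence of the expansions over U(2)_r *)

Section UniformConvergence.
Local Open Scope sesquilinear_scope.
Variables (R : realType) (r : R).
Hypothesis hr : 0 < r.
Implicit Types (f g : HC R -> R[i]) (S T : nat -> HC R -> R[i]) (W X Y Z : HC R) (x y u v e M : R).

Let U x y u v := U2param r (row4 x y u v).

Definition ucv f S := forall e, 0 < e -> exists N, forall n, (N <= n)%N -> Ucl r f (S n) e.
Definition ubd f := exists2 M, 0 <= M & forall x y u v, `|f (U x y u v)| <= M%:C.

Lemma norm_U2 x y u v i j : `|U x y u v i j| <= r%:C.
Proof.
have r0 : 0 <= r%:C :> R[i] by rewrite lecR ltW.
have h (c : R) (z : R[i]) : `|c| <= 1 -> `|z| = 1 -> `|r%:C * c%:C * z| <= r%:C.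
  move=> c1 z1; rewrite !normrM z1 mulr1 !norm_real (ger0_norm (ltW hr)).
  by rewrite -[leRHS]mulr1 ler_wpM2l// lecR.
have hm (a b : int) s t : `|em a s * em b t| = 1 :> R[i] by rewrite normrM !norm_em mulr1.
case: (ord2_cases i) => ->; case: (ord2_cases j) => ->; rewrite /U (U2E r x y u v) ?normrN;
  by apply: h; rewrite ?norm_em ?hm ?cos_max ?sin_max.
Qed.

Lemma norm_detU2 x y u v : `|\det (U x y u v)| = r%:C ^+ 2.
Proof. by rewrite /U det_U2 normrM norm_em mulr1 normrX norm_real (ger0_norm (ltW hr)). Qed.

Lemma conj_em m x : Num.conj (em m x) = em (- m) x :> R[i].
Proof. by rewrite /em /cis mulrNz mulNr cosN sinN. Qed.

Lemma conj_real x : Num.conj x%:C = x%:C :> R[i].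
Proof. by rewrite /Num.conj /= oppr0. Qed.

Lemma U2_unitary x y u v : let W := U x y u v in W *m W^t* = (r ^+ 2)%:C%:M.
Proof.
have E := U2E r x y u v; rewrite /= in E.
have cr z w : Num.conj (z * w) = Num.conj z * Num.conj w :> R[i] by rewrite rmorphM.
have cn z : Num.conj (- z) = - Num.conj z :> R[i] by rewrite rmorphN.
have c2 : (cos y)%:C ^+ 2 + (sin y)%:C ^+ 2 = 1 :> R[i].
  by rewrite -!rmorphXn -rmorphD cos2Dsin2.
have ex a : em 1 a * em (-1) a = 1 :> R[i] by rewrite emD em0.
move: E; rewrite /= -/(U x y u v) rmorphXn; move: (U x y u v) => W E.
apply/matrixP => i j; rewrite !mxE sum2 !mxE.
have ex2 a : em (-1) a * em 1 a = 1 :> R[i] by rewrite mulrC ex.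
have [kc ks] := (conj_real (cos y), conj_real (sin y)); have kr := conj_real r.
case: (ord2_cases i) => ->; case: (ord2_cases j) => ->; rewrite !E ?cn !cr !conj_em kc ks kr ?opprK /=;
  set c := (cos y)%:C in c2 *; set s := (sin y)%:C in c2 *.
- transitivity (r%:C ^+ 2 * (c ^+ 2 * (em 1 x * em (-1) x) + s ^+ 2 * (em 1 u * em (-1) u))); first by ring.
  by rewrite !ex !mulr1 c2 mulr1.
- transitivity (r%:C ^+ 2 * c * s * em (-1) v * (em 1 u * em 1 x - em 1 x * em 1 u)); first by ring.
  by rewrite mulrC; ring.
- transitivity (r%:C ^+ 2 * c * s * em 1 v * (em (-1) x * em (-1) u - em (-1) u * em (-1) x)); first by ring.
  by rewrite mulrC; ring.
- transitivity (r%:C ^+ 2 * (c ^+ 2 * (em 1 x * em (-1) x) + s ^+ 2 * (em 1 u * em (-1) u)) * (em 1 v * em (-1) v)); first by ring.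
  by rewrite !ex !mulr1 c2 mulr1.
Qed.

Lemma Lam_ext f g : (forall x y u v, f (U x y u v) = g (U x y u v)) -> Lam r f = Lam r g.
Proof.
move=> e; rewrite !LamU; congr Us; apply/funext => x; apply/funext => y.
by apply/funext => u; apply/funext => v; rewrite /pull -[U2param _ _]/(U x y u v) e.
Qed.

Lemma ubd_L f : L None f -> ubd f.
Proof.
elim=> {f} [z k a b c d _|f g _ [M M0 h1] _ [M' M0' h2]|f g _ [M M0 h] e].
- pose m : R[i] := `|z| * ((r%:C ^+ 2) ^ k * (r%:C ^+ a * r%:C ^+ b * r%:C ^+ c * r%:C ^+ d)).
  have r0 : 0 <= r%:C :> R[i] by rewrite lecR ltW.
  have m0 : 0 <= m by rewrite /m !mulr_ge0 ?exprn_ge0 ?exprz_ge0 ?exprn_ge0.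
  have mR : m = (complex.Re m)%:C by move: m0; clearbody m; case: m => s t; rewrite lecE /= => /andP[/eqP -> _].
  have nz (t : R[i]) (n : int) : `|exprz t n| = exprz `|t| n.
    case: n => l; first exact: normrX.
    by rewrite -[exprz t (Negz l)]/((t ^+ l.+1)^-1) normfV normrX.
  exists (complex.Re m) => [|x y u v]; first by move: m0; rewrite mR lecR.
  rewrite -mR /m /mon /pmon !normrM nz norm_detU2; apply: ler_wpM2l => //.
  apply: ler_wpM2l; first by rewrite exprz_ge0 ?exprn_ge0.
  rewrite !normrX; have h i j n : `|U x y u v i j| ^+ n <= r%:C ^+ n.
    by rewrite lerXn2r ?nnegrE//; exact: norm_U2.
  by do 3! (apply: ler_pM => //; rewrite ?mulr_ge0 ?exprn_ge0//).
- exists (M + M') => [|x y u v]; first exact: addr_ge0.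
  by rewrite rmorphD; apply: le_trans (ler_normD _ _) _; exact: lerD.
- by exists M => // x y u v; rewrite -e//; exact: U2_unit.
Qed.

Lemma ubd_ucv f S : ucv f S -> (forall n, L None (S n)) -> ubd f.
Proof.
move=> h lS; have [N hN] := h 1 ltr01; have [M M0 hM] := ubd_L (lS N).
exists (1 + M) => [|x y u v]; first exact: addr_ge0.
rewrite rmorphD -[f _](subrK (S N (U x y u v))).
by apply: le_trans (ler_normD _ _) _; apply: lerD => //; exact: hN.
Qed.

Lemma ubd_M f g : ubd f -> ubd g -> ubd (fun W => f W * g W).
Proof.
move=> [M M0 h] [M' M0' h']; exists (M * M') => [|x y u v]; first exact: mulr_ge0.
by rewrite normrM rmorphM; apply: ler_pM.
Qed.

Lemma ucv_refl f : ucv f (fun=> f).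
Proof. by move=> e e0; exists 0%N => n _ x y u v; rewrite subrr normr0 lecR ltW. Qed.

Lemma ucv_D f g S T : ucv f S -> ucv g T -> ucv (fun W => f W + g W) (fun n W => S n W + T n W).
Proof.
move=> h1 h2 e e0; have e2 : 0 < e / 2 by lra.
have [N hN] := h1 _ e2; have [N' hN'] := h2 _ e2.
exists (maxn N N') => n; rewrite geq_max => /andP[n1 n2] x y u v.
rewrite opprD addrACA (_ : e = e / 2 + e / 2) ?rmorphD; last by lra.
by apply: le_trans (ler_normD _ _) _; apply: lerD; [exact: hN|exact: hN'].
Qed.

Lemma ucv_M f g S T : ubd f -> ubd g -> ucv f S -> ucv g T ->
  ucv (fun W => f W * g W) (fun n W => S n W * T n W).
Proof.
move=> [M M0 h] [M' M0' h'] h1 h2 e e0.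
(* As d <= 1, the values of [S n] stay below M + 1, so m bounds every factor that occurs. *)
pose m := M + M' + 1; have m0 : 0 < m by rewrite /m; lra.
pose d := Num.min 1 (e / (2 * m)).
have d0 : 0 < d by rewrite lt_min ltr01 divr_gt0// mulr_gt0.
have d1 : d <= 1 by rewrite ge_min lexx.
have dm : d * m + d * m <= e.
  have : d <= e / (2 * m) by rewrite ge_min lexx orbT.
  rewrite ler_pdivlMr ?mulr_gt0//; lra.
have [N hN] := h1 _ d0; have [N' hN'] := h2 _ d0.
exists (maxn N N') => n; rewrite geq_max => /andP[n1 n2] x y u v.
set W := U2param _ _.
have -> : f W * g W - S n W * T n W = (f W - S n W) * g W + S n W * (g W - T n W) by ring.
apply: le_trans (_ : (d * m + d * m)%:C <= _); last by rewrite lecR.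
rewrite rmorphD; apply: le_trans (ler_normD _ _) _; apply: lerD.
  rewrite normrM rmorphM; apply: ler_pM => //; first exact: hN.
  by apply: le_trans (h' _ _ _ _) _; rewrite lecR /m; lra.
rewrite normrM mulrC rmorphM; apply: ler_pM => //; first exact: hN'.
rewrite -[S n W](subKr (f W)); apply: le_trans (ler_normB _ _) _.
apply: le_trans (lerD (h _ _ _ _) (hN _ n1 _ _ _ _)) _.
by rewrite -rmorphD lecR /m; lra.
Qed.

Lemma Taylor_unif (q : R) (B nu : R[i]) : 0 <= q < 1 -> 0 <= B -> 0 < nu ->
  forall e, 0 < e -> exists N, forall n, (N <= n)%N -> forall X Y (l1 l2 : R[i]) i p,
  HCunits Y -> n1 X Y = - (\det Y * (l1 + l2)) -> \det X = \det Y * (l1 * l2) ->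
  `|l1| <= q%:C -> `|l2| <= q%:C -> nu <= `|\det Y| ->
  (forall i j, `|X i j| <= B) -> (forall i j, `|Y i j| <= B) ->
  HCunits (Y - X) /\ `|K i p (Y - X) - \sum_(a < n.+2) E a X (K i p) Y| <= e%:C.
Proof.
move=> /andP[q0 q1] B0 nu0 e e0.
(* A rate strictly between q and 1, here the midpoint; s solves s (rho - q) = rho. *)
pose rho : R := (1 + q) / 2; pose s : R := rho / (rho - q).
have p0 : 0 <= rho by rewrite /rho; lra.
have p1 : rho < 1 by rewrite /rho; lra.
have pq : 0 < rho - q by rewrite /rho; lra.
have s1 : 1 <= s by rewrite /s ler_pdivlMr//; lra.
have hs : s * (rho - q) = rho by rewrite divfK ?gt_eqF.
have cq1 : q%:C < 1 by rewrite ltcR.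
have cp0 : 0 <= rho%:C :> R[i] by rewrite lecR.
have cp1 : rho%:C <= 1 by rewrite lecR ltW.
have cs1 : 1 <= s%:C by rewrite lecR.
have chs : s%:C * (rho%:C - q%:C) = rho%:C by rewrite -rmorphB -rmorphM hs.
have C0 := Cst_ge0 cq1 cs1 B0 nu0.
have CR : Cst q%:C s%:C B nu = (complex.Re (Cst q%:C s%:C B nu))%:C.
  by move: C0; move: (Cst _ _ _ _) => [a b]; rewrite lecE /= => /andP[/eqP -> _].
have [N hN] := geometric_small (complex.Re (Cst q%:C s%:C B nu)) p0 p1 e0.
exists N => n Nn X Y l1 l2 i p uY e1 e2 h1 h2 h3 hX hY.
have [uYX h] := Taylor_K cq1 cp0 cp1 cs1 chs nu0 n i p uY e1 e2 h1 h2 h3 hX hY.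
split=> //; rewrite distrC; apply: le_trans h _.
by rewrite CR -rmorphXn -rmorphM lecR; exact: hN.
Qed.

Lemma K_odd i p Y : K i p (- Y) = - K i p Y.
Proof.
have e : mxplus (- Y) i p = - mxplus Y i p.
  by rewrite /mxplus; case: (ord2_cases i) => ->; case: (ord2_cases p) => ->; rewrite !mx2E !mxE.
by rewrite /K e mulrN; congr (- (_ ^ _ * _)); rewrite !det2 !mxE; ring.
Qed.

Lemma conv_plus Z : Dplus r Z -> (forall x y u v, HCunits (U x y u v - Z)) /\
  forall i p, ucv (fun W => K i p (W - Z)) (fun n W => \sum_(a < n.+2) E a Z (K i p) W).
Proof.
move=> hZ; have [q q01 hq] := Dplus_roots hr hZ.
pose B : R[i] := \sum_i \sum_j `|Z i j| + r%:C.
have r0 : 0 <= r%:C :> R[i] by rewrite lecR ltW.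
have s0 : 0 <= \sum_i \sum_j `|Z i j| by apply: sumr_ge0 => i _; exact: sumr_ge0.
have B0 : 0 <= B by rewrite addr_ge0.
have hZB i j : `|Z i j| <= B.
  rewrite /B (bigD1 i) //= (bigD1 j) //= -!addrA lerDl !addr_ge0 ?sumr_ge0// => k _.
  exact: sumr_ge0.
have hWB x y u v i j : `|U x y u v i j| <= B.
  by apply: le_trans (norm_U2 _ _ _ _ _ _) _; rewrite lerDr.
have nu0 : 0 < r%:C ^+ 2 :> R[i] by rewrite exprn_gt0// ltcR.
have key e : 0 < e -> exists N, forall n, (N <= n)%N -> forall x y u v i p,
    HCunits (U x y u v - Z) /\ `|K i p (U x y u v - Z) - \sum_(a < n.+2) E a Z (K i p) (U x y u v)| <= e%:C.
  move=> e0; have [N hN] := Taylor_unif q01 B0 nu0 e0; exists N => n Nn x y u v i p.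
  have uW := U2_unit hr x y u v; have [l1 [l2 [e1 e2 hl]]] := roots_of Z uW.
  have bl l : l = l1 \/ l = l2 -> `|l| <= q%:C.
    by move=> /hl [w w0 hw]; exact: hq (U2_unitary x y u v) w0 hw.
  apply: (hN n Nn Z (U x y u v) l1 l2 i p uW e1 e2) => //; [exact: bl (or_introl erefl)|exact: bl (or_intror erefl)|].
  by rewrite norm_detU2.
split=> [x y u v|i p e e0].
  by have [N hN] := key 1 ltr01; case: (hN N (leqnn _) x y u v 0 0).
by have [N hN] := key e e0; exists N => n Nn x y u v; case: (hN n Nn x y u v i p).
Qed.

(** K is odd, so K (W - Z) = - K (Z - W), which is expanded at Z in powers of W; this is the sign in
    [Aminus]. *)
Lemma conv_minus Z : Dminus r Z -> HCunits Z /\ (forall x y u v, HCunits (U x y u v - Z)) /\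
  forall i p, ucv (fun W => K i p (W - Z)) (fun n W => - \sum_(a < n.+2) E a W (K i p) Z).
Proof.
move=> hZ; have [uZ [q q01 hq]] := Dminus_roots hr hZ; split=> //.
pose B : R[i] := \sum_i \sum_j `|Z i j| + r%:C.
have r0 : 0 <= r%:C :> R[i] by rewrite lecR ltW.
have s0 : 0 <= \sum_i \sum_j `|Z i j| by apply: sumr_ge0 => i _; exact: sumr_ge0.
have B0 : 0 <= B by rewrite addr_ge0.
have hZB i j : `|Z i j| <= B.
  rewrite /B (bigD1 i) //= (bigD1 j) //= -!addrA lerDl !addr_ge0 ?sumr_ge0// => k _.
  exact: sumr_ge0.
have hWB x y u v i j : `|U x y u v i j| <= B.
  by apply: le_trans (norm_U2 _ _ _ _ _ _) _; rewrite lerDr.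
have nu0 : 0 < `|\det Z| by rewrite normr_gt0.
have key e : 0 < e -> exists N, forall n, (N <= n)%N -> forall x y u v i p,
    HCunits (Z - U x y u v) /\ `|K i p (Z - U x y u v) - \sum_(a < n.+2) E a (U x y u v) (K i p) Z| <= e%:C.
  move=> e0; have [N hN] := Taylor_unif q01 B0 nu0 e0; exists N => n Nn x y u v i p.
  have [l1 [l2 [e1 e2 hl]]] := roots_of (U x y u v) uZ.
  have bl l : l = l1 \/ l = l2 -> `|l| <= q%:C.
    by move=> /hl [w w0 hw]; exact: hq (U2_unitary x y u v) w0 hw.
  apply: (hN n Nn (U x y u v) Z l1 l2 i p uZ e1 e2) => //; [exact: bl (or_introl erefl)|exact: bl (or_intror erefl)].
have opp W : W - Z = - (Z - W) by rewrite opprB.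
split=> [x y u v|i p e e0].
  have [N hN] := key 1 ltr01; case: (hN N (leqnn _) x y u v 0 0) => h _.
  by move: h; rewrite /HCunits /= !det2 !mxE; congr (_ != 0); ring.
have [N hN] := key e e0; exists N => n Nn x y u v; case: (hN n Nn x y u v i p) => _.
by rewrite opp K_odd -opprB normrN opprK addrC.
Qed.

Lemma ucv_sum (I : finType) (f : I -> HC R -> R[i]) (S : I -> nat -> HC R -> R[i]) :
  (forall i, ucv (f i) (S i)) -> ucv (fun W => \sum_i f i W) (fun n W => \sum_i S i n W).
Proof.
move=> h; elim: (index_enum I) => [|i s ih].
  move=> e e0; exists 0%N => n _ x y u v; rewrite !big_nil subrr normr0 lecR; exact: ltW.
move=> e e0; have [N hN] := ucv_D (h i) ih e0; exists N => n Nn x y u v.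
by rewrite !big_cons; exact: hN.
Qed.

End UniformConvergence.

(** * The series for J *)

Lemma bound_all (Q : nat -> 'I_2 -> 'I_2 -> Prop) :
  (forall D D' p q, (D <= D')%N -> Q D p q -> Q D' p q) ->
  (forall p q, exists D, Q D p q) -> exists D, forall p q, Q D p q.
Proof.
move=> mono h; have [D00 h00] := h 0 0; have [D01 h01] := h 0 1.
have [D10 h10] := h 1 0; have [D11 h11] := h 1 1.
exists (maxn (maxn D00 D01) (maxn D10 D11)) => p q.
case: (ord2_cases p) => ->; case: (ord2_cases q) => ->.
- by apply: mono h00; lia.
- by apply: mono h01; lia.
- by apply: mono h10; lia.
- by apply: mono h11; lia.
Qed.

Section Series.
Variables (R : realType) (r : R).
Hypothesis hr : 0 < r.
Implicit Types (f g : HC R -> R[i]) (W X Y Z : HC R) (i j p q : 'I_2).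

Lemma sum_ord_trunc (V : nmodType) (g : nat -> V) D m : (D <= m)%N ->
  (forall a, (D <= a)%N -> g a = 0) -> \sum_(a < m) g a = \sum_(a < D) g a.
Proof.
move=> Dm h; rewrite (big_ord_widen m g Dm) [RHS]big_mkcond; apply: eq_bigr => a _.
by case: ltnP => // Da; rewrite h.
Qed.

(** A Laurent function has finitely many degrees, and only total degree -4 survives integration. *)
Lemma Lam_far f : L None f -> exists M : nat, forall d u, L (Some d) u -> (M < `|d|)%N ->
  Lam r (fun W => u W * f W) = 0.
Proof.
elim=> {f} [z k a b c d _|f g lf [M h] lg [M' h']|f g _ [M h] e].
- exists (`|(k * 2 + (a + b + c + d)%:Z)%R| + 4)%N => n u lu hn.
  apply: (Lam_deg hr (n := n + (k * 2 + (a + b + c + d)%:Z))); last by lia.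
  apply: L_mulS lu _ erefl; apply: L_mon; exact: eqxx.
- exists (maxn M M') => d u lu; rewrite gtn_max => /andP[h1 h2].
  rewrite (Lam_eqU hr (g := fun W => u W * f W + u W * g W)); last by move=> W _; rewrite mulrDr.
  by rewrite (LamD hr (L_mul (L_None lu) lf) (L_mul (L_None lu) lg)) (h _ _ lu h1) (h' _ _ lu h2) addr0.
- exists M => d u lu hd; rewrite -(h d u lu hd); apply: (Lam_eqU hr) => W uW.
  by rewrite e.
Qed.

Definition term (A B : 'I_2 -> 'I_2 -> HC R -> R[i]) f i p q j : R[i] :=
  Lam r (fun W => A i p W * f W * B q j W).

Section Expansion.
Variables (kA kB : 'I_2 -> 'I_2 -> HC R -> R[i]) (A B : nat -> 'I_2 -> 'I_2 -> HC R -> R[i]).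
Hypotheses (lA : forall a i p, L None (A a i p)) (lB : forall a i p, L None (B a i p)).
Hypothesis cA : forall i p, ucv r (kA i p) (fun n W => \sum_(a < n.+2) A a i p W).
Hypothesis cB : forall i p, ucv r (kB i p) (fun n W => \sum_(a < n.+2) B a i p W).
Variable F : 'I_2 -> 'I_2 -> HC R -> R[i].
Hypothesis lF : forall p q, L None (F p q).

(** Both kernels are cut at the same n. By the vanishing hypothesis the integral of the truncated
    product is the same for all n >= D, so [Lam_limit] applies. *)
Lemma Lam_series D i j :
  (forall a b, (D <= a)%N || (D <= b)%N -> forall p q, term (A a) (B b) (F p q) i p q j = 0) ->
  Lam r (fun W => \sum_p \sum_q kA i p W * F p q W * kB q j W) =
  \sum_(a < D) \sum_(b < D) \sum_p \sum_q term (A a) (B b) (F p q) i p q j.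
Proof.
move=> hD.
have lSA n p : L None (fun W => \sum_(a < n) A a i p W) by exact: L_sum.
have lSB n q : L None (fun W => \sum_(b < n) B b q j W) by exact: L_sum.
have lS n p q : L None (fun W => (\sum_(a < n) A a i p W) * F p q W * (\sum_(b < n) B b q j W)).
  by apply: L_mul => //; exact: L_mul.
have bA p : ubd r (kA i p) by apply: (ubd_ucv hr (cA i p)).
have bB q : ubd r (kB q j) by apply: (ubd_ucv hr (cB q j)).
apply: (Lam_limit hr (S := fun n W => \sum_p \sum_q (\sum_(a < n.+2) A a i p W) * F p q W * (\sum_(b < n.+2) B b q j W))).
- by move=> n; apply: L_sum => p _; exact: L_sum.
- apply: (ucv_sum (f := fun p W => \sum_q kA i p W * F p q W * kB q j W)) => p.
  apply: (ucv_sum (f := fun q W => kA i p W * F p q W * kB q j W)) => q.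
  apply: ucv_M => //; first by apply: ubd_M => //; exact: ubd_L.
  by apply: ucv_M => //; [exact: ubd_L|exact: ucv_refl].
exists D => n Dn.
rewrite (@linear_on_L_sum R _ _ _ _ (fun p W => \sum_q _) (Lam_linear hr)); last by move=> p _; exact: L_sum.
under eq_bigr => p _ do rewrite (@linear_on_L_sum R _ _ _ _ (fun q W => _) (Lam_linear hr)) //.
have ex p q : Lam r (fun W => (\sum_(a < n.+2) A a i p W) * F p q W * (\sum_(b < n.+2) B b q j W)) =
  \sum_(a < D) \sum_(b < D) term (A a) (B b) (F p q) i p q j.
  have lt a b : L None (fun W => A a i p W * F p q W * B b q j W).
    by apply: L_mul => //; exact: L_mul.
  transitivity (Lam r (fun W => \sum_(a < n.+2) \sum_(b < n.+2) A a i p W * F p q W * B b q j W)).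
    apply: (Lam_eqU hr) => W _; rewrite !mulr_suml; apply: eq_bigr => a _.
    by rewrite mulr_sumr.
  rewrite (@linear_on_L_sum R _ _ _ _ (fun (a : 'I_n.+2) W => \sum_(b < n.+2) A a i p W * F p q W * B b q j W) (Lam_linear hr)); last by move=> a _; exact: L_sum.
  have Dn2 : (D <= n.+2)%N by lia.
  have e a : Lam r (fun W => \sum_(b < n.+2) A a i p W * F p q W * B b q j W) =
     \sum_(b < D) term (A a) (B b) (F p q) i p q j.
    rewrite (@linear_on_L_sum R _ _ _ _ (fun (b : 'I_n.+2) W => A a i p W * F p q W * B b q j W) (Lam_linear hr))//.
    by apply: (@sum_ord_trunc _ (fun b => term (A a) (B b) (F p q) i p q j)) => // b Db; rewrite hD ?Db ?orbT.
  rewrite -(sum_ord_trunc (g := fun a => \sum_(b < D) term (A a) (B b) (F p q) i p q j) Dn2).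
    by apply: eq_bigr => a _; exact: e.
  by move=> a Da; rewrite big1// => b _; rewrite hD ?Da.
under eq_bigr => p _ do under eq_bigr => q _ do rewrite ex.
rewrite exchange_big /=.
under [RHS]eq_bigr => a _ do rewrite exchange_big /=.
rewrite [RHS]exchange_big /= [LHS]exchange_big /=; apply: eq_bigr => p _.
under [RHS]eq_bigr => a _ do rewrite exchange_big /=.
by rewrite [RHS]exchange_big.
Qed.

End Expansion.

Definition cJ : R[i] := 12 * 'i / (pi ^+ 3)%:C.

(** The value matches the constant in [Lop_detN2], so no factor is left over on the diagonal. *)
Lemma cJ_lam0 : cJ * lam0 R = 24.
Proof.
have p0 : (pi%:C : R[i]) != 0 by rewrite fmorph_eq0 gt_eqF// pi_gt0.
have e (x y : R[i]) : x != 0 -> 12 * y / x ^+ 3 * (- 2 * x ^+ 3 * y) = - 24 * y ^+ 2 by move=> *; field.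
by rewrite /cJ /lam0 rmorphXn /= e// sqr_i; ring.
Qed.

Lemma J_Lam (F : HC R -> HC R) Z1 Z2 i j :
  (forall x y u v, HCunits (U2param r (row4 x y u v) - Z1)) ->
  (forall x y u v, HCunits (U2param r (row4 x y u v) - Z2)) ->
  J r F Z1 Z2 i j = cJ * Lam r (fun W => \sum_p \sum_q K i p (W - Z1) * F W p q * K q j (W - Z2)).
Proof.
move=> u1 u2; rewrite /J !mxE LamE; congr (_ * _); apply: Lam_ext => x y u v.
rewrite !mxE; under eq_bigr => q _ do rewrite mxE mulr_suml.
rewrite exchange_big; apply: eq_bigr => p _; apply: eq_bigr => q _.
by rewrite !kernE.
Qed.

(** Terms of the kernel expansion as functions of W: homogeneous of degree -3 - a here, polynomial
    of degree a for [Aminus], where W is the translation parameter and the derivatives of K are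
    taken at Z. *)
Definition Aplus Z a i p : HC R -> R[i] := E a Z (K i p).
Definition Aminus Z a i p : HC R -> R[i] := fun W => - E a W (K i p) Z.

Lemma Aplus_L Z a i p : L (Some (- 3 - a%:Z)) (Aplus Z a i p).
Proof. exact: E_L (K_L _ _ _). Qed.

Lemma Aminus_P Z a i p : HCunits Z -> P (Some a) (Aminus Z a i p).
Proof. by move=> uZ; apply: P_opp; exact: linear_E_P (linear_eval uZ) (K_LN _ _ _). Qed.

Definition far (F : HC R -> HC R) (D : nat) := forall p q d u, L (Some d) u -> (D <= `|d|)%N ->
  Lam r (fun W => u W * F W p q) = 0.

Lemma exists_far (F : HC R -> HC R) : (forall p q, L None (fun W => F W p q)) -> exists D, far F D.
Proof.
move=> lF; have [D hD] : exists D, forall p q d u, L (Some d) u -> (D <= `|d|)%N ->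
    Lam r (fun W => u W * F W p q) = 0.
  apply: bound_all => [D D' p q DD h d u lu hd|p q]; first by apply: h lu _; exact: leq_trans DD hd.
  by have [M hM] := Lam_far (lF p q); exists M.+1.
by exists D.
Qed.

(** Products of two terms have degree -6 - a - b or a + b. In both cases the absolute value is at
    least a + b, so [far] cuts the double series down to a square. *)
Lemma J_series_gen (A B : nat -> 'I_2 -> 'I_2 -> HC R -> R[i]) (dA dB : nat -> int)
    (F : HC R -> HC R) Z1 Z2 D :
  (forall a i p, L (Some (dA a)) (A a i p)) -> (forall a i p, L (Some (dB a)) (B a i p)) ->
  (forall a b, (a + b <= `|(dA a + dB b)%R|)%N) ->
  (forall i p, ucv r (fun W => K i p (W - Z1)) (fun n W => \sum_(a < n.+2) A a i p W)) ->
  (forall i p, ucv r (fun W => K i p (W - Z2)) (fun n W => \sum_(a < n.+2) B a i p W)) ->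
  (forall x y u v, HCunits (U2param r (row4 x y u v) - Z1)) ->
  (forall x y u v, HCunits (U2param r (row4 x y u v) - Z2)) ->
  (forall p q, L None (fun W => F W p q)) -> far F D ->
  forall i j, J r F Z1 Z2 i j =
    cJ * \sum_(a < D) \sum_(b < D) \sum_p \sum_q term (A a) (B b) (fun W => F W p q) i p q j.
Proof.
move=> lA lB dAB cA cB u1 u2 lF hD0 i j; rewrite (J_Lam _ _ _ u1 u2); congr (_ * _).
apply: (@Lam_series (fun i p W => K i p (W - Z1)) (fun i p W => K i p (W - Z2)) A B _ _ _ _
   (fun p q W => F W p q)) => //.
- by move=> a i' p; exact: L_None (lA _ _ _).
- by move=> a i' p; exact: L_None (lB _ _ _).
move=> a b hab p q; rewrite /term.
transitivity (Lam r (fun W => (A a i p W * B b q j W) * F W p q)).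
  by apply: (Lam_eqU hr) => W _; rewrite mulrAC.
apply: (hD0 _ _ _ _ (L_mulS (lA a i p) (lB b q j) erefl)).
by apply: leq_trans (dAB a b); case/orP: hab => h; apply: leq_trans h _; rewrite ?leq_addr ?leq_addl.
Qed.

Lemma J_series_plus (F : HC R -> HC R) D Z1 Z2 :
  (forall p q, L None (fun W => F W p q)) -> far F D -> Dplus r Z1 -> Dplus r Z2 ->
  forall i j, J r F Z1 Z2 i j =
    cJ * \sum_(a < D) \sum_(b < D) \sum_p \sum_q
      term (Aplus Z1 a) (Aplus Z2 b) (fun W => F W p q) i p q j.
Proof.
move=> lF hD h1 h2; have [u1 c1] := conv_plus hr h1; have [u2 c2] := conv_plus hr h2.
apply: (J_series_gen (dA := fun a => - 3 - a%:Z) (dB := fun a => - 3 - a%:Z)) => //.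
- exact: Aplus_L.
- exact: Aplus_L.
- by move=> a b; lia.
Qed.

Lemma J_series_minus (F : HC R -> HC R) D Z1 Z2 :
  (forall p q, L None (fun W => F W p q)) -> far F D -> Dminus r Z1 -> Dminus r Z2 ->
  forall i j, J r F Z1 Z2 i j =
    cJ * \sum_(a < D) \sum_(b < D) \sum_p \sum_q
      term (Aminus Z1 a) (Aminus Z2 b) (fun W => F W p q) i p q j.
Proof.
move=> lF hD h1 h2.
have [v1 [u1 c1]] := conv_minus hr h1; have [v2 [u2 c2]] := conv_minus hr h2.
have lA Z : HCunits Z -> forall a i p, L (Some a%:Z) (Aminus Z a i p).
  by move=> uZ a i p; exact: P_L (Aminus_P _ _ _ uZ).
have cm Z : (forall i p, ucv r (fun W => K i p (W - Z)) (fun n W => - \sum_(a < n.+2) E a W (K i p) Z)) ->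
    forall i p, ucv r (fun W => K i p (W - Z)) (fun n W => \sum_(a < n.+2) Aminus Z a i p W).
  move=> h i p e e0; have [N hN] := h i p e e0; exists N => n Nn x y u v.
  by rewrite /Aminus sumrN; exact: hN.
apply: (J_series_gen (dA := Posz) (dB := Posz)) => //; [exact: lA|exact: lA|exact: cm|exact: cm].
Qed.

Lemma laurentfun_L f : laurentfun f -> L None f.
Proof.
move=> [n [c [g [hg e]]]].
apply: L_ext (_ : L None (fun Z => \sum_(i < n) c i * g i Z)) _; last by move=> Z uZ; rewrite e.
apply: L_sum => i _; apply: L_scale; have [d [k ->]] := hg i.
apply: L_ext (L_mon (o := None) 1 (k := k) (a := d 0 0) (b := d 0 1) (c := d 1 0) (d := d 1 1) isT) _.
move=> W _; rewrite mul1r /mon /pmon /monomial; congr (_ * _).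
rewrite !big_ord_recl !big_ord0 /= !mulr1 !mulrA.
by rewrite (_ : lift ord0 ord0 = 1 :> 'I_2) //; exact/val_inj.
Qed.

Lemma Wprime_L (F : HC R -> HC R) : Wprime F -> forall p q, L None (fun W => F W p q).
Proof. by move=> h p q; apply: laurentfun_L. Qed.

End Series.

(** * Annihilation *)

Section Divergence.
Variable R : realType.
Implicit Types (f g : HC R -> R[i]) (W X Y Z : HC R).
Variables (I : finType) (c : I -> R[i]) (x y : I -> 'I_2) (u : I -> HC R -> R[i]).
Hypothesis lu : forall k, L None (u k).
Hypothesis div0 : eqU (fun W => \sum_k c k * pd (x k) (y k) (u k) W) (fun=> 0).

Lemma linear_E_div0 l a X : linear_on_L l ->
  \sum_k c k * l (E a X (pd (x k) (y k) (u k))) = 0.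
Proof.
move=> hl; have [lD lZ le] := hl.
transitivity (l (E a X (fun W => \sum_k c k * pd (x k) (y k) (u k) W))).
  transitivity (l (fun W => \sum_k c k * E a X (pd (x k) (y k) (u k)) W)).
    rewrite linear_on_L_sum// => [|k _]; last by apply: L_scale; apply: E_LN; exact: L_pdN.
    by apply: eq_bigr => k _; rewrite lZ//; apply: E_LN; exact: L_pdN.
  apply: le; first by apply: L_sum => k _; apply: L_scale; apply: E_LN; exact: L_pdN.
  move=> W uW; rewrite [RHS](E_sum _ _ _ _ uW); last by move=> k _; apply: L_scale; exact: L_pdN.
  by apply: eq_bigr => k _; rewrite (EZ _ _ _ _ uW)//; exact: L_pdN.
have l0 : L None (fun=> 0 : R[i]) by exact: L_0.
transitivity (l (fun W => 0 * E a X (fun=> 0) W)).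
  apply: le; first by apply: E_LN; apply: L_sum => k _; apply: L_scale; exact: L_pdN.
  move=> W uW; rewrite -(EZ _ _ _ l0 uW); apply: E_eqU uW => V uV.
  by rewrite div0// mul0r.
by rewrite lZ ?mul0r//; exact: E_LN.
Qed.

(** By [linear_E_pd], the equation that the u k satisfy in W passes to the variable X with the order
    lowered by one; the terms of order 0 are constant in X. *)
Lemma div_linear_E l a X : linear_on_L l ->
  \sum_k c k * pd (x k) (y k) (fun X => l (E a X (u k))) X = 0.
Proof.
move=> hl; case: a => [|a].
  apply: big1 => k _; rewrite [X in pd _ _ X](_ : _ = fun=> l (u k)) ?pd_cst ?mulr0//.
  by apply/funext => V; rewrite E0.
transitivity (- \sum_k c k * l (E a X (pd (x k) (y k) (u k)))).
  by rewrite -sumrN; apply: eq_bigr => k _; rewrite linear_E_pd// mulrN.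
by rewrite linear_E_div0 ?oppr0.
Qed.

Lemma div_E a Z : eqU (fun W => \sum_k c k * pd (x k) (y k) (E a Z (u k)) W) (fun=> 0).
Proof.
move=> W uW /=; rewrite -[RHS](linear_E_div0 a Z (linear_eval uW)).
by apply: eq_bigr => k _; rewrite pd_E.
Qed.

End Divergence.

Section Annihilation.
Variables (R : realType) (r : R).
Hypothesis hr : 0 < r.
Implicit Types (f g : HC R -> R[i]) (W X Y Z : HC R) (i j p q : 'I_2).
Implicit Types (A B : 'I_2 -> 'I_2 -> HC R -> R[i]).

Definition rowfree A := forall i q, eqU (fun W => \sum_k nbp k q (A i k) W) (fun=> 0).
Definition colfree A := forall q j, eqU (fun W => \sum_k nbp q k (A k j) W) (fun=> 0).

Lemma nbp_c (i k : 'I_2) f W : nbp i k f W = (if i == k then 2 else -2) * pd (1 - i) (1 - k) f W.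
Proof. by []. Qed.

Lemma rowfree_plus Z a : rowfree (Aplus Z a).
Proof.
move=> i q; apply: (@div_E R _ _ _ _ (fun k => K i k)) => [k|]; first exact: K_LN.
exact: nbp_K_row.
Qed.

Lemma colfree_plus Z a : colfree (Aplus Z a).
Proof.
move=> q j; apply: (@div_E R _ _ _ _ (fun k => K k j)) => [k|]; first exact: K_LN.
exact: nbp_K_col.
Qed.

Lemma nbpN i k f : L None f -> eqU (nbp i k (fun W => - f W)) (fun W => - nbp i k f W).
Proof.
move=> lf W uW; rewrite /nbp (pd_eqU _ _ _ uW (g := fun W => -1 * f W)); last by move=> V _; rewrite mulN1r.
by rewrite (pdZ _ _ _ _ uW)// mulN1r mulrN.
Qed.

Lemma rowfree_minus Z a : HCunits Z -> rowfree (Aminus Z a).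
Proof.
move=> uZ i q W uW /=.
have := @div_linear_E R _ (fun k => if k == q then 2 else -2) (fun k => 1 - k) (fun k => 1 - q)
  (fun k => K i k) (fun k => K_LN _ _ _) (nbp_K_row _ _) _ a W (linear_eval uZ) => h.
rewrite -[RHS]oppr0 -[in RHS]h -sumrN; apply: eq_bigr => k _; rewrite (nbpN _ _ _ uW)//.
by apply: P_LN (linear_E_P a (linear_eval uZ) _); exact: K_LN.
Qed.

Lemma colfree_minus Z a : HCunits Z -> colfree (Aminus Z a).
Proof.
move=> uZ q j W uW /=.
have := @div_linear_E R _ (fun k => if q == k then 2 else -2) (fun k => 1 - q) (fun k => 1 - k)
  (fun k => K k j) (fun k => K_LN _ _ _) (nbp_K_col _ _) _ a W (linear_eval uZ) => h.
rewrite -[RHS]oppr0 -[in RHS]h -sumrN; apply: eq_bigr => k _; rewrite (nbpN _ _ _ uW)//.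
by apply: P_LN (linear_E_P a (linear_eval uZ) _); exact: K_LN.
Qed.

(** Moving the derivative off f leaves f times (∂A) B + A (∂B), summed over p and q; the sum over p
    kills the first part by [rowfree], the sum over q kills the second by [colfree]. *)
Lemma term_stokes A B f i j : (forall i p, L None (A i p)) -> (forall i p, L None (B i p)) ->
  rowfree A -> colfree B -> L None f -> \sum_p \sum_q term r A B (nbp p q f) i p q j = 0.
Proof.
move=> lA lB hA hB lf.
have lp g p q : L None g -> L None (nbp p q g) by move=> lg; apply: L_scale; exact: L_pdN.
pose G p q := fun W => f W * (nbp p q (A i p) W * B q j W + A i p W * nbp p q (B q j) W).
have lG p q : L None (G p q).
  by apply: L_mul => //; apply: L_add; apply: L_mul => //; exact: lp.
transitivity (- Lam r (fun W => \sum_p \sum_q G p q W)).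
  rewrite (@linear_on_L_sum R _ _ _ _ (fun p W => \sum_q G p q W) (Lam_linear hr)); last by move=> p _; exact: L_sum.
  rewrite -sumrN; apply: eq_bigr => p _.
  rewrite (@linear_on_L_sum R _ _ _ _ (fun q W => G p q W) (Lam_linear hr))//.
  rewrite -sumrN; apply: eq_bigr => q _; rewrite /term.
  pose c : R[i] := if p == q then 2 else -2.
  have lAB : L None (fun W => A i p W * B q j W) by exact: L_mul.
  transitivity (Lam r (fun W => c * (pd (1 - p) (1 - q) f W * (A i p W * B q j W)))).
    by apply: (Lam_eqU hr) => W _; rewrite nbp_c -/c; ring.
  have lm : L None (fun W => pd (1 - p) (1 - q) f W * (A i p W * B q j W)) by apply: L_mul => //; exact: L_pdN.
  rewrite (LamZ hr)// (Lam_ibp hr)// mulrN -(LamZ hr); last by apply: L_mul => //; exact: L_pdN.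
  congr (- _); apply: (Lam_eqU hr) => W uW; rewrite (pdM _ _ _ _ uW)// /G !nbp_c -/c; ring.
rewrite (Lam_eqU hr (g := fun=> 0)) ?(Lam0 hr) ?oppr0// => W uW.
transitivity (f W * (\sum_q (\sum_p nbp p q (A i p) W) * B q j W + \sum_p A i p W * (\sum_q nbp p q (B q j) W))).
  by rewrite /G !sum2; ring.
rewrite !big1 ?addr0 ?mulr0// => p _; first by rewrite hB// mulr0.
by rewrite hA// mul0r.
Qed.

Lemma term_eqU A B f g i p q j : eqU f g -> term r A B f i p q j = term r A B g i p q j.
Proof. by move=> e; apply: (Lam_eqU hr) => W uW; rewrite e. Qed.

Lemma term_negl A B f i p q j : (forall i p, P None (A i p)) -> (forall i p, P None (B i p)) ->
  negl r f -> term r A B f i p q j = 0.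
Proof.
move=> pA pB [lf nf]; rewrite -(nf (fun W => A i p W * B q j W)); last exact: P_mul.
by apply: (Lam_eqU hr) => W _; rewrite mulrAC.
Qed.

End Annihilation.

(** * Functions that become polynomial after inversion *)

Section PolyHat.
Variable R : realType.
Implicit Types (f g : HC R -> R[i]) (u : 'I_2 -> HC R -> R[i]) (W X Y Z U : HC R) (i j p q s : 'I_2).

Definition polyhat f := exists2 h, P None h & forall U, HCunits U -> f U = h U^-1.

Lemma polyhat_add f g : polyhat f -> polyhat g -> polyhat (fun U => f U + g U).
Proof.
move=> [h ph e] [h' ph' e']; exists (fun U => h U + h' U); first exact: P_add.
by move=> U uU; rewrite e// e'.
Qed.

Lemma polyhat_mul f g : polyhat f -> polyhat g -> polyhat (fun U => f U * g U).
Proof.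
move=> [h ph e] [h' ph' e']; exists (fun U => h U * h' U); first exact: P_mul.
by move=> U uU; rewrite e// e'.
Qed.

Lemma polyhat_cst z : polyhat (fun=> z).
Proof. by exists (fun=> z) => //; apply: P_None (P_cst _). Qed.

Lemma polyhat_coord i j : polyhat (fun U => U^-1 i j).
Proof. by exists (fun U => U i j) => //; apply: P_None (P_coord _ _ _). Qed.

Lemma polyhat_eqU f g : polyhat f -> eqU f g -> polyhat g.
Proof. by move=> [h ph e] h2; exists h => // U uU; rewrite -h2// e. Qed.

Lemma polyhat_sum (I : finType) (F : I -> HC R -> R[i]) : (forall k, polyhat (F k)) ->
  polyhat (fun U => \sum_k F k U).
Proof.
move=> h; elim: index_enum => [|k l ih].
  by apply: polyhat_eqU (polyhat_cst 0) _ => U _; rewrite big_nil.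
by apply: polyhat_eqU (polyhat_add (h k) ih) _ => U _; rewrite big_cons.
Qed.

Lemma polyhat_pd f i j : polyhat f -> polyhat (pd i j f).
Proof.
move=> [h ph e].
have [_ hd] := invo_pd (P_LN ph).
apply: polyhat_eqU (_ : polyhat (fun U => -1 * \sum_k \sum_l (U^-1 k i * U^-1 j l) * invo (pd k l h) U)) _.
  apply: polyhat_mul (polyhat_cst _) _; apply: polyhat_sum => k; apply: polyhat_sum => l.
  apply: polyhat_mul; first by apply: polyhat_mul; exact: polyhat_coord.
  by exists (pd k l h) => //; exact: P_pd.
by move=> U uU; rewrite (pd_eqU _ _ (_ : eqU f (invo h)) uU)// hd// mulN1r.
Qed.

(** With U = Z^-1 this is the twist in the definition of [V'minus], and [hatL] is that of [Vminus].
    The same property describes the kernel terms of D_R^+ after inversion. *)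
Definition hatR u := forall s, polyhat (fun U => \det U * \sum_p u p U * U p s).
Definition hatL u := forall s, polyhat (fun U => \det U * \sum_i U s i * u i U).

Lemma hatR_eqU u v : hatR u -> (forall p, eqU (u p) (v p)) -> hatR v.
Proof.
move=> hu e s; apply: polyhat_eqU (hu s) _ => U uU.
by congr (_ * _); apply: eq_bigr => p _; rewrite e.
Qed.

Lemma hatL_eqU u v : hatL u -> (forall p, eqU (u p) (v p)) -> hatL v.
Proof.
move=> hu e s; apply: polyhat_eqU (hu s) _ => U uU.
by congr (_ * _); apply: eq_bigr => p _; rewrite e.
Qed.

Lemma pd_det_inv i j U : HCunits U -> pd i j (fun U => \det U) U = \det U * U^-1 j i.
Proof.
by move=> uU; rewrite (isd_pd (isd_det i j U)) inv_entry// mulrA mulfV ?mul1r.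
Qed.

Lemma det_L : L None (fun U : HC R => \det U).
Proof. exact: P_LN (P_det _). Qed.

Lemma hatR_recover u p U : HCunits U ->
  \det U * u p U = \sum_s (\det U * \sum_q u q U * U q s) * U^-1 s p.
Proof.
move=> uU; have d0 : U 0 0 * U 1 1 - U 0 1 * U 1 0 != 0 by rewrite -det2; exact: uU.
rewrite !sum2 !inv_entry// det2 /mxplus; case: (ord2_cases p) => ->; rewrite !mx2E; by field.
Qed.

Lemma hatL_recover u p U : HCunits U ->
  \det U * u p U = \sum_s U^-1 p s * (\det U * \sum_q U s q * u q U).
Proof.
move=> uU; have d0 : U 0 0 * U 1 1 - U 0 1 * U 1 0 != 0 by rewrite -det2; exact: uU.
rewrite !sum2 !inv_entry// det2 /mxplus; case: (ord2_cases p) => ->; rewrite !mx2E; by field.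
Qed.

(** Differentiate w = N u U. The derivative of N returns w times an entry of U^-1, the derivative of
    the factor U returns N u = w U^-1; both corrections are polynomial in U^-1. *)
Lemma hatR_pd u i j : (forall p, L None (u p)) -> hatR u -> hatR (fun p => pd i j (u p)).
Proof.
move=> lu hu s; pose w s U := \det U * \sum_p u p U * U p s.
have lc p k : L None (fun U : HC R => U p k) by exact: L_coord.
have lw : L None (fun U => \sum_p u p U * U p s) by apply: L_sum => p _; exact: L_mul.
apply: polyhat_eqU (_ : polyhat (fun U => pd i j (w s) U + ((-1 * U^-1 j i) * w s U +
    (- 1 * (j == s)%:R) * \sum_t w t U * U^-1 t i))) _.
  apply: polyhat_add; first exact: polyhat_pd (hu s).
  apply: polyhat_add; first by apply: polyhat_mul (hu s); apply: polyhat_mul; [exact: polyhat_cst|exact: polyhat_coord].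
  apply: polyhat_mul; first exact: polyhat_cst.
  by apply: polyhat_sum => t; apply: polyhat_mul; [exact: hu|exact: polyhat_coord].
move=> U uU; rewrite /w (pdM _ _ det_L lw uU) pd_det_inv// -(hatR_recover _ _ uU).
rewrite (pd_sum _ _ _ _ uU); last by move=> p _; exact: L_mul.
have -> : \sum_p pd i j (fun U => u p U * U p s) U =
    \sum_p pd i j (u p) U * U p s + u i U * (j == s)%:R.
  transitivity (\sum_p (pd i j (u p) U * U p s + u p U * ((i == p) && (j == s))%:R)).
    by apply: eq_bigr => p _; rewrite (pdM _ _ _ _ uU)// pd_coord.
  rewrite big_split; congr (_ + _).
  by rewrite (bigD1 i)//= eqxx big1 ?addr0// => p; rewrite eq_sym => /negbTE ->; rewrite mulr0.
by ring.
Qed.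

Lemma hatL_pd u i j : (forall p, L None (u p)) -> hatL u -> hatL (fun p => pd i j (u p)).
Proof.
move=> lu hu s; pose w s U := \det U * \sum_p U s p * u p U.
have lc p k : L None (fun U : HC R => U p k) by exact: L_coord.
have lw : L None (fun U => \sum_p U s p * u p U) by apply: L_sum => p _; exact: L_mul.
apply: polyhat_eqU (_ : polyhat (fun U => pd i j (w s) U + ((-1 * U^-1 j i) * w s U +
    (- 1 * (i == s)%:R) * \sum_t U^-1 j t * w t U))) _.
  apply: polyhat_add; first exact: polyhat_pd (hu s).
  apply: polyhat_add; first by apply: polyhat_mul (hu s); apply: polyhat_mul; [exact: polyhat_cst|exact: polyhat_coord].
  apply: polyhat_mul; first exact: polyhat_cst.
  by apply: polyhat_sum => t; apply: polyhat_mul; [exact: polyhat_coord|exact: hu].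
move=> U uU; rewrite /w (pdM _ _ det_L lw uU) pd_det_inv// -(hatL_recover _ _ uU).
rewrite (pd_sum _ _ _ _ uU); last by move=> p _; exact: L_mul.
have -> : \sum_p pd i j (fun U => U s p * u p U) U =
    \sum_p U s p * pd i j (u p) U + u j U * (i == s)%:R.
  transitivity (\sum_p (U s p * pd i j (u p) U + u p U * ((i == s) && (j == p))%:R)).
    by apply: eq_bigr => p _; rewrite (pdM _ _ _ _ uU)// pd_coord; ring.
  rewrite big_split; congr (_ + _).
  by rewrite (bigD1 j)//= eqxx andbT big1 ?addr0// => p; rewrite eq_sym => /negbTE ->; rewrite andbF mulr0.
by ring.
Qed.

Lemma hatR_lin (I : finType) (c : I -> R[i]) (v : I -> 'I_2 -> HC R -> R[i]) :
  (forall k, hatR (v k)) -> hatR (fun p U => \sum_k c k * v k p U).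
Proof.
move=> hv s; apply: polyhat_eqU (_ : polyhat (fun U => \sum_k c k * (\det U * \sum_p v k p U * U p s))) _.
  by apply: polyhat_sum => k; apply: polyhat_mul; [exact: polyhat_cst|exact: hv].
move=> U _; under [LHS]eq_bigr => k _ do rewrite mulrCA mulr_sumr.
rewrite -mulr_sumr exchange_big; congr (_ * _); apply: eq_bigr => p _ /=.
by rewrite mulr_suml; apply: eq_bigr => k _; rewrite mulrA.
Qed.

Lemma hatL_lin (I : finType) (c : I -> R[i]) (v : I -> 'I_2 -> HC R -> R[i]) :
  (forall k, hatL (v k)) -> hatL (fun p U => \sum_k c k * v k p U).
Proof.
move=> hv s; apply: polyhat_eqU (_ : polyhat (fun U => \sum_k c k * (\det U * \sum_p U s p * v k p U))) _.
  by apply: polyhat_sum => k; apply: polyhat_mul; [exact: polyhat_cst|exact: hv].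
move=> U _; under [LHS]eq_bigr => k _ do rewrite mulrCA mulr_sumr.
rewrite -mulr_sumr exchange_big; congr (_ * _); apply: eq_bigr => p _ /=.
by rewrite mulr_sumr; apply: eq_bigr => k _; rewrite mulrCA.
Qed.

Lemma hat_Dop n T u : Dop n T -> (forall p, L None (u p)) ->
  (hatR u -> hatR (fun p => T (u p))) /\ (hatL u -> hatL (fun p => T (u p))).
Proof.
move=> hT; elim: hT u => {n T} [|n T i j hT ih|n T T' hT ih hT' ih'|n z T hT ih] u lu.
- by [].
- have [h1 h2] := ih (fun p => pd i j (u p)) (fun p => L_pdN _ _ (lu p)).
  by split=> hu; [apply: h1; exact: hatR_pd|apply: h2; exact: hatL_pd].
- have [h1 h2] := ih u lu; have [h1' h2'] := ih' u lu; split=> hu.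
    apply: hatR_eqU (@hatR_lin _ (fun=> 1) (fun b p => (if b then T else T') (u p)) _) _ => [[]|p U _].
    + exact: h1.
    + exact: h1'.
    + by rewrite big_bool !mul1r.
  apply: hatL_eqU (@hatL_lin _ (fun=> 1) (fun b p => (if b then T else T') (u p)) _) _ => [[]|p U _].
  + exact: h2.
  + exact: h2'.
  + by rewrite big_bool !mul1r.
- have [h1 h2] := ih u lu; split=> hu.
        by apply: hatR_eqU (@hatR_lin _ (fun _ : unit => z) (fun _ p => T (u p)) (fun _ => h1 hu)) _ => p U _; rewrite big_const card_unit /= addr0.
  by apply: hatL_eqU (@hatL_lin _ (fun _ : unit => z) (fun _ p => T (u p)) (fun _ => h2 hu)) _ => p U _; rewrite big_const card_unit /= addr0.
Qed.

(** N K U is the identity matrix. *)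
Lemma hatR_K i : hatR (K i).
Proof.
move=> s; apply: polyhat_eqU (polyhat_cst (i == s)%:R) _ => U uU; rewrite /K sum2 expN2.
have d0 : \det U != 0 by [].
case: (ord2_cases i) => ->; case: (ord2_cases s) => ->; rewrite /mxplus !mx2E /=.
- by transitivity ((\det U)^-1 * (U 0 0 * U 1 1 - U 0 1 * U 1 0)); [rewrite -det2 mulVf|field].
- by field.
- by field.
- by transitivity ((\det U)^-1 * (U 0 0 * U 1 1 - U 0 1 * U 1 0)); [rewrite -det2 mulVf|field].
Qed.

Lemma hatL_K j : hatL (fun q => K q j).
Proof.
move=> s; apply: polyhat_eqU (polyhat_cst (s == j)%:R) _ => U uU; rewrite /K sum2 expN2.
have d0 : \det U != 0 by [].
case: (ord2_cases j) => ->; case: (ord2_cases s) => ->; rewrite /mxplus !mx2E /=.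
- by transitivity ((\det U)^-1 * (U 0 0 * U 1 1 - U 0 1 * U 1 0)); [rewrite -det2 mulVf|field].
- by field.
- by field.
- by transitivity ((\det U)^-1 * (U 0 0 * U 1 1 - U 0 1 * U 1 0)); [rewrite -det2 mulVf|field].
Qed.

Lemma hatR_plus Z a i : hatR (Aplus Z a i).
Proof.
have [I [m [d [pm dd e]]]] := E_expand R a.
apply: hatR_eqU (@hatR_lin _ (fun k => m k Z) (fun k p => d k (K i p)) _) _ => [k|p U uU].
  by apply: (hat_Dop (dd k) _).1 (hatR_K i) => p; exact: K_LN.
by rewrite /Aplus (e _ _ _ _ uU)//; exact: K_LN.
Qed.

Lemma hatL_plus Z a j : hatL (fun q => Aplus Z a q j).
Proof.
have [I [m [d [pm dd e]]]] := E_expand R a.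
apply: hatL_eqU (@hatL_lin _ (fun k => m k Z) (fun k q => d k (K q j)) _) _ => [k|p U uU].
  by apply: (hat_Dop (dd k) _).2 (hatL_K j) => p; exact: K_LN.
by rewrite /Aplus (e _ _ _ _ uU)//; exact: K_LN.
Qed.

End PolyHat.

(** * The pairing on D_R^+ after inversion *)

Section Sigma.
Variables (R : realType) (r : R).
Hypothesis hr : 0 < r.

(** What F becomes under W = V^-1: [Lam_inv] gives N^-4, and each of the two kernel factors gives N
    and a matrix V, its remaining part being polynomial in V. *)
Definition sigma (F : 'I_2 -> 'I_2 -> HC R -> R[i]) (s t : 'I_2) (V : HC R) : R[i] :=
  \det V ^ (-2) * \sum_p \sum_q V s p * F p q V^-1 * V q t.

Lemma term_sigma A B F i j : (forall i p, L None (A i p)) -> (forall i p, L None (B i p)) ->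
  (forall p q, L None (F p q)) ->
  hatR (A i) -> hatL (fun q => B q j) -> (forall s t, negl r (sigma F s t)) ->
  \sum_p \sum_q term r A B (F p q) i p q j = 0.
Proof.
move=> lA lB lF hA hB hF.
have [a pa ea] : exists2 a : 'I_2 -> HC R -> R[i], forall s, P None (a s) &
    forall s U, HCunits U -> \det U * \sum_p A i p U * U p s = a s U^-1.
  by have /choice[a ha] : forall s, exists h, P None h /\ forall U, HCunits U -> \det U * \sum_p A i p U * U p s = h U^-1;
    [move=> s; have [h ph e] := hA s; exists h | exists a => s; have [] := ha s].
have [b pb eb] : exists2 b : 'I_2 -> HC R -> R[i], forall s, P None (b s) &
    forall s U, HCunits U -> \det U * \sum_q U s q * B q j U = b s U^-1.
  by have /choice[b hb] : forall s, exists h, P None h /\ forall U, HCunits U -> \det U * \sum_q U s q * B q j U = h U^-1;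
    [move=> s; have [h ph e] := hB s; exists h | exists b => s; have [] := hb s].
have lt p q : L None (fun W => A i p W * F p q W * B q j W) by apply: L_mul => //; exact: L_mul.
transitivity (Lam r (fun W => \sum_p \sum_q A i p W * F p q W * B q j W)).
  rewrite (@linear_on_L_sum R _ _ _ _ (fun p W => \sum_q _) (Lam_linear hr)); last by move=> p _; exact: L_sum.
  by apply: eq_bigr => p _; rewrite (@linear_on_L_sum R _ _ _ _ (fun q W => _) (Lam_linear hr)).
rewrite -(Lam_inv hr); last by apply: L_sum => p _; exact: L_sum.
transitivity (Lam r (fun V => \sum_s \sum_t (a s V * b t V) * sigma F s t V)); last first.
  rewrite (@linear_on_L_sum R _ _ _ _ (fun s V => \sum_t _) (Lam_linear hr)).
    apply: big1 => s _; rewrite (@linear_on_L_sum R _ _ _ _ (fun t V => _) (Lam_linear hr)).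
      by apply: big1 => t _; apply: (hF s t).2; exact: P_mul.
    by move=> t _; apply: L_mul; [apply: P_LN; exact: P_mul|exact: (hF s t).1].
  by move=> s _; apply: L_sum => t _; apply: L_mul; [apply: P_LN; exact: P_mul|exact: (hF s t).1].
apply: (Lam_eqU hr) => V uV; have uVi := inv_HCunits uV.
have eA p : A i p V^-1 = \det V * \sum_s a s V * V s p.
  have d0 : \det V^-1 != 0 by exact: uVi.
  apply: (mulfI d0); rewrite (hatR_recover _ _ uVi) mulrA det_invHC mulVf ?mul1r//.
  by apply: eq_bigr => s _; rewrite -det_invHC ea// !invrK.
have eB q : B q j V^-1 = \det V * \sum_t V q t * b t V.
  have d0 : \det V^-1 != 0 by exact: uVi.
  apply: (mulfI d0); rewrite (hatL_recover (fun q => B q j) _ uVi) mulrA det_invHC mulVf ?mul1r//.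
  by apply: eq_bigr => s _; rewrite -det_invHC eb// !invrK.
rewrite /invo; under eq_bigr => p _ do under eq_bigr => q _ do rewrite eA eB.
have d0 : \det V != 0 by [].
have dd : \det V ^ (-4) * (\det V * \det V) = \det V ^ (-2).
  by rewrite -expr2 -[_ ^+ 2]/(_ ^ 2%:Z) -expfzDr.
rewrite /sigma !sum2 -dd; ring.
Qed.

End Sigma.

(** * Matrix coefficients and K-types *)

Section Coefficients.
Variable R : realType.
Implicit Types (f g h : HC R -> R[i]) (W X Y Z V : HC R) (i j : 'I_2) (p q e n : nat).

Definition linp Z j : {poly R[i]} := 'X * (Z 0 j)%:P + (Z 1 j)%:P.

(** With p = l - m and q = l + m this is a coefficient of the generating polynomial of the t^l, and
    n - e stands for l - n in the notation there. The spare exponent e turns n + 1 into e = 1 and so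
    avoids a predecessor truncated at 0. *)
Definition T e p q n Z : R[i] := ('X^e * linp Z 0 ^+ p * linp Z 1 ^+ q)`_n.

Lemma T_aux (K : comNzRingType) (x a c Y A B : K) :
  (Y * ((x * a + c) * A) * B = a * (Y * x * A * B) + c * (Y * A * B)) *
  (Y * A * ((x * a + c) * B) = a * (Y * x * A * B) + c * (Y * A * B)).
Proof. by split; ring. Qed.

Lemma T00 e n Z : T e 0 0 n Z = (n == e)%:R.
Proof. by rewrite /T !expr0 !mulr1 coefXn. Qed.

Lemma T_p e p q n Z : T e p.+1 q n Z = Z 0 0 * T e.+1 p q n Z + Z 1 0 * T e p q n Z.
Proof.
by rewrite /T -!coefCM -coefD exprS exprSr {1}/linp T_aux.
Qed.

Lemma T_q e p q n Z : T e p q.+1 n Z = Z 0 1 * T e.+1 p q n Z + Z 1 1 * T e p q n Z.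
Proof.
by rewrite /T -!coefCM -coefD exprS (exprSr _ e) {2}/linp T_aux.
Qed.

Lemma T_shift e p q n Z : T e.+1 p q n.+1 Z = T e p q n Z.
Proof. by rewrite /T exprS -!mulrA coefXM. Qed.

Lemma T_low e p q n Z : (n < e)%N -> T e p q n Z = 0.
Proof. by move=> h; rewrite /T -mulrA coefXnM h. Qed.

Lemma T_high e p q n Z : (e + p + q < n)%N -> T e p q n Z = 0.
Proof.
elim: p e => [|p ih] e; last by move=> h; rewrite T_p !ih ?mulr0 ?addr0//; lia.
elim: q e => [|q ih] e h; last by rewrite T_q !ih ?mulr0 ?addr0//; lia.
by rewrite T00 gtn_eqF//; lia.
Qed.

Lemma T_P e p q n : P (Some (p + q)%N) (T e p q n).
Proof.
elim: p e => [|p ih] e.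
  elim: q e => [|q ih] e.
    by apply: P_eq (P_cst (n == e)%:R) _; apply/funext => Z; rewrite T00.
  apply: P_eq (P_add (P_mulS (P_coord _ 0 1) (ih e.+1)) (P_mulS (P_coord _ 1 1) (ih e))) _.
  by apply/funext => Z; rewrite T_q.
apply: P_eq (P_add (P_mulS (P_coord _ 0 0) (ih e.+1)) (P_mulS (P_coord _ 1 0) (ih e))) _.
by apply/funext => Z; rewrite T_p.
Qed.

Lemma isd_T0 i e p q n Z :
  isd i 0 (T e p q n) Z (p%:R * T (if i == 0 then e.+1 else e) p.-1 q n Z).
Proof.
elim: p e => [|p ih] e.
  elim: q e => [|q ih] e.
    rewrite (_ : T e 0 0 n = fun=> (n == e)%:R); last by apply/funext => V; rewrite T00.
    by apply: isd_eq (isd_cst _ _ _ _) _; rewrite mul0r.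
  rewrite (_ : T e 0 q.+1 n = fun Z => Z 0 1 * T e.+1 0 q n Z + Z 1 1 * T e 0 q n Z); last first.
    by apply/funext => V; rewrite T_q.
  apply: isd_eq (isdD (isdM (isd_coord _ _ _ _ _) (ih _)) (isdM (isd_coord _ _ _ _ _) (ih _))) _.
  by rewrite !andbF !mul0r !mulr0 !addr0.
rewrite (_ : T e p.+1 q n = fun Z => Z 0 0 * T e.+1 p q n Z + Z 1 0 * T e p q n Z); last first.
  by apply/funext => V; rewrite T_p.
apply: isd_eq (isdD (isdM (isd_coord _ _ _ _ _) (ih _)) (isdM (isd_coord _ _ _ _ _) (ih _))) _.
rewrite !andbT -[p.+1.-1]/p mulrSr; case: p {ih} => [|p].
  by case: (ord2_cases i) => -> /=; rewrite !mul0r; ring.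
by rewrite -[p.+1.-1]/p !T_p; case: (ord2_cases i) => -> /=; ring.
Qed.

Lemma isd_T1 i e p q n Z :
  isd i 1 (T e p q n) Z (q%:R * T (if i == 0 then e.+1 else e) p q.-1 n Z).
Proof.
elim: q e => [|q ih] e.
  elim: p e => [|p ih] e.
    rewrite (_ : T e 0 0 n = fun=> (n == e)%:R); last by apply/funext => V; rewrite T00.
    by apply: isd_eq (isd_cst _ _ _ _) _; rewrite mul0r.
  rewrite (_ : T e p.+1 0 n = fun Z => Z 0 0 * T e.+1 p 0 n Z + Z 1 0 * T e p 0 n Z); last first.
    by apply/funext => V; rewrite T_p.
  apply: isd_eq (isdD (isdM (isd_coord _ _ _ _ _) (ih _)) (isdM (isd_coord _ _ _ _ _) (ih _))) _.
  by rewrite !andbF !mul0r !mulr0 !addr0.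
rewrite (_ : T e p q.+1 n = fun Z => Z 0 1 * T e.+1 p q n Z + Z 1 1 * T e p q n Z); last first.
  by apply/funext => V; rewrite T_q.
apply: isd_eq (isdD (isdM (isd_coord _ _ _ _ _) (ih _)) (isdM (isd_coord _ _ _ _ _) (ih _))) _.
rewrite !andbT -[q.+1.-1]/q mulrSr; case: q {ih} => [|q].
  by case: (ord2_cases i) => -> /=; rewrite !mul0r; ring.
by rewrite -[q.+1.-1]/q !T_q; case: (ord2_cases i) => -> /=; ring.
Qed.

Lemma pd_T e p q n :
  ((pd 0 0 (T e p q n) = fun Z => p%:R * T e.+1 p.-1 q n Z) *
   (pd 1 0 (T e p q n) = fun Z => p%:R * T e p.-1 q n Z) *
   (pd 0 1 (T e p q n) = fun Z => q%:R * T e.+1 p q.-1 n Z) *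
   (pd 1 1 (T e p q n) = fun Z => q%:R * T e p q.-1 n Z)).
Proof.
by do !split; apply/funext => Z; [rewrite (isd_pd (isd_T0 _ _ _ _ _ _))|rewrite (isd_pd (isd_T0 _ _ _ _ _ _))
 |rewrite (isd_pd (isd_T1 _ _ _ _ _ _))|rewrite (isd_pd (isd_T1 _ _ _ _ _ _))].
Qed.

Lemma pd_TZ z e p q n i j : pd i j (fun Z => z * T e p q n Z) = fun Z => z * pd i j (T e p q n) Z.
Proof.
by apply/funext => Z; apply: isd_pd; apply: isdZ; exact: P_isd (T_P _ _ _ _).
Qed.

(** Both products of derivatives multiply the generating polynomial by s, lower p and q by one and
    bring the same factor p q. *)
Lemma box2_T e p q n : box2 (T e p q n) = fun=> 0.
Proof. by apply/funext => Z; rewrite /box2 !pd_T !pd_TZ !pd_T; ring. Qed.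

Lemma deriv_linp Z j : (linp Z j)^`() = (Z 0 j)%:P.
Proof. by rewrite /linp derivD derivM derivX !derivC mul1r mulr0 !addr0. Qed.

(* Both identities come from Euler's relations for s * d/ds and for the degree of the
   generating polynomial (s z00 + z10)^p (s z01 + z11)^q. *)
Lemma T_euler p q n Z :
  n%:R * T 0 p q n Z = p%:R * (Z 0 0 * T 1 p.-1 q n Z) + q%:R * (Z 0 1 * T 1 p q.-1 n Z).
Proof.
case: n => [|n]; first by rewrite mul0r !T_low// !mulr0 addr0.
rewrite !T_shift /T [LHS]mulr_natl -coef_deriv !mulr_natl -!coefCM -!coefMn -coefD; congr (_`_ _).
rewrite !expr0 !mul1r derivM !deriv_exp !deriv_linp.
set a := (Z 0 0)%:P; set b := (Z 0 1)%:P; set A := linp Z 0; set B := linp Z 1.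
by rewrite mulrnAl mulrnAr !mulrA [A ^+ p * b]mulrC.
Qed.

Lemma T_euler' p q n Z : (p + q)%:R * T 0 p q n Z - n%:R * T 0 p q n Z =
  p%:R * (Z 1 0 * T 0 p.-1 q n Z) + q%:R * (Z 1 1 * T 0 p q.-1 n Z).
Proof.
rewrite T_euler natrD mulrDl.
have -> : p%:R * T 0 p q n Z = p%:R * (Z 0 0 * T 1 p.-1 q n Z + Z 1 0 * T 0 p.-1 q n Z).
  by case: p => [|p]; rewrite ?mul0r// -T_p.
have -> : q%:R * T 0 p q n Z = q%:R * (Z 0 1 * T 1 p q.-1 n Z + Z 1 1 * T 0 p q.-1 n Z).
  by case: q => [|q]; rewrite ?mul0r// -T_q.
by ring.
Qed.

Lemma cint_coef (c : nat -> R[i]) m N :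
  cint 0 (2 * pi) (fun x => \sum_(k < N) c k * em (k%:Z - m%:Z) x) =
  (if (m < N)%N then (2 * pi)%:C * c m else 0) /\
  cc (fun x => \sum_(k < N) c k * em (k%:Z - m%:Z) x).
Proof.
elim: N => [|N [ih1 ih2]].
  rewrite (_ : (fun _ => _) = fun=> 0 * 0); last by apply/funext => x; rewrite big_ord0 mul0r.
  by split; [rewrite cintZ ?mul0r//; exact: cc_cst | exact: cc_cst].
rewrite (_ : (fun _ => _) = fun x => \sum_(k < N) c k * em (k%:Z - m%:Z) x + c N * em (N%:Z - m%:Z) x); last first.
  by apply/funext => x; rewrite big_ord_recr.
have ce := cc_em R (N%:Z - m%:Z).
have ce' : cc (fun x => c N * em (N%:Z - m%:Z) x) by apply: ccM => //; exact: cc_cst.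
split; last exact: ccD.
rewrite cintD// ih1 cintZ// cint_em subr_eq0 eqz_nat ltnS.
by case: (ltngtP m N) => [h|h|->]; rewrite ?mulr0 ?addr0 ?add0r// mulrC.
Qed.

(** On the unit circle the contour integral is a Fourier coefficient of the generating polynomial.
    The convention t = 0 for |n| > l agrees with the vanishing of coefficients outside the range of
    degrees. *)
Lemma tcoef_T (l n m : rat) (p q j e : nat) Z : 2 * l = (p + q)%:R -> l - m = p%:R ->
  l - n = j%:R - e%:R -> tcoef l n m Z = T e p q j Z.
Proof.
move=> hl hm hn; have em' : m = l - p%:R by lra.
have en : n = l - j%:R + e%:R by lra.
have lm : l + m = q%:R by move: hl; rewrite natrD; lra.
rewrite /tcoef hl natr_nat.
have -> : m - l \is a Num.int by rewrite em' (_ : l - p%:R - l = - p%:R) ?rpredN ?natr_int//; ring.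
have -> : n - l \is a Num.int by rewrite en (_ : l - j%:R + e%:R - l = e%:R - j%:R) ?rpredB ?natr_int//; ring.
have -> : `|m| <= l.
  have := ler0n rat p; have := ler0n rat q.
  by move: lm hm => <- <- h1 h2; rewrite ler_norml; apply/andP; split; lra.
have -> : (`|n| <= l) = (e <= j <= e + p + q)%N.
  rewrite ler_norml -!(ler_nat rat) !natrD; move: hl; rewrite natrD en => hl.
  by apply/idP/idP => /andP[h1 h2]; apply/andP; split; lra.
rewrite /=; case: ifPn => [/andP[ej jN]|]; last first.
  by rewrite negb_and -!ltnNge => /orP[h|h]; [rewrite T_low|rewrite T_high].
rewrite hm lm (_ : n - l = (e%:Z - j%:Z)%:~R); last first.
  by rewrite rmorphB /= -!pmulrn en; ring.
rewrite -[p%:R]/(p%:Z%:~R) -[q%:R]/(q%:Z%:~R) !intrKfloor.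
pose g := 'X^e * linp Z 0 ^+ p * linp Z 1 ^+ q.
rewrite (_ : circle_int _ = 'i * cint 0 (2 * pi) (fun x => \sum_(k < size g) g`_k * em (k%:Z - j%:Z) x)).
  have [-> _] := cint_coef (fun k => g`_k) j (size g).
  have p0 : (pi%:C : R[i]) != 0 by rewrite fmorph_eq0 gt_eqF// pi_gt0.
  have i0 : 'i != 0 :> R[i] by rewrite neq0Ci.
  rewrite /T -/g; case: ltnP => [_|h]; last by rewrite !mulr0 nth_default.
  have ef (x y z : R[i]) : x != 0 -> y != 0 -> (2 * x * y)^-1 * (y * (2 * x * z)) = z.
    by move=> x0 y0; field; rewrite x0 y0.
  by rewrite rmorphM rmorph_nat /= ef.
have [_ cg] := cint_coef (fun k => g`_k) j (size g).
rewrite -cintZ// /circle_int; congr cint; apply/funext => x.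
have e1 : cis x = em 1 x :> R[i] by rewrite /em mul1r.
have c0 : cis x != 0 :> R[i] by rewrite e1 em_neq0.
have el k : cis x * Z 0 k + Z 1 k = (linp Z k).[cis x].
  by rewrite /linp hornerD hornerM hornerX !hornerC.
rewrite !el expfzDr//.
transitivity ('i * (g.[cis x] * em (- j%:Z) x)).
  rewrite /g !hornerM hornerXn !horner_exp (_ : em (- j%:Z) x = (cis x ^+ j)^-1).
    have ef (c a b u v w : R[i]) : c != 0 -> a * b * (u * v) / c * (w * c) = w * (u * a * b * v).
      by move=> c00; field.
    by rewrite -exprnN -!exprnP ef.
  by rewrite e1 exprnN emXz mul1r.
rewrite horner_coef mulr_suml; congr (_ * _); apply: eq_bigr => k _.
by rewrite e1 emX mul1r -mulrA emD.
Qed.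

Lemma tcoef_cases (l n m : rat) : (@tcoef R l n m = fun=> 0) \/
  exists p q (j : nat), [/\ 2 * l = (p + q)%:R, (j <= p + q)%N & @tcoef R l n m = T 0 p q j].
Proof.
have [|h] := boolP ([&& 2 * l \is a Num.nat, m - l \is a Num.int, n - l \is a Num.int,
         `|m| <= l & `|n| <= l]); last by left; apply/funext => Z; rewrite /tcoef (negbTE h).
move=> /and5P[/natrP[N hN] hm hn]; rewrite !ler_norml => /andP[m1 m2] /andP[n1 n2]; right.
have hm' : l - m \is a Num.int by rewrite -opprB rpredN.
have hn' : l - n \is a Num.int by rewrite -opprB rpredN.
have /natrP[p hp] : l - m \is a Num.nat by rewrite natrEint hm' subr_ge0.
have /natrP[j hj] : l - n \is a Num.nat by rewrite natrEint hn' subr_ge0.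
have pN : (p <= N)%N by rewrite -(ler_nat rat) -hN -hp; lra.
have jN : (j <= N)%N by rewrite -(ler_nat rat) -hN -hj; lra.
exists p, (N - p)%N, j; rewrite subnKC//; split=> //.
by apply/funext => Z; rewrite (tcoef_T (p := p) (q := (N - p)%N) (j := j) (e := 0))// ?subnKC// subr0.
Qed.

Lemma pmon_mxplus a b c d V : pmon a b c d (mxplus V) = (-1) ^+ (b + c) * pmon d b c a V.
Proof. by rewrite /pmon /mxplus !mx2E exprD ![(- V _ _) ^+ _]exprNn; ring. Qed.

Lemma pmon_dil a b c d (z : R[i]) V :
  pmon a b c d (z *: V) = z ^+ (a + b + c + d) * pmon a b c d V.
Proof. by rewrite /pmon !mxE !exprMn !exprD; ring. Qed.

Lemma P_inv n h : P (Some n) h -> eqU (invo h) (fun V => \det V ^ (- n%:Z) * h (mxplus V)).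
Proof.
elim=> {h} [z a b c d /= /eqP hn|f g _ ihf _ ihg] V uV; last by rewrite /invo mulrDr -ihf// -ihg.
by rewrite /invo inv_mx2// pmon_dil hn exprVn exprnN mulrCA.
Qed.

Lemma P_plus o h : P o h -> P o (fun V => h (mxplus V)).
Proof.
elim=> {h} [z a b c d hn|f g _ ihf _ ihg]; last exact: P_add.
apply: P_eq (@P_mon R o (z * (-1) ^+ (b + c)) d b c a _) _.
  by case: o hn => //= m; rewrite (_ : (d + b + c + a = a + b + c + d)%N)//; lia.
by apply/funext => V; rewrite pmon_mxplus [RHS]mulrA.
Qed.

Lemma box2_pmon z a b c d : box2 (fun V => z * pmon a b c d V) =
  fun V => z * (a%:R * d%:R * pmon a.-1 b c d.-1 V - b%:R * c%:R * pmon a b.-1 c.-1 d V).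
Proof.
have dp w a' b' c' d' i j : pd i j (fun V => w * pmon a' b' c' d' V) = fun V => w * dpmon i j a' b' c' d' V.
  by apply/funext => V; apply: isd_pd; apply: isdZ; exact: isd_pmon.
apply/funext => V; rewrite /box2 !dp /dpmon !mx2E.
have -> : (fun V => z * (d%:R * pmon a b c d.-1 V)) = fun V => (z * d%:R) * pmon a b c d.-1 V.
  by apply/funext => U; rewrite mulrA.
have -> : (fun V => z * (c%:R * pmon a b c.-1 d V)) = fun V => (z * c%:R) * pmon a b c.-1 d V.
  by apply/funext => U; rewrite mulrA.
by rewrite !dp /dpmon !mx2E; ring.
Qed.

Lemma box2_PD f g : P None f -> P None g -> box2 (fun V => f V + g V) = fun V => box2 f V + box2 g V.
Proof.
have pD f' g' i j : P None f' -> P None g' -> pd i j (fun V => f' V + g' V) = fun V => pd i j f' V + pd i j g' V.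
  by move=> pf pg; apply/funext => V; apply: isd_pd; apply: isdD; [exact: P_isd pf|exact: P_isd pg].
by move=> pf pg; apply/funext => V; rewrite /box2 !pD//; try exact: P_pd; ring.
Qed.

(** The map V to V^+ exchanges the diagonal entries and changes the sign of the others, and so
    preserves both products of derivatives in [box2]. *)
Lemma box2_plus h : P None h -> box2 (fun V => h (mxplus V)) = fun V => box2 h (mxplus V).
Proof.
elim=> {h} [z a b c d _|f g pf ihf pg ihg]; last by rewrite !box2_PD ?ihf ?ihg//; exact: P_plus.
rewrite (_ : (fun _ => _) = fun V => (z * (-1) ^+ (b + c)) * pmon d b c a V); last first.
  by apply/funext => V; rewrite pmon_mxplus [LHS]mulrA.
rewrite !box2_pmon; apply/funext => V; rewrite !pmon_mxplus.
have e : b%:R * c%:R * (-1) ^+ (b.-1 + c.-1) = b%:R * c%:R * (-1) ^+ (b + c) :> R[i].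
  by case: b c => [|b] [|c]; rewrite ?mul0r ?mulr0 ?mul0r//= addSn addnS !exprS; ring.
transitivity (z * (a%:R * d%:R * (-1) ^+ (b + c) * pmon d.-1 b c a.-1 V
   - b%:R * c%:R * (-1) ^+ (b + c) * pmon d b.-1 c.-1 a V)); first by ring.
by rewrite -e; ring.
Qed.

End Coefficients.

(** * Harmonic matrix functions and orthogonality after inversion *)

Section Harmonic.
Variables (R : realType) (r : R).
Hypothesis hr : 0 < r.
Implicit Types (f g : HC R -> R[i]) (W X Y Z V : HC R) (i j s t : 'I_2) (e n : nat).
Implicit Types h : 'I_2 -> 'I_2 -> HC R -> R[i].

Definition harm n f := P (Some n) f /\ box2 f = fun=> 0.

Lemma harm_scale n (c : R[i]) f : harm n f -> harm n (fun V => c * f V).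
Proof.
move=> [pf bf]; split; first exact: P_scale.
have pZ g i j : P None g -> pd i j (fun V => c * g V) = fun V => c * pd i j g V.
  by move=> pg; apply/funext => V; apply: isd_pd; apply: isdZ; exact: P_isd pg.
have pf' := P_None pf.
apply/funext => V; rewrite /box2 !pZ//; try exact: P_pd.
by rewrite -mulrBr -/(box2 f V) bf mulr0.
Qed.

Lemma harm0 n : harm n (fun=> 0).
Proof. by split; [exact: P_0|apply/funext => W; rewrite /box2 !pd_cst subrr]. Qed.

Lemma harm_T n (c : R[i]) e p q (m : nat) : (p + q)%N = n \/ c = 0 -> harm n (fun W => c * T e p q m W).
Proof.
case=> [<-|->]; first by apply: harm_scale; split; [exact: T_P|exact: box2_T].
by rewrite (_ : (fun _ => _) = fun=> 0); [exact: harm0|apply/funext => W; rewrite mul0r].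
Qed.

Lemma harm_negl n f (k : int) : harm n f -> 0 < k + n%:Z + 2 -> negl r (fun W => \det W ^ k * f W).
Proof.
move=> [pf bf] hk; apply: negl_harmonic hk => //; first exact: P_L pf.
by rewrite bf.
Qed.

Lemma harm_plus n f : harm n f -> harm n (fun V => f (mxplus V)).
Proof.
by move=> [pf bf]; split; [exact: P_plus|rewrite box2_plus ?bf//; exact: P_None pf].
Qed.

(** After inversion the entries are sums of polynomials times N^(-2 - k - n) h (V^+), for which the
    criterion of [harm_negl] becomes -k > 0. *)
Lemma sigma_crude n (k : int) h s t : (forall p q, harm n (h p q)) -> k < 0 ->
  negl r (sigma (fun p q W => \det W ^ k * h p q W) s t).
Proof.
move=> hh k0.
have ng p q : negl r (fun V => V s p * V q t * (\det V ^ (-2 - k - n%:Z) * h p q (mxplus V))).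
  apply: (negl_mul hr); first by apply: P_mul; apply: P_None (P_coord _ _ _).
  by apply: harm_negl (harm_plus (hh p q)) _; lia.
pose G p q V := V s p * V q t * (\det V ^ (-2 - k - n%:Z) * h p q (mxplus V)).
apply: (negl_eqU hr) (negl_add hr (negl_add hr (ng 0 0) (ng 0 1)) (negl_add hr (ng 1 0) (ng 1 1))) _ => V uV.
rewrite /sigma !sum2; have e p q : h p q V^-1 = \det V ^ (- n%:Z) * h p q (mxplus V).
  by rewrite -(P_inv (hh p q).1 uV).
have d0 : \det V != 0 by exact: uV.
rewrite !e det_invHC (_ : (\det V)^-1 ^ k = \det V ^ (- k)) ?exprz_inv// !expfzDr//.
by move: (\det V ^ (- k)) (\det V ^ (- n%:Z)) (\det V ^ (-2)) => x y z; ring.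
Qed.

Definition traceless h := forall Z,
  Z 1 1 * h 0 0 Z - Z 1 0 * h 0 1 Z - Z 0 1 * h 1 0 Z + Z 0 0 * h 1 1 Z = 0.

(** This is -h^+. *)
Definition flat h : 'I_2 -> 'I_2 -> HC R -> R[i] :=
  mx2 (fun V => -1 * h 1 1 V) (h 0 1) (h 1 0) (fun V => -1 * h 0 0 V).

(* [tr (h Z^+) = 0] says that [Z^-1 h Z^+ = flat h]. *)
Lemma sigma_traceless n h s t : (forall p q, harm n (h p q)) -> traceless h ->
  negl r (sigma h s t).
Proof.
move=> hh tr; have hf : harm n (flat h s t).
  by rewrite /flat; case: (ord2_cases s) => ->; case: (ord2_cases t) => ->; rewrite mx2E //; exact: harm_scale.
(* For k = 0 the exponent -2 - n of the crude estimate is the excluded borderline case; one more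
   power of N makes the criterion read 1 > 0. *)
apply: (negl_eqU hr) (harm_negl (k := -1 - n%:Z) (harm_plus hf) _) _ => [|V uV]; first by lia.
have d0 : \det V != 0 by exact: uV.
rewrite expfzDr// -mulrA -(P_inv hf.1 uV) /invo /sigma expN2 exprN1.
have := tr V^-1; rewrite !inv_entry// /mxplus !mx2E -!mulrA -!mulrBr -mulrDr => /eqP.
rewrite mulf_eq0 invr_eq0 (negbTE d0) /= => /eqP e.
apply: (mulfI d0); apply: (mulfI d0); rewrite !mulrA !mulfK// mulfV// mul1r !sum2.
have e2 : \det V = V 0 0 * V 1 1 - V 0 1 * V 1 0 := det2 V.
rewrite {1}e2 /flat; move: e.
case: (ord2_cases s) => ->; case: (ord2_cases t) => ->; rewrite !mx2E;
  move: (h 0 0 V^-1) (h 0 1 V^-1) (h 1 0 V^-1) (h 1 1 V^-1) => x y z w e;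
  have fin c : 0 = - (c * (V 0 0 * x - - V 1 0 * y - - V 0 1 * z + V 1 1 * w)) by rewrite e mulr0 oppr0.
- by apply/subr0_eq; rewrite [RHS](fin (V 0 0)); ring.
- by apply/subr0_eq; rewrite [RHS](fin (V 0 1)); ring.
- by apply/subr0_eq; rewrite [RHS](fin (V 1 0)); ring.
- by apply/subr0_eq; rewrite [RHS](fin (V 1 1)); ring.
Qed.

End Harmonic.

(** * The K-types in terms of generating polynomials *)

Section KTypes.
Variable R : realType.
Implicit Types (f g : HC R -> R[i]) (W X Y Z V : HC R).
Implicit Types h : 'I_2 -> 'I_2 -> HC R -> R[i].

(** The choice q = l + m + 1 is symmetric in the columns m and m + 1 of a K-type: their exponents
    are (p, q - 1) and (p - 1, q), and the edges m = l and m = -l - 1 are p = 0 and q = 0. *)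
Lemma half_nat (l m n : rat) : halfint3 l m n -> - l - 1 <= m <= l -> n <= l ->
  exists p q j : nat, [/\ l - m = p%:R, l + m + 1 = q%:R & l - n = j%:R].
Proof.
move=> /and3P[h1 h2 h3] /andP[m1 m2] n1.
have i1 : l - m \is a Num.int by rewrite -opprB rpredN.
have i2 : l + m + 1 \is a Num.int.
  have -> : l + m + 1 = 2 * l + (m - l) + 1 by ring.
  by rewrite rpredD ?rpred1 // rpredD.
have i3 : l - n \is a Num.int by rewrite -opprB rpredN.
have /natrP[p hp] : l - m \is a Num.nat by rewrite natrEint i1 subr_ge0.
have /natrP[q hq] : l + m + 1 \is a Num.nat by rewrite natrEint i2; lra.
have /natrP[j hj] : l - n \is a Num.nat by rewrite natrEint i3 subr_ge0.
by exists p, q, j.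
Qed.

Section Entries.
Variables (l m n : rat) (p q j : nat).
Hypotheses (hp : l - m = p%:R) (hq : l + m + 1 = q%:R) (hj : l - n = j%:R).

(** The factor q is kept because at the edge q = 0 the truncated q - 1 is meaningless, while both
    sides vanish. *)
Lemma tcoef_q e Z : q%:R * tcoef l (n + e%:R) m Z = q%:R * T e p q.-1 j Z.
Proof.
case: q hq => [|q'] hq'; first by rewrite !mul0r.
congr (_ * _); apply: tcoef_T; rewrite ?natrD //; last by rewrite opprD addrA hj.
by move: hq'; rewrite -hp -[q'.+1%:R]natr1 /=; lra.
Qed.

Lemma tcoef_p e Z : p%:R * tcoef l (n + e%:R) (m + 1) Z = p%:R * T e p.-1 q j Z.
Proof.
case: p hp => [|p'] hp'; first by rewrite !mul0r.
have e1 : l - (m + 1) = p'%:R by move: hp'; rewrite -natr1; lra.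
congr (_ * _); apply: tcoef_T => //; last by rewrite opprD addrA hj.
by rewrite natrD -hq -e1; lra.
Qed.

Lemma ratr_q : ratr (l + m + 1) = q%:R :> R[i]. Proof. by rewrite hq ratr_nat. Qed.
Lemma ratr_p : ratr (l - m) = p%:R :> R[i]. Proof. by rewrite hp ratr_nat. Qed.
Lemma ratr_j : ratr (l - n) = j%:R :> R[i]. Proof. by rewrite hj ratr_nat. Qed.
Lemma ratr_nj : ratr (l + n + 1) = (p + q)%:R - j%:R :> R[i].
Proof.
rewrite (_ : l + n + 1 = (p + q)%:R - j%:R) ?rmorphB ?rmorph_nat//.
by rewrite natrD -hp -hq -hj; ring.
Qed.

Definition hF : 'I_2 -> 'I_2 -> HC R -> R[i] := mx2
  (fun Z => q%:R * j%:R * T 0 p q.-1 j Z)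
  (fun Z => - (p%:R * j%:R) * T 0 p.-1 q j Z)
  (fun Z => q%:R * ((p + q)%:R - j%:R) * T 1 p q.-1 j Z)
  (fun Z => - (p%:R * ((p + q)%:R - j%:R)) * T 1 p.-1 q j Z).

Lemma FtildeE Z a b : Ftilde l m n Z a b = hF a b Z.
Proof.
have t0 m' : tcoef l n m' Z = tcoef l (n + 0%:R) m' Z by rewrite addr0.
have t1 m' : tcoef l (n + 1) m' Z = tcoef l (n + 1%:R) m' Z by [].
rewrite /Ftilde !rmorphM /= ratr_q ratr_p ratr_j ratr_nj !t0 !t1 /hF.
case: (ord2_cases a) => ->; case: (ord2_cases b) => ->; rewrite !mx2E.
- by rewrite mulrAC tcoef_q mulrAC.
- by rewrite !mulNr mulrAC tcoef_p mulrAC.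
- by rewrite mulrAC tcoef_q mulrAC.
- by rewrite !mulNr mulrAC tcoef_p mulrAC.
Qed.

Lemma hF_harm a b : (0 < p + q)%N -> harm (p + q).-1 (hF a b).
Proof.
move=> pq; rewrite /hF; case: (ord2_cases a) => ->; case: (ord2_cases b) => ->; rewrite !mx2E; apply: harm_T.
- by case: (q) => [|q']; [right; rewrite !mul0r|left; lia].
- by case: (p) => [|p']; [right; rewrite !mul0r oppr0|left; lia].
- by case: (q) => [|q']; [right; rewrite !mul0r|left; lia].
- by case: (p) => [|p']; [right; rewrite !mul0r oppr0|left; lia].
Qed.

(** The combination j times [T_euler'] minus p + q - j times [T_euler]. *)
Lemma hF_traceless : traceless hF.
Proof.
move=> Z; rewrite /hF !mx2E.
transitivity (j%:R * (p%:R * (Z 1 0 * T 0 p.-1 q j Z) + q%:R * (Z 1 1 * T 0 p q.-1 j Z))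
  - ((p + q)%:R - j%:R) * (p%:R * (Z 0 0 * T 1 p.-1 q j Z) + q%:R * (Z 0 1 * T 1 p q.-1 j Z))).
  by ring.
by rewrite -T_euler -T_euler'; ring.
Qed.

Definition hH : 'I_2 -> 'I_2 -> HC R -> R[i] := mx2
  (fun Z => q%:R * T 0 p q.-1 j Z) (fun Z => - p%:R * T 0 p.-1 q j Z)
  (fun Z => - q%:R * T 1 p q.-1 j Z) (fun Z => p%:R * T 1 p.-1 q j Z).

Lemma HtildeE Z a b : Htilde l m n Z a b = hH a b Z.
Proof.
have t0 m' : tcoef l n m' Z = tcoef l (n + 0%:R) m' Z by rewrite addr0.
have t1 m' : tcoef l (n + 1) m' Z = tcoef l (n + 1%:R) m' Z by [].
rewrite /Htilde ratr_q ratr_p !t0 !t1 /hH.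
by case: (ord2_cases a) => ->; case: (ord2_cases b) => ->; rewrite !mx2E ?mulNr ?tcoef_q ?tcoef_p.
Qed.

Lemma hH_harm a b : (0 < p + q)%N -> harm (p + q).-1 (hH a b).
Proof.
move=> pq; rewrite /hH; case: (ord2_cases a) => ->; case: (ord2_cases b) => ->; rewrite !mx2E; apply: harm_T.
- by case: (q) => [|q']; [right|left; lia].
- by case: (p) => [|p']; [right; rewrite oppr0|left; lia].
- by case: (q) => [|q']; [right; rewrite oppr0|left; lia].
- by case: (p) => [|p']; [right|left; lia].
Qed.

(** H is half of ∇^+ t^(l + 1/2), as p + q = 2 l + 1. *)
Lemma hH_nbp a b Z : nbp a b (T 0 p q j) Z = 2 * hH a b Z.
Proof.
rewrite /nbp /hH; case: (ord2_cases a) => ->; case: (ord2_cases b) => ->;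
  by rewrite !sub1ord !pd_T !mx2E /=; ring.
Qed.

Definition hM : 'I_2 -> 'I_2 -> HC R -> R[i] := mx2
  (fun Z => j.+1%:R * T 0 p.+1 q j.+1 Z) (fun Z => j.+1%:R * T 0 p q.+1 j.+1 Z)
  (fun Z => ((p + q).+1%:R - j%:R) * T 0 p.+1 q j Z) (fun Z => ((p + q).+1%:R - j%:R) * T 0 p q.+1 j Z).

(** [hM] is the second matrix in the definition of I, made of t^(l+1). Euler's relations lower it to
    t^(l + 1/2), which makes I recognizable as a gradient. *)
Lemma hM_hH Z a b : hM a b Z = (p + q).+1%:R * Z a b * T 0 p q j Z - \det Z * hH a b Z.
Proof.
have Tq e : q%:R * T e p q j Z = q%:R * (Z 0 1 * T e.+1 p q.-1 j Z + Z 1 1 * T e p q.-1 j Z).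
  by case: (q) => [|q']; rewrite ?mul0r// T_q.
have Tp e : p%:R * T e p q j Z = p%:R * (Z 0 0 * T e.+1 p.-1 q j Z + Z 1 0 * T e p.-1 q j Z).
  by case: (p) => [|p']; rewrite ?mul0r// T_p.
have s1 : (p + q).+1%:R = p%:R + q%:R + 1 :> R[i] by rewrite -natr1 natrD.
rewrite /hM /hH det2; case: (ord2_cases a) => ->; case: (ord2_cases b) => ->; rewrite !mx2E.
- rewrite T_euler !T_shift T_p -[p.+1.-1]/p -[p.+1%:R]natr1 s1.
  transitivity ((p%:R + 1) * (Z 0 0 * T 0 p q j Z) + q%:R * (Z 0 1 * (Z 0 0 * T 1 p q.-1 j Z + Z 1 0 * T 0 p q.-1 j Z))) => //.
  transitivity ((p%:R + 1) * (Z 0 0 * T 0 p q j Z) + Z 0 0 * (q%:R * T 0 p q j Z) - (Z 0 0 * Z 1 1 - Z 0 1 * Z 1 0) * (q%:R * T 0 p q.-1 j Z)).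
    by rewrite Tq; ring.
  by ring.
- rewrite T_euler !T_shift T_q -[q.+1.-1]/q -[q.+1%:R]natr1 s1.
  transitivity ((q%:R + 1) * (Z 0 1 * T 0 p q j Z) + Z 0 1 * (p%:R * T 0 p q j Z) + (Z 0 0 * Z 1 1 - Z 0 1 * Z 1 0) * (p%:R * T 0 p.-1 q j Z)).
    by rewrite Tp; ring.
  by ring.
- rewrite mulrBl -addSn T_euler' T_p -[p.+1.-1]/p -[p.+1%:R]natr1 addSn s1.
  transitivity ((p%:R + 1) * (Z 1 0 * T 0 p q j Z) + Z 1 0 * (q%:R * T 0 p q j Z) + (Z 0 0 * Z 1 1 - Z 0 1 * Z 1 0) * (q%:R * T 1 p q.-1 j Z)).
    by rewrite Tq; ring.
  by ring.
- rewrite mulrBl -addnS T_euler' T_q -[q.+1.-1]/q -[q.+1%:R]natr1 addnS s1.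
  transitivity ((q%:R + 1) * (Z 1 1 * T 0 p q j Z) + Z 1 1 * (p%:R * T 0 p q j Z) - (Z 0 0 * Z 1 1 - Z 0 1 * Z 1 0) * (p%:R * T 1 p.-1 q j Z)).
    by rewrite Tp; ring.
  by ring.
Qed.

(** The potential is (l + 1) N^k t^(l + 1/2). By [hM_hH] the terms k N^k H cancel, and what is left
    is (2 l + 2) (N^k H + k N^(k-1) t Z), where ∇^+ N^k = 2 k N^(k-1) Z and ∇^+ t = 2 H. *)
Lemma ItildeE k Z a b : HCunits Z -> Itilde k l m n Z a b =
  nbp a b (fun V => ((p + q).+1%:R / 2) * (\det V ^ k * T 0 p q j V)) Z.
Proof.
move=> uZ; have d0 : \det Z != 0 by exact: uZ.
have hl : 2 * l + 1 = (p + q)%:R by rewrite natrD -hp -hq; ring.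
have tM : (mx2 (ratr (l - n + 1) * tcoef (l + 1) n m Z)
        (ratr (l - n + 1) * tcoef (l + 1) n (m + 1) Z)
        (ratr (l + n + 2) * tcoef (l + 1) (n + 1) m Z)
        (ratr (l + n + 2) * tcoef (l + 1) (n + 1) (m + 1) Z)) a b = hM a b Z.
  have c1 : ratr (l - n + 1) = j.+1%:R :> R[i] by rewrite hj natr1 ratr_nat.
  have c2 : ratr (l + n + 2) = (p + q).+1%:R - j%:R :> R[i].
    rewrite (_ : l + n + 2 = (p + q).+1%:R - j%:R) ?rmorphB ?rmorph_nat//.
    by rewrite -[(p + q).+1%:R]natr1 natrD -hp -hq -hj; ring.
  have e1 N : (N.+1%:R : rat) = N%:R + 1 by rewrite -natr1.
  have e2 : ((p + q)%:R : rat) = p%:R + q%:R by rewrite natrD.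
  rewrite c1 c2 /hM; case: (ord2_cases a) => ->; case: (ord2_cases b) => ->; rewrite !mx2E; congr (_ * _).
  - by apply: tcoef_T; rewrite ?subr0 ?addSn ?addnS ?(e1 p) ?(e1 q) ?(e1 j) ?(e1 (p + q)%N) ?e2 -?hp -?hq -?hj; ring.
  - by apply: tcoef_T; rewrite ?subr0 ?addSn ?addnS ?(e1 p) ?(e1 q) ?(e1 j) ?(e1 (p + q)%N) ?e2 -?hp -?hq -?hj; ring.
  - by apply: tcoef_T; rewrite ?subr0 ?addSn ?addnS ?(e1 p) ?(e1 q) ?(e1 j) ?(e1 (p + q)%N) ?e2 -?hp -?hq -?hj; ring.
  - by apply: tcoef_T; rewrite ?subr0 ?addSn ?addnS ?(e1 p) ?(e1 q) ?(e1 j) ?(e1 (p + q)%N) ?e2 -?hp -?hq -?hj; ring.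
have ck : ratr (2 * l + k%:~R + 2) = (p + q).+1%:R + k%:~R :> R[i].
  rewrite (_ : 2 * l + k%:~R + 2 = (p + q).+1%:R + k%:~R) ?rmorphD ?rmorph_nat ?rmorph_int//.
  by rewrite -[(p + q).+1%:R]natr1 -hl; ring.
rewrite /Itilde mxE [X in X + _]mxE [X in _ + X]mxE tM HtildeE ck hM_hH.
have lT : L None (T 0 p q j : HC R -> _) by exact: P_LN (T_P _ _ _ _ _).
have ld : L None (fun V : HC R => \det V ^ k) by exact: L_None (L_detz _ _).
have lm : L None (fun V : HC R => \det V ^ k * T 0 p q j V) by exact: L_mul.
rewrite nbp_c (pdZ _ _ _ lm uZ) (pdM _ _ ld lT uZ) (pd_detz _ _ _ uZ).
have := hH_nbp a b Z; rewrite nbp_c.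
have -> : mxplus Z (1 - b) (1 - a) = (if a == b then 1 else -1) * Z a b.
  by case: (ord2_cases a) => ->; case: (ord2_cases b) => ->; rewrite ?sub1ord /mxplus !mx2E /=; ring.
have -> : \det Z ^ k = \det Z ^ (k - 1) * \det Z by rewrite -[X in _ * X]expr1z -expfzDr// subrK.
move: (\det Z ^ (k - 1)) (k%:~R : R[i]) ((p + q).+1%:R : R[i]) => u c N.
move: (pd _ _ _ Z) (hH a b Z) (Z a b) (\det Z) (T 0 p q j Z) => x y z d t.
have h2 : y = 2^-1 * (2 * y) by field.
by case: eqP => _ e; rewrite h2 -e; field.
Qed.

End Entries.

Section Entries2.
Variables (l m n : rat) (p q j : nat).
Hypotheses (hp : l - m = p%:R) (hq : l + m + 1 = q%:R) (hj : l - n = j%:R).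
Hypotheses (p0 : (0 < p)%N) (q0 : (0 < q)%N).

Definition hG : 'I_2 -> 'I_2 -> HC R -> R[i] := mx2
  (fun Z => 1 * T 0 p q.-1 j Z) (fun Z => 1 * T 0 p.-1 q j Z)
  (fun Z => -1 * T 1 p q.-1 j Z) (fun Z => -1 * T 1 p.-1 q j Z).

Lemma tcoef_q0 e Z : tcoef l (n + e%:R) m Z = T e p q.-1 j Z :> R[i].
Proof.
have q1 : (q%:R : R[i]) != 0 by rewrite pnatr_eq0 -lt0n.
by apply: (mulfI q1); apply: tcoef_q.
Qed.

Lemma tcoef_p0 e Z : tcoef l (n + e%:R) (m + 1) Z = T e p.-1 q j Z :> R[i].
Proof.
have q1 : (p%:R : R[i]) != 0 by rewrite pnatr_eq0 -lt0n.
by apply: (mulfI q1); apply: tcoef_p.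
Qed.

Lemma GtildeE Z a b : Gtilde l m n Z a b = hG a b Z.
Proof.
have t0 m' : tcoef l n m' Z = tcoef l (n + 0%:R) m' Z by rewrite addr0.
have t1 m' : tcoef l (n + 1) m' Z = tcoef l (n + 1%:R) m' Z by [].
rewrite /Gtilde !t0 !t1 !tcoef_q0 !tcoef_p0 /hG.
by case: (ord2_cases a) => ->; case: (ord2_cases b) => ->; rewrite !mx2E ?mul1r ?mulN1r.
Qed.

Lemma hG_harm a b : harm (p + q).-1 (hG a b).
Proof.
by rewrite /hG; case: (ord2_cases a) => ->; case: (ord2_cases b) => ->; rewrite !mx2E;
  apply: harm_T; left; lia.
Qed.

(** The polynomial [T 0 p q j] expands along a linear factor of either column; the trace is the
    difference of the two expansions. *)
Lemma hG_traceless : traceless hG.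
Proof.
move=> Z; rewrite /hG !mx2E; have := T_q 0 p q.-1 j Z; have := T_p 0 p.-1 q j Z.
rewrite !prednK// => -> e.
transitivity ((Z 0 1 * T 1 p q.-1 j Z + Z 1 1 * T 0 p q.-1 j Z) - (Z 0 0 * T 1 p.-1 q j Z + Z 1 0 * T 0 p.-1 q j Z)).
  by ring.
by rewrite -e subrr.
Qed.

Definition hJ : 'I_2 -> 'I_2 -> HC R -> R[i] := mx2
  (fun Z => ratr (l - n) * T 0 p q.-1 j Z) (fun Z => ratr (l - n) * T 0 p.-1 q j Z)
  (fun Z => ratr (l + n + 1) * T 1 p q.-1 j Z) (fun Z => ratr (l + n + 1) * T 1 p.-1 q j Z).

Lemma JtildeE Z a b : Jtilde l m n Z a b = \det Z ^ (-1) * hJ a b Z.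
Proof.
have t0 m' : tcoef l n m' Z = tcoef l (n + 0%:R) m' Z by rewrite addr0.
have t1 m' : tcoef l (n + 1) m' Z = tcoef l (n + 1%:R) m' Z by [].
rewrite /Jtilde mxE exprN1 !t0 !t1 !tcoef_q0 !tcoef_p0 /hJ; congr (_ * _).
by case: (ord2_cases a) => ->; case: (ord2_cases b) => ->; rewrite !mx2E.
Qed.

Lemma hJ_harm a b : harm (p + q).-1 (hJ a b).
Proof.
by rewrite /hJ; case: (ord2_cases a) => ->; case: (ord2_cases b) => ->; rewrite !mx2E;
  apply: harm_T; left; lia.
Qed.

End Entries2.

Lemma eq_rat_pred (l m n : rat) (p q j : nat) : l - m = p%:R -> l + m + 1 = q%:R -> 2 * l + 1 = (p + q)%:R.
Proof. by move=> hp hq; rewrite natrD -hp -hq; ring. Qed.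

(* The degree n of the entries of h is 2 l. *)
Lemma Kfun_shape b : Kvalid b ->
  (exists2 f, L None f & forall i j, eqU (fun W : HC R => Kfun b W i j) (nbp i j f)) \/
  exists (k : int) (n : nat) h, [/\ forall i j, harm n (h i j),
    forall W i j, Kfun b W i j = \det W ^ k * h i j W,
    ~~ in_Qminus b -> 0 < k + n%:Z + 2 &
    ~~ in_Qplus b -> k < 0 \/ (k = 0 /\ traceless h)].
Proof.
(* N is 2 l + 1 and the entries have degree N - 1 = 2 l; the complement of k <= -(2 l + 2) is
   exactly the criterion k + 2 l + 2 > 0. *)
have deg (k : int) (l : rat) (N : nat) : 2 * l + 1 = N%:R -> (0 < N)%N -> ~~ (k%:~R <= - (2 * l + 2)) -> 0 < k + N.-1%:Z + 2.
  move=> e N0; rewrite -ltNge (_ : - _ = (- (N%:Z + 1))%:~R); last by rewrite rmorphN rmorphD /= -pmulrn -e; ring.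
  by rewrite ltr_int; lia.
have pos (k : int) : ~~ (1 <= k) -> k < 0 \/ k = 0 by lia.
case: b => [k l m n|k l m n|k l m n|k l m n|l m n] /=.
- move=> /and4P[h3 l1 hm /andP[n1 n2]]; right.
  have [|p [q [j [hp hq hj]]]] := half_nat h3 hm; first by lra.
  have el := eq_rat_pred n j hp hq.
  have pq : (0 < p + q)%N by rewrite lt0n; apply/eqP => e; move: el; rewrite e; lra.
  exists k, (p + q).-1, (hF p q j); split.
  + by move=> *; exact: hF_harm.
  + by move=> W i j'; rewrite mxE (FtildeE hp hq hj).
  + exact: deg.
  + by move/pos => [|]; [left|right; split=> //; exact: hF_traceless].
- move=> /and4P[h3 l1 /andP[m1 m2] /andP[n1 n2]]; right.
  have [|p [q [j [hp hq hj]]]] := half_nat h3 (_ : - l - 1 <= m <= l) n2; first by apply/andP; split; lra.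
  have el := eq_rat_pred n j hp hq.
  have p0 : (0 < p)%N by rewrite -(ltr_nat rat) -hp; lra.
  have q0 : (0 < q)%N by rewrite -(ltr_nat rat) -hq; lra.
  exists k, (p + q).-1, (hG p q j); split.
  + by move=> *; exact: hG_harm.
  + by move=> W i j'; rewrite mxE (GtildeE hp hq hj).
  + by apply: deg => //; lia.
  + by move/pos => [|]; [left|right; split=> //; exact: hG_traceless].
- move=> /and4P[h3 l1 hm /andP[n1 n2]].
  have [p [q [j [hp hq hj]]]] := half_nat h3 hm n2.
  have el := eq_rat_pred n j hp hq.
  have pq : (0 < p + q)%N by rewrite lt0n; apply/eqP => e; move: el; rewrite e; lra.
  (* H is not traceless, so the borderline case k = 0 is settled by the fact that H is a
     gradient. *)
  have [->|k0] := eqVneq k 0.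
    left; exists (fun W => 2^-1 * T 0 p q j W); first by apply: L_scale; exact: P_LN (T_P _ _ _ _ _).
    move=> i j' W _; rewrite expr0z scale1r (HtildeE hp hq hj) nbp_c pd_TZ.
    by have := hH_nbp p q j i j' W; rewrite nbp_c => e; field: e.
  right; exists k, (p + q).-1, (hH p q j); split.
  + by move=> *; exact: hH_harm.
  + by move=> W i j'; rewrite mxE (HtildeE hp hq hj).
  + exact: deg.
  + by move/pos => [|e]; [left|rewrite e in k0].
- move=> /and5P[k0 h3 l1 hm /andP[n1 n2]]; left.
  have [p [q [j [hp hq hj]]]] := half_nat h3 hm n2.
  exists (fun V => ((p + q).+1%:R / 2) * (\det V ^ k * T 0 p q j V)).
    by apply: L_scale; apply: L_mul; [exact: L_None (L_detz _ _)|exact: P_LN (T_P _ _ _ _ _)].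
  by move=> i j' W uW; rewrite (ItildeE hp hq hj).
- move=> /and4P[h3 l1 /andP[m1 m2] /andP[n1 n2]]; right.
  have [||p [q [j [hp hq hj]]]] := half_nat h3 (_ : - l - 1 <= m <= l) (_ : n <= l); [by apply/andP; split; lra|by lra|].
  have p0 : (0 < p)%N by rewrite -(ltr_nat rat) -hp; lra.
  have q0 : (0 < q)%N by rewrite -(ltr_nat rat) -hq; lra.
  exists (-1), (p + q).-1, (hJ l n p q j); split.
  + by move=> *; exact: hJ_harm.
  + by move=> W i j'; rewrite (JtildeE hp hq hj).
  + by move=> _; lia.
  + by left.
Qed.

End KTypes.

(** * Annihilation of the K-types outside Q'^+ and Q'^- *)

Section Annihilate.
Variables (R : realType) (r : R).
Hypothesis hr : 0 < r.
Implicit Types (W Z : HC R) (F : HC R -> HC R).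

Lemma Kfun_L b : Kvalid b -> forall i j, L None (fun W : HC R => Kfun b W i j).
Proof.
move=> hb i j; case: (Kfun_shape R hb) => [[f lf e]|[k [n [h [hh e _ _]]]]].
  by apply: L_ext (_ : L None (nbp i j f)) _ => [|W uW]; [apply: L_scale; exact: L_pdN|rewrite e].
apply: L_ext (L_mul (L_None (L_detz _ k)) (P_LN (hh i j).1)) _ => W _; by rewrite e.
Qed.

Lemma J_zero_plus b Z1 Z2 : Kvalid b -> ~~ in_Qplus b -> Dplus r Z1 -> Dplus r Z2 ->
  J r (Kfun b) Z1 Z2 = 0.
Proof.
move=> hb qb h1 h2; have lF := Kfun_L hb.
have [D fD] := exists_far hr lF.
apply/matrixP => i j; rewrite (J_series_plus hr lF fD h1 h2) mxE; apply/eqP; rewrite mulf_eq0; apply/orP; right; apply/eqP.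
apply: big1 => a _; apply: big1 => c _.
have lA Z m i' p : L None (Aplus Z m i' p) := L_None (Aplus_L Z m i' p).
case: (Kfun_shape R hb) => [[f lf e]|[k [n [h [hh e _ hq]]]]].
  rewrite -[RHS](term_stokes hr i j (lA Z1 a) (lA Z2 c) (rowfree_plus Z1 a) (colfree_plus Z2 c) lf).
  by apply: eq_bigr => p _; apply: eq_bigr => q _; apply: (term_eqU hr).
apply: (term_sigma hr (F := fun p q W => Kfun b W p q)) => // [||s t].
- exact: hatR_plus.
- exact: hatL_plus.
rewrite (_ : (fun p q W => Kfun b W p q) = fun p q W => \det W ^ k * h p q W); last first.
  by apply/funext => p; apply/funext => q; apply/funext => W.
case: (hq qb) => [k0|[-> tr]]; first exact: (sigma_crude hr _ _ hh k0).
rewrite (_ : (fun p q W => _) = h); first exact: (sigma_traceless hr _ _ hh tr).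
by apply/funext => p; apply/funext => q; apply/funext => W; rewrite expr0z mul1r.
Qed.

Lemma J_zero_minus b Z1 Z2 : Kvalid b -> ~~ in_Qminus b -> Dminus r Z1 -> Dminus r Z2 ->
  J r (Kfun b) Z1 Z2 = 0.
Proof.
move=> hb qb h1 h2; have lF := Kfun_L hb.
have [u1 _] := conv_minus hr h1; have [u2 _] := conv_minus hr h2.
have [D fD] := exists_far hr lF.
apply/matrixP => i j; rewrite (J_series_minus hr lF fD h1 h2) mxE; apply/eqP; rewrite mulf_eq0; apply/orP; right; apply/eqP.
apply: big1 => a _; apply: big1 => c _.
have pA Z m : HCunits Z -> forall i p, P None (Aminus Z m i p).
  by move=> uZ i' p; exact: P_None (Aminus_P _ _ _ uZ).
have lA Z m : HCunits Z -> forall i p, L None (Aminus Z m i p).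
  by move=> uZ i' p; exact: P_LN (Aminus_P _ _ _ uZ).
case: (Kfun_shape R hb) => [[f lf e]|[k [n [h [hh e hq _]]]]].
  rewrite -[RHS](term_stokes hr i j (lA Z1 a u1) (lA Z2 c u2) (rowfree_minus a u1) (colfree_minus c u2) lf).
  by apply: eq_bigr => p _; apply: eq_bigr => q _; apply: (term_eqU hr).
apply: big1 => p _; apply: big1 => q _; apply: (term_negl hr _ _ _ _ (pA Z1 a u1) (pA Z2 c u2)).
by apply: (negl_eqU hr) (harm_negl hr (hh p q) (hq qb)) _ => W _; rewrite e.
Qed.

End Annihilate.

(** * Tensor products *)

Section Tensor.
Variable R : realType.
Implicit Types (f g : HC R -> R[i]) (W X Y Z : HC R) (i j s : 'I_2).

(** Both factors are linear combinations of the columns and of the rows of g. A linear condition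
    that g satisfies in one index therefore passes to each factor separately. *)
Lemma rank_factorization (S1 S2 : finType) (g : S1 -> S2 -> R[i]) :
  exists (n : nat) (al : 'I_n -> S1 -> R[i]) (be : 'I_n -> S2 -> R[i])
    (ga : 'I_n -> S2 -> R[i]) (de : 'I_n -> S1 -> R[i]),
  [/\ forall x y, g x y = \sum_k al k x * be k y,
      forall k x, al k x = \sum_y g x y * ga k y &
      forall k y, be k y = \sum_x de k x * g x y].
Proof.
pose G : 'M[R[i]]_(#|S1|, #|S2|) := \matrix_(x, y) g (enum_val x) (enum_val y).
have [B hB] := row_freeP (row_base_free G); have [A hA] := row_fullP (col_base_full G).
have eA : col_base G = G *m B.
  by have := congr1 (mulmx^~ B) (mulmx_base G); rewrite -mulmxA hB mulmx1.
have eB : row_base G = A *m G.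
  by have := congr1 (mulmx A) (mulmx_base G); rewrite mulmxA hA mul1mx.
exists (\rank G), (fun k x => col_base G (enum_rank x) k), (fun k y => row_base G k (enum_rank y)),
  (fun k y => B (enum_rank y) k), (fun k x => A k (enum_rank x)); split=> [x y|k x|k y].
- have := congr1 (fun M : 'M[R[i]]_(#|S1|, #|S2|) => M (enum_rank x) (enum_rank y)) (mulmx_base G).
  by rewrite !mxE !enum_rankK => <-.
- rewrite eA mxE (reindex _ (onW_bij _ (@enum_rank_bij S2))); apply: eq_bigr => y _.
  by rewrite mxE !enum_rankK.
- rewrite eB mxE (reindex _ (onW_bij _ (@enum_rank_bij S1))); apply: eq_bigr => x _.
  by rewrite mxE !enum_rankK.
Qed.

Lemma span_on_add D S f g : @span_on R D S f -> @span_on R D S g -> @span_on R D S (fun Z => f Z + g Z).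
Proof.
move=> [n [c [u [hu e]]]] [n' [c' [u' [hu' e']]]].
exists (n + n')%N, (fun k => match fintype.split k with inl a => c a | inr a => c' a end),
  (fun k => match fintype.split k with inl a => u a | inr a => u' a end); split=> [k|Z DZ].
  by case: fintype.split.
rewrite big_split_ord e// e'//; congr (_ + _); apply: eq_bigr => a _.
  by rewrite (unsplitK (inl _ a)).
by rewrite (unsplitK (inr _ a)).
Qed.

Lemma P_polyfun f : P None f -> polyfun f.
Proof.
elim=> {f} [z a b c d _|f g _ ihf _ ihg]; last exact: span_on_add.
exists 1%N, (fun=> z), (fun=> pmon a b c d); split=> [_|Z _]; last by rewrite big_ord1.
exists (mx2 a b c d); apply/funext => Z.
have l1 : lift ord0 ord0 = 1 :> 'I_2 by exact/val_inj.
by rewrite /monomial !big_ord_recl !big_ord0 l1 !mx2E !mulr1 !mulrA.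
Qed.

Lemma in_tensor_add V V' D G H : @in_tensor R V V' D G -> in_tensor V V' D H ->
  in_tensor V V' D (fun Z1 Z2 => G Z1 Z2 + H Z1 Z2).
Proof.
move=> [n [c [u [hc hu e]]]] [n' [c' [u' [hc' hu' e']]]].
exists (n + n')%N, (fun k => match fintype.split k with inl a => c a | inr a => c' a end),
  (fun k => match fintype.split k with inl a => u a | inr a => u' a end).
split=> [k|k|Z1 Z2 D1 D2]; [by case: fintype.split|by case: fintype.split|].
rewrite big_split_ord e// e'//; congr (_ + _); apply: eq_bigr => a _.
  by rewrite (unsplitK (inl _ a)).
by rewrite (unsplitK (inr _ a)).
Qed.

Lemma in_tensor_sum V V' D (I : Type) (r : seq I) G : (forall a, @in_tensor R V V' D (G a)) ->
  in_tensor V V' D (fun Z1 Z2 => \sum_(a <- r) G a Z1 Z2).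
Proof.
move=> h; elim: r => [|a r ih].
  exists 0%N, (fun _ _ => 0), (fun _ _ => 0); split=> [[]|[]|Z1 Z2 _ _] //.
  by rewrite big_nil big_ord0.
have [n [v [v' [hv hv' e]]]] := in_tensor_add (h a) ih.
by exists n, v, v'; split=> // Z1 Z2 D1 D2; rewrite big_cons e.
Qed.

Lemma in_tensor_eq V V' D G H : @in_tensor R V V' D G ->
  (forall Z1 Z2, D Z1 -> D Z2 -> H Z1 Z2 = G Z1 Z2) -> in_tensor V V' D H.
Proof. by move=> [n [v [v' [hv hv' e]]]] h; exists n, v, v'; split=> // *; rewrite h// e. Qed.

Lemma pd_PD f g i j : P None f -> P None g ->
  pd i j (fun V => f V + g V) = fun V => pd i j f V + pd i j g V.
Proof.
by move=> pf pg; apply/funext => V; apply: isd_pd; apply: isdD; [exact: P_isd pf|exact: P_isd pg].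
Qed.

(** The functionals act in W, so polynomiality and the Dirac equation in Z come from the Taylor
    terms of the columns of K alone. *)
Lemma Vplus_linear (l : 'I_2 -> (HC R -> R[i]) -> R[i]) a : (forall p, linear_on_L (l p)) ->
  Vplus (fun Z => \col_i \sum_p l p (E a Z (K i p))).
Proof.
move=> hl.
have pP i p : P None (fun Z => l p (E a Z (K i p))).
  by apply: P_None (linear_E_P a (hl p) _); exact: K_LN.
split=> [i|Z s].
  by apply: P_polyfun; apply: P_eq (P_sum _ (fun p _ => pP i p)) _; apply/funext => Z; rewrite mxE.
have dv p := div_linear_E (I := 'I_2) (c := fun k => if s == k then 2 else -2) (x := fun=> 1 - s)
  (y := fun k => 1 - k) (fun k => K_LN _ _ _) (nbp_K_col s p) a Z (hl p).
transitivity (\sum_k nbp s k (fun Y => l 0 (E a Y (K k 0)) + l 1 (E a Y (K k 1))) Z).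
  apply: eq_bigr => k _; rewrite nablaplusE; congr (nbp _ _ _ _); apply/funext => Y.
  by rewrite mxE sum2.
have d0 := dv 0; have d1 := dv 1; rewrite !sum2 /= in d0 d1.
rewrite sum2 /nbp !pd_PD// -[RHS]addr0; apply: etrans (congr2 +%R d0 d1); rewrite !mulrDr; exact: addrACA.
Qed.

Lemma V'plus_linear (l : 'I_2 -> (HC R -> R[i]) -> R[i]) a : (forall q, linear_on_L (l q)) ->
  V'plus (fun Z => \row_j \sum_q l q (E a Z (K q j))).
Proof.
move=> hl.
have pP j q : P None (fun Z => l q (E a Z (K q j))).
  by apply: P_None (linear_E_P a (hl q) _); exact: K_LN.
split=> [j|Z s].
  by apply: P_polyfun; apply: P_eq (P_sum _ (fun q _ => pP j q)) _; apply/funext => Z; rewrite mxE.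
have dv p := div_linear_E (I := 'I_2) (c := fun k => if k == s then 2 else -2) (x := fun k => 1 - k)
  (y := fun=> 1 - s) (fun k => K_LN _ _ _) (nbp_K_row p s) a Z (hl p).
transitivity (\sum_k nbp k s (fun Y => l 0 (E a Y (K 0 k)) + l 1 (E a Y (K 1 k))) Z).
  apply: eq_bigr => k _; rewrite nablaplusE; congr (nbp _ _ _ _); apply/funext => Y.
  by rewrite mxE sum2.
have d0 := dv 0; have d1 := dv 1; rewrite !sum2 /= in d0 d1.
rewrite sum2 /nbp !pd_PD// -[RHS]addr0; apply: etrans (congr2 +%R d0 d1); rewrite !mulrDr; exact: addrACA.
Qed.

Section TensorPlus.
Variable r : R.
Hypothesis hr : 0 < r.

Lemma in_tensor_plus (F : HC R -> HC R) : (forall p q, L None (fun W => F W p q)) ->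
  in_tensor (@Vplus R) (@V'plus R) (Dplus r) (J r F).
Proof.
move=> lF; have [D fD] := exists_far hr lF.
pose G (a b : 'I_D) Z1 Z2 : HC R := \matrix_(i, j) (cJ R * \sum_p \sum_q
   term r (Aplus Z1 a) (Aplus Z2 b) (fun W => F W p q) i p q j).
apply: (@in_tensor_eq _ _ _ (fun Z1 Z2 => \sum_a \sum_b G a b Z1 Z2)); last first.
  move=> Z1 Z2 h1 h2; apply/matrixP => i j; rewrite (J_series_plus hr lF fD h1 h2).
  rewrite summxE mulr_sumr; apply: eq_bigr => a _; rewrite summxE mulr_sumr.
  by apply: eq_bigr => b _; rewrite mxE.
apply: in_tensor_sum => a; apply: in_tensor_sum => b; rewrite /G {G}.
have [I1 [m1 [d1 [pm1 dd1 e1]]]] := E_expand R a.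
have [I2 [m2 [d2 [pm2 dd2 e2]]]] := E_expand R b.
have l1 x i p : L None (d1 x (K i p)) by apply: Dop_LN (dd1 x) _; exact: K_LN.
have l2 x i p : L None (d2 x (K i p)) by apply: Dop_LN (dd2 x) _; exact: K_LN.
(* The coefficient matrix of one term of the double series: x holds a derivative from the first
   expansion with the indices p and i, y one from the second with q and j. *)
pose g (x : I1 * 'I_2 * 'I_2) (y : I2 * 'I_2 * 'I_2) := cJ R * Lam r (fun W =>
  d1 x.1.1 (K x.2 x.1.2) W * F W x.1.2 y.1.2 * d2 y.1.1 (K y.1.2 y.2) W).
have [n [al [be [ga [de [eg ea eb]]]]]] := rank_factorization g.
have lam_lin (c : R[i]) h : L None h -> linear_on_L (fun f => c * Lam r (fun W => f W * h W)).
  move=> lh; have [lD lZ le] := Lam_linear_mul hr lh; split.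
  - by move=> f f' lf lf'; rewrite lD// mulrDr.
  - by move=> z f lf; rewrite lZ// mulrCA.
  - by move=> f f' lf ef; rewrite (le f f').
have sum_lin (I : finType) (u : I -> (HC R -> R[i]) -> R[i]) : (forall x, linear_on_L (u x)) ->
    linear_on_L (fun f => \sum_x u x f).
  move=> hu; split.
  - by move=> f f' lf lf'; rewrite -big_split; apply: eq_bigr => x _; have [lD _ _] := hu x; rewrite lD.
  - by move=> z f lf; rewrite mulr_sumr; apply: eq_bigr => x _; have [_ lZ _] := hu x; rewrite lZ.
  - by move=> f f' lf ef; apply: eq_bigr => x _; have [_ _ le] := hu x; rewrite (le f f').
(* The weights [ga] and [de] turn the factors of g into integrals of K against Laurent functions,
   hence into elements of V^+ and V'^+. *)
pose la k p f := \sum_(y : I2 * 'I_2 * 'I_2) (cJ R * ga k y) * Lam r (fun W =>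
  f W * (F W p y.1.2 * d2 y.1.1 (K y.1.2 y.2) W)).
pose lb k q f := \sum_(x : I1 * 'I_2 * 'I_2) (cJ R * de k x) * Lam r (fun W =>
  f W * (d1 x.1.1 (K x.2 x.1.2) W * F W x.1.2 q)).
have hla k p : linear_on_L (la k p) by apply: sum_lin => y; apply: lam_lin; apply: L_mul.
have hlb k q : linear_on_L (lb k q) by apply: sum_lin => y; apply: lam_lin; apply: L_mul.
have ela k Z i : \sum_p la k p (E a Z (K i p)) = \sum_p \sum_x m1 x Z * al k (x, p, i).
  apply: eq_bigr => p _; have [lD lZ le] := hla k p.
  rewrite (le _ (fun W => \sum_x m1 x Z * d1 x (K i p) W)); last 2 first.
  - by apply: E_LN; exact: K_LN.
  - by move=> W uW; rewrite (e1 _ _ _ _ uW)//; exact: K_LN.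
  rewrite linear_on_L_sum// => [|x _]; last exact: L_scale.
  apply: eq_bigr => x _; rewrite lZ// ea; congr (_ * _); apply: eq_bigr => y _.
  by rewrite /g mulrAC; congr (_ * _ * _); apply: (Lam_eqU hr) => W _; rewrite mulrA.
have elb k Z j : \sum_q lb k q (E b Z (K q j)) = \sum_q \sum_y m2 y Z * be k (y, q, j).
  apply: eq_bigr => q _; have [lD lZ le] := hlb k q.
  rewrite (le _ (fun W => \sum_x m2 x Z * d2 x (K q j) W)); last 2 first.
  - by apply: E_LN; exact: K_LN.
  - by move=> W uW; rewrite (e2 _ _ _ _ uW)//; exact: K_LN.
  rewrite linear_on_L_sum// => [|x _]; last exact: L_scale.
  apply: eq_bigr => x _; rewrite lZ// eb; congr (_ * _); apply: eq_bigr => y _.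
  by rewrite /g mulrA [cJ R * _]mulrC; congr (_ * _ * _); apply: (Lam_eqU hr) => W _; rewrite mulrC.
exists n, (fun k Z => \col_i \sum_p la k p (E a Z (K i p))),
  (fun k Z => \row_j \sum_q lb k q (E b Z (K q j))); split.
- by move=> k; exact: Vplus_linear.
- by move=> k; exact: V'plus_linear.
move=> Z1 Z2 _ _; apply/matrixP => i j; rewrite mxE summxE.
transitivity (\sum_k (\sum_p \sum_x m1 x Z1 * al k (x, p, i)) * (\sum_q \sum_y m2 y Z2 * be k (y, q, j))); last first.
  by apply: eq_bigr => k _; rewrite !mxE big_ord1 !mxE ela elb.
transitivity (\sum_p \sum_x \sum_q \sum_y m1 x Z1 * m2 y Z2 * g (x, p, i) (y, q, j)); last first.
  under [RHS]eq_bigr => k _ do rewrite mulr_suml.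
  rewrite [RHS]exchange_big; apply: eq_bigr => p _ /=.
  under [RHS]eq_bigr => k _ do rewrite mulr_suml.
  rewrite [RHS]exchange_big; apply: eq_bigr => x _ /=.
  under [RHS]eq_bigr => k _ do rewrite mulr_sumr.
  rewrite [RHS]exchange_big; apply: eq_bigr => q _ /=.
  under [RHS]eq_bigr => k _ do rewrite mulr_sumr.
  rewrite [RHS]exchange_big; apply: eq_bigr => y _ /=.
  by rewrite eg mulr_sumr; apply: eq_bigr => k _; rewrite mulrACA.
rewrite mulr_sumr; apply: eq_bigr => p _.
rewrite mulr_sumr exchange_big; apply: eq_bigr => q _ /=.
have lw x y : L None (fun W => d1 x (K i p) W * F W p q * d2 y (K q j) W).
  by apply: L_mul => //; exact: L_mul.
transitivity (cJ R * Lam r (fun W => \sum_x \sum_y (m1 x Z1 * m2 y Z2) * (d1 x (K i p) W * F W p q * d2 y (K q j) W))).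
  congr (_ * _); apply: (Lam_eqU hr) => W uW; rewrite /Aplus (e1 _ _ _ _ uW); last exact: K_LN.
  rewrite (e2 _ _ _ _ uW); last exact: K_LN.
  rewrite !mulr_suml; apply: eq_bigr => x _; rewrite mulr_sumr; apply: eq_bigr => y _; ring.
rewrite (@linear_on_L_sum R _ _ _ _ (fun x W => \sum_y _) (Lam_linear hr)); last first.
  by move=> x _; apply: L_sum => y _; exact: L_scale.
rewrite mulr_sumr; apply: eq_bigr => x _.
rewrite (@linear_on_L_sum R _ _ _ _ (fun y W => (m1 x Z1 * m2 y Z2) * _) (Lam_linear hr)); last first.
  by move=> y _; exact: L_scale.
by rewrite mulr_sumr; apply: eq_bigr => y _; rewrite (LamZ hr)// mulrCA.
Qed.

End TensorPlus.

End Tensor.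

(** * The tensor product on D_R^- *)

Section TensorMinus.
Variable R : realType.
Implicit Types (f g : HC R -> R[i]) (W X Y Z U : HC R) (i j s : 'I_2).

Lemma P_line f Z : P None f -> exists q : {poly R[i]}, forall t, f (Z + t%:M) = q.[t].
Proof.
elim=> {f} [z a b c d _|f g _ [q hq] _ [q' hq']]; last first.
  by exists (q + q') => t; rewrite hq hq' hornerD.
exists (z%:P * (('X + (Z 0 0)%:P) ^+ a * (Z 0 1)%:P ^+ b * (Z 1 0)%:P ^+ c * ('X + (Z 1 1)%:P) ^+ d)) => t.
rewrite !(hornerM, horner_exp, hornerD, hornerX, hornerC) /pmon !mxE /=.
by rewrite !addr0 ![Z _ _ + t]addrC.
Qed.

Lemma poly_eq0 (q : {poly R[i]}) : (forall t, q.[t] = 0) -> q = 0.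
Proof.
move=> h; apply/eqP; apply: contraT => q0.
have := max_poly_roots (rs := [seq n%:R | n <- iota 0 (size q)]) q0.
rewrite size_map size_iota ltnn => -> //; first by apply/allP => t _; rewrite /root h.
by rewrite map_inj_uniq ?iota_uniq// => m n /eqP; rewrite eqr_nat => /eqP.
Qed.

(** On the line Z + t, N is a monic quadratic polynomial in t, hence nonzero, and its product with f
    vanishes identically. *)
Lemma P_eqU0 f : P None f -> eqU f (fun=> 0) -> forall Z, f Z = 0.
Proof.
move=> pf h Z; have [q hq] := P_line Z pf.
have [qd hqd] := P_line Z (P_None (@P_det R)).
have : q * qd = 0.
  apply: poly_eq0 => t; rewrite hornerM -hq -hqd.
  by have [->|d0] := eqVneq (\det (Z + t%:M)) 0; rewrite ?mulr0// h ?mul0r.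
move=> /eqP; rewrite mulf_eq0 => /orP[] /eqP q0.
  by have := hq 0; rewrite q0 horner0 (_ : 0%:M = 0) ?addr0// -scalemx1 scale0r.
have dt t : (Z 0 0 + t) * (Z 1 1 + t) - Z 0 1 * Z 1 0 = 0.
  by rewrite -[RHS](horner0 t) -q0 -hqd det2 !mxE /= !addr0.
(* The second difference of a monic quadratic polynomial is 2. *)
suff : (2 : R[i]) = 0 by move=> /eqP; rewrite pnatr_eq0.
transitivity (((Z 0 0 + 2) * (Z 1 1 + 2) - Z 0 1 * Z 1 0) - 2 * ((Z 0 0 + 1) * (Z 1 1 + 1) - Z 0 1 * Z 1 0)
  + ((Z 0 0 + 0) * (Z 1 1 + 0) - Z 0 1 * Z 1 0)); first by ring.
by rewrite !dt; ring.
Qed.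

Lemma invo_pd_hat (w : HC R -> R[i]) (h : HC R -> R[i]) i j Z : L None w -> HCunits Z ->
  eqU h (invo w) ->
  pd i j h Z = - \sum_k \sum_l Z^-1 k i * Z^-1 j l * pd k l w Z^-1.
Proof.
move=> lw uZ e; rewrite (pd_eqU _ _ e uZ); have [_ hd] := invo_pd lw; by rewrite hd.
Qed.

(** Covariance of the Dirac equation under inversion: the chain rule turns the equation of f into
    that of the twisted function h. [hatL] says that h is polynomial, and [P_eqU0] extends its
    equation to singular matrices. *)
Lemma Vminus_col (f : 'I_2 -> HC R -> R[i]) : (forall i, L None (f i)) -> hatL f ->
  (forall q, eqU (fun W => \sum_i nbp q i (f i) W) (fun=> 0)) -> Vminus (fun Z => \col_i f i Z).
Proof.
move=> lf hf df.
have [h hP eh] : exists2 h : 'I_2 -> HC R -> R[i], forall s, P None (h s) &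
    forall s U, HCunits U -> \det U * \sum_i U s i * f i U = h s U^-1.
  by have /choice[b hb] : forall s, exists h, P None h /\ forall U, HCunits U -> \det U * \sum_q U s q * f q U = h U^-1;
    [move=> s; have [h ph e] := hf s; exists h | exists b => s; have [] := hb s].
pose w s U := \det U * \sum_i U s i * f i U.
have eq s : eqU (h s) (invo (w s)).
  by move=> Z uZ; rewrite /invo /w eh ?invrK//; exact: inv_HCunits.
have lc a b : L None (fun U : HC R => U a b) by exact: L_coord.
have lS s : L None (fun U => \sum_i U s i * f i U) by apply: L_sum => i _; exact: L_mul.
have lw s : L None (w s) by apply: L_mul => //; exact: det_L.
have pw k l s U : HCunits U -> pd k l (w s) U = mxplus U l k * (\sum_i U s i * f i U) +
    \det U * \sum_i (((k == s) && (l == i))%:R * f i U + U s i * pd k l (f i) U).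
  move=> uU; rewrite (pdM _ _ (det_L R) (lS s) uU) (isd_pd (isd_det k l U)).
  rewrite (pd_sum _ _ _ _ uU); last by move=> i _; exact: L_mul.
  by congr (_ + _ * _); apply: eq_bigr => i _; rewrite (pdM _ _ _ _ uU)// pd_coord.
exists (fun Z => \col_s h s Z); last first.
  move=> Z uZ; apply/matrixP => s t; rewrite !mxE eq// /invo /w det_invHC; congr (_ * _).
  by apply: eq_bigr => i _; rewrite mxE.
split=> [s|Z t].
  by rewrite (_ : (fun Z => _) = h s); [exact: P_polyfun|apply/funext => Z; rewrite mxE].
rewrite (eq_bigr (fun s => nbp t s (h s) Z)); last first.
  by move=> s _; rewrite nablaplusE; congr (nbp _ _ _ _); apply/funext => Y; rewrite mxE.
apply: (P_eqU0 (f := fun Z => \sum_s nbp t s (h s) Z)) => [|{}Z uZ].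
  by apply: P_sum => s _; apply: P_scale; exact: P_pd.
have uU := inv_HCunits uZ.
rewrite sum2 /nbp !(invo_pd_hat _ _ (lw _) uZ (eq _)) !sum2 !pw// det2 /mxplus !mx2E.
have := df 0 _ uU; have := df 1 _ uU; rewrite !sum2 /nbp !sub1ord /=.
have two x y : 2 * x + -2 * y = 0 -> x = y :> R[i].
  move=> e; apply: (mulfI (_ : (2 : R[i]) != 0)); first by rewrite pnatr_eq0.
  by apply/subr0_eq; rewrite -[RHS]e mulNr.
rewrite addrC => /two e1 /two e2; rewrite ?sum2 ?e1 e2.
by case: (ord2_cases t) => ->; rewrite ?sub1ord /=; rewrite -?e1 -?e2; ring.
Qed.

Lemma V'minus_row (f : 'I_2 -> HC R -> R[i]) : (forall i, L None (f i)) -> hatR f ->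
  (forall q, eqU (fun W => \sum_i nbp i q (f i) W) (fun=> 0)) -> V'minus (fun Z => \row_i f i Z).
Proof.
move=> lf hf df.
have [h hP eh] : exists2 h : 'I_2 -> HC R -> R[i], forall s, P None (h s) &
    forall s U, HCunits U -> \det U * \sum_i f i U * U i s = h s U^-1.
  by have /choice[b hb] : forall s, exists h, P None h /\ forall U, HCunits U -> \det U * \sum_q f q U * U q s = h U^-1;
    [move=> s; have [h ph e] := hf s; exists h | exists b => s; have [] := hb s].
pose w s U := \det U * \sum_i f i U * U i s.
have eq s : eqU (h s) (invo (w s)).
  by move=> Z uZ; rewrite /invo /w eh ?invrK//; exact: inv_HCunits.
have lc a b : L None (fun U : HC R => U a b) by exact: L_coord.
have lS s : L None (fun U => \sum_i f i U * U i s) by apply: L_sum => i _; exact: L_mul.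
have lw s : L None (w s) by apply: L_mul => //; exact: det_L.
have pw k l s U : HCunits U -> pd k l (w s) U = mxplus U l k * (\sum_i f i U * U i s) +
    \det U * \sum_i (pd k l (f i) U * U i s + f i U * ((k == i) && (l == s))%:R).
  move=> uU; rewrite (pdM _ _ (det_L R) (lS s) uU) (isd_pd (isd_det k l U)).
  rewrite (pd_sum _ _ _ _ uU); last by move=> i _; exact: L_mul.
  by congr (_ + _ * _); apply: eq_bigr => i _; rewrite (pdM _ _ _ _ uU)// pd_coord.
exists (fun Z => \row_s h s Z); last first.
  move=> Z uZ; apply/matrixP => t s; rewrite !mxE eq// /invo /w det_invHC; congr (_ * _).
  by apply: eq_bigr => i _; rewrite mxE.
split=> [s|Z t].
  by rewrite (_ : (fun Z => _) = h s); [exact: P_polyfun|apply/funext => Z; rewrite mxE].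
rewrite (eq_bigr (fun s => nbp s t (h s) Z)); last first.
  by move=> s _; rewrite nablaplusE; congr (nbp _ _ _ _); apply/funext => Y; rewrite mxE.
apply: (P_eqU0 (f := fun Z => \sum_s nbp s t (h s) Z)) => [|{}Z uZ].
  by apply: P_sum => s _; apply: P_scale; exact: P_pd.
have uU := inv_HCunits uZ.
rewrite sum2 /nbp !(invo_pd_hat _ _ (lw _) uZ (eq _)) !sum2 !pw// det2 /mxplus !mx2E.
have := df 0 _ uU; have := df 1 _ uU; rewrite !sum2 /nbp !sub1ord /=.
have two x y : 2 * x + -2 * y = 0 -> x = y :> R[i].
  move=> e; apply: (mulfI (_ : (2 : R[i]) != 0)); first by rewrite pnatr_eq0.
  by apply/subr0_eq; rewrite -[RHS]e mulNr.
rewrite addrC => /two e1 /two e2; rewrite ?sum2 ?e1 e2.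
by case: (ord2_cases t) => ->; rewrite ?sub1ord /=; rewrite -?e1 -?e2; ring.
Qed.

Lemma Dop_div0 n T (c : 'I_2 -> R[i]) (x y : 'I_2 -> 'I_2) (u : 'I_2 -> HC R -> R[i]) :
  Dop n T -> (forall k, L None (u k)) -> eqU (fun W => \sum_k c k * pd (x k) (y k) (u k) W) (fun=> 0) ->
  eqU (fun W => \sum_k c k * pd (x k) (y k) (T (u k)) W) (fun=> 0).
Proof.
move=> dT lu h W uW; have lp k : L None (pd (x k) (y k) (u k)) by exact: L_pdN.
transitivity (T (fun W => \sum_k c k * pd (x k) (y k) (u k) W) W).
  rewrite (Dop_eqU dT (g := fun W => c 0 * pd (x 0) (y 0) (u 0) W + c 1 * pd (x 1) (y 1) (u 1) W) _ uW); last first.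
    by move=> V _; rewrite sum2.
  by rewrite sum2 (DopD dT _ _ uW) ?(DopZ _ dT _ uW) ?(pd_Dop _ _ dT _ uW)//; exact: L_scale.
rewrite (Dop_eqU dT (g := fun=> 0 * 0) _ uW); last by move=> V uV; rewrite mul0r; exact: h.
by rewrite (DopZ _ dT (L_0 _ _) uW) mul0r.
Qed.

(** The derivatives of K at Z_1 and Z_2 already lie in V^- and V'^-, and the integrals over W are
    scalars, absorbed in the right factor. *)
Lemma in_tensor_minus (r : R) (F : HC R -> HC R) : 0 < r -> (forall p q, L None (fun W => F W p q)) ->
  in_tensor (@Vminus R) (@V'minus R) (Dminus r) (J r F).
Proof.
move=> hr lF; have [D fD] := exists_far hr lF.
pose G (a b : 'I_D) Z1 Z2 : HC R := \matrix_(i, j) (cJ R * \sum_p \sum_q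
   term r (Aminus Z1 a) (Aminus Z2 b) (fun W => F W p q) i p q j).
apply: (@in_tensor_eq _ _ _ _ (fun Z1 Z2 => \sum_a \sum_b G a b Z1 Z2)); last first.
  move=> Z1 Z2 h1 h2; apply/matrixP => i j; rewrite (J_series_minus hr lF fD h1 h2).
  rewrite summxE mulr_sumr; apply: eq_bigr => a _; rewrite summxE mulr_sumr.
  by apply: eq_bigr => b _; rewrite mxE.
apply: in_tensor_sum => a; apply: in_tensor_sum => b; rewrite /G {G}.
have [I1 [m1 [d1 [pm1 dd1 e1]]]] := E_expand R a.
have [I2 [m2 [d2 [pm2 dd2 e2]]]] := E_expand R b.
pose c x y p q := cJ R * Lam r (fun W => m1 x W * F W p q * m2 y W).
pose G x y p q Z1 Z2 : HC R := (\col_i d1 x (K i p) Z1) *m (\row_j (c x y p q * d2 y (K q j) Z2)).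
apply: (@in_tensor_eq _ _ _ _ (fun Z1 Z2 => \sum_p \sum_q \sum_x \sum_y G x y p q Z1 Z2)).
  apply: in_tensor_sum => p; apply: in_tensor_sum => q.
  apply: in_tensor_sum => x; apply: in_tensor_sum => y.
  exists 1%N, (fun _ Z => \col_i d1 x (K i p) Z), (fun _ Z => \row_j (c x y p q * d2 y (K q j) Z)).
  split=> [_|_|Z1 Z2 _ _]; last by rewrite big_ord1.
  - apply: Vminus_col => [i||t]; first by apply: Dop_LN (dd1 x) _; exact: K_LN.
      by apply: (hat_Dop (dd1 x) _).2 (hatL_K R p) => i; exact: K_LN.
    apply: (Dop_div0 (c := fun k => if t == k then 2 else -2) (x := fun=> 1 - t) (y := fun k => 1 - k) (dd1 x)).
      by move=> k; exact: K_LN.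
    exact: nbp_K_col.
  - have dd := Dop_scale (c x y p q) (dd2 y).
    apply: (@V'minus_row (fun j Z => c x y p q * d2 y (K q j) Z)) => [i||t].
    + by apply: L_scale; apply: Dop_LN (dd2 y) _; exact: K_LN.
    + by apply: (hat_Dop dd _).1 (hatR_K R q) => i; exact: K_LN.
    apply: (Dop_div0 (c := fun k => if k == t then 2 else -2) (x := fun k => 1 - k) (y := fun=> 1 - t) dd).
      by move=> k; exact: K_LN.
    exact: nbp_K_row.
move=> Z1 Z2 h1 h2; have [u1 _] := conv_minus hr h1; have [u2 _] := conv_minus hr h2.
apply/matrixP => i j; rewrite mxE summxE mulr_sumr; apply: eq_bigr => p _.
rewrite summxE mulr_sumr; apply: eq_bigr => q _; rewrite /term.
have lm x y : L None (fun W => m1 x W * F W p q * m2 y W).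
  by apply: L_mul (P_LN (pm2 y)); apply: L_mul => //; exact: P_LN (pm1 x).
pose g x y W := (d1 x (K i p) Z1 * d2 y (K q j) Z2) * (m1 x W * F W p q * m2 y W).
transitivity (cJ R * Lam r (fun W => \sum_x \sum_y g x y W)).
  congr (_ * _); apply: (Lam_eqU hr) => W uW; rewrite /Aminus (e1 _ _ _ _ u1); last exact: K_LN.
  rewrite (e2 _ _ _ _ u2); last exact: K_LN.
  rewrite mulNr mulrNN !mulr_suml; apply: eq_bigr => x _; rewrite mulr_sumr; apply: eq_bigr => y _.
  by rewrite /g; ring.
rewrite (@linear_on_L_sum R _ _ _ _ (fun x W => \sum_y g x y W) (Lam_linear hr)); last first.
  by move=> x _; apply: L_sum => y _; exact: L_scale.
rewrite mulr_sumr summxE; apply: eq_bigr => x _.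
rewrite (@linear_on_L_sum R _ _ _ _ (fun y W => g x y W) (Lam_linear hr)); last first.
  by move=> y _; exact: L_scale.
rewrite mulr_sumr summxE; apply: eq_bigr => y _; rewrite /g (LamZ hr)// /G mxE big_ord1 !mxE /c.
by ring.
Qed.

End TensorMinus.

(** * The restriction to the diagonal *)

Section Restriction.
Variable R : realType.
Implicit Types (f g h : HC R -> R[i]) (W X Y Z U : HC R) (i j p q : 'I_2).

(** The matrix of F to F^+, whose (i, j) entry is the sum of [eps i j p q] F_pq. *)
Definition eps i j p q : R[i] :=
  if i == j then ((p == 1 - i) && (q == 1 - i))%:R else - ((p == i) && (q == j))%:R.

(* The contribution of the entry F_pq to (Mx F)_ij. *)
Definition Lop i p q j f Z : R[i] := 4 * pd p i (pd j q f) Z - 4 * eps i j p q * box2 f Z.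

Lemma pd_PZ (z : R[i]) f i j : P None f -> pd i j (fun V => z * f V) = fun V => z * pd i j f V.
Proof. by move=> pf; apply/funext => V; apply: isd_pd; apply: isdZ; exact: P_isd pf. Qed.

(** Linearity of the derivatives is asked at Z only, so that both polynomial F at a possibly
    singular Z in D_R^+ and Laurent F on D_R^- are covered. *)
Lemma Mx_Lop (F : HC R -> HC R) Z i j :
  (forall p q a b c d (z : R[i]), pd a b (fun W => z * pd c d (fun Y => F Y p q) W) Z =
     z * pd a b (pd c d (fun Y => F Y p q)) Z) ->
  (forall p q, box2 (fun Y => - F Y p q) Z = - box2 (fun Y => F Y p q) Z) ->
  Mx F Z i j = \sum_p \sum_q Lop i p q j (fun Y => F Y p q) Z.
Proof.
move=> hZ hN; rewrite mxE.
have -> : \sum_(a < 2) \sum_(b < 2) nabla R i a (nabla R b j (fun Y => F Y a b)) Z =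
    \sum_p \sum_q 4 * pd p i (pd j q (fun Y => F Y p q)) Z.
  apply: eq_bigr => a _; apply: eq_bigr => b _.
  by rewrite !nablaE hZ mulrA; congr (_ * _); ring.
have -> : box (fun Y => mxplus (F Y) i j) Z =
    \sum_p \sum_q 4 * eps i j p q * box2 (fun Y => F Y p q) Z.
  rewrite boxE !sum2 /eps; case: (ord2_cases i) => ->; case: (ord2_cases j) => ->; rewrite ?sub1ord /=.
  - by rewrite (_ : (fun Y => _) = fun Y => F Y 1 1); [ring|apply/funext => Y; rewrite /mxplus mx2E].
  - by rewrite (_ : (fun Y => _) = fun Y => - F Y 0 1); [rewrite hN; ring|apply/funext => Y; rewrite /mxplus mx2E].
  - by rewrite (_ : (fun Y => _) = fun Y => - F Y 1 0); [rewrite hN; ring|apply/funext => Y; rewrite /mxplus mx2E].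
  - by rewrite (_ : (fun Y => _) = fun Y => F Y 0 0); [ring|apply/funext => Y; rewrite /mxplus mx2E].
by rewrite /Lop !sum2; ring.
Qed.

Lemma Lop_P n f i p q j : P (Some n.+2) f -> P (Some n) (Lop i p q j f).
Proof.
by move=> pf; apply: P_sub; apply: P_scale; [do 2!apply: P_pdS|exact: box2_P].
Qed.

Lemma Lop_low n f i p q j : P (Some n) f -> (n < 2)%N -> Lop i p q j f = fun=> 0.
Proof.
move=> pf n2; apply/funext => Z; rewrite /Lop (box2_P1 pf n2) mulr0 subr0.
case: n n2 pf => [|[|//]] _ pf; first by rewrite (P_pd0 j q pf) pd_cst mulr0.
by rewrite (P_pd0 p i (P_pdS j q pf)) mulr0.
Qed.

Lemma box2_LD f g : L None f -> L None g -> eqU (box2 (fun W => f W + g W)) (fun W => box2 f W + box2 g W).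
Proof.
have e i j i' j' f' g' : L None f' -> L None g' ->
    eqU (pd i j (pd i' j' (fun W => f' W + g' W))) (fun W => pd i j (pd i' j' f') W + pd i j (pd i' j' g') W).
  move=> lf lg W uW; rewrite (pd_eqU _ _ (pdD _ _ lf lg) uW).
  by rewrite (pdD _ _ _ _ uW)//; exact: L_pdN.
by move=> lf lg W uW; rewrite /box2 !(e _ _ _ _ _ _ lf lg _ uW); ring.
Qed.

Lemma box2_LZ z f : L None f -> eqU (box2 (fun W => z * f W)) (fun W => z * box2 f W).
Proof.
have e i j i' j' f' : L None f' ->
    eqU (pd i j (pd i' j' (fun W => z * f' W))) (fun W => z * pd i j (pd i' j' f') W).
  move=> lf W uW; rewrite (pd_eqU _ _ (pdZ z _ _ lf) uW).
  by rewrite (pdZ _ _ _ _ uW)//; exact: L_pdN.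
by move=> lf W uW; rewrite /box2 !(e _ _ _ _ _ lf _ uW); ring.
Qed.

Lemma Lop_LD f g i p q j : L None f -> L None g ->
  eqU (Lop i p q j (fun W => f W + g W)) (fun W => Lop i p q j f W + Lop i p q j g W).
Proof.
move=> lf lg W uW; rewrite /Lop (box2_LD lf lg uW) (pd_eqU _ _ (pdD _ _ lf lg) uW).
by rewrite (pdD _ _ _ _ uW); [ring|exact: L_pdN|exact: L_pdN].
Qed.

Lemma Lop_PD f g i p q j Z : P None f -> P None g ->
  Lop i p q j (fun W => f W + g W) Z = Lop i p q j f Z + Lop i p q j g Z.
Proof.
move=> pf pg; rewrite /Lop (box2_PD pf pg) (pd_PD _ _ pf pg).
by rewrite pd_PD; [ring|exact: P_pd|exact: P_pd].
Qed.

Lemma Lop_eqU f g i p q j : eqU f g -> eqU (Lop i p q j f) (Lop i p q j g).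
Proof.
by move=> e W uW; rewrite /Lop (box2_eqU e uW) (pd_eqU _ _ (pd_eqU _ _ e) uW).
Qed.

Lemma Lop_L f i p q j : L None f -> L None (Lop i p q j f).
Proof.
by move=> lf; apply: L_sub; apply: L_scale; [do 2!apply: L_pdN|exact: (box2_L lf)].
Qed.

(** Two derivatives of N^-2 give (-2)(-3) = 6 times N^-4 and two entries of W^+, and the factor 4
    makes 24. The terms in N^-3, from the derivative of W^+, are cancelled by those of □. *)
Lemma Lop_detN2 i p q j : eqU (Lop i p q j (fun W => \det W ^ (-2))) (fun W => 24 * (K i p W * K q j W)).
Proof.
move=> W uW; have d0 : \det W != 0 by exact: uW.
have e1 : eqU (pd j q (fun W => \det W ^ (-2))) (fun W => - 2 * (\det W ^ (-3) * mxplus W q j)).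
  by move=> V uV; rewrite (pd_detz _ _ _ uV) mulrA.
have l3 : L None (fun W : HC R => \det W ^ (-3)) by exact: L_None (L_detz _ _).
have lx : L None (fun W : HC R => mxplus W q j) by exact: P_LN (P_mxplus _ _ _).
rewrite /Lop (pd_eqU _ _ e1 uW) (pdZ _ _ _ (L_mul l3 lx) uW) (pdM _ _ l3 lx uW) (pd_detz _ _ _ uW) pd_mxplus.
have -> : box2 (fun W => \det W ^ (-2)) W = 2 * \det W ^ (-3).
  have h := box2_detz (-3) (L_cst (1 : R[i])) _ uW.
  rewrite -(box2_eqU (f := fun W => \det W ^ (-3 + 1) * 1) _ uW); last by move=> V _; rewrite mulr1.
  rewrite h; last by move=> V uV; rewrite /box2 !pd_cst subrr.
  by rewrite mulr1.
rewrite /K /eps.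
have -> : \det W ^ (-3 - 1) = \det W ^ (-2) * \det W ^ (-2) by rewrite -expfzDr.
move: (\det W ^ (-2)) (\det W ^ (-3)) => u v.
case: (ord2_cases i) => ->; case: (ord2_cases j) => ->; case: (ord2_cases p) => ->; case: (ord2_cases q) => ->;
  rewrite ?sub1ord /=; ring.
Qed.

Lemma E_top n f X : P (Some n) f ->
  eqU (E n X f) (fun=> f (- X)) /\ forall a, (n < a)%N -> eqU (E a X f) (fun=> 0).
Proof.
pose top n f := eqU (E n X f) (fun=> f (- X)) /\ forall a, (n < a)%N -> eqU (E a X f) (fun=> 0).
have topM m f' i j : P (Some m) f' -> top m f' -> top m.+1 (fun W => W i j * f' W).
  move=> pf [h1 h2]; have lf := P_LN pf; split=> [W uW|[//|a] ma W uW].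
    by rewrite (E_mulX _ _ _ _ lf uW) h1// h2// mulr0 sub0r mxE mulNr.
  by rewrite (E_mulX _ _ _ _ lf uW) !h2 ?mulr0 ?subr0// leqW.
have tmon a b c d : top (a + b + c + d)%N (pmon a b c d).
  have pp a' b' c' d' : P (Some (a' + b' + c' + d')%N) (@pmon R a' b' c' d').
    apply: P_eq (@P_mon R (Some _) 1 a' b' c' d' (eqxx _)) _.
    by apply/funext => W; rewrite mul1r.
  elim: a => [|a ih].
    elim: b => [|b ih].
      elim: c => [|c ih].
        elim: d => [|d ih].
          rewrite (_ : pmon 0 0 0 0 = fun=> 1); last by apply/funext => W; rewrite /pmon !expr0 !mulr1.
          by split=> [W _|[//|a] _ W _]; rewrite ?E0 ?E_cst.
        rewrite (_ : pmon 0 0 0 d.+1 = fun W => W 1 1 * pmon 0 0 0 d W); first exact: topM (pp 0 0 0 d)%N ih.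
        by apply/funext => W; rewrite /pmon exprS; ring.
      rewrite (_ : pmon 0 0 c.+1 d = fun W => W 1 0 * pmon 0 0 c d W); first exact: topM (pp 0 0 c d)%N ih.
      by apply/funext => W; rewrite /pmon exprS; ring.
    rewrite (_ : pmon 0 b.+1 c d = fun W => W 0 1 * pmon 0 b c d W); first exact: topM (pp 0 b c d)%N ih.
    by apply/funext => W; rewrite /pmon exprS; ring.
  rewrite (_ : pmon a.+1 b c d = fun W => W 0 0 * pmon a b c d W); first exact: topM (pp a b c d) ih.
  by apply/funext => W; rewrite /pmon exprS; ring.
elim=> {f} [z a b c d /= /eqP hn|f g pf [f1 f2] pg [g1 g2]]; last first.
  have lf := P_LN pf; have lg := P_LN pg.
  by split=> [W uW|a na W uW]; rewrite (ED _ _ lf lg uW) ?f1 ?g1 ?f2 ?g2 ?addr0.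
have [t1 t2] := tmon a b c d; rewrite -hn in t1 t2.
have lm : L None (@pmon R a b c d) := L_None (L_pmon _ _ _ _ _).
by split=> [W uW|k nk W uW]; rewrite (EZ _ _ _ lm uW) ?t1 ?t2 ?mulr0.
Qed.

End Restriction.

(** * The diagonal formula for a single entry of F *)

Section MxProof.
Variables (R : realType) (r : R).
Hypothesis hr : 0 < r.
Implicit Types (f g h : HC R -> R[i]) (W X Y Z U : HC R) (i j p q : 'I_2).

Lemma diag_sum (V : nmodType) (t : nat -> nat -> V) n D : (n < D)%N ->
  (forall a b, (a + b)%N != n -> t a b = 0) ->
  \sum_(a < D) \sum_(b < D) t a b = \sum_(a < n.+1) t a (n - a)%N.
Proof.
move=> nD h; have e a : \sum_(b < D) t a b = if (a <= n)%N then t a (n - a)%N else 0.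
  case: leqP => an; last by apply: big1 => b _; apply: h; lia.
  have hb : (n - a < D)%N by lia.
  rewrite (bigD1 (Ordinal hb))//= big1 ?addr0// => b /eqP bn; apply: h; apply/eqP => e.
  by apply: bn; apply/val_inj => /=; lia.
under eq_bigr => a _ do rewrite e.
rewrite (@sum_ord_trunc _ (fun a => if (a <= n)%N then t a (n - a)%N else 0) n.+1) => [|//|a]; last first.
  by move=> an; rewrite leqNgt an.
by apply: eq_bigr => a _; rewrite -ltnS ltn_ord.
Qed.

Lemma Lam_E_ibp n X u g : L None u -> L None g ->
  Lam r (fun W => E n X u W * g W) = Lam r (fun W => u W * E n (- X) g W).
Proof.
move=> lu lg; have step u' g' : L None u' -> L None g' ->
    Lam r (fun W => dX X u' W * g' W) = Lam r (fun W => u' W * dX (- X) g' W).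
  move=> lu' lg'.
  have lp k l : L None (fun W => pd k l u' W * g' W) by apply: L_mul => //; exact: L_pdN.
  have lq k l : L None (fun W => u' W * pd k l g' W) by apply: L_mul => //; exact: L_pdN.
  transitivity (Lam r (fun W => \sum_k \sum_l (- X k l) * (pd k l u' W * g' W))).
    by apply: (Lam_eqU hr) => W _; rewrite /dX !sum2; ring.
  transitivity (Lam r (fun W => \sum_k \sum_l X k l * (u' W * pd k l g' W))); last first.
    by apply: (Lam_eqU hr) => W _; rewrite /dX !sum2 !mxE; ring.
  rewrite !(@linear_on_L_sum R _ _ _ _ (fun k W => \sum_l _) (Lam_linear hr));
    try (by move=> k _; apply: L_sum => l _; exact: L_scale).
  apply: eq_bigr => k _.
  rewrite (@linear_on_L_sum R _ _ _ _ (fun l W => (- X k l) * (pd k l u' W * g' W)) (Lam_linear hr));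
    last by move=> l _; exact: L_scale.
  rewrite (@linear_on_L_sum R _ _ _ _ (fun l W => X k l * (u' W * pd k l g' W)) (Lam_linear hr));
    last by move=> l _; exact: L_scale.
  by apply: eq_bigr => l _; rewrite !(LamZ hr)// (Lam_ibp hr)// mulrNN.
have it m : forall g', L None g' -> Lam r (fun W => iter m (dX X) u W * g' W) = Lam r (fun W => u W * iter m (dX (- X)) g' W).
  elim: m => [//|m ih] g' lg'; rewrite /= step//; last exact: iter_dX_LN.
  by rewrite ih -?iterSr//; exact: dX_LN.
rewrite /E; transitivity (n`!%:R^-1 * Lam r (fun W => iter n (dX X) u W * g W)).
  by rewrite -(LamZ hr); [apply: (Lam_eqU hr) => W _; rewrite mulrA|apply: L_mul => //; exact: iter_dX_LN].
rewrite it// -(LamZ hr); last by apply: L_mul => //; exact: iter_dX_LN.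
by apply: (Lam_eqU hr) => W _; rewrite mulrCA.
Qed.

Lemma Lam_Lop f g i p q j : L None f -> L None g ->
  Lam r (fun W => Lop i p q j f W * g W) = Lam r (fun W => f W * Lop i p q j g W).
Proof.
move=> lf lg.
have lL u v : L None u -> L None v -> L None (fun W => pd p i (pd j q u) W * v W).
  by move=> lu lv; apply: L_mul => //; do 2!apply: L_pdN.
have lB u v : L None u -> L None v -> L None (fun W => box2 u W * v W).
  by move=> lu lv; apply: L_mul => //; exact: (box2_L lu).
have ex u v : L None u -> L None v -> Lam r (fun W => Lop i p q j u W * v W) =
    4 * Lam r (fun W => pd p i (pd j q u) W * v W) + (- 4 * eps R i j p q) * Lam r (fun W => box2 u W * v W).
  move=> lu lv; rewrite -!(LamZ hr)//; try exact: lL; try exact: lB.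
  rewrite -(LamD hr); try (apply: L_scale; first [exact: lL|exact: lB]).
  by apply: (Lam_eqU hr) => W _; rewrite /Lop; ring.
rewrite ex//; transitivity (Lam r (fun W => Lop i p q j g W * f W)); last first.
  by apply: (Lam_eqU hr) => W _; rewrite mulrC.
rewrite ex// (Lam_box2 hr)//; congr (_ * _ + _ * _); last first.
  by apply: (Lam_eqU hr) => W _; rewrite mulrC.
rewrite (Lam_ibp hr)//; last exact: L_pdN.
rewrite (Lam_ibp hr)//; last exact: L_pdN.
by rewrite opprK; apply: (Lam_eqU hr) => W uW; rewrite pd_comm// mulrC.
Qed.

(** By [cJ_lam0] this says that f, placed in the entry (p, q), contributes [Lop i p q j f Z] to the
    series. The bound D0 lets several such statements be combined at a common D. *)
Definition diag_formula (A : nat -> 'I_2 -> 'I_2 -> HC R -> R[i]) i p q j f Z :=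
  exists D0, forall D, (D0 <= D)%N ->
    24 * \sum_(a < D) \sum_(b < D) term r (A a) (A b) f i p q j = lam0 R * Lop i p q j f Z.

Lemma diag_formula_add A i p q j f g Z : (forall a i p, L None (A a i p)) -> L None f -> L None g ->
  Lop i p q j (fun W => f W + g W) Z = Lop i p q j f Z + Lop i p q j g Z ->
  diag_formula A i p q j f Z -> diag_formula A i p q j g Z ->
  diag_formula A i p q j (fun W => f W + g W) Z.
Proof.
move=> lA lf lg e [D1 h1] [D2 h2]; exists (maxn D1 D2) => D; rewrite geq_max => /andP[d1 d2].
rewrite e mulrDr -(h1 D d1) -(h2 D d2) -mulrDr; congr (_ * _).
rewrite -big_split; apply: eq_bigr => a _; rewrite -big_split; apply: eq_bigr => b _ /=.
rewrite /term -(LamD hr); try (apply: L_mul => //; exact: L_mul).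
by apply: (Lam_eqU hr) => W _; rewrite mulrDr mulrDl.
Qed.

Lemma term_L A B f i p q j m n d : L (Some m) (A i p) -> L (Some n) (B q j) -> L (Some d) f ->
  m + d + n != -4 -> term r A B f i p q j = 0.
Proof.
by move=> lA lB lf; apply: (Lam_deg hr); apply: L_mulS (L_mulS lA lf erefl) lB erefl.
Qed.

Lemma Lam_cst_N2 z : Lam r (fun W => \det W ^ (-2) * z) = z * lam0 R.
Proof.
rewrite -(Lam_detN2 hr) -(LamZ hr); last exact: L_None (L_detz _ _).
by apply: (Lam_eqU hr) => W _; rewrite mulrC.
Qed.

Lemma detN2_L : L None (fun W : HC R => \det W ^ (-2)).
Proof. exact: L_None (L_detz _ _). Qed.

Lemma diag_plus f i p q j Z : P None f -> diag_formula (Aplus Z) i p q j f Z.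
Proof.
have lA a i' p' : L None (Aplus Z a i' p') by exact: L_None (Aplus_L Z a i' p').
move: f; apply: P_homog_ind => [f g pf pg|n f pf].
  by apply: diag_formula_add => //; [exact: P_LN pf|exact: P_LN pg|exact: Lop_PD].
have lf := P_LN pf; exists n => D nD.
have h a b : (a + b + 2)%N != n -> term r (Aplus Z a) (Aplus Z b) f i p q j = 0.
  move=> ab; apply: (term_L (Aplus_L Z a i p) (Aplus_L Z b q j) (P_L pf)); apply/eqP => e.
  by move/eqP: ab; apply; lia.
case: (ltnP n 2) => n2.
  rewrite (Lop_low _ _ _ _ pf n2) mulr0 big1 ?mulr0// => a _; apply: big1 => b _; apply: h.
  by lia.
case: n n2 pf nD h => [//|[//|n]] _ pf nD h.
(* The two kernel terms have total degree -6 - a - b and f now has degree n + 2, so only a + b = n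
   reaches -4. *)
rewrite (@diag_sum _ (fun a b => term r (Aplus Z a) (Aplus Z b) f i p q j) n); [|lia|by move=> a b ab; apply: h; lia].
have lKK : L None (fun W => K i p W * K q j W) by apply: L_mul; exact: K_LN.
have lLf : L None (Lop i p q j f) by exact: Lop_L.
have lEN : L None (E n Z (fun W => \det W ^ (-2))) by apply: E_LN; exact: detN2_L.
have lEL : L None (E n Z (Lop i p q j (fun W => \det W ^ (-2)))) by apply: E_LN; apply: Lop_L; exact: detN2_L.
transitivity (24 * Lam r (fun W => E n Z (fun W => K i p W * K q j W) W * f W)).
  congr (_ * _); transitivity (Lam r (fun W => \sum_(a < n.+1) Aplus Z a i p W * f W * Aplus Z (n - a) q j W)).
    by rewrite (@linear_on_L_sum R _ _ _ _ (fun (a : 'I_n.+1) W => _) (Lam_linear hr))// => a _; apply: L_mul => //; exact: L_mul.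
  apply: (Lam_eqU hr) => W uW; rewrite (E_mul n Z (K_LN _ i p) (K_LN _ q j) uW) mulr_suml.
  by apply: eq_bigr => a _; rewrite mulrAC.
transitivity (Lam r (fun W => E n Z (Lop i p q j (fun W => \det W ^ (-2))) W * f W)).
  rewrite -(LamZ hr); last by apply: L_mul => //; exact: E_LN.
  apply: (Lam_eqU hr) => W uW; rewrite mulrA; congr (_ * _).
  by rewrite -(EZ _ _ _ lKK uW); apply: E_eqU uW => V uV; rewrite Lop_detN2.
rewrite Lam_E_ibp//; last by apply: Lop_L; exact: detN2_L.
rewrite Lam_Lop//; [|exact: detN2_L|exact: E_LN].
(* Applied to f, [Lop] gives a homogeneous polynomial of degree n, so its Taylor term of order n for
   the translation parameter -Z is its value at Z, constant in W. *)
transitivity (Lam r (fun W => \det W ^ (-2) * Lop i p q j f Z)); last by rewrite Lam_cst_N2 mulrC.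
apply: (Lam_eqU hr) => W uW; congr (_ * _).
have := (E_top (- Z) (Lop_P i p q j pf)).1 W uW; rewrite opprK => <-.
rewrite /Lop; have e g a b : L None g -> eqU (pd a b (E n (- Z) g)) (E n (- Z) (pd a b g)) by move=> lg; exact: pd_E.
have e2 a b c d : eqU (pd a b (pd c d (E n (- Z) f))) (E n (- Z) (pd a b (pd c d f))).
  by move=> V uV; rewrite (pd_eqU _ _ (e _ _ _ lf) uV) e//; exact: L_pdN.
have l2 a b c d : L None (pd a b (pd c d f)) by do 2!apply: L_pdN.
rewrite /box2 !e2//.
pose c : R[i] := - 4 * eps R i j p q.
rewrite [RHS](E_eqU n (- Z) (g := fun W => 4 * pd p i (pd j q f) W + (c * pd 0 0 (pd 1 1 f) W + (- c) * pd 0 1 (pd 1 0 f) W)) _ uW); last first.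
  by move=> V uV; rewrite /c /=; ring.
rewrite (ED _ _ _ _ uW); [|exact: L_scale|by apply: L_add; exact: L_scale].
rewrite (ED _ _ _ _ uW); [|exact: L_scale|exact: L_scale].
by rewrite !(EZ _ _ _ _ uW)// /c; ring.
Qed.

(** Each integration by parts moves one derivative from g to the Taylor term of h (Z - W), where by
    [linear_E_pd] it acts on h and lowers the order; the two signs cancel. After n steps the
    constant [T h Z] remains. *)
Lemma Lam_Dop n T g : Dop n T -> L None g -> forall h Z, L None h -> HCunits Z ->
  Lam r (fun W => E n W h Z * T g W) = Lam r g * T h Z.
Proof.
move=> hT; elim: hT g => {n T} [|n T i j hT ih|n T T' hT ih hT' ih'|n z T hT ih] g lg h Z lh uZ.
- rewrite [RHS]mulrC -(LamZ hr)//; apply: (Lam_eqU hr) => W _; by rewrite E0.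
- have lE m u : L None u -> L None (fun W => E m W u Z).
    by move=> lu; exact: P_LN (linear_E_P m (linear_eval uZ) lu).
  transitivity (Lam r (fun W => E n.+1 W h Z * pd i j (T g) W)).
    by apply: (Lam_eqU hr) => W uW; rewrite (pd_Dop _ _ hT lg uW).
  transitivity (- Lam r (fun W => pd i j (fun W => E n.+1 W h Z) W * T g W)).
    by rewrite (Lam_ibp hr) ?opprK//; [exact: lE|exact: Dop_LN hT lg].
  rewrite -(ih g lg (pd i j h) Z (L_pdN _ _ lh) uZ) -mulN1r -(LamZ hr); last first.
    by apply: L_mul; [apply: L_pdN; exact: lE|exact: Dop_LN hT lg].
  apply: (Lam_eqU hr) => W _; rewrite (linear_E_pd n i j W (linear_eval uZ) lh); ring.
- have lE m u : L None u -> L None (fun W => E m W u Z).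
    by move=> lu; exact: P_LN (linear_E_P m (linear_eval uZ) lu).
  rewrite mulrDr -(ih _ lg h Z lh uZ) -(ih' _ lg h Z lh uZ) -(LamD hr).
  + by apply: (Lam_eqU hr) => W _; rewrite mulrDr.
  + by apply: L_mul; [exact: lE|exact: Dop_LN hT lg].
  + by apply: L_mul; [exact: lE|exact: Dop_LN hT' lg].
- have lE m u : L None u -> L None (fun W => E m W u Z).
    by move=> lu; exact: P_LN (linear_E_P m (linear_eval uZ) lu).
  rewrite mulrCA -(ih _ lg h Z lh uZ) -(LamZ hr).
    by apply: (Lam_eqU hr) => W _; rewrite mulrCA.
  by apply: L_mul; [exact: lE|exact: Dop_LN hT lg].
Qed.

Lemma Lop_Dop n T f i p q j : Dop n T -> L None f -> eqU (Lop i p q j (T f)) (T (Lop i p q j f)).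
Proof.
move=> dT lf; have e g a b : L None g -> eqU (pd a b (T g)) (T (pd a b g)) by move=> lg; exact: pd_Dop dT lg.
have e2 a b c d : eqU (pd a b (pd c d (T f))) (T (pd a b (pd c d f))).
  by move=> V uV; rewrite (pd_eqU _ _ (e _ _ _ lf) uV) e//; exact: L_pdN.
have l2 a b c d : L None (pd a b (pd c d f)) by do 2!apply: L_pdN.
move=> W uW; rewrite /Lop /box2 !e2//; pose c : R[i] := - 4 * eps R i j p q.
rewrite [RHS](Dop_eqU dT (g := fun W => 4 * pd p i (pd j q f) W + (c * pd 0 0 (pd 1 1 f) W + (- c) * pd 0 1 (pd 1 0 f) W)) _ uW); last first.
  by move=> V uV; rewrite /c /=; ring.
rewrite (DopD dT _ _ uW); [|exact: L_scale|by apply: L_add; exact: L_scale].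
rewrite (DopD dT _ _ uW); [|exact: L_scale|exact: L_scale].
by rewrite !(DopZ _ dT _ uW)// /c; ring.
Qed.

(** For g = N^-2 in [Lam_Dop], integrating a Taylor term against such a function evaluates the
    corresponding derivative at Z. *)
Definition DN2 n f := exists2 T, Dop n T & eqU f (T (fun W => \det W ^ (-2))).

Lemma diag_minus n f i p q j Z : HCunits Z -> DN2 n f -> diag_formula (Aminus Z) i p q j f Z.
Proof.
move=> uZ [T dT ef]; have lN2 := detN2_L; exists n.+1 => D nD.
have lA a i' p' : P (Some a) (Aminus Z a i' p') := Aminus_P a i' p' uZ.
have lA' a i' p' : L None (Aminus Z a i' p') := P_LN (lA a i' p').
have dTN : L (Some (- 4 - n%:Z)) (T (fun W => \det W ^ (-2))) by apply: (Dop_L dT); apply: L_cast (L_detz _ (-2)) _.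
have lT := L_None dTN.
have lKK : L None (fun W => K i p W * K q j W) by apply: L_mul; exact: K_LN.
transitivity (24 * \sum_(a < D) \sum_(b < D) term r (Aminus Z a) (Aminus Z b) (T (fun W => \det W ^ (-2))) i p q j).
  by congr (_ * _); apply: eq_bigr => a _; apply: eq_bigr => b _; exact: term_eqU.
rewrite (@diag_sum _ (fun a b => term r (Aminus Z a) (Aminus Z b) (T (fun W => \det W ^ (-2))) i p q j) n)//; last first.
  move=> a b ab; apply: (term_L (P_L (lA a i p)) (P_L (lA b q j)) dTN); apply/eqP => e.
  by move/eqP: ab; apply; lia.
rewrite (Lop_eqU _ _ _ _ ef uZ) (Lop_Dop _ _ _ _ dT lN2 uZ) -(Lam_detN2 hr).
rewrite -(Lam_Dop dT lN2 (Lop_L _ _ _ _ lN2) uZ).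
transitivity (24 * Lam r (fun W => \sum_(a < n.+1) Aminus Z a i p W * T (fun W => \det W ^ (-2)) W * Aminus Z (n - a) q j W)).
  by rewrite (@linear_on_L_sum R _ _ _ _ (fun (a : 'I_n.+1) W => _) (Lam_linear hr))// => a _; apply: L_mul => //; exact: L_mul.
rewrite -(LamZ hr); last by apply: L_sum => a _; apply: L_mul => //; exact: L_mul.
apply: (Lam_eqU hr) => W uW; transitivity (E n W (fun W => 24 * (K i p W * K q j W)) Z * T (fun W => \det W ^ (-2)) W).
  rewrite (EZ _ _ _ lKK uZ) -mulrA; congr (_ * _).
  rewrite (E_mul n W (K_LN _ i p) (K_LN _ q j) uZ) mulr_suml; apply: eq_bigr => a _.
  by rewrite /Aminus mulNr mulrNN mulrAC.
by congr (_ * _); apply: E_eqU uZ => V uV; rewrite Lop_detN2.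
Qed.

End MxProof.

(** * Zh^+ and Zh^-, and the restriction of J to the diagonal *)

Section Zh.
Variable R : realType.
Implicit Types (f g : HC R -> R[i]) (W Z : HC R) (i j : 'I_2).

Lemma DN2_scale n z f : DN2 n f -> DN2 n (fun W => z * f W).
Proof.
move=> [T dT e]; exists (fun f W => z * T f W); first exact: Dop_scale.
by move=> W uW; rewrite e.
Qed.

Lemma DN2_add n f g : DN2 n f -> DN2 n g -> DN2 n (fun W => f W + g W).
Proof.
move=> [T dT e] [T' dT' e']; exists (fun f W => T f W + T' f W); first exact: Dop_add.
by move=> W uW; rewrite e// e'.
Qed.

Lemma DN2_eqU n f g : DN2 n f -> eqU f g -> DN2 n g.
Proof. by move=> [T dT e] h; exists T => // W uW; rewrite -h// e. Qed.

Lemma DN2_pd n f i j : DN2 n f -> DN2 n.+1 (pd i j f).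
Proof.
move=> [T dT e]; exists (fun f => T (pd i j f)); first exact: Dop_pd.
by move=> W uW; rewrite (pd_eqU _ _ e uW) (pd_Dop _ _ dT (detN2_L R) uW).
Qed.

Lemma DN2_0 : DN2 0 (fun=> 0 : R[i]).
Proof.
apply: DN2_eqU (_ : DN2 0 (fun W => 0 * \det W ^ (-2))) _ => [|W _]; last by rewrite mul0r.
by apply: DN2_scale; exists id => //; exact: Dop_id.
Qed.

(** By [box2_detz] with h = 1, [box2] sends N^-s to s (s - 1) N^(-s-1); for s = k + 2 the factor is
    nonzero. *)
Lemma DN2_det k : DN2 k.*2 (fun W : HC R => \det W ^ (- (2 + k)%:Z)).
Proof.
elim: k => [|k ih]; first by exists id; [exact: Dop_id|].
set s := (2 + k)%N; have s0 : (s%:R * k.+1%:R : R[i]) != 0 by rewrite mulf_neq0// pnatr_eq0.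
apply: DN2_eqU (_ : DN2 k.+1.*2 (fun W => (s%:R * k.+1%:R)^-1 * (pd 0 0 (pd 1 1 (fun W => \det W ^ (- s%:Z))) W +
   (-1) * pd 0 1 (pd 1 0 (fun W => \det W ^ (- s%:Z))) W))) _.
  by apply: DN2_scale; apply: DN2_add; [|apply: DN2_scale]; do 2!apply: DN2_pd.
move=> W uW; rewrite mulN1r -/(box2 (fun W => \det W ^ (- s%:Z)) W).
have h := box2_detz (- (s.+1)%:Z) (L_cst (1 : R[i])) _ uW.
rewrite (box2_eqU (g := fun W => \det W ^ (- s.+1%:Z + 1) * 1) _ uW); last first.
  by move=> V _; rewrite mulr1; congr (_ ^ _); lia.
rewrite h; last by move=> V uV; rewrite /box2 !pd_cst subrr.
rewrite mulr1 (_ : ((- (s.+1)%:Z + 1) * (- (s.+1)%:Z + 2 + 0))%:~R = s%:R * k.+1%:R :> R[i]) ?mulKf//.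
rewrite (_ : (_ * _)%R = (s * k.+1)%:Z) -?pmulrn ?natrM//.
by rewrite /s; lia.
Qed.

Lemma DN2_shift n s p q (m : nat) : (forall m, DN2 n (fun W : HC R => \det W ^ s * T 0 p q m W)) ->
  DN2 n (fun W : HC R => \det W ^ s * T 1 p q m W).
Proof.
move=> h; case: m => [|m]; last by apply: DN2_eqU (h m) _ => W _; rewrite T_shift.
by apply: DN2_eqU (DN2_scale 0 (h 0%N)) _ => W _; rewrite mul0r T_low// mulr0.
Qed.

Lemma pd_detT (s : int) e p q m i j W : HCunits W ->
  pd i j (fun W => \det W ^ s * T e p q m W) W =
  s%:~R * \det W ^ (s - 1) * mxplus W j i * T e p q m W + \det W ^ s * pd i j (T e p q m) W.
Proof.
move=> uW; rewrite (pdM _ _ _ _ uW) ?(pd_detz _ _ _ uW)//.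
  exact: L_None (L_detz _ _).
exact: P_LN (T_P _ _ _ _ _).
Qed.

(** A ladder in p and q. With -s the exponent of N, [pd 1 1] of N^-s [T 1] minus [pd 0 1] of N^-s
    [T 0] loses the derivatives of T, which agree, and leaves -s N^(-s-1) times W 0 0 [T 1] + W 1 0
    [T 0], which is [T 0] with p + 1. In the same way [pd 0 0] and [pd 1 0] raise q. *)
Lemma DN2_T k p q m : DN2 (k.*2 + p + q) (fun W : HC R => \det W ^ (- (2 + k + p + q)%:Z) * T 0 p q m W).
Proof.
elim: p m => [|p ih] m; last first.
  have s0 : (- (2 + k + p + q)%:Z%:~R : R[i]) != 0 by rewrite oppr_eq0 -pmulrn pnatr_eq0.
  rewrite addnS addSn.
  apply: DN2_eqU (DN2_scale (- (2 + k + p + q)%:Z%:~R)^-1 (DN2_add (DN2_pd 1 1 (DN2_shift m ih))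
    (DN2_scale (-1) (DN2_pd 0 1 (ih m))))) _ => W uW.
  rewrite !pd_detT// !pd_T T_p /mxplus !mx2E.
  apply: (mulfI s0); rewrite mulrA mulfV// mul1r.
  rewrite (_ : - (2 + k + p.+1 + q)%:Z = - (2 + k + p + q)%:Z - 1); last by lia.
  by rewrite rmorphN /=; ring.
elim: q m => [|q ih] m; last first.
  have s0 : (- (2 + k + 0 + q)%:Z%:~R : R[i]) != 0 by rewrite oppr_eq0 -pmulrn pnatr_eq0.
  rewrite addnS.
  apply: DN2_eqU (DN2_scale (- (2 + k + 0 + q)%:Z%:~R)^-1 (DN2_add (DN2_scale (-1) (DN2_pd 1 0 (DN2_shift m ih)))
    (DN2_pd 0 0 (ih m)))) _ => W uW.
  rewrite !pd_detT// !pd_T T_q /mxplus !mx2E.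
  apply: (mulfI s0); rewrite mulrA mulfV// mul1r.
  rewrite (_ : - (2 + k + 0 + q.+1)%:Z = - (2 + k + 0 + q)%:Z - 1); last by lia.
  by rewrite rmorphN /=; ring.
rewrite !addn0; apply: DN2_eqU (DN2_scale (m == 0)%:R (DN2_det k)) _ => W _.
by rewrite T00 mulrC.
Qed.

(** With p + q = 2 l, the bound on k says exactly that k = -(2 + a + p + q) for some a >= 0, the
    exponents reached by [DN2_T]. *)
Lemma DN2_Zh (k : int) (l m n : rat) : k%:~R <= - (2 * l + 2) ->
  exists d, DN2 d (fun W : HC R => \det W ^ k * tcoef l n m W).
Proof.
case: (@tcoef_cases R l n m) => [->|[p [q [j [hl _ ->]]]]] hk.
  by exists 0%N; apply: DN2_eqU DN2_0 _ => W _; rewrite mulr0.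
have {hk} : k <= - (2 + p + q)%:Z.
  rewrite -(ler_int rat); apply: le_trans hk _.
  by rewrite rmorphN /= -pmulrn !natrD opprD hl natrD; lra.
move=> hk; pose a := `|- k - (2 + p + q)%:Z|%N.
have -> : k = - (2 + a + p + q)%:Z by rewrite /a; lia.
by eexists; exact: DN2_T.
Qed.

Lemma DN2_L n f : DN2 n f -> L None f.
Proof.
move=> [T dT e]; apply: L_ext (Dop_LN dT (detN2_L R)) _ => W uW; by rewrite e.
Qed.

Lemma Zhplus_P f : Zhplus f -> P None f.
Proof.
move=> [n [c [g [hg e]]]].
apply: P_eq (_ : P None (fun Z => \sum_(i < n) c i * g i Z)) _; last by apply/funext => Z; rewrite e.
apply: P_sum => i _; apply: P_scale; have [k [l [m [n' [k0 ->]]]]] := hg i.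
case: k k0 => // k _; apply: P_mul.
  elim: k => [|k ih]; first by apply: P_eq (P_None (P_cst 1)) _; apply/funext => Z.
  by apply: P_eq (P_mul (P_None (@P_det R)) ih) _; apply/funext => Z; rewrite -!exprnP exprS.
case: (@tcoef_cases R l n' m) => [->|[p [q [j [_ _ ->]]]]]; first exact: P_0.
exact: P_None (T_P _ _ _ _ _).
Qed.

Lemma Zhminus_diag (r : R) f Z i p q j : 0 < r -> HCunits Z -> Zhminus f ->
  L None f /\ diag_formula r (Aminus Z) i p q j f Z.
Proof.
move=> hr uZ [n [c [g [hg e]]]].
have lA a i' p' : L None (Aminus Z a i' p') := P_LN (Aminus_P a i' p' uZ).
have hd a : exists d, DN2 d (fun W => c a * g a W).
  have [k [l [m [n' [hk ->]]]]] := hg a; have [d hd] := DN2_Zh m n' hk.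
  by exists d; exact: DN2_scale.
have {hd} [ls [D0 hs]] : L None (fun W => \sum_a c a * g a W) /\
    diag_formula r (Aminus Z) i p q j (fun W => \sum_a c a * g a W) Z.
  elim: (index_enum _) => [|a s [ls ih]].
    rewrite (_ : (fun W => _) = fun=> 0); last by apply/funext => W; rewrite big_nil.
    by split; [exact: L_0|exact: (diag_minus hr i p q j uZ DN2_0)].
  have [d hda] := hd a; have la := DN2_L hda.
  rewrite (_ : (fun W => _) = fun W => c a * g a W + \sum_(b <- s) c b * g b W); last first.
    by apply/funext => W; rewrite big_cons.
  split; first exact: L_add.
  apply: (diag_formula_add hr lA la ls) => //; last exact: (diag_minus hr i p q j uZ hda).
  by rewrite (Lop_LD _ _ _ _ la ls uZ).
have ef : eqU (fun W => \sum_a c a * g a W) f by move=> W uW; rewrite e.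
split; first exact: L_ext ls ef.
exists D0 => D DD; rewrite -(Lop_eqU i p q j ef uZ) -(hs D)//; congr (_ * _).
by apply: eq_bigr => a _; apply: eq_bigr => b _; apply: (term_eqU hr) => W uW; rewrite ef.
Qed.

Lemma far_le (r : R) F D D' : (D <= D')%N -> far r F D -> far r F D'.
Proof. by move=> DD h p q d u lu hd; apply: h lu _; exact: leq_trans DD hd. Qed.

Lemma diag_Lop (r : R) (A : nat -> 'I_2 -> 'I_2 -> HC R -> R[i]) (F : HC R -> HC R) Z i j D0 Jv :
  (forall p q, diag_formula r A i p q j (fun W => F W p q) Z) ->
  (forall D, (D0 <= D)%N -> Jv = cJ R * \sum_(a < D) \sum_(b < D) \sum_p \sum_q
      term r (A a) (A b) (fun W => F W p q) i p q j) ->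
  Jv = \sum_p \sum_q Lop i p q j (fun W => F W p q) Z.
Proof.
move=> hd hJ.
have [D hD] : exists D, forall p q, forall E, (D <= E)%N ->
   24 * \sum_(a < E) \sum_(b < E) term r (A a) (A b) (fun W => F W p q) i p q j = lam0 R * Lop i p q j (fun W => F W p q) Z.
  apply: bound_all => [D D' p q DD h E hE|p q]; first by apply: h; exact: leq_trans DD hE.
  exact: hd.
rewrite (hJ (maxn D0 D)) ?leq_maxl//; set M := maxn D0 D.
have c24 : (24 : R[i]) != 0 by rewrite pnatr_eq0.
have h p q : cJ R * \sum_(a < M) \sum_(b < M) term r (A a) (A b) (fun W => F W p q) i p q j =
    Lop i p q j (fun W => F W p q) Z.
  apply: (mulfI c24); rewrite mulrCA hD ?leq_maxr// mulrA cJ_lam0//.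
transitivity (cJ R * \sum_p \sum_q \sum_(a < M) \sum_(b < M) term r (A a) (A b) (fun W => F W p q) i p q j).
  congr (_ * _); under eq_bigr => a _ do rewrite exchange_big /=.
  rewrite exchange_big /=; apply: eq_bigr => p _.
  under eq_bigr => a _ do rewrite exchange_big /=.
  by rewrite exchange_big.
by rewrite mulr_sumr; apply: eq_bigr => p _; rewrite mulr_sumr; apply: eq_bigr => q _; exact: h.
Qed.

Lemma J_diag_plus (r : R) (F : HC R -> HC R) Z : 0 < r -> HCtensor (@Zhplus R) F -> Dplus r Z ->
  J r F Z Z = Mx F Z.
Proof.
move=> hr hF hZ; have pF p q : P None (fun W => F W p q) by exact: Zhplus_P (hF p q).
have lF p q : L None (fun W => F W p q) := P_LN (pF p q).
have [D0 fD] := exists_far hr lF.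
apply/matrixP => i j; rewrite Mx_Lop.
- apply: (diag_Lop (r := r) (A := Aplus Z) (D0 := D0)) => [p q|D DD]; first exact: diag_plus.
  by rewrite (J_series_plus hr lF (far_le DD fD) hZ hZ).
- by move=> p q a b c d z; rewrite pd_PZ//; apply: P_pd.
- move=> p q; rewrite (_ : (fun Y => - F Y p q) = fun Y => (-1) * F Y p q); last by apply/funext => Y; rewrite mulN1r.
  by rewrite /box2 !pd_PZ//; [ring|..]; apply: P_pd.
Qed.

Lemma J_diag_minus (r : R) (F : HC R -> HC R) Z : 0 < r -> HCtensor (@Zhminus R) F -> Dminus r Z ->
  J r F Z Z = Mx F Z.
Proof.
move=> hr hF hZ; have [uZ _] := conv_minus hr hZ.
have lF p q : L None (fun W => F W p q) := (Zhminus_diag 0 0 0 0 hr uZ (hF p q)).1.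
have [D0 fD] := exists_far hr lF.
apply/matrixP => i j; rewrite Mx_Lop.
- apply: (diag_Lop (r := r) (A := Aminus Z) (D0 := D0)) => [p q|D DD]; first exact: (Zhminus_diag i p q j hr uZ (hF p q)).2.
  by rewrite (J_series_minus hr lF (far_le DD fD) hZ hZ).
- by move=> p q a b c d z; rewrite (pdZ _ _ _ _ uZ)//; exact: L_pdN.
- move=> p q; rewrite (_ : (fun Y => - F Y p q) = fun Y => (-1) * F Y p q); last by apply/funext => Y; rewrite mulN1r.
  by rewrite (box2_LZ _ (lF p q) uZ) mulN1r.
Qed.

End Zh.

Theorem theorem65 (R : realType) (r : R) (hr : 0 < r) :
  [/\ forall F : HC R -> HC R, Wprime F ->
        in_tensor (@Vplus R) (@V'plus R) (Dplus r) (J r F),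
      forall b : Kindex, Kvalid b -> ~~ in_Qplus b ->
        forall Z1 Z2 : HC R, Dplus r Z1 -> Dplus r Z2 ->
          J r (Kfun b) Z1 Z2 = 0 &
      forall F : HC R -> HC R, HCtensor (@Zhplus R) F ->
        forall Z : HC R, Dplus r Z -> J r F Z Z = Mx F Z]
  /\
  [/\ forall F : HC R -> HC R, Wprime F ->
        in_tensor (@Vminus R) (@V'minus R) (Dminus r) (J r F),
      forall b : Kindex, Kvalid b -> ~~ in_Qminus b ->
        forall Z1 Z2 : HC R, Dminus r Z1 -> Dminus r Z2 ->
          J r (Kfun b) Z1 Z2 = 0 &
      forall F : HC R -> HC R, HCtensor (@Zhminus R) F ->
        forall Z : HC R, Dminus r Z -> J r F Z Z = Mx F Z].
Proof.
split; split.
- by move=> F /Wprime_L lF; exact: in_tensor_plus.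
- by move=> b hb qb Z1 Z2 h1 h2; exact: J_zero_plus.
- by move=> F hF Z hZ; exact: J_diag_plus.
- by move=> F /Wprime_L lF; exact: in_tensor_minus.
- by move=> b hb qb Z1 Z2 h1 h2; exact: J_zero_minus.
- by move=> F hF Z hZ; exact: J_diag_minus.
Qed.
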